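(* Let $m\ge 3$ and $n\ge 2$ be integers, let $\mathcal M$ be an orientably-regular embedding of $K_{m[n]}$, and let $G=\mathrm{Aut}^+(\mathcal M)$. Then exactly one of the following holds, with $G$ and $\mathcal M$ as described. \begin{enumerate} \item $m=p\ge 5$ is a prime and $n=p^e$ ($e\ge1$). Then $G\cong G_1(p,e)=\langle a,c\mid a^{p^e(p-1)}=c^{p^{e+1}}=1,\ c^a=c^r\rangle$, where $r$ is a fixed generator of $\mathbb Z_{p^{e+1}}^*$, and $\mathcal M\cong \mathcal M_1(p,e,j):=\mathcal M\big(G_1(p,e);a^j,a^{p^e(p-1)/2}c\big)$ for some $j\in\mathbb Z_{p^e(p-1)}^*$. \item $m=n=p\ge5$ is a prime. Then $G\cong G_2(p)=\langle w,z\rangle\rtimes\langle c,g\rangle=\langle w,z,c,g\mid w^p=z^p=c^p=g^{p-1}=1,\ [w,z]=1,\ c^g=c^t,\ w^c=wz,\ z^c=z,\ w^g=w,\ z^g=z^t\rangle$, where $t$ is a fixed generator of $\mathbb Z_p^*$, and $\mathcal M\cong\mathcal M_2(p,j):=\mathcal M\big(G_2(p);wg^j,cg^{(p-1)/2}\big)$ for some $j\in\mathbb Z_{p-1}^*$. \item $m=3$ and $n=3^ek$ with $3\nmid k$ and $e\ge1$, and $G\cong G_3(k,e)$, the group generated by $a,b$ subject to: $a^{2\cdot 3^ek}=b^2=1$; writing $c=a^{3^e}b$, $x_1=a^{2\cdot 3^e}$, $y_1=x_1^b$: $[x_1,y_1]=1$, $c^{3^{e+1}}=1$, $y_1^a=x_1^{-1}y_1^{-1}$,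 $c^a=c^2x_1^uy_1^{\frac{1-3^e}{2}u}$, where for $k=1$ the last relation reads $c^a=c^2$, and for $k\ge2$ the integer $u$ satisfies $u3^e\equiv1\pmod k$. Then $\mathcal M\cong\mathcal M_3(k,e,j):=\mathcal M(G_3(k,e);a^j,b)$ for some $j\in\mathbb Z^*_{2\cdot3^ek}$. \item $m=3$ and $n=3^ek$ with $3\nmid k$ ($e\ge0$), and $G\cong G_4(k,e,i,l)$, the group generated by $a,b$ subject to: $a^{2n}=b^2=1$; writing $x=a^2$, $y=x^b$: $[x,y]=x^{\frac{in}{3}}y^{-\frac{in}{3}}$, $y^a=x^{-1}y^{-1}$, $(ab)^3=x^{\frac{ln}{3}}y^{-\frac{ln}{3}}$; here $(i,l)=(0,0)$ if $e=0$; $(i,l)\in\{(0,0),(0,1)\}$ if $e=1$; $(i,l)\in\{(0,0),(0,1),(1,0),(1,1),(1,-1)\}$ if $e\ge2$. Then $\mathcal M\cong\mathcal M_4(k,e,i,l,j):=\mathcal M(G_4(k,e,i,l);a^j,b)$ where $j=1$ if $(i,l)=(0,0)$ and $j=\pm1$ otherwise. \end{enumerate} Each of the listed maps is an orientably-regular embedding of the corresponding $K_{m[n]}$, and the maps are uniquely determined by the given parameters. Moreover: \begin{itemize} \item The maps $\mathcal M_1(p,e,j)$ are $p^{e-1}(p-1)\phi(p-1)$ in number, chiral, of type $\{p^e(p-1),p^e(p-1)\}$ if $p\equiv1\pmod4$ and $\{\frac{p^e(p-1)}2,p^e(p-1)\}$ if $p\equiv3\pmod 4$. \item The maps $\mathcal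 M_2(p,j)$ ($p\ge5$) are $\phi(p-1)$ in number, chiral, of type $\{p(p-1),p(p-1)\}$ if $p\equiv1\pmod4$ and $\{\frac{p(p-1)}2,p(p-1)\}$ if $p\equiv 3\pmod4$. \item The maps $\mathcal M_3(k,e,j)$ are $2\cdot3^{e-1}$ in number, chiral, of type $\{3^{e+1},2n\}$. \item $\mathcal M_4(k,e,0,0,1)$ is a single reflexible map of type $\{3,2n\}$; the maps $\mathcal M_4(k,e,0,1,\pm1)$ are $2$ chiral maps of type $\{9,2n\}$; the maps $\mathcal M_4(k,e,1,0,\pm1)$ are $2$ chiral maps of type $\{3,2n\}$; the maps $\mathcal M_4(k,e,1,\pm1,\pm1)$ are $4$ chiral maps of type $\{9,2n\}$. \end{itemize} Consequently, the numbers of orientably-regular embeddings of $K_{m[n]}$ (reflexible / chiral / total) are: for $m=3$, $n=k$ with $3\nmid k$: $1/0/1$; for $m=3$, $n=3k$ with $3\nmid k$: $1/2/3$; for $m=3$, $n=3^ek$ with $3\nmid k$, $e\ge2$: $1/(2\cdot3^{e-1}+8)/(2\cdot 3^{e-1}+9)$; for $m=p\ge5$ prime, $n=p$: $0/p\phi(p-1)/p\phi(p-1)$; for $m=p\ge5$ prime, $n=p^e$ with $e\ge2$: $0/p^{e-1}(p-1)\phi(p-1)/p^{e-1}(p-1)\phi(p-1)$; and for all other $(m,n)$ with $m\ge3$, $n\ge2$ there are none.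
   Context: $K_{m[n]}$ denotes the complete multipartite graph with $m$ parts, each containing $n$ vertices. A map is a 2-cell embedding of a connected graph in a closed surface; an orientably-regular map is a map on an orientable surface whose group $\mathrm{Aut}^+(\mathcal M)$ of orientation-preserving automorphisms acts regularly on the arcs (incident vertex–edge pairs); an orientably-regular embedding of a graph $\Gamma$ is an orientably-regular map with underlying graph $\Gamma$. Conjugation is $x^g=g^{-1}xg$ and $[x,y]=x^{-1}y^{-1}xy$. For a finite group $G$ generated by an element $a$ and an involution $b$ with $\langle a\rangle$ core-free in $G$, the algebraic map $\mathcal M(G;a,b)$ is the orientably-regular map with underlying graph the coset graph $\mathrm{Cos}(G,\langle a\rangle,b)$ (vertices the right cosets $\langle a\rangle g$, arcs the pairs $(\langle a\rangle g,\langle a\rangle bg)$, $g\in G$), with local rotation $(\langle a\rangle g,\langle a\rangle bg)\mapsto(\langle a\rangle g,\langle a\rangle bag)$; $G$ acts by right multiplication as $\mathrm{Aut}^+$. Every orientably-regular map with simple underlying graph is of this form, with $\langle a\rangle$ a vertex stabiliser and $b$ an involution reversing an arc at that vertex. $\mathcal M(G;a,b)\cong\mathcal M(G;a',b')$ iff some automorphism of $G$ sends $a\mapsto a'$, $b\mapsto b'$. The map $\mathcal M(G;a,b)$ is reflexible if it is isomorphic to $\mathcal M(G;a^{-1},b)$ and chiral otherwise; it has type $\{s,t\}$ where $s$ is the order of $ab$ and $t$ the order of $a$. $\phi$ is Euler's function and $\mathbb Z_N^*$ is the unit group of $\mathbb Z_N$.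
   Formalization: In the ''exactly one'' claim, case 3 is taken with e≥2, since for e=1 the maps M_3(k,1,j) coincide with M_4(k,1,0,1,±1); the properties of M_3 are still stated for all e≥1. Group presentations are read as universal among finite groups. *)

(* Defs.v *)
(* Orientably-regular maps are encoded as algebraic maps
   M(G;a,b) with a, b elements of a finite group type gT and G = <<a,b>>. *)
From HB Require Import structures.
From mathcomp Require Import all_boot all_order all_algebra all_fingroup.

Set Implicit Arguments.
Unset Strict Implicit.
Unset Printing Implicit Defensive.

Import GRing.Theory.

Local Open Scope group_scope.

Definition expgz (gT : finGroupType) (x : gT) (z : int) : gT :=
  match z with
  | Posz k => x ^+ k
  | Negz k => x ^- k.+1
  end.

Definition mgrp (gT : finGroupType) (a b : gT) : {group gT} := <<[set a; b]>>%G.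

Definition alg_map (gT : finGroupType) (a b : gT) : Prop :=
  #[b] = 2%N /\ gcore <[a]> (mgrp a b) = 1.

Definition cos_adj (gT : finGroupType) (a b : gT) (X Y : {set gT}) : bool :=
  [exists g in mgrp a b, (X == <[a]> :* g) && (Y == <[a]> :* (b * g))].

(* M(G;a,b) is an orientably-regular embedding of K_{m[n]}:
   - it is an algebraic map;
   - its coset graph (vertex set = right cosets of <a> in G) is isomorphic
     to K_{m[n]}, the graph on 'I_m * 'I_n in which two vertices are adjacent
     iff they lie in different parts (different first coordinates);
   - the underlying graph is simple, i.e. the |a| arcs at a vertex go to
     distinct neighbours: the valency (m-1)n of K_{m[n]} equals #[a]. *)
Definition is_Kmn_embedding (m n : nat) (gT : finGroupType) (a b : gT) : Prop :=
  alg_map a b /\ #[a] = ((m - 1) * n)%N /\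
  exists f : 'I_m * 'I_n -> {set gT},
    [/\ injective f,
        [set f u | u in [set: 'I_m * 'I_n]] = rcosets <[a]> (mgrp a b)
      & forall u v, cos_adj a b (f u) (f v) = (u.1 != v.1)].

Definition map_iso (gT hT : finGroupType) (a b : gT) (a' b' : hT) : Prop :=
  exists2 f : {morphism mgrp a b >-> hT},
    isom (mgrp a b) (mgrp a' b') f & f a = a' /\ f b = b'.

Definition reflexible (gT : finGroupType) (a b : gT) : Prop := map_iso a b a^-1 b.
Definition chiral (gT : finGroupType) (a b : gT) : Prop := ~ reflexible a b.

Definition map_type (s t : nat) (gT : finGroupType) (a b : gT) : Prop :=
  #[a * b] = s /\ #[a] = t.

Record omap := OMap { om_gT : finGroupType; om_a : om_gT; om_b : om_gT }.

Definition omap_iso (M M' : omap) : Prop := map_iso (om_a M) (om_b M) (om_a M') (om_b M').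

Definition num_classes (P : omap -> Prop) (N : nat) : Prop :=
  exists L : 'I_N -> omap,
    [/\ forall i, P (L i),
        forall i j, omap_iso (L i) (L j) -> i = j
      & forall M, P M -> exists i, omap_iso M (L i)].

(* Presentations.  [presents2 x y R] says that (x, y) generate <<x,y>>,
   satisfy the relations R, and are universal for them: any pair of elements
   of a finite group satisfying R is the image of (x, y) under a morphism
   defined on <<x,y>>.  Thus <<x,y>> is the group presented by R, with x, y
   the images of the formal generators (this is exactly the semantics of
   MathComp's [G \isog Grp (...)] in fingroup/presentation.v, but keeping track
   of the generators).  Same for four generators. *)
Definition presents2 (gT : finGroupType) (x y : gT)
    (R : forall hT : finGroupType, hT -> hT -> bool) : Prop :=
  R gT x y /\
  forall (hT : finGroupType) (u v : hT), R hT u v ->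
    exists f : {morphism <<[set x; y]>> >-> hT}, f x = u /\ f y = v.

Definition presents4 (gT : finGroupType) (x y z w : gT)
    (R : forall hT : finGroupType, hT -> hT -> hT -> hT -> bool) : Prop :=
  R gT x y z w /\
  forall (hT : finGroupType) (x' y' z' w' : hT), R hT x' y' z' w' ->
    exists f : {morphism <<[set x; y; z; w]>> >-> hT},
      [/\ f x = x', f y = y', f z = z' & f w = w'].

Definition unit_generator (r N : nat) : Prop :=
  coprime r N /\ forall k, (0 < k)%N -> r ^ k = 1 %[mod N] -> (totient N <= k)%N.

Definition G1rel (p e r : nat) (hT : finGroupType) (a c : hT) : bool :=
  [&& a ^+ (p ^ e * (p - 1)) == 1, c ^+ (p ^ e.+1) == 1 & c ^ a == c ^+ r].

Definition G2rel (p t : nat) (hT : finGroupType) (w z c g : hT) : bool :=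
  [&& w ^+ p == 1, z ^+ p == 1, c ^+ p == 1, g ^+ (p - 1) == 1,
      [~ w, z] == 1, c ^ g == c ^+ t, w ^ c == w * z, z ^ c == z,
      w ^ g == w & z ^ g == z ^+ t].

Definition G3rel (k e u : nat) (hT : finGroupType) (a b : hT) : bool :=
  let c := a ^+ (3 ^ e) * b in
  let x1 := a ^+ (2 * 3 ^ e) in
  let y1 := x1 ^ b in
  [&& a ^+ (2 * 3 ^ e * k) == 1, b ^+ 2 == 1, [~ x1, y1] == 1,
      c ^+ (3 ^ e.+1) == 1, y1 ^ a == x1^-1 * y1^-1
    & c ^ a == c ^+ 2 * x1 ^+ u * y1 ^- ((3 ^ e - 1)./2 * u)].

Definition G4rel (n i : nat) (l : int) (hT : finGroupType) (a b : hT) : bool :=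
  let x := a ^+ 2 in
  let y := x ^ b in
  [&& a ^+ (2 * n) == 1, b ^+ 2 == 1,
      [~ x, y] == x ^+ (i * (n %/ 3)) * y ^- (i * (n %/ 3)),
      y ^ a == x^-1 * y^-1
    & (a * b) ^+ 3 == expgz x (l * (n %/ 3)%:Z)%R * expgz y (- (l * (n %/ 3)%:Z))%R].

Definition adm_il (e i : nat) (l : int) : bool :=
  [|| (i == 0%N) && (l == 0%R),
      [&& (1 <= e)%N, i == 0%N & l == 1%R]
    | [&& (2 <= e)%N, i == 1%N & (l \in [:: 0; 1; -1]%R)]].

Definition adm_j4 (i : nat) (l j : int) : bool :=
  if (i == 0%N) && (l == 0%R) then j == 1%R else (j == 1%R) || (j == (-1)%R).

(* "M(G;a,b) is isomorphic to M_1(p,e,j) = M(G_1(p,e); a^j, a^{p^e(p-1)/2} c)"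
   (with the fixed generator r): there are x, c in G = <a,b> presenting G_1
   (so x, c are the images of the generators under an isomorphism
   G_1 -> G) with a = x^j and b = x^{p^e(p-1)/2} c. *)
Definition isM1 (p e r j : nat) (gT : finGroupType) (a b : gT) : Prop :=
  exists x c : gT,
    [/\ mgrp x c = mgrp a b, presents2 x c (G1rel p e r),
        a = x ^+ j & b = x ^+ ((p ^ e * (p - 1))./2) * c].

Definition isM2 (p t j : nat) (gT : finGroupType) (a b : gT) : Prop :=
  exists w z c g : gT,
    [/\ <<[set w; z; c; g]>> = mgrp a b, presents4 w z c g (G2rel p t),
        a = w * g ^+ j & b = c * g ^+ (p - 1)./2].

Definition isM3 (k e u j : nat) (gT : finGroupType) (a b : gT) : Prop :=
  exists x y : gT,
    [/\ mgrp x y = mgrp a b, presents2 x y (G3rel k e u), a = x ^+ j & b = y].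

Definition isM4 (k e i : nat) (l j : int) (gT : finGroupType) (a b : gT) : Prop :=
  exists x y : gT,
    [/\ mgrp x y = mgrp a b, presents2 x y (G4rel (3 ^ e * k) i l),
        a = expgz x j & b = y].

Definition exactly_one4 (P1 P2 P3 P4 : Prop) : Prop :=
  (P1 \/ P2 \/ P3 \/ P4) /\
  (~ (P1 /\ P2) /\ ~ (P1 /\ P3) /\ ~ (P1 /\ P4) /\
   ~ (P2 /\ P3) /\ ~ (P2 /\ P4) /\ ~ (P3 /\ P4)).

Definition embedding_counts (m n R C T : nat) : Prop :=
  [/\ num_classes (fun M => is_Kmn_embedding m n (om_a M) (om_b M) /\
                            reflexible (om_a M) (om_b M)) R,
      num_classes (fun M => is_Kmn_embedding m n (om_a M) (om_b M) /\
                            chiral (om_a M) (om_b M)) C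
    & num_classes (fun M => is_Kmn_embedding m n (om_a M) (om_b M)) T].

(* Main.v *)
(* Write G = <a, b>, x = a^(m-1) and y = x^b.  Being an embedding of K_{m[n]} is a factorisation
   property: there is a subgroup L of order (m-1)n^2 and index m containing a but not b, and
   <a> meets <a>^b trivially; the core K of L is then <x><y>, of order n^2.  For some prime r | n
   the elements of order r of <x> and <y> span a normal subgroup of order r^2 (a "layer") central
   in K, and the action of a and b on it forces m = 3 or m = r.  Factoring the layer out and
   inducting on n gives that m > 3 is a prime p and n = p^e.

   For n = p^e everything hinges on c = a^(|a|/2) b.  Lifting through the central layers, either
   <c> is cyclic of order p^(e+1) and normalised by a, which gives G_1 (and the 3-part of G_3), or
   not; for p >= 5 the latter happens only if e = 1 and gives G_2, for p = 3 it gives the relations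
   of G_4, [x, y] and (ab)^3 being powers of the element x^(n/3) y^(-n/3) of order 3.  For m = 3 and
   general n, K is nilpotent and G embeds in G/O_3(K) x G/O_{3'}(K), where the relations are
   checked separately.

   Conversely the relations bound the order of G from above, and permutation models (subdirect
   products of models for G_3) attain the bound, so that satisfying a presentation is the same as
   satisfying the relations and having the right order.  The action of a on c separates the maps
   of the families M_1, M_2, M_3, and the exponents modulo 3 of [x, y] and (ab)^3 those of M_4. *)
Require Import Defs.
From HB Require Import structures.
From mathcomp Require Import all_boot all_order all_algebra all_fingroup.
From mathcomp Require Import all_solvable finfield zify ring.

Set Implicit Arguments.
Unset Strict Implicit.
Unset Printing Implicit Defensive.

(** * Embeddings as factorised groups *)

Section Factorisation.
Local Open Scope group_scope.

Record Kmn_group (m n : nat) (gT : finGroupType) (a b : gT) (L : {group gT}) : Prop :=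
  KmnGroup {
    kmn_ordb : #[b] = 2;
    kmn_orda : #[a] = ((m - 1) * n)%N;
    kmn_HL : <[a]> \subset L;
    kmn_LG : L \subset mgrp a b;
    kmn_cardL : #|L| = ((m - 1) * n * n)%N;
    kmn_cardG : #|mgrp a b| = (m * ((m - 1) * n * n))%N;
    kmn_bL : b \notin L;
    kmn_TI : <[a]> :&: <[a]> :^ b = 1 }.

Lemma mem_mgrpl (gT : finGroupType) (a b : gT) : a \in mgrp a b.
Proof. by rewrite mem_gen // !inE eqxx. Qed.

Lemma mem_mgrpr (gT : finGroupType) (a b : gT) : b \in mgrp a b.
Proof. by rewrite mem_gen // !inE eqxx orbT. Qed.

Lemma mgrp_sub (gT : finGroupType) (a b : gT) (K : {group gT}) :
  (mgrp a b \subset K) = (a \in K) && (b \in K).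
Proof. by rewrite gen_subG subUset !sub1set. Qed.

Lemma cos_adjP (gT : finGroupType) (a b g h : gT) : g \in mgrp a b ->
  cos_adj a b (<[a]> :* g) (<[a]> :* h) = (h * g^-1 \in <[a]> :* b * <[a]>).
Proof.
move=> gG; apply/existsP/idP.
  case=> u /and3P[uG /eqP e1 /eqP e2].
  have /rcosetP[c cH eg] : g \in <[a]> :* u by rewrite -e1 rcoset_refl.
  have /rcosetP[d dH eh] : h \in <[a]> :* (b * u) by rewrite -e2 rcoset_refl.
  have -> : h * g^-1 = d * b * c^-1 by rewrite eg eh !invMg !mulgA mulgK.
  by rewrite mem_mulg ?groupV // mem_rcoset mulgK.
case/mulsgP=> u v; rewrite mem_rcoset => ubH vH e.
exists (v * g); apply/and3P; split.
- by rewrite groupM // (subsetP _ _ vH) // cycle_subG mem_mgrpl.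
- by apply/eqP; rewrite rcosetM (rcoset_id vH).
- apply/eqP; have -> : h = (u * b^-1) * (b * (v * g)).
    by rewrite !mulgA mulgKV -e mulgKV.
  by apply/rcoset_eqP; rewrite mem_rcoset mulgK.
Qed.


Lemma Kmn_dcoset m n (gT : finGroupType) (a b : gT) (L : {group gT}) :
  Kmn_group m n a b L -> 0 < m -> <[a]> :* b * <[a]> = mgrp a b :\: L.
Proof.
case=> _ oa HL LG cL cG bL TI m0; apply/eqP; rewrite eqEcard; apply/andP; split.
  apply/subsetP=> g /mulsgP[u v]; rewrite mem_rcoset => ubH vH ->.
  have uE : u = (u * b^-1) * b by rewrite mulgKV.
  have uL := subsetP HL _ ubH; have vL := subsetP HL _ vH.
  apply/setDP; split; last by rewrite (groupMr _ vL) uE (groupMl _ uL).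
  by rewrite groupM ?(subsetP LG _ vL) // uE groupM ?mem_mgrpr ?(subsetP LG _ uL).
have -> : <[a]> :* b * <[a]> = b *: (<[a]> :^ b * <[a]>).
  by rewrite conjsgE !mulgA mulg_set1 mulgV mul1g.
rewrite card_lcoset TI_cardMg; last by rewrite setIC.
by rewrite cardJg -orderE oa cardsD (setIidPr LG) cL cG; nia.
Qed.

Lemma Kmn_TI m n (gT : finGroupType) (a b g : gT) (L : {group gT}) :
  Kmn_group m n a b L -> 0 < m -> g \in mgrp a b -> g \notin L ->
  <[a]> :&: <[a]> :^ g = 1.
Proof.
move=> k m0 gG gL; have : g \in <[a]> :* b * <[a]>.
  by rewrite (Kmn_dcoset k m0); apply/setDP.
case/mulsgP=> u v; rewrite mem_rcoset => ubH vH ->.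
rewrite -{1}(conjGid vH) conjsgM -conjIg.
have -> : u = (u * b^-1) * b by rewrite mulgKV.
by rewrite conjsgM (conjGid ubH) (kmn_TI k) conjs1g.
Qed.

Lemma Kmn_is_embedding m n (gT : finGroupType) (a b : gT) (L : {group gT}) :
  Kmn_group m n a b L -> 1 < m -> 0 < n -> is_Kmn_embedding m n a b.
Proof.
move=> k m1 n0; have m0 : 0 < m by lia.
case: (k) => ob oa HL LG cL cG bL TI; set G := mgrp a b in LG cG.
have HG : <[a]> \subset G by apply: subset_trans LG.
have idxL : #|G : L| = m.
  by rewrite -divgS // cG cL mulnK // !muln_gt0; lia.
have idxH : #|L : <[a]>| = n.
  by rewrite -divgS // cL -orderE oa mulKn // !muln_gt0; lia.
have idxG : #|G : <[a]>| = (m * n)%N.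
  by rewrite -(Lagrange_index LG HL) idxL idxH.
split; [|split] => //.
  split => //; apply/trivgP; rewrite -(TI); apply/subsetIP; split.
    exact: gcore_sub.
  rewrite -(conjSg _ _ b^-1) conjsgK.
  have /normsP/(_ b^-1) -> : G \subset 'N(gcore <[a]> G) by apply: gcore_norm.
    exact: gcore_sub.
  by rewrite groupV mem_mgrpr.
pose sL := enum (rcosets L G); pose sH := enum (rcosets <[a]> L).
have szL : size sL = m by rewrite -cardE.
have szH : size sH = n by rewrite -cardE.
pose S (i : 'I_m) := nth set0 sL i; pose T (j : 'I_n) := nth set0 sH j.
have SE i : exists2 g, g \in G & S i = L :* g.
  have : S i \in sL by rewrite mem_nth ?szL.
  by rewrite mem_enum => /rcosetsP.
have TE j : exists2 g, g \in L & T j = <[a]> :* g.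
  have : T j \in sH by rewrite mem_nth ?szH.
  by rewrite mem_enum => /rcosetsP.
have rS i : repr (S i) \in G /\ S i = L :* repr (S i).
  case: (SE i) => g gG ->; have := mem_repr_rcoset L g => h; split.
    by apply: subsetP h; rewrite mul_subG // sub1set.
  by apply/rcoset_eqP; rewrite rcoset_sym.
pose f (u : 'I_m * 'I_n) := T u.2 :* repr (S u.1).
have fE u : exists2 g, g \in S u.1 & f u = <[a]> :* g.
  case: (TE u.2) => l lL El; exists (l * repr (S u.1)).
    by rewrite {2}(rS u.1).2 mem_rcoset mulgK.
  by rewrite /f El rcosetM.
have SG i g : g \in S i -> g \in G.
  by rewrite (rS i).2 => /rcosetP[l lL ->]; rewrite groupM ?(rS i).1 // (subsetP LG).
have Sinj i j g : g \in S i -> g \in S j -> i = j.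
  rewrite (rS i).2 (rS j).2 => /rcoset_eqP e1 /rcoset_eqP e2.
  have e : S i = S j by rewrite (rS i).2 (rS j).2 -e1 e2.
  apply/val_inj/eqP; rewrite -(nth_uniq set0 (s := sL)) ?szL ?ltn_ord ?enum_uniq //.
  exact/eqP.
have Sadj i j g h : g \in S i -> h \in S j -> (h * g^-1 \in L) = (i == j).
  move=> gi hj; apply/idP/eqP => [hgL|eij].
    apply: (Sinj _ _ h) => //; rewrite (rS i).2.
    move: gi; rewrite {1}(rS i).2 !mem_rcoset => gi.
    by rewrite -(mulgKV g h) -mulgA groupM.
  move: gi hj; rewrite eij (rS j).2 !mem_rcoset => gi hj.
  by rewrite -(mulgKV (repr (S j)) h) -mulgA groupM // -groupV invMg invgK.
have finj : injective f.
  move=> [i j] [i' j'] e.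
  case: (fE (i,j)) => g /= gS fg; case: (fE (i',j')) => h /= hS fh.
  have ghH : h * g^-1 \in <[a]>.
    by rewrite -mem_rcoset -fg e fh rcoset_refl.
  have eii : i = i'.
    by apply/eqP; rewrite -(Sadj _ _ _ _ gS hS) (subsetP HL).
  move: e; rewrite /f /= eii => /rcoset_inj e; congr (_, _).
  apply/val_inj/eqP; rewrite -(nth_uniq set0 (s := sH)) ?szH ?ltn_ord ?enum_uniq //.
  exact/eqP.
exists f; split=> //.
- apply/eqP; rewrite eqEcard; apply/andP; split.
    apply/subsetP=> X /imsetP[u _ ->]; case: (fE u) => g gS ->.
    by apply/rcosetsP; exists g => //; apply: SG gS.
  have -> : #|[set f u | u in [set: 'I_m * 'I_n]]| = (m * n)%N.
    by rewrite (card_imset _ finj) cardsT card_prod !card_ord.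
  by rewrite -idxG.
- move=> u v; case: (fE u) => g gS ->; case: (fE v) => h hS ->.
  rewrite cos_adjP ?(SG _ _ gS) // (Kmn_dcoset k m0) inE (Sadj _ _ _ _ gS hS).
  by rewrite groupM ?groupV ?(SG _ _ gS) ?(SG _ _ hS) ?andbT.
Qed.

Lemma embedding_Kmn m n (gT : finGroupType) (a b : gT) :
  is_Kmn_embedding m n a b -> 1 < m -> 0 < n -> exists L, Kmn_group m n a b L.
Proof.
case=> [[ob core]] [oa [f [finj fim fadj]]] m1 n0.
set G := mgrp a b in core fim.
have aG : a \in G := mem_mgrpl a b; have bG : b \in G := mem_mgrpr a b.
have HG : <[a]> \subset G by rewrite cycle_subG.
have idxG : #|G : <[a]>| = (m * n)%N.
  by rewrite /indexg -fim (card_imset _ finj) cardsT card_prod !card_ord.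
have cG : #|G| = (m * ((m - 1) * n * n))%N.
  by rewrite -(Lagrange HG) idxG -orderE oa; nia.
have fex g : g \in G -> exists u, f u = <[a]> :* g.
  move=> gG; have : <[a]> :* g \in rcosets <[a]> G by apply/rcosetsP; exists g.
  by rewrite -fim => /imsetP[u _ ->]; exists u.
have adjM g h k : g \in G -> h \in G -> k \in G ->
  cos_adj a b (<[a]> :* (g * k)) (<[a]> :* (h * k)) =
  cos_adj a b (<[a]> :* g) (<[a]> :* h).
  by move=> gG hG kG; rewrite !cos_adjP ?groupM // invMg !mulgA mulgK.
have adj1 g : cos_adj a b <[a]> (<[a]> :* g) = (g \in <[a]> :* b * <[a]>).
  by rewrite -[X in cos_adj a b X]mulg1 cos_adjP // invg1 mulg1.
pose L0 := [set g in G | ~~ cos_adj a b <[a]> (<[a]> :* g)].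
have HE : <[a]> = <[a]> :* 1 by rewrite mulg1.
have nadjT g h : g \in G -> h \in G -> ~~ cos_adj a b <[a]> (<[a]> :* g) ->
  ~~ cos_adj a b (<[a]> :* g) (<[a]> :* h) -> ~~ cos_adj a b <[a]> (<[a]> :* h).
  move=> gG hG; rewrite [in cos_adj a b <[a]>]HE.
  case: (fex 1) => // u <-; case: (fex g) => // v <-; case: (fex h) => // w <-.
  by rewrite !fadj !negbK => /eqP -> /eqP ->.
have L0g : group_set L0.
  apply/group_setP; split.
    rewrite inE group1 /= -HE; case: (fex 1) => // u; rewrite -HE => Eu.
    by rewrite -Eu fadj eqxx.
  move=> g h; rewrite !inE => /andP[gG gn] /andP[hG hn].
  rewrite groupM //=; apply: (nadjT h) => //; first by rewrite groupM.
  by rewrite -{1}(mul1g h) adjM // -HE.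
pose L := Group L0g.
have HL : <[a]> \subset L.
  have rc : <[a]> :* a = <[a]> := rcoset_id (cycle_id a).
  rewrite cycle_subG inE aG /= rc.
  by case: (fex 1) => // u; rewrite -HE => Eu; rewrite -Eu fadj eqxx.
have LG : L \subset G by apply/subsetP=> g; rewrite inE => /andP[].
have [u0 Eu0] : exists u, f u = <[a]>.
  by case: (fex 1) => // u; rewrite -HE => Eu; exists u.
have idxL : #|L : <[a]>| = n.
  have -> : #|L : <[a]>| = #|f @: setX [set u0.1] [set: 'I_n]|.
    congr #|pred_of_set _|; apply/setP=> X; apply/rcosetsP/imsetP.
      case=> g; rewrite inE => /andP[gG].
      case: (fex g) => // v <-; rewrite -Eu0 fadj negbK => /eqP e ->.
      by exists v => //; rewrite !inE e eqxx.
    case=> v; rewrite !inE andbT => /eqP ev ->.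
    have : f v \in rcosets <[a]> G by rewrite -fim imset_f.
    case/rcosetsP=> g gG Eg; exists g => //.
    by rewrite inE gG /= -Eg -Eu0 fadj ev eqxx.
  by rewrite (card_imset _ finj) cardsX cards1 cardsT card_ord mul1n.
have cL : #|L| = ((m - 1) * n * n)%N by rewrite -(Lagrange HL) idxL -orderE oa.
exists L; split=> //.
- rewrite inE bG /= negbK adj1.
  by rewrite -[b in b \in _]mulg1 mem_mulg ?rcoset_refl ?group1.
- have E : <[a]> :* b * <[a]> = G :\: L.
    apply/setP=> g; rewrite !inE.
    case: (boolP (g \in G)) => gG /=; last first.
      apply/negP=> /mulsgP[u v /rcosetP[w wH ->] vH eg]; case/negP: gG.
      by rewrite eg !groupM ?(subsetP HG _ vH) ?(subsetP HG _ wH).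
    by rewrite andbT negbK adj1.
  have E2 : #|<[a]> :^ b * <[a]>| = #|G :\: L|.
    rewrite -E; have -> : <[a]> :* b * <[a]> = b *: (<[a]> :^ b * <[a]>).
      by rewrite conjsgE !mulgA mulg_set1 mulgV mul1g.
    by rewrite card_lcoset.
  have := mul_cardG (<[a]> :^ b)%G <[a]>%G.
  rewrite /= E2 cardsD (setIidPr LG) cL cG cardJg -orderE oa setIC => E3.
  have h0 : 0 < (m - 1) * n by rewrite muln_gt0; lia.
  apply/eqP; rewrite trivg_card1; apply/eqP; move: E3.
  set h := ((m - 1) * n)%N in h0 *; set c := #|_|.
  have -> : (m * (h * n) - h * n)%N = (h * h)%N.
    by rewrite -[X in (_ - X)%N]mul1n -mulnBl mulnCA.
  have hh : 0 < h * h by rewrite muln_gt0 h0.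
  by rewrite -[LHS]muln1 => /eqP; rewrite (eqn_pmul2l hh) => /eqP <-.
Qed.
End Factorisation.

Section Kernel.
Local Open Scope group_scope.
Variables (m n : nat) (gT : finGroupType) (a b : gT) (L : {group gT}).
Hypotheses (k : Kmn_group m n a b L) (m3 : 2 < m) (n0 : 0 < n).
Local Notation G := (mgrp a b).
Local Notation x := (a ^+ (m - 1)).
Local Notation y := (x ^ b).
Local Notation K := (gcore L G).

Let m0 : 0 < m. Proof. by apply: leq_trans m3. Qed.
Let m1 : 0 < m - 1. Proof. by rewrite subn_gt0; apply: leq_trans m3. Qed.
Let aG : a \in G. Proof. exact: mem_mgrpl. Qed.
Let bG : b \in G. Proof. exact: mem_mgrpr. Qed.
Let aL : a \in L. Proof. by rewrite -cycle_subG (kmn_HL k). Qed.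

Lemma Kmn_bV : b^-1 = b.
Proof. by apply/eqP; rewrite eq_invg_mul -(expgS b 1) -(kmn_ordb k) expg_order. Qed.

Lemma Kmn_bb : b * b = 1.
Proof. by rewrite -{2}Kmn_bV mulgV. Qed.

Lemma Kmn_orderx : #[x] = n.
Proof. by rewrite orderXdiv (kmn_orda k) ?dvdn_mulr // mulKn. Qed.

Lemma Kmn_ordery : #[y] = n.
Proof. by rewrite orderJ Kmn_orderx. Qed.

Lemma Kmn_yb : y ^ b = x.
Proof. by rewrite -{1}Kmn_bV conjgKV. Qed.

Lemma Kmn_xa : x ^ a = x.
Proof. by rewrite conjXg /conjg mulKg. Qed.

Lemma Kmn_HLb : <[a]> :&: L :^ b = <[x]>.
Proof.
have E : L :* b * <[a]> = G :\: L.
  apply/eqP; rewrite eqEsubset -(Kmn_dcoset k m0).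
  apply/andP; split; last by rewrite !mulSg ?(kmn_HL k).
  rewrite (Kmn_dcoset k m0); apply/subsetP=> g /mulsgP[_ v /rcosetP[l lL ->] vH ->].
  have vL := subsetP (kmn_HL k) _ vH.
  apply/setDP; rewrite (groupMr _ vL) (groupMl _ lL) (kmn_bL k).
  by rewrite !groupM // (subsetP (kmn_LG k)).
have : #|L :^ b * <[a]>| = #|G :\: L|.
  rewrite -E; have -> : L :* b * <[a]> = b *: (L :^ b * <[a]>).
    by rewrite conjsgE !mulgA mulg_set1 mulgV mul1g.
  by rewrite card_lcoset.
have E1 : (#|L :^ b| * #|<[a]>| = #|(L :^ b * <[a]>)%g| * #|L :^ b :&: <[a]>|)%N.
  exact: (mul_cardG (L :^ b)%G <[a]>%G).
move=> E2; move: E1; rewrite E2 cardJg cardsD (setIidPr (kmn_LG k)) (kmn_cardG k) (kmn_cardL k).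
rewrite -orderE (kmn_orda k) setIC => E3.
apply/eqP; rewrite (eq_subG_cyclic (cycle_cyclic a)) ?subsetIl //; last first.
  by rewrite cycle_subG mem_cycle.
rewrite -orderE Kmn_orderx; apply/eqP.
set h := ((m - 1) * n)%N in E3; set c := #|_| in E3 *.
have hn : 0 < h * n by rewrite !muln_gt0 m1 n0.
have E4 : (m * (h * n) - h * n)%N = (h * n * (m - 1))%N.
  by rewrite -[X in (_ - X)%N]mul1n -mulnBl mulnC.
apply/eqP; rewrite -(eqn_pmul2l m1) -(eqn_pmul2l hn) mulnA -E4 -E3 -/h.
by [].
Qed.

Lemma Kmn_xcore : x \in K.
Proof.
have xb : x \in L :^ b by have : x \in <[a]> :&: L :^ b; [rewrite Kmn_HLb cycle_id | case/setIP].
apply/bigcapP=> g gG; case: (boolP (g \in L)) => gL.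
  by rewrite conjGid // groupX.
have : g \in <[a]> :* b * <[a]> by rewrite (Kmn_dcoset k m0); apply/setDP.
case/mulsgP=> _ v /rcosetP[u uH ->] vH ->.
have uL := subsetP (kmn_HL k) _ uH.
rewrite !conjsgM (conjGid uL).
have -> : x = x ^ v.
  by apply/esym/conjg_fixP/commgP/(centsP (cycle_abelian a)) => //; rewrite mem_cycle.
by rewrite memJ_conjg.
Qed.

Lemma Kmn_Knorm : G \subset 'N(K).
Proof. exact: gcore_norm. Qed.

Lemma Kmn_ycore : y \in K.
Proof. by rewrite memJ_norm ?Kmn_xcore // (subsetP Kmn_Knorm). Qed.

Lemma Kmn_Knormal : K <| G.
Proof. by apply: gcore_normal; exact: kmn_LG k. Qed.

Lemma Kmn_KL : K \subset L.
Proof. exact: gcore_sub. Qed.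

Lemma Kmn_xyTI : <[x]> :&: <[y]> = 1.
Proof.
apply/trivgP; rewrite /= -(kmn_TI k) cycleJ; apply: setISS; last rewrite conjSg.
  by rewrite cycle_subG mem_cycle.
by rewrite cycle_subG mem_cycle.
Qed.

Lemma Kmn_HyTI : <[a]> :&: <[y]> = 1.
Proof.
by apply/trivgP; rewrite /= -(kmn_TI k) cycleJ; apply: setIS; rewrite conjSg cycle_subG mem_cycle.
Qed.

Lemma Kmn_LE : <[a]> * <[y]> = L.
Proof.
apply/eqP; rewrite eqEcard; apply/andP; split.
  by rewrite mul_subG ?(kmn_HL k) // cycle_subG (subsetP Kmn_KL) ?Kmn_ycore.
by rewrite (TI_cardMg Kmn_HyTI) -!orderE (kmn_orda k) Kmn_ordery (kmn_cardL k).
Qed.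

Lemma Kmn_HK : <[a]> :&: K = <[x]>.
Proof.
apply/eqP; rewrite eqEsubset; apply/andP; split.
  by rewrite -Kmn_HLb; apply: setIS; apply: (bigcap_inf b).
by rewrite subsetI !cycle_subG mem_cycle Kmn_xcore.
Qed.

Lemma Kmn_KE : <[x]> * <[y]> = K.
Proof.
have yK : <[y]> \subset K by rewrite cycle_subG Kmn_ycore.
apply/esym; rewrite -{1}(setIidPl Kmn_KL) -[X in _ :&: X]Kmn_LE -Kmn_HK [_ :&: K]setIC.
by rewrite group_modr.
Qed.

Lemma Kmn_cardK : #|K| = (n * n)%N.
Proof. by rewrite -Kmn_KE (TI_cardMg Kmn_xyTI) -!orderE Kmn_ordery Kmn_orderx. Qed.

Lemma Kmn_yyaTI : <[y]> :&: <[y ^ a]> = 1.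
Proof.
have gG : b * a * b \in G by rewrite !groupM.
have gL : b * a * b \notin L.
  have aLb : a \notin L :^ b.
    apply/negP=> aLb; have : a \in <[a]> :&: L :^ b by rewrite inE cycle_id.
    rewrite Kmn_HLb -cycle_subG => /subset_leq_card.
    rewrite -!orderE Kmn_orderx (kmn_orda k) -{2}(mul1n n) leq_pmul2r // => h.
    by have := leq_trans m3 (leqnn m); lia.
  apply: contra aLb; rewrite -(memJ_conjg _ b) /conjg !mulgA Kmn_bV.
  by rewrite Kmn_bb mul1g -mulgA Kmn_bb mulg1.
apply/trivgP; rewrite /= -(conjs1g b) -(Kmn_TI k m0 gG gL).
have e : b * a * b * b = b * a by rewrite -mulgA Kmn_bb mulg1.
rewrite conjIg -conjsgM e conjsgM.
by rewrite -!cycleJ !conjXg; apply: setISS; rewrite cycle_subG mem_cycle.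
Qed.
End Kernel.

Section Layer.
Local Open Scope group_scope.

Definition layer (m n : nat) (gT : finGroupType) (a b : gT) (r : nat) : {group gT} :=
  (<[(a ^+ (m - 1)) ^+ (n %/ r)]> <*> <[((a ^+ (m - 1)) ^ b) ^+ (n %/ r)]>)%G.

Lemma order_expg_div (gT : finGroupType) (g : gT) (d : nat) :
  0 < d -> d %| #[g] -> #[g ^+ (#[g] %/ d)] = d.
Proof.
move=> d0 dg; rewrite orderXdiv ?dvdn_div //.
by rewrite -{1}(divnK dg) mulKn // divn_gt0 // dvdn_leq.
Qed.

Lemma cycle_sub_of_dvd (gT : finGroupType) (g : gT) (d : nat) (W : {group gT}) :
  0 < d -> d %| #[g] -> d %| #|W| -> W \subset <[g]> -> <[g ^+ (#[g] %/ d)]> \subset W.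
Proof.
move=> d0 dg dW Wg; rewrite -(cardSg_cyclic (cycle_cyclic g)) ?cycle_subG ?mem_cycle //.
by rewrite /= -orderE order_expg_div.
Qed.

Lemma eq_mulg_conj (gT : finGroupType) (g u p : gT) : g = u * p ^ g -> g = p * u.
Proof.
rewrite conjgE => eg; have e : u * (g^-1 * p) = 1.
  by apply: (mulIg g); rewrite mul1g -!mulgA; exact: esym eg.
apply: invg_inj; rewrite invMg; apply: (mulgI u); apply: (mulIg p).
by rewrite mulVKg mulVg -mulgA e.
Qed.
End Layer.

Section Layer2.
Local Open Scope group_scope.
Variables (m n : nat) (gT : finGroupType) (a b : gT) (L : {group gT}).
Hypotheses (k : Kmn_group m n a b L) (m3 : 2 < m) (n0 : 0 < n).
Local Notation G := (mgrp a b).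
Local Notation x := (a ^+ (m - 1)).
Local Notation y := (x ^ b).
Local Notation K := (gcore L G).

Let aG : a \in G. Proof. exact: mem_mgrpl. Qed.
Let bG : b \in G. Proof. exact: mem_mgrpr. Qed.
Let ox : #[x] = n. Proof. exact: Kmn_orderx k m3. Qed.
Let oy : #[y] = n. Proof. exact: Kmn_ordery k m3. Qed.
Let xK : x \in K. Proof. exact: Kmn_xcore k m3 n0. Qed.
Let yK : y \in K. Proof. exact: Kmn_ycore k m3 n0. Qed.
Let GNK : G \subset 'N(K). Proof. exact: Kmn_Knorm. Qed.

Lemma Kmn_prime_normal : 1 < n -> exists2 r, prime r & (r %| n) /\ y \in 'N(<[x ^+ (n %/ r)]>).
Proof.
move=> n1; pose W := <[x]> :&: <[x ^ y]>.
have W1 : W != 1.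
  apply/eqP => W1.
  have E : <[x]> * <[x ^ y]> = K.
    apply/eqP; rewrite eqEcard; apply/andP; split.
      by rewrite mul_subG // cycle_subG // groupJ.
    rewrite (TI_cardMg W1) -!orderE orderJ.
    by rewrite (Kmn_cardK k m3 n0) ox.
  move: yK; rewrite -E => /mulsgP[u v uX /cycleP[i ->]].
  rewrite -conjXg => /eq_mulg_conj ey.
  have yX : y \in <[x]>.
    rewrite ey.
    by rewrite groupM // mem_cycle.
  have : y \in <[x]> :&: <[y]> by rewrite inE yX cycle_id.
  rewrite (Kmn_xyTI k) inE -order_eq1 oy => /eqP; lia.
pose r := pdiv #|W|.
have cW : 1 < #|W| by rewrite cardG_gt1.
have pr : prime r by apply: pdiv_prime.
have rW : r %| #|W| by apply: pdiv_dvd.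
have rn : r %| n.
  by apply: dvdn_trans rW _; rewrite -ox orderE cardSg ?subsetIl.
exists r => //; split=> //.
have S1 : <[x ^+ (n %/ r)]> \subset W.
  by rewrite -{1}ox; apply: cycle_sub_of_dvd; rewrite ?prime_gt0 ?ox ?subsetIl.
apply/normP; rewrite -cycleJ conjXg; apply/eqP.
have oxr : #[x ^+ (n %/ r)] = r by rewrite -{1}ox order_expg_div ?prime_gt0 ?ox.
rewrite eq_sym (eq_subG_cyclic (cycle_cyclic (x ^ y))).
- by rewrite -!orderE -conjXg orderJ.
- by apply: subset_trans S1 _; apply: subsetIr.
- by rewrite cycle_subG mem_cycle.
Qed.

Section FixedPrime.
Variable r : nat.
Hypotheses (pr : prime r) (rn : r %| n).
Local Notation n1 := (x ^+ (n %/ r)).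
Local Notation n2 := (y ^+ (n %/ r)).
Local Notation N := (layer m n a b r).

Let r0 : 0 < r. Proof. exact: prime_gt0. Qed.

Lemma layer_on1 : #[n1] = r.
Proof. by rewrite -{1}ox order_expg_div ?ox. Qed.

Lemma layer_on2 : #[n2] = r.
Proof. by rewrite -{1}oy order_expg_div ?oy. Qed.

Lemma layer_n1b : n1 ^ b = n2.
Proof. by rewrite conjXg. Qed.

Lemma layer_n2b : n2 ^ b = n1.
Proof. by rewrite conjXg (Kmn_yb k). Qed.

Lemma layer_n1a : n1 ^ a = n1.
Proof. by rewrite conjXg Kmn_xa. Qed.

Lemma layer_n1K : n1 \in K. Proof. by rewrite groupX. Qed.

Lemma layer_n2K : n2 \in K. Proof. by rewrite groupX. Qed.

Lemma layer_sub : N \subset K.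
Proof. by rewrite join_subG !cycle_subG layer_n1K layer_n2K. Qed.

Lemma layer_n1X : <[n1]> \subset <[x]>. Proof. by rewrite cycle_subG mem_cycle. Qed.

Lemma layer_n2X : <[n2]> \subset <[y]>. Proof. by rewrite cycle_subG mem_cycle. Qed.

Lemma layer_TI : <[n1]> :&: <[n2]> = 1.
Proof.
by apply/trivgP; rewrite /= -(Kmn_xyTI k); apply: setISS; [exact: layer_n1X | exact: layer_n2X].
Qed.

Section Normalized.
Hypothesis yN : y \in 'N(<[n1]>).

Lemma layer_KN1 : K \subset 'N(<[n1]>).
Proof.
rewrite -(Kmn_KE k m3 n0) mul_subG ?cycle_subG //.
by apply: (subsetP (cent_sub _)); rewrite cent_cycle; apply/cent1P/commuteX.
Qed.
Lemma layer_KN2 : K \subset 'N(<[n2]>).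
Proof.
have /normsP/(_ b bG) <- := GNK.
by rewrite -layer_n1b cycleJ normJ conjSg layer_KN1.
Qed.
Lemma layer_KN3 : K \subset 'N(<[n2 ^ a]>).
Proof.
have /normsP/(_ a aG) <- := GNK.
by rewrite cycleJ normJ conjSg layer_KN2.
Qed.
Lemma layer_comm : commute n1 n2.
Proof.
apply/commgP/eqP/set1P; rewrite -[[set 1]]/(1 : {set gT}) -layer_TI.
apply/setIP; split.
  rewrite commgEl groupM ?groupV ?cycle_id //.
  by rewrite memJ_norm ?cycle_id // (subsetP layer_KN1) ?layer_n2K.
rewrite commgEr groupM ?cycle_id //.
by rewrite memJ_norm ?groupV ?cycle_id // (subsetP layer_KN2) ?layer_n1K.
Qed.

Lemma layer_NE : N = <[n1]> * <[n2]> :> {set gT}.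
Proof.
rewrite /layer /= norm_joinEl // cycle_subG.
by rewrite (subsetP layer_KN2) ?layer_n1K.
Qed.

Lemma layer_cardN : #|N| = (r * r)%N.
Proof. by rewrite layer_NE (TI_cardMg layer_TI) -!orderE layer_on1 layer_on2. Qed.

Lemma layer_xy3TI : <[x]> :&: <[y ^ a]> = 1.
Proof.
rewrite -(conjs1g a) -(Kmn_xyTI k) conjIg -!cycleJ; congr (<[_]> :&: _).
by rewrite Kmn_xa.
Qed.

Lemma layer_n3 : n2 ^ a \in N.
Proof.
have n3N : <[y ^ a]> \subset 'N(<[n2]>).
  by rewrite cycle_subG (subsetP layer_KN2) // memJ_norm // (subsetP GNK).
pose U := (<[n2]> <*> <[y ^ a]>)%G.
have UE : U = <[n2]> * <[y ^ a]> :> {set gT} by rewrite /= norm_joinEr.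
have TI23 : <[n2]> :&: <[y ^ a]> = 1.
  apply/trivgP; rewrite /= -(Kmn_yyaTI k m3 n0); apply: setSI; exact: layer_n2X.
have cU : #|U| = (r * n)%N by rewrite UE (TI_cardMg TI23) -!orderE layer_on2 orderJ oy.
have KE3 : <[x]> * <[y ^ a]> = K.
  apply/eqP; rewrite eqEcard mul_subG ?cycle_subG //=; last by rewrite memJ_norm // (subsetP GNK).
  by rewrite (TI_cardMg layer_xy3TI) -!orderE orderJ ox oy (Kmn_cardK k m3 n0).
have UK : U \subset K.
  by rewrite join_subG !cycle_subG layer_n2K memJ_norm ?yK // (subsetP GNK).
have cUx : #|U :&: <[x]>| = r.
  have e : (U :&: <[x]>) * <[y ^ a]> = U.
    rewrite group_modr; first by rewrite KE3 (setIidPl UK).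
    by rewrite /= joing_subr.
  have TI : U :&: <[x]> :&: <[y ^ a]> = 1.
    apply/trivgP; rewrite /= -layer_xy3TI; apply: setSI; exact: subsetIr.
  have := TI_cardMg TI; rewrite e -orderE orderJ oy cU => /eqP.
  by rewrite eqn_pmul2r // => /eqP.
have n1U : <[n1]> \subset U.
  apply: subset_trans (subsetIl U <[x]>).
  by rewrite -{1}ox; apply: cycle_sub_of_dvd; rewrite ?ox ?subsetIr //= cUx.
have NU : N \subset U by rewrite join_subG n1U joing_subl.
have c1 : r %| #|N :&: <[y ^ a]>|.
  have e : (r * r * n = #|(N * <[y ^ a]>)%g| * #|N :&: <[y ^ a]>|)%N.
    by rewrite -[RHS](mul_cardG N <[y ^ a]>%G) layer_cardN -orderE orderJ oy.
  have : #|(N * <[y ^ a]>)%g| <= r * n.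
    by rewrite -cU subset_leq_card // mul_subG // joing_subr.
  have : #|N :&: <[y ^ a]>| %| r * r.
    by rewrite -layer_cardN cardSg // subsetIl.
  rewrite -(expnSr r 1) => /(dvdn_pfactor _ _ pr)[[|j] _ cW] le; last first.
    by rewrite cW expnS dvdn_mulr.
  have r1 := prime_gt1 pr; move: e le; rewrite cW muln1 => <-.
  by rewrite leq_pmul2r // -{3}(muln1 r) leq_pmul2l // leqNgt r1.
have : <[(y ^ a) ^+ (n %/ r)]> \subset N :&: <[y ^ a]>.
  have := @cycle_sub_of_dvd _ (y ^ a) r (N :&: <[y ^ a]>)%G.
  by rewrite orderJ oy; apply => //; exact: subsetIr.
by rewrite -conjXg cycle_subG => /setIP[].
Qed.

Lemma layer_norm : G \subset 'N(N).
Proof.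
rewrite mgrp_sub; apply/andP; split; rewrite inE /=.
  rewrite conjYg -!cycleJ layer_n1a join_subG !cycle_subG layer_n3 andbT.
  by rewrite mem_gen // inE cycle_id.
rewrite conjYg -!cycleJ layer_n1b layer_n2b join_subG !cycle_subG.
by rewrite !mem_gen // inE cycle_id ?orbT.
Qed.

Lemma layer_cent : K \subset 'C(N).
Proof.
have n1N : n1 \in N by rewrite mem_gen // inE cycle_id.
have n2N : n2 \in N by rewrite mem_gen // inE cycle_id orbT.
have xC : x \in 'C(N).
  have xn1 : commute x n1 by exact: commuteX.
  rewrite layer_NE centM inE !cent_cycle.
  have -> /= : x \in 'C[n1] by apply/cent1P/commute_sym.
  have := layer_n3; rewrite layer_NE => /mulsgP[u v uX vY euv].
  have vx : v ^ x = v.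
    suff : [~ v, x] \in <[y]> :&: <[y ^ a]>.
      rewrite (Kmn_yyaTI k m3 n0) commgEl => /set1P e.
      by apply: (mulgI v^-1); rewrite e mulVg.
    apply/setIP; split.
      apply: (subsetP layer_n2X); rewrite commgEl groupM ?groupV //.
      by rewrite memJ_norm // (subsetP layer_KN2).
    have -> : [~ v, x] = [~ n2 ^ a, x].
      rewrite euv commMgJ.
      have -> : [~ u, x] = 1.
        by apply/eqP/commgP; case/cycleP: uX => i ->; apply/commute_sym/commuteX.
      by rewrite conj1g mul1g.
    have n3X : <[n2 ^ a]> \subset <[y ^ a]> by rewrite conjXg cycle_subG mem_cycle.
    apply: (subsetP n3X); rewrite commgEl groupM ?groupV ?cycle_id //.
    by rewrite memJ_norm ?cycle_id // (subsetP layer_KN3).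
  have v1 : v != 1.
    apply/eqP => v1; have : n2 ^ a \in <[x]> :&: <[y ^ a]>.
      rewrite inE {2}conjXg mem_cycle andbT euv v1 mulg1.
      exact: (subsetP layer_n1X).
    rewrite layer_xy3TI => /set1P e; have := prime_gt1 pr.
    by rewrite -layer_on2 -(orderJ n2 a) e order1.
  have ov : #[v] = r.
    apply: nt_prime_order => //; apply/eqP; rewrite -order_dvdn -layer_on2.
    exact: order_dvdG vY.
  have n2v : n2 \in <[v]>.
    have -> : <[v]> = <[n2]>; last exact: cycle_id.
    apply/eqP; rewrite (eq_subG_cyclic (cycle_cyclic n2)) ?cycle_subG ?cycle_id //.
    by rewrite -!orderE ov layer_on2.
  have vxc : commute x v by apply/commute_sym/commgP/conjg_fixP.
  by case/cycleP: n2v => i ->; apply/cent1P/(commuteX i vxc).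
have yC : y \in 'C(N).
  have /normsP/(_ b bG) <- := layer_norm.
  by rewrite centJ memJ_conjg.
by rewrite -(Kmn_KE k m3 n0) mul_subG ?cycle_subG.
Qed.
End Normalized.
End FixedPrime.
End Layer2.

Section QuotientMap.
Local Open Scope group_scope.
Variables (m n : nat) (gT : finGroupType) (a b : gT) (L : {group gT}).
Hypotheses (k : Kmn_group m n a b L) (m3 : 2 < m) (n0 : 0 < n).
Local Notation G := (mgrp a b).
Local Notation x := (a ^+ (m - 1)).
Local Notation y := (x ^ b).
Local Notation K := (gcore L G).
Variables (N : {group gT}) (d : nat).
Hypotheses (NK : N \subset K) (GN : G \subset 'N(N)) (d0 : 0 < d) (dn : d %| n).
Hypotheses (cN : #|N| = (d * d)%N) (xN : x ^+ (n %/ d) \in N).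

Let aG : a \in G. Proof. exact: mem_mgrpl. Qed.
Let bG : b \in G. Proof. exact: mem_mgrpr. Qed.
Let ox : #[x] = n. Proof. exact: Kmn_orderx k m3. Qed.
Let oy : #[y] = n. Proof. exact: Kmn_ordery k m3. Qed.
Let NL : N \subset L. Proof. exact: subset_trans NK (Kmn_KL _ _ _). Qed.
Let NG : N \subset G. Proof. exact: subset_trans NL (kmn_LG k). Qed.

Lemma mgrp_quotient (M : {group gT}) : G \subset 'N(M) ->
  mgrp (coset M a) (coset M b) = (G / M)%G.
Proof.
move=> GM; apply/val_inj; rewrite /= quotient_gen ?subUset ?sub1set; last first.
  by rewrite !(subsetP GM).
by rewrite quotientU !quotient_set1 ?(subsetP GM).
Qed.

Let yN : y ^+ (n %/ d) \in N.
Proof. by rewrite -conjXg memJ_norm // (subsetP GN). Qed.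

Let sN1 : <[x ^+ (n %/ d)]> \subset N. Proof. by rewrite cycle_subG. Qed.
Let sN2 : <[y ^+ (n %/ d)]> \subset N. Proof. by rewrite cycle_subG. Qed.

Let on1 : #[x ^+ (n %/ d)] = d. Proof. by rewrite -{1}ox order_expg_div ?ox. Qed.
Let on2 : #[y ^+ (n %/ d)] = d. Proof. by rewrite -{1}oy order_expg_div ?oy. Qed.

Lemma quotient_NE : <[x ^+ (n %/ d)]> * <[y ^+ (n %/ d)]> = N.
Proof.
apply/eqP; rewrite eqEcard mul_subG //= TI_cardMg.
  by rewrite -!orderE cN on1 on2.
apply/trivgP; rewrite /= -(Kmn_xyTI k).
by apply: setISS; rewrite cycle_subG mem_cycle.
Qed.

Lemma quotient_XN : N :&: <[x]> = <[x ^+ (n %/ d)]>.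
Proof.
apply/eqP; rewrite eq_sym eqEsubset subsetI sN1 cycle_subG mem_cycle /=.
apply/subsetP=> g /setIP[]; rewrite -quotient_NE => /mulsgP[u v uX vY ->] gX.
have uX' : u \in <[x]> by apply: (subsetP _ _ uX); rewrite cycle_subG mem_cycle.
have : v \in <[x]> :&: <[y]>.
  rewrite inE -(groupMl _ uX') gX; apply: (subsetP _ _ vY).
  by rewrite cycle_subG mem_cycle.
by rewrite (Kmn_xyTI k) => /set1P ->; rewrite mulg1.
Qed.

Lemma quotient_Kmn : Kmn_group m (n %/ d) (coset N a) (coset N b) (L / N)%G.
Proof.
have aNN : a \in 'N(N) by rewrite (subsetP GN).
have bNN : b \in 'N(N) by rewrite (subsetP GN).
have HN : <[a]> \subset 'N(N) by rewrite cycle_subG.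
have LN : L \subset 'N(N) by apply: subset_trans (kmn_LG k) GN.
have bL : coset N b \notin (L / N).
  apply: contra (kmn_bL k) => bL.
  have NLn : N <| L by apply/andP.
  by rewrite -(quotientGK NLn) mem_morphpre.
have idx (H : {group gT}) : H \subset 'N(N) -> N \subset H -> #|H / N| = (#|H| %/ (d * d))%N.
  by move=> h1 h2; rewrite card_quotient // -divgS ?cN.
have dd : 0 < d * d by rewrite muln_gt0 d0.
have nE : n = (n %/ d * d)%N by rewrite divnK.
split.
- apply: nt_prime_order => //; first by rewrite -morphX // -(kmn_ordb k) expg_order morph1.
  by apply: contraNneq bL => ->; rewrite group1.
- rewrite orderE -quotient_cycle // card_quotient // -divgI.
  have -> : <[a]> :&: N = <[x ^+ (n %/ d)]>.
    by rewrite -quotient_XN -(Kmn_HK k m3 n0) [RHS]setIC -setIA (setIidPr NK).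
  rewrite -!orderE (kmn_orda k) on1.
  by rewrite {1}nE mulnA mulnK.
- by rewrite cycle_subG mem_quotient // -cycle_subG (kmn_HL k).
- by rewrite (mgrp_quotient GN) quotientS ?(kmn_LG k).
- rewrite idx // (kmn_cardL k) {1 2}nE.
  by rewrite !mulnA -(mulnA _ d) (mulnC d) mulnA -mulnA mulnK.
- rewrite (mgrp_quotient GN) idx // (kmn_cardG k) {1 2}nE.
  by rewrite !mulnA -(mulnA _ d) (mulnC d) mulnA -mulnA mulnK.
- exact: bL.
apply/trivgP/subsetP=> _ /setIP[/cycleP[i ->]].
rewrite /= -cycleJ => /cycleP[j]; rewrite -morphX // -morphJ // -morphX ?groupJ //= => e.
have /rcosetP[v vN ev] : a ^+ i \in N :* ((a ^ b) ^+ j).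
  by apply/rcoset_kercosetP; rewrite ?groupX ?groupJ.
have aL : a \in L by rewrite -cycle_subG (kmn_HL k).
have KLb : K \subset L :^ b by apply: (bigcap_inf b).
have bb := Kmn_bb k.
have iX : a ^+ i \in <[x]>.
  rewrite -(Kmn_HLb k m3 n0) inE mem_cycle ev groupM //; first exact: (subsetP KLb _ (subsetP NK _ vN)).
  by rewrite groupX // memJ_conjg.
have jY : (a ^ b) ^+ j \in <[y]>.
  have : a ^+ j \in <[x]>.
    rewrite -(Kmn_HLb k m3 n0) inE mem_cycle -(memJ_conjg _ b) -conjsgM bb conjsg1.
    rewrite conjXg -(groupMl _ (subsetP NL _ vN)) -ev.
    by rewrite groupX.
  by rewrite -conjXg cycleJ memJ_conjg.
have /mulsgP[u w uX wY vE] : v \in <[x ^+ (n %/ d)]> * <[y ^+ (n %/ d)]> by rewrite quotient_NE.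
have uX' : u \in <[x]> by apply: (subsetP _ _ uX); rewrite cycle_subG mem_cycle.
have wY' : w \in <[y]> by apply: (subsetP _ _ wY); rewrite cycle_subG mem_cycle.
have : u^-1 * a ^+ i \in <[x]> :&: <[y]>.
  by rewrite inE groupM ?groupV //= ev vE -mulgA mulKg groupM.
rewrite (Kmn_xyTI k) => /set1P e1.
have -> : a ^+ i = u by rewrite -(mulKVg u (a ^+ i)) e1 mulg1.
by apply/set1P/coset_id; apply: (subsetP sN1).
Qed.


Lemma quotient_gcore : gcore (L / N)%G (mgrp (coset N a) (coset N b)) = K / N.
Proof.
apply/eqP; rewrite eq_sym eqEcard; apply/andP; split.
  rewrite (mgrp_quotient GN); apply: gcore_max; first by rewrite quotientS // Kmn_KL.
  by rewrite quotient_norms // Kmn_Knorm.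
rewrite (Kmn_cardK quotient_Kmn) ?divn_gt0 ?(dvdn_leq n0) //.
have KN : K \subset 'N(N) by apply: subset_trans GN; apply: subset_trans (Kmn_KL _ _ _) (kmn_LG k).
rewrite card_quotient // -divgS // cN (Kmn_cardK k m3 n0) -{3 4}(divnK dn).
by rewrite mulnACA mulnK ?muln_gt0 ?d0.
Qed.
End QuotientMap.

Import GRing.Theory.

Section AffineOrbit.
Local Open Scope ring_scope.
Variables (r : nat) (m : nat) (al be : 'F_r).
Let A k := al * \sum_(i < k) be ^+ i.
Let B k := be ^+ k.
Hypotheses (pr : prime r) (m3 : (2 < m)%N) (al0 : al != 0) (be0 : be != 0).
Hypothesis swapH : forall k, (B k = 1 /\ A k = 0) \/ exists j, B k = A j /\ A k = B j.
Hypothesis perH : forall k, A k = 0 -> B k = 1 -> (m.-1 %| k)%N.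
Hypothesis perB : be ^+ m.-1 = 1.

Lemma affine_orbit : (m = 3 /\ al = -1 /\ be = -1) \/ (m = r /\ al = 1 - be).
Proof.
have A1 : A 1 = al by rewrite /A big_ord_recl big_ord0 expr0 addr0 mulr1.
have A2 : A 2 = al * (1 + be).
  by rewrite /A !big_ord_recl big_ord0 addr0 expr0 expr1.
have B1 : B 1 = be by rewrite /B expr1.
case: (eqVneq be 1) => [be1|be1].
  have Ak k : A k = al * k%:R.
    by rewrite /A be1 (eq_bigr (fun=> 1)) ?sumr_const ?card_ord // => i _; rewrite expr1n.
  have Bk k : B k = 1 by rewrite /B be1 expr1n.
  have al1 : al = 1.
    case: (swapH 1) => [[_]|[j []]]; rewrite A1 ?Bk //.
    by move/eqP; rewrite (negPf al0).
  have two : 2%:R = 0 :> 'F_r.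
    case: (swapH 2) => [[_]|[j [_]]]; rewrite Ak al1 mul1r // Bk => e.
    by move/eqP: e; rewrite -subr_eq0 mulr2n addrK oner_eq0.
  left; have : (m.-1 %| 2)%N by apply: perH; rewrite ?Ak ?two ?mulr0 ?Bk.
  move/(@dvdn_leq _ 2 isT) => m2; split; first lia.
  have e : -1 = 1 :> 'F_r by apply/eqP; rewrite eq_sym -subr_eq0 opprK -mulr2n two.
  by rewrite al1 be1 e.
have be1' : be - 1 != 0 by rewrite subr_eq0.
have Ak k : A k * (be - 1) = al * (B k - 1).
  by rewrite /A /B -mulrA [X in al * X]mulrC -subrX1.
have E : al = be \/ al = 1 - be.
  case: (swapH 1) => [[]|[j []]]; rewrite B1.
    by move/eqP; rewrite (negPf be1).
  rewrite A1 => e1 e2; have := Ak j; rewrite -e1 -e2 => e3.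
  have : (be - al) * (be + al - 1) == 0.
    by rewrite -subr_eq0 subr0; apply/eqP; transitivity (be * (be - 1) - al * (al - 1)); [ring|rewrite e3 subrr].
  rewrite mulf_eq0 !subr_eq0 => /orP[/eqP ->|/eqP <-]; first by left.
  by right; ring.
case: (eqVneq al (1 - be)) => [E'|E'].
  right; split=> //.
  pose S u := u = 0 \/ exists k, u = be ^+ k.
  have S1 : S 1 by right; exists 0%N.
  have SM u v : S u -> S v -> S (u * v).
    case=> [->|[i ->]]; first by left; rewrite mul0r.
    case=> [->|[j ->]]; first by left; rewrite mulr0.
    by right; exists (i + j)%N; rewrite exprD.
  have SC u : S u -> S (1 - u).
    case=> [->|[i ->]]; first by rewrite subr0.
    case: (swapH i) => [[e _]|[j [_ e]]].
      by left; rewrite -/(B i) e subrr.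
    right; exists j; rewrite -/(B j) -e; apply: (mulIf be1'); rewrite Ak E' /B; ring.
  have SV u : S u -> u != 0 -> S u^-1.
    case=> [->|[i ->]]; first by rewrite eqxx.
    move=> _; right; exists (i * (m.-2))%N.
    apply: (mulfI (expf_neq0 i be0)); rewrite divff ?expf_neq0 // -exprD -mulnS.
    by rewrite prednK ?[(i * _)%N]mulnC ?exprM ?perB ?expr1n //; lia.
  have SN : S (-1).
    have h1 : 1 - be != 0 by rewrite subr_eq0 eq_sym.
    have Sb : S be by right; exists 1%N.
    have -> : -1 = be * (1 - be^-1) * (1 - be)^-1.
      by field; rewrite be0 h1.
    by apply: (SM _ _); [apply: (SM _ _ Sb); apply/SC/SV | apply: SV => //; apply: (SC _)].
  have SD u : S u -> S (u + 1).
    move=> Su; have -> : u + 1 = 1 - (-1 * u) by ring.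
    by apply/SC/SM.
  have Sall u : S u.
    rewrite -[u]natr_Zp; elim: (nat_of_ord u) => [|c IH]; first by left.
    by rewrite -addn1 natrD; apply: SD.
  have cF : #|'F_r| = r by rewrite card_Fp.
  have bo : be ^+ r.-1 = 1.
    apply: (mulfI be0); rewrite -exprS prednK ?prime_gt0 // mulr1.
    by have := expf_card be; rewrite cF.
  have d1 : (m.-1 %| r.-1)%N.
    apply: perH => //; apply: (mulIf be1').
    by rewrite Ak mul0r /B bo subrr mulr0.
  have le1 : (r.-1 <= m.-1)%N.
    have -> : r.-1 = #|[set u : 'F_r | u != 0]|.
      by rewrite cardsE cardC1 cF.
    pose g (i : 'I_m.-1) := be ^+ i.
    apply: (@leq_trans #|[set g i | i : 'I_m.-1]|).
      apply/subset_leq_card/subsetP=> u; rewrite inE => u0.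
      case: (Sall u) => [e|[i ->]]; first by rewrite e eqxx in u0.
      have m1 : (0 < m.-1)%N by lia.
      apply/imsetP; exists (Ordinal (ltn_pmod i m1)) => //.
      by rewrite /g /= {1}(divn_eq i m.-1) exprD mulnC exprM perB expr1n mul1r.
    by apply: leq_trans (leq_imset_card _ _) _; rewrite card_ord.
  have := dvdn_leq _ d1; have := prime_gt1 pr; move: le1 m3; lia.
left; have {}E : al = be.
  by case: E => // E; rewrite E eqxx in E'.
case: (swapH 2) => [[e1 e2]|[j [e1 e2]]].
  move: e2; rewrite A2 => /eqP; rewrite mulf_eq0 (negPf al0) /= => /eqP e2.
  have e : be = -1 by apply/eqP; rewrite -subr_eq0 opprK addrC e2.
  have : (m.-1 %| 2)%N by apply: perH; rewrite // A2 e2 mulr0.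
  by move/(@dvdn_leq _ 2 isT) => m2; split; [lia | rewrite E e].
case/eqP: E'; have := Ak j; rewrite -e1 -e2 A2 E /B => e3.
have e4 : be * (be - 1 + 2%:R * be * 0 + be) = 0.
  have : be ^+ 2 * (be - 1) - be * (be * (1 + be) - 1) = 0 by rewrite e3 subrr.
  move=> e5; rewrite -[RHS]oppr0 -[in RHS]e5; ring.
move/eqP: e4; rewrite mulf_eq0 (negPf be0) /= => /eqP e4.
by apply/eqP; rewrite -subr_eq0; apply/eqP; rewrite -[RHS]e4; ring.
Qed.

Lemma affine_orbit3 : m = 3 -> al = -1 /\ be = -1.
Proof.
move=> em; case: affine_orbit => [[_ //]|[er E]].
have be1 : be != 1 by apply: contraNneq al0 => e; rewrite E e subrr.
have e : be = -1.
  have := perB; rewrite em /= => /eqP; rewrite sqrf_eq1 (negPf be1) /= => /eqP //.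
have three : 3%:R = 0 :> 'F_r by apply/val_inj; rewrite [LHS]val_Fp_nat // -er em.
split=> //; rewrite E e opprK; apply/eqP; rewrite -subr_eq0 opprK; apply/eqP.
by rewrite -[RHS]three; ring.
Qed.
End AffineOrbit.

Section TwoGenerators.
Local Open Scope group_scope.
Variables (m r al be : nat) (gT : finGroupType) (a b u v : gT).
Hypotheses (pr : prime r) (m3 : 2 < m) (cuv : commute u v) (ou : #[u] = r) (ov : #[v] = r).
Hypothesis inj : forall i j i' j', u ^+ i * v ^+ j = u ^+ i' * v ^+ j' ->
  (i = i' %[mod r]) /\ (j = j' %[mod r]).
Hypotheses (ua : u ^ a = u) (ub : u ^ b = v) (vb : v ^ b = u).
Hypothesis va : v ^ a = u ^+ al * v ^+ be.
Hypotheses (vau : v ^ a \notin <[u]>) (vav : v ^ a \notin <[v]>).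
Hypothesis stab : forall j, (v ^ (a ^+ j)) ^ b = u \/ exists i, (v ^ (a ^+ j)) ^ b = v ^ (a ^+ i).
Hypothesis per : forall j, v ^ (a ^+ j) = v -> m.-1 %| j.
Hypothesis per1 : v ^ (a ^+ m.-1) = v.

Let A j := (al * \sum_(i < j) be ^ i)%N.

Let FE (i j : nat) : (i = j %[mod r]) <-> (i%:R = j%:R :> 'F_r)%R.
Proof.
split=> e; first by apply/val_inj; rewrite [LHS]val_Fp_nat // [RHS]val_Fp_nat.
by rewrite -!(val_Fp_nat pr) e.
Qed.

Lemma conj_expg_pair j : v ^ (a ^+ j) = u ^+ A j * v ^+ (be ^ j).
Proof.
have cX i l : commute (u ^+ i) (v ^+ l) by apply: commuteX2.
elim: j => [|j IH]; first by rewrite /A big_ord0 muln0 mul1g conjg1 expn0.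
rewrite expgSr conjgM IH conjMg !conjXg ua va expgMn // -!expgM.
by rewrite mulgA -expgD /A big_ord_recr mulnDr expnS.
Qed.

Lemma two_generators :
  [/\ m = 3 \/ m = r,
      m = 3 -> v ^ a = u^-1 * v^-1
    & m = r -> exists l, (u^-1 * v) ^ a = (u^-1 * v) ^+ l].
Proof.
pose alF : 'F_r := al%:R%R; pose beF : 'F_r := be%:R%R.
have AF j : ((A j)%:R = alF * \sum_(i < j) beF ^+ i)%R.
  by rewrite /A natrM natr_sum; congr (_ * _)%R; apply: eq_bigr => i _; rewrite natrX.
have BF j : ((be ^ j)%:R = beF ^+ j)%R by rewrite natrX.
have v1 : v ^+ 1 = v by [].
have zF (c : nat) : (c%:R = 0 :> 'F_r)%R -> r %| c.
  by rewrite -(mulr0n 1%R) => /(FE c 0) e; rewrite /dvdn e mod0n.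
have al0 : (alF != 0)%R.
  apply: contra vav => /eqP /zF d; rewrite va.
  have -> : u ^+ al = 1 by apply/eqP; rewrite -order_dvdn ou.
  by rewrite mul1g mem_cycle.
have be0 : (beF != 0)%R.
  apply: contra vau => /eqP /zF d; rewrite va.
  have -> : v ^+ be = 1 by apply/eqP; rewrite -order_dvdn ov.
  by rewrite mulg1 mem_cycle.
have swapH j : ((beF ^+ j = 1 /\ alF * \sum_(i < j) beF ^+ i = 0) \/
   exists i, beF ^+ j = alF * \sum_(l < i) beF ^+ l /\ alF * \sum_(l < j) beF ^+ l = beF ^+ i)%R.
  rewrite -AF -BF.
  have E : (v ^ (a ^+ j)) ^ b = u ^+ (be ^ j) * v ^+ A j.
    by rewrite conj_expg_pair conjMg !conjXg ub vb; apply: commuteX2; apply: commute_sym.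
  case: (stab j) => [e|[i e]].
    have := @inj (be ^ j) (A j) 1 0; rewrite -E e expg1 expg0 mulg1 => /(_ erefl)[].
    by move=> /FE e1 /FE e2; left; rewrite e1 e2.
  right; exists i; have := @inj (be ^ j) (A j) (A i) (be ^ i).
  rewrite -E e conj_expg_pair => /(_ erefl)[] /FE e1 /FE e2.
  by rewrite e1 e2 AF BF.
have perH j : (alF * \sum_(i < j) beF ^+ i = 0)%R -> (beF ^+ j = 1)%R -> m.-1 %| j.
  rewrite -AF -BF => /zF e1 e2; apply: per; rewrite conj_expg_pair.
  have -> : u ^+ A j = 1 by apply/eqP; rewrite -order_dvdn ou.
  rewrite mul1g -[RHS]expg1; apply/eqP; rewrite eq_expg_mod_order ov.
  by apply/eqP/FE.
have perB : (beF ^+ m.-1 = 1)%R.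
  rewrite -BF -(mulr1n 1%R); apply/FE.
  by have := @inj (A m.-1) (be ^ m.-1) 0 1; rewrite -conj_expg_pair per1 mul1g => /(_ erefl)[].
have h := affine_orbit pr m3 al0 be0 swapH perH perB.
split.
- by case: h => [[]|[]]; [left|right].
- move=> em; have [ea eb] := affine_orbit3 pr m3 al0 be0 swapH perH perB em.
  have inv (g : gT) (c : nat) : #[g] = r -> (c%:R = -1 :> 'F_r)%R -> g ^+ c = g^-1.
    move=> og ec; apply: (mulIg g); rewrite mulVg -expgSr; apply/eqP.
    by rewrite -order_dvdn og; apply: zF; rewrite -natr1 ec addNr.
  by rewrite va (inv _ _ ou ea) (inv _ _ ov eb).
- move=> em; exists be.
  have ab1 : u ^+ (al + be) = u.
    rewrite -[RHS]expg1; apply/eqP; rewrite eq_expg_mod_order ou; apply/eqP/FE.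
    rewrite natrD -/alF -/beF; case: h => [[m3' [-> ->]]|[_ ->]]; last by ring.
    have three : (3%:R = 0 :> 'F_r)%R by apply/val_inj; rewrite [LHS]val_Fp_nat // -em m3'.
    by rewrite -[LHS]addr0 -three; ring.
  have cV : commute u^-1 v by apply/commute_sym/commuteV.
  rewrite conjMg conjVg ua va expgMn // mulgA; congr (_ * _).
  by apply: (mulIg (u ^+ be)); rewrite -mulgA -expgD ab1 mulVg expgVn mulVg.
Qed.
End TwoGenerators.

Section LayerAction.
Local Open Scope group_scope.
Variables (m n : nat) (gT : finGroupType) (a b : gT) (L : {group gT}).
Hypotheses (k : Kmn_group m n a b L) (m3 : 2 < m) (n0 : 0 < n).
Local Notation G := (mgrp a b).
Local Notation x := (a ^+ (m - 1)).
Local Notation y := (x ^ b).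
Local Notation K := (gcore L G).
Variable r : nat.
Hypotheses (pr : prime r) (rn : r %| n).
Local Notation n1 := (x ^+ (n %/ r)).
Local Notation n2 := (y ^+ (n %/ r)).
Local Notation N := (layer m n a b r).
Hypothesis yN : y \in 'N(<[n1]>).

Let m0 : 0 < m. Proof. by apply: leq_trans m3. Qed.
Let aG : a \in G. Proof. exact: mem_mgrpl. Qed.
Let bG : b \in G. Proof. exact: mem_mgrpr. Qed.
Let on1 : #[n1] = r. Proof. exact: (layer_on1 k m3 pr rn). Qed.
Let on2 : #[n2] = r. Proof. exact: (layer_on2 k m3 pr rn). Qed.
Let c12 : commute n1 n2. Proof. exact: (layer_comm k m3 n0 yN). Qed.

Lemma layer_inj i j i' j' : n1 ^+ i * n2 ^+ j = n1 ^+ i' * n2 ^+ j' ->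
  (i = i' %[mod r]) /\ (j = j' %[mod r]).
Proof.
move=> e; have : n2 ^+ j * (n2 ^+ j')^-1 \in <[n1]> :&: <[n2]>.
  apply/setIP; split; last by rewrite groupM ?groupV ?mem_cycle.
  have -> : n2 ^+ j * (n2 ^+ j')^-1 = (n1 ^+ i)^-1 * n1 ^+ i'.
    by apply: (mulgI (n1 ^+ i)); apply: (mulIg (n2 ^+ j')); rewrite !mulgA mulgKV e mulgV mul1g.
  by rewrite groupM ?groupV ?mem_cycle.
rewrite (layer_TI k) => /set1P e2.
have e3 : n2 ^+ j = n2 ^+ j' by apply/eqP; rewrite eq_mulgV1 e2.
have e4 : n1 ^+ i = n1 ^+ i' by apply: (mulIg (n2 ^+ j)); rewrite e e3.
by move/eqP: e3; move/eqP: e4; rewrite !eq_expg_mod_order on1 on2 => /eqP -> /eqP ->.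
Qed.

Let n1a i : n1 ^ (a ^+ i) = n1.
Proof. by apply/conjg_fixP/commgP/commuteX/commute_sym/commuteX/commuteX. Qed.

Lemma layer_stabL g : g \in L -> n1 ^ g = n1.
Proof.
rewrite -(Kmn_LE k m3 n0) => /mulsgP[_ v /cycleP[i ->] vY ->].
rewrite conjgM n1a; apply/conjg_fixP/commgP.
have n1N : n1 \in N by rewrite mem_gen // inE cycle_id.
have vK : v \in K by apply: (subsetP _ _ vY); rewrite cycle_subG (Kmn_ycore k m3 n0).
by apply/commute_sym/(centP (subsetP (layer_cent k m3 n0 pr rn yN) _ vK)).
Qed.

Lemma layer_stabN g : g \in G -> g \notin L -> exists j, n1 ^ g = n2 ^ (a ^+ j).
Proof.
move=> gG gL; have : g \in <[a]> :* b * <[a]> by rewrite (Kmn_dcoset k m0); apply/setDP.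
case/mulsgP=> _ _ /rcosetP[_ /cycleP[i ->] ->] /cycleP[j ->] ->; exists j.
by rewrite !conjgM n1a (layer_n1b).
Qed.

Lemma layer_per j : n2 ^ (a ^+ j) = n2 -> m.-1 %| j.
Proof.
have n1b : n1 ^ b = n2 by rewrite conjXg.
have n2b : n2 ^ b = n1 by rewrite (layer_n2b k).
have m1E : m.-1 = (m - 1)%N by rewrite subn1.
move=> e; have gG : b * a ^+ j * b \in G by rewrite !groupM ?groupX.
case: (boolP (b * a ^+ j * b \in L)) => h.
  have : a ^+ j \in <[a]> :&: L :^ b.
    rewrite inE mem_cycle -(memJ_conjg _ b) -conjsgM (Kmn_bb k) conjsg1.
    by rewrite conjgE (Kmn_bV k) mulgA.
  rewrite (Kmn_HLb k m3 n0) => /cycleP[i]; rewrite -expgM => /eqP.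
  rewrite eq_expg_mod_order (kmn_orda k) m1E => /eqP e2.
  have : (m - 1) %| j %% ((m - 1) * n).
    by rewrite e2 /dvdn modn_dvdm ?dvdn_mulr // modnMr.
  by rewrite /dvdn modn_dvdm ?dvdn_mulr.
have [i] := layer_stabN gG h; rewrite !conjgM n1b e n2b => e2.
have e5 : n1 = n2 by apply: (conjg_inj (a ^+ i)); rewrite n1a.
have : n1 \in <[n1]> :&: <[n2]> by rewrite inE cycle_id e5 cycle_id.
rewrite (layer_TI k) => /set1P e4; have := prime_gt1 pr.
by rewrite -on1 e4 order1.
Qed.

Lemma layer_alt :
  [/\ m = 3 \/ m = r,
      m = 3 -> n2 ^ a = n1^-1 * n2^-1
    & m = r -> exists be, (n1^-1 * n2) ^ a = (n1^-1 * n2) ^+ be].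
Proof.
have := layer_n3 k m3 n0 pr rn yN; rewrite (layer_NE k m3 n0 yN).
case/mulsgP=> _ _ /cycleP[al ->] /cycleP[be ->] e3.
have n1a' : n1 ^ a = n1 by rewrite layer_n1a.
have n1b : n1 ^ b = n2 by rewrite conjXg.
have n2b : n2 ^ b = n1 by rewrite (layer_n2b k).
have m1E : m.-1 = (m - 1)%N by rewrite subn1.
have n2N : n2 \in N by rewrite mem_gen // inE cycle_id orbT.
apply: (@two_generators m r al be gT a b n1 n2) => //.
- exact: layer_inj.
- apply/negP=> h; have : n2 ^ a \in <[x]> :&: <[y ^ a]>.
    by rewrite inE (subsetP (layer_n1X _ _ _ _) _ h) conjXg mem_cycle.
  rewrite (layer_xy3TI k) => /set1P e; have := prime_gt1 pr.
  by rewrite -on2 -(orderJ n2 a) e order1.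
- apply/negP=> h; have : n2 ^ a \in <[y]> :&: <[y ^ a]>.
    by rewrite inE (subsetP (layer_n2X _ _ _ _ _) _ h) conjXg mem_cycle.
  rewrite (Kmn_yyaTI k m3 n0) => /set1P e; have := prime_gt1 pr.
  by rewrite -on2 -(orderJ n2 a) e order1.
- move=> j; have gG : b * a ^+ j * b \in G by rewrite !groupM ?groupX.
  have -> : (n2 ^ (a ^+ j)) ^ b = n1 ^ (b * a ^+ j * b) by rewrite !conjgM n1b.
  by case: (boolP (b * a ^+ j * b \in L)) => h; [left; apply: layer_stabL | right; apply: layer_stabN].
- exact: layer_per.
- rewrite m1E; apply/conjg_fixP/commgP/commute_sym.
  have xK : x \in K := Kmn_xcore k m3 n0.
  exact: (centP (subsetP (layer_cent k m3 n0 pr rn yN) _ xK)).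
Qed.
End LayerAction.

Section Peel.
Local Open Scope group_scope.

Record central_layer (m n : nat) (gT : finGroupType) (a b : gT) (L : {group gT}) (r : nat) : Prop :=
  CentralLayer {
    cl_prime : prime r;
    cl_dvd : r %| n;
    cl_sub : layer m n a b r \subset gcore L (mgrp a b);
    cl_norm : mgrp a b \subset 'N(layer m n a b r);
    cl_cent : gcore L (mgrp a b) \subset 'C(layer m n a b r);
    cl_card : #|layer m n a b r| = (r * r)%N;
    cl_NE : <[(a ^+ (m - 1)) ^+ (n %/ r)]> * <[((a ^+ (m - 1)) ^ b) ^+ (n %/ r)]> = layer m n a b r;
    cl_mr : m = 3 \/ m = r;
    cl_n2a3 : m = 3 -> let x := a ^+ (m - 1) in let y := x ^ b in
       (y ^+ (n %/ r)) ^ a = (x ^+ (n %/ r))^-1 * (y ^+ (n %/ r))^-1;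
    cl_za : m = r -> let x := a ^+ (m - 1) in let y := x ^ b in
       exists l, ((x ^+ (n %/ r))^-1 * y ^+ (n %/ r)) ^ a = ((x ^+ (n %/ r))^-1 * y ^+ (n %/ r)) ^+ l;
    cl_per : forall j, let x := a ^+ (m - 1) in let y := x ^ b in
       (y ^+ (n %/ r)) ^ (a ^+ j) = y ^+ (n %/ r) -> m.-1 %| j;
    cl_quo : Kmn_group m (n %/ r) (coset (layer m n a b r) a) (coset (layer m n a b r) b)
               (L / layer m n a b r)%G }.

Lemma Kmn_central_layer m n (gT : finGroupType) (a b : gT) (L : {group gT}) :
  Kmn_group m n a b L -> 2 < m -> 1 < n -> exists r, central_layer m n a b L r.
Proof.
move=> k m3 n1; have n0 : 0 < n by apply: ltnW.
have [r pr [rn yN]] := Kmn_prime_normal k m3 n0 n1.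
have [h1 h2 h3] := layer_alt k m3 n0 pr rn yN.
have NK := layer_sub k m3 n0 r.
have NE := layer_NE k m3 n0 yN.
have GN := layer_norm k m3 n0 pr rn yN.
have cN := layer_cardN k m3 n0 pr rn yN.
exists r; split=> //; first exact: layer_cent.
  by move=> j x y; apply: (layer_per k m3 n0 pr rn).
by apply: quotient_Kmn => //; rewrite ?prime_gt0 // mem_gen // inE cycle_id.
Qed.

Lemma Kmn_prime_power m n (gT : finGroupType) (a b : gT) (L : {group gT}) :
  Kmn_group m n a b L -> 3 < m -> 0 < n ->
  (1 < n -> prime m) /\ exists e, n = (m ^ e)%N.
Proof.
elim: n {-2}n (leqnn n) gT a b L => [|c IH] n nc gT a b L k m3 n0; first by lia.
have [n1|n1] := leqP n 1.
  by split; [lia | exists 0; rewrite expn0; lia].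
have [r C] := Kmn_central_layer k (ltnW m3) n1.
have er : m = r by case: (cl_mr C) => // e; move: m3; rewrite e.
have pr := cl_prime C; have r1 := prime_gt1 pr.
split; first by rewrite er.
have lt : n %/ r < n by rewrite ltn_Pdiv.
have h0 : 0 < n %/ r by rewrite divn_gt0 ?prime_gt0 // dvdn_leq ?(cl_dvd C).
have hc : n %/ r <= c by move: lt nc; lia.
have [_ [e E]] := IH _ hc _ _ _ _ (cl_quo C) m3 h0.
by exists e.+1; rewrite expnSr -E er divnK ?(cl_dvd C).
Qed.

Lemma Kmn_nilpotent m n (gT : finGroupType) (a b : gT) (L : {group gT}) :
  Kmn_group m n a b L -> 2 < m -> 0 < n -> nilpotent (gcore L (mgrp a b)).
Proof.
elim: n {-2}n (leqnn n) gT a b L => [|c IH] n nc gT a b L k m3 n0; first by lia.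
have [n1|n1] := leqP n 1.
  have e : n = 1%N by lia.
  have := Kmn_cardK k m3 n0; rewrite e => /card1_trivg ->.
  exact: nilpotent1.
have [r C] := Kmn_central_layer k m3 n1.
have pr := cl_prime C; have r1 := prime_gt1 pr.
have lt : n %/ r < n by rewrite ltn_Pdiv.
set K := gcore _ _; set N := layer m n a b r.
have nil : nilpotent (K / N).
  have h0 : 0 < n %/ r by rewrite divn_gt0 ?prime_gt0 // dvdn_leq ?(cl_dvd C).
  have hc : n %/ r <= c by move: lt nc; lia.
  have := IH _ hc _ _ _ _ (cl_quo C) m3 h0.
  rewrite (quotient_gcore k m3 n0 (d := r)) ?(cl_sub C) ?(cl_norm C) ?(cl_dvd C) ?(cl_card C) ?prime_gt0 //.
  by rewrite mem_gen // inE cycle_id.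
have NZ : N \subset 'Z(K).
  by rewrite subsetI (cl_sub C) centsC (cl_cent C).
have NK : N <| K.
  by rewrite /normal (cl_sub C) (subset_trans (Kmn_KL _ _ _)) // (subset_trans (kmn_LG k)) ?(cl_norm C).
rewrite -quotient_center_nil.
have := third_isog NZ NK (center_normal K) => /isog_nil <-.
exact: quotient_nil.
Qed.
End Peel.

Section Dihedral.
Local Open Scope group_scope.
Variables (gT : finGroupType) (a b : gT).

Lemma mgrp_order6 : #|mgrp a b| = 6 -> a ^+ 2 = 1 -> b ^+ 2 = 1 -> a != 1 -> b \notin <[a]> ->
  (a * b) ^+ 3 = 1.
Proof.
move=> c6 a2 b2 a1 bA; set t := a * b.
have oa : #[a] = 2 by apply: nt_prime_order.
have b1 : b != 1 by apply: contraNneq bA => ->; rewrite group1.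
have ob : #[b] = 2 by apply: nt_prime_order.
have nc : ~ commute a b.
  move=> cab; have TI : <[a]> :&: <[b]> = 1.
    apply/eqP; rewrite setIC; apply/eqP; apply: prime_TIg; rewrite -?orderE ?ob //.
    by rewrite cycle_subG.
  have cg : <[a]> * <[b]> = <[b]> * <[a]>.
    by apply/normC; rewrite cycle_subG (subsetP (cent_sub _)) // cent_cycle; apply/cent1P.
  have : 4 %| #|mgrp a b|.
    have -> : 4 = #|(<[a]> <*> <[b]>)%G|.
      by rewrite /= comm_joingE // TI_cardMg // -!orderE oa ob.
    by apply: cardSg; rewrite join_subG !cycle_subG mem_mgrpl mem_mgrpr.
  by rewrite c6.
have tG : t \in mgrp a b by rewrite groupM ?mem_mgrpl ?mem_mgrpr.
have : #[t] %| 6 by rewrite -c6 order_dvdG.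
have t2 : commute a b -> t ^+ 2 = 1.
  by move=> cab; rewrite expgMn // a2 b2 mulg1.
have aV : a^-1 = a by apply/eqP; rewrite eq_invg_mul -(expgS a 1) a2.
have bV : b^-1 = b by apply/eqP; rewrite eq_invg_mul -(expgS b 1) b2.
have nt2 : t ^+ 2 != 1.
  apply/eqP; rewrite expgS expg1 => e; apply: nc.
  have : t = t^-1 by apply/eqP; rewrite eq_sym eq_invg_mul e.
  by rewrite /t invMg aV bV.
rewrite -order_dvdn in nt2; move=> d6.
apply/eqP; rewrite -order_dvdn.
have n6 : #[t] != 6.
  apply/eqP => o6; apply: nc.
  have E : <[t]> = mgrp a b.
    by apply/eqP; rewrite eqEcard cycle_subG tG -orderE o6 c6.
  have cA := cycle_abelian t; rewrite E in cA.
  exact: (centsP cA) (mem_mgrpl a b) _ (mem_mgrpr a b).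
move: nt2 n6 d6; have := order_gt0 t; move: #[t] => o.
case: o => [|[|[|[|[|[|[|o]]]]]]] //.
Qed.
End Dihedral.

Ltac commute_tac :=
  first [ assumption
        | apply: commute_sym; assumption
        | exact: commute_refl
        | exact: commute1
        | apply: commuteM; commute_tac
        | apply: commuteX; commute_tac
        | apply: commuteV; commute_tac
        | apply: commute_sym;
          first [ apply: commuteM; commute_tac
                | apply: commuteX; commute_tac
                | apply: commuteV; commute_tac ] ].

Ltac group_simp :=
  rewrite ?(invMg, invgK) ?mulgA
          ?(mulgA, mulgK, mulgKV, mulgV, mulVg, mulg1, mul1g, invg1).

Section Relations.
Local Open Scope group_scope.
Variables (gT : finGroupType) (a b x y P R : gT).
Hypotheses (bb : b * b = 1) (aa : a * a = x) (xb : x ^ b = y).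
Hypotheses (PX : P \in <[x]>) (Pb : P ^ b = R) (cPy : commute P y).
Hypotheses (TI1 : <[x]> :&: <[y]> = 1) (TI2 : <[y]> :&: <[y ^ a]> = 1).

Let xa : x ^ a = x. Proof. by rewrite -aa conjgE -mulgA mulKg. Qed.
Let yb : y ^ b = x. Proof. by rewrite -xb -conjgM bb conjg1. Qed.
Let Rb : R ^ b = P. Proof. by rewrite -Pb -conjgM bb conjg1. Qed.
Let Pa : P ^ a = P. Proof. by case/cycleP: PX => i ->; rewrite conjXg xa. Qed.
Let RY : R \in <[y]>. Proof. by rewrite -Pb -xb cycleJ memJ_conjg. Qed.
Let cRx : commute R x.
Proof. by have /(congr1 (conjg^~ b)) := cPy; rewrite /= !conjMg Pb yb. Qed.
Let cPx : commute P x. Proof. by case/cycleP: PX => i ->; commute_tac. Qed.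
Let cRy : commute R y. Proof. by case/cycleP: RY => i ->; commute_tac. Qed.
Let cPR : commute P R. Proof. by case/cycleP: RY => i ->; commute_tac. Qed.

Lemma relation_ya i j i' j' : y ^ a = x^-1 * y^-1 * (P ^+ i * R ^+ j) ->
  (a * b) ^+ 3 = P ^+ i' * R ^+ j' -> y ^ a = x^-1 * y^-1.
Proof.
set nu := P ^+ i * R ^+ j => ya tau.
have cnx : commute nu x by rewrite /nu; commute_tac.
have cny : commute nu y by rewrite /nu; commute_tac.
have e1 : (y ^ a) ^ a = y ^ x by rewrite -conjgM aa.
have nua : nu ^ a = nu.
  have e2 : (y ^ a) ^ a = x^-1 * (y ^ a)^-1 * nu ^ a.
    by rewrite {1}ya !conjMg !conjVg xa.
  have e3 : (y ^ a)^-1 = nu^-1 * (y * x) by rewrite ya !invMg !invgK.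
  have e4 : y * x = nu^-1 * (y * x) * nu ^ a.
    by move: e2; rewrite e1 e3 conjgE -!mulgA => /mulgI.
  apply: (mulgI (nu^-1 * (y * x))); rewrite -e4.
  have c : commute nu (y * x) by commute_tac.
  by rewrite -mulgA -c mulKg.
have RjE : (R ^+ j) = 1.
  have e5 : (R ^+ j) ^ a = R ^+ j.
    by apply: (mulgI (P ^+ i)); rewrite -{1}Pa -conjXg -conjMg.
  have : R ^+ j \in <[y]> :&: <[y ^ a]>.
    by rewrite inE groupX //= -e5 cycleJ memJ_conjg groupX.
  by rewrite TI2 => /set1P.
have nuE : nu = P ^+ i by rewrite /nu RjE mulg1.
have e6 : (y ^ a) ^ b = x * y ^ a * x^-1.
  set tt := P ^+ i' * R ^+ j' in tau.
  have e7 : b * a * b = a^-1 * tt * b * a^-1.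
    rewrite -tau !expgS expg0 mulg1 !mulgA mulVg mul1g.
    by rewrite -(mulgA _ b b) bb mulg1 mulgK.
  have cx : x ^ tt = x.
    by apply/conjg_fixP/commgP; rewrite /tt; commute_tac.
  clearbody tt; have xaV : x ^ a^-1 = x by rewrite -{1}xa conjgK.
  have -> : (y ^ a) ^ b = x ^ (b * a * b) by rewrite !conjgM xb.
  rewrite e7 !conjgM xaV cx xb; apply: (conjg_inj a).
  have -> : (x * y ^ a * x^-1) ^ a = x * y ^ x * x^-1.
    by rewrite conjMg (conjMg x (y ^ a)) conjVg xa e1.
  by rewrite conjgKV (conjgE y x); group_simp.
clearbody nu; have nub : nu ^ b = nu.
  apply: (mulgI (y^-1 * x^-1)).
  have -> : y^-1 * x^-1 * nu ^ b = (y ^ a) ^ b by rewrite ya !conjMg !conjVg yb xb.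
  have c : commute nu x^-1 by apply: commuteV.
  by rewrite e6 ya !mulgA mulgV mul1g -(mulgA _ nu) c mulgA.
have : nu \in <[x]> :&: <[y]>.
  apply/setIP; split; first by rewrite nuE groupX.
  by rewrite -nub nuE conjXg Pb groupX.
by rewrite TI1 => /set1P e8; rewrite ya e8 mulg1.
Qed.

Lemma relation_fixed i j (c : gT) : R ^ a = P^-1 * R^-1 -> c = P ^+ i * R ^+ j ->
  c ^ (a * b) = c -> exists s, c = (P^-1 * R) ^+ s /\ P ^+ (3 * s) = 1.
Proof.
move=> Ra cE.
have cV : commute P^-1 R by commute_tac.
have cVV : commute P^-1 R^-1 by commute_tac.
have e1 : c ^ (a * b) = R ^+ i * ((R ^+ j)^-1 * (P ^+ j)^-1).
  have -> : c ^ (a * b) = (P ^+ i * (P^-1 * R^-1) ^+ j) ^ b.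
    by rewrite conjgM cE (conjMg (P ^+ i)) (conjXg P) (conjXg R) Pa Ra.
  rewrite (conjMg (P ^+ i)) (conjXg P) conjXg conjMg !conjVg Pb Rb.
  by rewrite expgMn ?expgVn //; commute_tac.
move=> cf; rewrite e1 cE in cf.
have e2 : P ^+ (i + j) = R ^+ i * (R ^+ j)^-1 * (R ^+ j)^-1.
  rewrite expgD; apply: (mulIg (R ^+ j)); rewrite mulgKV.
  have c1 : commute (P ^+ j) (R ^+ j) by commute_tac.
  by rewrite -mulgA c1 mulgA -cf -!mulgA mulVg mulg1.
have e3 : P ^+ (i + j) = 1.
  have : P ^+ (i + j) \in <[x]> :&: <[y]>.
    by rewrite inE groupX //= e2 !groupM ?groupV ?groupX.
  by rewrite TI1 => /set1P.
exists j; split.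
  rewrite expgMn // expgVn cE; congr (_ * _).
  by apply: (mulIg (P ^+ j)); rewrite mulVg -expgD.
have e4 : R ^+ i = R ^+ (j + j).
  by move: e2; rewrite e3 expgD => e; apply: (mulIg (R ^+ j)^-1); apply: (mulIg (R ^+ j)^-1); rewrite -e; group_simp.
have e5 : P ^+ i = P ^+ (j + j).
  by apply: (conjg_inj b); rewrite !conjXg Pb.
have -> : (3 * j = j + j + j)%N by lia.
by rewrite expgD -e5 -expgD.
Qed.

Lemma relation_comm nu : y ^ a = x^-1 * y^-1 * nu -> commute (nu ^ b) x -> commute (nu ^ b) y ->
  commute [~ x, y] x -> [~ x, y] ^ (a * b) = [~ x, y].
Proof.
move=> ya c1 c2 c3.
have -> : [~ x, y] ^ (a * b) = x * [~ x, y] * x^-1.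
  rewrite conjRg !conjgM xa ya !conjMg !conjVg yb xb.
  move: (nu ^ b) c1 c2 => n c1 c2.
  have cy : commute n^-1 (x * y * x^-1) by commute_tac.
  rewrite !commgEl !conjgE; group_simp.
  rewrite -!mulgA; congr (_ * _); rewrite !mulgA.
  move: cy; rewrite /commute !mulgA => ->; by group_simp.
by rewrite -c3 mulgK.
Qed.
End Relations.

Section ThreeParts.
Local Open Scope group_scope.
Variables (n : nat) (gT : finGroupType) (a b : gT) (L : {group gT}).
Hypotheses (k : Kmn_group 3 n a b L) (n0 : 0 < n).
Local Notation G := (mgrp a b).
Local Notation x := (a ^+ 2).
Local Notation y := (x ^ b).
Local Notation K := (gcore L G).

Let aG : a \in G. Proof. exact: mem_mgrpl. Qed.
Let bG : b \in G. Proof. exact: mem_mgrpr. Qed.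
Let xK : x \in K. Proof. exact: (Kmn_xcore k isT n0). Qed.
Let yK : y \in K. Proof. exact: (Kmn_ycore k isT n0). Qed.
Let bb : b * b = 1. Proof. exact: (Kmn_bb k). Qed.
Let aa : a * a = x. Proof. by []. Qed.
Let KN g : g \in G -> forall h, h \in K -> h ^ g \in K.
Proof. by move=> gG h hK; rewrite memJ_norm // (subsetP (Kmn_Knorm _ _ _)). Qed.
Let TI1 : <[x]> :&: <[y]> = 1. Proof. exact: (Kmn_xyTI k). Qed.
Let TI2 : <[y]> :&: <[y ^ a]> = 1. Proof. exact: (Kmn_yyaTI k isT n0). Qed.

Lemma K_pair g : g \in K -> exists i j, g = x ^+ i * y ^+ j.
Proof. by rewrite -(Kmn_KE k isT n0) => /mulsgP[_ _ /cycleP[i ->] /cycleP[j ->] ->]; exists i, j. Qed.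

Lemma tau_core : (a * b) ^+ 3 \in K.
Proof.
have GK : G \subset 'N(K) := Kmn_Knorm a b L.
have cK := Kmn_cardK k isT n0.
have aNK : a \in 'N(K) by rewrite (subsetP GK).
have bNK : b \in 'N(K) by rewrite (subsetP GK).
have KL : K \subset L := Kmn_KL a b L.
have aL : a \in L by rewrite -cycle_subG (kmn_HL k).
have e : (coset K a * coset K b) ^+ 3 = 1.
  apply: mgrp_order6.
  - rewrite (mgrp_quotient (M := (gcore L G)%G)) // card_quotient //.
    rewrite -divgS; last exact: subset_trans KL (kmn_LG k).
    rewrite cK (kmn_cardG k) -mulnA mulnA mulnK ?muln_gt0 ?n0 //.
  - by rewrite -morphX //= coset_id.
  - by rewrite -morphX //= expgS expg1 bb morph1.
  - apply/eqP => /coset_idr => /(_ aNK) aK.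
    have : a \in <[a]> :&: K by rewrite inE cycle_id.
    rewrite (Kmn_HK k isT n0) -cycle_subG => /subset_leq_card.
    by rewrite -!orderE (Kmn_orderx k isT) (kmn_orda k); lia.
  - apply: contra (kmn_bL k) => /cycleP[i].
    rewrite -morphX // => /rcoset_kercosetP h.
    have /rcosetP[v vK ->] := h bNK (groupX i aNK).
    by rewrite groupM ?groupX // (subsetP KL).
apply: coset_idr; first by rewrite groupX // groupM.
by rewrite morphX ?groupM // morphM.
Qed.

Lemma abelian_ya : [~ x, y] = 1 -> y ^ a = x^-1 * y^-1.
Proof.
move/eqP/commgP => cxy.
have [i [j e]] : exists i j, y * x * y ^ a = x ^+ i * y ^+ j.
  exact: K_pair (groupM (groupM yK xK) (KN aG yK)).
have [i' [j' e']] := K_pair tau_core.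
apply: (@relation_ya _ a b x y x y bb aa erefl _ _ _ TI1 TI2 i j i' j') => //.
- exact: cycle_id.
- by rewrite -e -invMg mulKg.
Qed.

Lemma abelian_tau : [~ x, y] = 1 -> exists s, (a * b) ^+ 3 = (x^-1 * y) ^+ s /\ x ^+ (3 * s) = 1.
Proof.
move=> cxy; have ya := abelian_ya cxy; move/eqP/commgP: cxy => cxy.
have [i' [j' e']] := K_pair tau_core.
apply: (@relation_fixed _ a b x y x y bb aa erefl _ _ _ TI1 i' j') => //.
- exact: cycle_id.
- by apply/conjg_fixP/commgP/commute_sym/commuteX.
Qed.

Section Lift.
Variable r : nat.
Hypothesis C : central_layer 3 n a b L r.
Local Notation N := (layer 3 n a b r).
Local Notation n1 := (x ^+ (n %/ r)).
Local Notation n2 := (y ^+ (n %/ r)).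

Let n1N : n1 \in N. Proof. by rewrite mem_gen // inE cycle_id. Qed.
Let cN g h : g \in N -> h \in K -> commute g h.
Proof. by move=> gN hK; apply/commute_sym/(centP (subsetP (cl_cent C) _ hK)). Qed.
Let N_pair g : g \in N -> exists i j, g = n1 ^+ i * n2 ^+ j.
Proof. by rewrite -(cl_NE C) => /mulsgP[_ _ /cycleP[i ->] /cycleP[j ->] ->]; exists i, j. Qed.
Let NN g : g \in G -> forall h, h \in N -> h ^ g \in N.
Proof. by move=> gG h hK; rewrite memJ_norm // (subsetP (cl_norm C)). Qed.
Let n2a : n2 ^ a = n1^-1 * n2^-1. Proof. exact: (cl_n2a3 C). Qed.

Lemma lift_ya : y * x * y ^ a \in N -> (a * b) ^+ 3 \in N -> y ^ a = x^-1 * y^-1.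
Proof.
move=> /N_pair[i [j e]] /N_pair[i' [j' e']].
apply: (@relation_ya _ a b x y n1 n2 bb aa erefl _ _ _ TI1 TI2 i j i' j') => //.
- exact: mem_cycle.
- by rewrite conjXg.
- exact: cN.
- by rewrite -e -invMg mulKg.
Qed.

Lemma lift_fixed g : g \in N -> g ^ (a * b) = g ->
  exists s, g = (n1^-1 * n2) ^+ s /\ n1 ^+ (3 * s) = 1.
Proof.
move=> /N_pair[i' [j' e']] gt.
apply: (@relation_fixed _ a b x y n1 n2 bb aa erefl _ _ _ TI1 i' j') => //.
- exact: mem_cycle.
- by rewrite conjXg.
- exact: cN.
Qed.

Lemma lift_tau : (a * b) ^+ 3 \in N ->
  exists s, (a * b) ^+ 3 = (n1^-1 * n2) ^+ s /\ n1 ^+ (3 * s) = 1.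
Proof.
by move/lift_fixed; apply; apply/conjg_fixP/commgP/commute_sym/commuteX.
Qed.

Lemma lift_comm : y * x * y ^ a \in N -> [~ x, y] \in N ->
  exists s, [~ x, y] = (n1^-1 * n2) ^+ s /\ n1 ^+ (3 * s) = 1.
Proof.
move=> nuN cN'; apply: lift_fixed => //.
apply: (@relation_comm _ a b x y bb aa erefl (y * x * y ^ a)).
- by rewrite -invMg mulKg.
- by apply: cN => //; apply: NN.
- by apply: cN => //; apply: NN.
- exact: cN.
Qed.
End Lift.
End ThreeParts.

Section ThreePrime.
Local Open Scope group_scope.

Lemma coprime3_abelian n (gT : finGroupType) (a b : gT) (L : {group gT}) :
  Kmn_group 3 n a b L -> 0 < n -> ~~ (3 %| n) -> [~ a ^+ 2, (a ^+ 2) ^ b] = 1.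
Proof.
elim: n {-2}n (leqnn n) gT a b L => [|c IH] n nc gT a b L k n0 n3; first by lia.
have [n1|n1] := leqP n 1.
  have e : n = 1%N by lia.
  have : #[a ^+ 2] = 1%N by rewrite (Kmn_orderx k isT) e.
  by move/eqP; rewrite order_eq1 => /eqP ->; rewrite conj1g comm1g.
have [r C] := Kmn_central_layer k isT n1.
have pr := cl_prime C; have r1 := prime_gt1 pr.
have lt : n %/ r < n by rewrite ltn_Pdiv.
have h0 : 0 < n %/ r by rewrite divn_gt0 ?prime_gt0 // dvdn_leq ?(cl_dvd C).
have hc : n %/ r <= c by move: lt nc; lia.
have r3 : ~~ (3 %| n %/ r).
  by apply: contra n3 => h; rewrite -(divnK (cl_dvd C)) dvdn_mulr.
have GN := cl_norm C; have aN := subsetP GN _ (mem_mgrpl a b); have bN := subsetP GN _ (mem_mgrpr a b).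
have E := IH _ hc _ _ _ _ (cl_quo C) h0 r3.
have E2 := abelian_ya (cl_quo C) h0 E.
have xN : a ^+ 2 \in 'N(layer 3 n a b r) by rewrite groupX.
have yN : (a ^+ 2) ^ b \in 'N(layer 3 n a b r) by rewrite groupJ.
have cN : [~ a ^+ 2, (a ^+ 2) ^ b] \in layer 3 n a b r.
  apply: coset_idr; first by rewrite groupR.
  by rewrite morphR // morphJ // morphX.
have nuN : (a ^+ 2) ^ b * a ^+ 2 * ((a ^+ 2) ^ b) ^ a \in layer 3 n a b r.
  have yxN := groupM yN xN; have yaN := groupJ yN aN.
  apply: coset_idr; first exact: groupM.
  rewrite (morphM _ yxN yaN) (morphM _ yN xN) (morphJ _ yN aN) (morphJ _ xN bN) (morphX _ _ aN).
  by rewrite E2 -invMg mulgV.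
have [s [-> e]] := lift_comm k n0 C nuN cN.
have rs : r %| s.
  have : r %| 3 * s.
    by rewrite -(layer_on1 k isT pr (cl_dvd C)) order_dvdn e.
  rewrite Gauss_dvdr // prime_coprime //; apply: contra n3 => r3'.
  have er : r = 3 by apply/eqP; rewrite -dvdn_prime2.
  by rewrite -er (cl_dvd C).
have cM : commute ((a ^+ 2) ^+ (n %/ r))^-1 (((a ^+ 2) ^ b) ^+ (n %/ r)).
  apply/commute_sym/commuteV.
  apply: (centP (subsetP (cl_cent C) _ _)); last by rewrite mem_gen // inE cycle_id.
  by rewrite groupX // (Kmn_ycore k isT n0).
rewrite expgMn // expgVn.
have -> : (a ^+ 2) ^+ (n %/ r) ^+ s = 1.
  by apply/eqP; rewrite -order_dvdn (layer_on1 k isT pr (cl_dvd C)).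
have -> : ((a ^+ 2) ^ b) ^+ (n %/ r) ^+ s = 1.
  by apply/eqP; rewrite -order_dvdn (layer_on2 k isT pr (cl_dvd C)).
by rewrite invg1 mulg1.
Qed.
End ThreePrime.

Section Arith.

Lemma expn_mod_prime_pow p R i : 0 < p -> R = 1 %[mod p] -> R ^ (p ^ i) = 1 %[mod p ^ i.+1].
Proof.
move=> p0; elim: i => [|i IH] R1; first by rewrite expn0 !expn1.
have R0 : 0 < R ^ p ^ i \/ p = 1%N.
  case: R R1 {IH} => [|R _]; last by left; rewrite expn_gt0.
  by move/esym/eqP; rewrite mod0n -/(dvdn p 1) dvdn1 => /eqP; right.
case: R0 => [R0|->]; last by rewrite !exp1n !modn1.
move/eqP: (IH R1); rewrite eqn_mod_dvd // => d1.
apply/eqP; rewrite eqn_mod_dvd; last by rewrite expn_gt0; case: R R0 {R1 d1 IH} => // ; rewrite exp0n ?expn_gt0 ?p0.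
rewrite (expnSr p i) expnM subn1 predn_exp expnSr.
apply: dvdn_mul; first by rewrite -subn1.
have e : forall j, (R ^ p ^ i) ^ j = 1 %[mod p].
  move=> j; rewrite -expnM -modnXm R1 modnXm exp1n //.
rewrite /dvdn -modn_summ (eq_bigr (fun=> 1 %% p)); last by move=> j _; rewrite e.
by rewrite modn_summ sum1_card card_ord modnn.
Qed.

Lemma sum_expn_mod p R j : R = 1 %[mod p] -> \sum_(i < j) R ^ i = j %[mod p].
Proof.
move=> R1; rewrite -modn_summ (eq_bigr (fun=> 1 %% p)).
  by rewrite modn_summ sum1_card card_ord.
by move=> i _; rewrite -modnXm R1 modnXm exp1n.
Qed.
End Arith.

Section CyclicStep.
Local Open Scope group_scope.
Variables (gT : finGroupType) (a b io c n1 z : gT) (p : nat).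
Hypotheses (pr : prime p) (p2 : odd p).
Hypotheses (cE : c = io * b) (bb : b * b = 1) (ioio : io * io = 1) (ioa : commute io a).
Hypotheses (on1 : #[n1] = p) (oz : #[z] = p) (TI : <[n1]> :&: <[z]> = 1).
Hypotheses (n1z : commute n1 z) (n1io : n1 ^ io = n1) (zio : z ^ io = z^-1) (zb : z ^ b = z^-1).
Hypothesis n1b : n1 ^ b = n1 * z.

Let bV : b^-1 = b. Proof. by apply/eqP; rewrite eq_invg_mul bb. Qed.
Let ioV : io^-1 = io. Proof. by apply/eqP; rewrite eq_invg_mul ioio. Qed.

Lemma step_zc : commute z c.
Proof. by apply/commgP/conjg_fixP; rewrite cE conjgM zio conjVg zb invgK. Qed.

Lemma step_n1c : n1 ^ c = n1 * z.
Proof. by rewrite cE conjgM n1io. Qed.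

Lemma step_cio : c ^ io = c^-1.
Proof. by rewrite cE conjgE ioV !mulgA ioio mul1g invMg bV ioV. Qed.

Lemma step_n1X i : n1 ^ (c ^+ i) = n1 * z ^+ i.
Proof.
elim: i => [|i IH]; first by rewrite conjg1 mulg1.
rewrite expgSr conjgM IH conjMg step_n1c conjXg.
have -> : z ^ c = z by apply/conjg_fixP/commgP/step_zc.
by rewrite -mulgA -expgS.
Qed.

Lemma step_pair s u s' u' : n1 ^+ s * z ^+ u = n1 ^+ s' * z ^+ u' ->
  n1 ^+ s = n1 ^+ s' /\ z ^+ u = z ^+ u'.
Proof.
move=> e; have : n1 ^- s' * n1 ^+ s \in <[n1]> :&: <[z]>.
  rewrite inE groupM ?groupV ?mem_cycle //=.
  have -> : n1 ^- s' * n1 ^+ s = z ^+ u' * z ^- u.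
    by apply: (mulgI (n1 ^+ s')); apply: (mulIg (z ^+ u)); rewrite !mulgA mulgV mul1g e mulgKV.
  by rewrite groupM ?groupV ?mem_cycle.
rewrite TI => /set1P e1.
have e2 : n1 ^+ s = n1 ^+ s' by rewrite -[RHS]mulg1 -e1 mulKVg.
by split=> //; apply: (mulgI (n1 ^+ s)); rewrite e e2.
Qed.

Lemma step_cent s u : commute c (n1 ^+ s * z ^+ u) -> n1 ^+ s = 1.
Proof.
move/commute_sym/commgP/conjg_fixP; rewrite conjMg !conjXg step_n1c.
have -> : z ^ c = z by apply/conjg_fixP/commgP/step_zc.
rewrite expgMn // -mulgA -expgD => /step_pair[_].
rewrite expgD -[RHS]mul1g => /mulIg e; apply/eqP; rewrite -order_dvdn on1 -oz order_dvdn.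
exact/eqP.
Qed.

Lemma step_ca rho s u : c ^ a = c ^+ rho * (n1 ^+ s * z ^+ u) -> c ^ a = c ^+ rho * z ^+ u.
Proof.
move=> ca; suff e : n1 ^+ s = 1 by rewrite ca e mul1g.
have e1 : (c ^ a) ^ io = (c ^ a)^-1.
  by rewrite -conjgM -ioa conjgM step_cio conjVg.
have e2 : (n1 ^+ s * z ^- u) ^ (c ^+ rho) = z ^- u * n1 ^- s.
  have e3 : c ^- rho * (n1 ^+ s * z ^- u) = z ^- u * n1 ^- s * c ^- rho.
    move: e1; rewrite ca conjMg conjMg !conjXg step_cio n1io zio !expgVn.
    by rewrite !invMg.
  by rewrite conjgE mulgA e3 mulgKV.
have cz : commute z (c ^+ rho) by apply/commuteX/step_zc.
have e4 : (n1 ^+ s * z ^- u) ^ (c ^+ rho) = n1 ^+ s * z ^+ (rho * s) * z ^- u.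
  rewrite conjMg conjXg step_n1X conjVg conjXg.
  have -> : z ^ (c ^+ rho) = z by apply/conjg_fixP/commgP.
  by rewrite expgMn -?expgM //; commute_tac.
have e5 : n1 ^+ (s + s) = z ^- (rho * s).
  have cc : commute (z ^- u) (n1 ^- s) by commute_tac.
  move: e2; rewrite e4 cc => /mulIg e5.
  by apply: (mulIg (z ^+ (rho * s))); rewrite mulVg expgD -mulgA e5 mulgV.
have : n1 ^+ (s + s) \in <[n1]> :&: <[z]>.
  by rewrite inE mem_cycle e5 groupV mem_cycle.
rewrite TI => /set1P/eqP; rewrite -order_dvdn on1 addnn -mul2n Euclid_dvdM //.
case/orP=> d; last by apply/eqP; rewrite -order_dvdn on1.
by move: p2; rewrite (eqP (_ : p == 2)) // -dvdn_prime2.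
Qed.

Lemma step_iter rho u l : c ^ a = c ^+ rho * z ^+ u -> z ^ a = z ^+ l ->
  forall j, exists u', c ^ (a ^+ j) = c ^+ (rho ^ j) * z ^+ u'.
Proof.
have cz := step_zc; move=> ca za; elim=> [|j [u' IH]].
  by exists 0; rewrite conjg1 mulg1.
exists (u * rho ^ j + l * u')%N; rewrite expgSr conjgM IH conjMg !conjXg ca za.
rewrite expgMn; last by commute_tac.
by rewrite -!expgM -mulgA -expgD -expnS.
Qed.

Lemma step_iterx x R U : c ^ x = c ^+ R * z ^+ U -> z ^ x = z ->
  forall j, c ^ (x ^+ j) = c ^+ (R ^ j) * z ^+ (U * \sum_(i < j) R ^ i).
Proof.
have cz := step_zc; move=> ca za; elim=> [|j IH].
  by rewrite conjg1 big_ord0 muln0 mulg1.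
rewrite expgSr conjgM IH conjMg !conjXg ca za.
rewrite expgMn; last by commute_tac.
by rewrite -!expgM -mulgA -expgD -expnS big_ord_recr mulnDr addnC.
Qed.

Lemma step_normal rho s u N : c ^ a = c ^+ rho * (n1 ^+ s * z ^+ u) ->
  (exists s u, c ^+ N = n1 ^+ s * z ^+ u) -> c ^+ N != 1 ->
  [/\ a \in 'N(<[c]>), z \in <[c]> & #[c ^+ N] = p].
Proof.
move=> ca [s' [u' cN]] cN1.
have e1 : n1 ^+ s' = 1 by apply: (@step_cent s' u'); rewrite -cN; commute_tac.
rewrite e1 mul1g in cN.
have zc : z \in <[c]>.
  have zu : z ^+ u' != 1 by rewrite -cN.
  have ou : #[z ^+ u'] = p.
    apply: nt_prime_order => //; rewrite -expgM mulnC expgM -oz expg_order expg1n //.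
  have E : <[z ^+ u']> = <[z]>.
    apply/eqP; rewrite (eq_subG_cyclic (cycle_cyclic z)) ?cycle_subG ?mem_cycle ?cycle_id //.
    by rewrite -!orderE ou oz.
  have : z \in <[z ^+ u']> by rewrite E cycle_id.
  by case/cycleP=> i ->; rewrite -cN groupX // mem_cycle.
split=> //.
  rewrite inE -cycleJ cycle_subG (step_ca ca).
  by rewrite groupM ?mem_cycle // groupX.
apply: nt_prime_order => //.
by rewrite cN -expgM mulnC expgM -oz expg_order expg1n.
Qed.

Lemma step_contra rho s u l e x : c ^ a = c ^+ rho * (n1 ^+ s * z ^+ u) -> z ^ a = z ^+ l ->
  x = a ^+ p.-1 -> z ^ x = z -> n1 = x ^+ (p ^ e.+1) -> c ^+ (p ^ e.+2) = 1 ->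
  rho ^ p.-1 = 1 %[mod p] -> False.
Proof.
move=> ca za xE zx n1E cp R1.
have [U cU] := step_iter (step_ca ca) za p.-1; rewrite -xE in cU.
have := step_iterx cU zx (p ^ e.+1); rewrite -n1E.
have -> : c ^+ ((rho ^ p.-1) ^ p ^ e.+1) = c.
  rewrite -[RHS]expg1; apply/eqP; rewrite eq_expg_mod_order.
  have d : #[c] %| p ^ e.+2 by rewrite order_dvdn cp.
  have /eqP := @expn_mod_prime_pow p (rho ^ p.-1) e.+1 (prime_gt0 pr) R1.
  by rewrite -(modn_dvdm _ d) => /eqP ->; rewrite modn_dvdm.
have -> : z ^+ (U * \sum_(i < p ^ e.+1) (rho ^ p.-1) ^ i) = 1.
  apply/eqP; rewrite -order_dvdn oz dvdn_mull // /dvdn (sum_expn_mod _ R1).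
  by rewrite -/(dvdn p _) expnS dvdn_mulr.
rewrite mulg1 => /conjg_fixP/commgP/commute_sym/commgP/conjg_fixP.
rewrite step_n1c -[RHS]mulg1 => /mulgI z1.
by have := prime_gt1 pr; rewrite -oz z1 order1.
Qed.
End CyclicStep.

Section CosetMorphism.
Local Open Scope group_scope.
Variables (gT : finGroupType) (N : {group gT}).

Lemma coset_X g i : g \in 'N(N) -> coset N (g ^+ i) = coset N g ^+ i.
Proof. by move=> gN; exact: (morphX (coset_morphism N) i gN). Qed.

Lemma coset_M g h : g \in 'N(N) -> h \in 'N(N) -> coset N (g * h) = coset N g * coset N h.
Proof. by move=> gN hN; exact: (morphM (coset_morphism N) gN hN). Qed.

Lemma coset_J g h : g \in 'N(N) -> h \in 'N(N) -> coset N (g ^ h) = coset N g ^ coset N h.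
Proof. by move=> gN hN; exact: (morphJ (coset_morphism N) gN hN). Qed.

Lemma coset_V g : g \in 'N(N) -> coset N g^-1 = (coset N g)^-1.
Proof. by move=> gN; exact: (morphV (coset_morphism N) gN). Qed.

Lemma coset_R g h : g \in 'N(N) -> h \in 'N(N) -> coset N [~ g, h] = [~ coset N g, coset N h].
Proof. by move=> gN hN; exact: (morphR (coset_morphism N) gN hN). Qed.

Lemma coset_mul_repr g h : g \in 'N(N) -> h \in 'N(N) -> coset N g = coset N h ->
  exists2 v, v \in N & g = h * v.
Proof.
move=> gN hN e; have /rcosetP[v vN ->] : g \in N :* h by apply/rcoset_kercosetP.
by exists (v ^ h); rewrite ?memJ_norm // -conjgC.
Qed.
End CosetMorphism.

Lemma half_muln_odd (o q : nat) : ~~ odd o -> odd q -> o./2 * q = o./2 %[mod o].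
Proof.
move=> ev oq; rewrite -{1}(odd_double_half q) oq mulnDr muln1 -muln2.
rewrite [(q./2 * 2)%N]mulnC mulnA muln2.
have -> : (o./2).*2 = o by rewrite -[RHS]odd_double_half (negPf ev).
by rewrite addnC mulnC modnMDl.
Qed.

Section Iota.
Local Open Scope group_scope.

Definition iota_of (gT : finGroupType) (a : gT) : gT := a ^+ (#[a]./2).
Definition cyc_gen (gT : finGroupType) (a b : gT) : gT := iota_of a * b.

Lemma iota_commute (gT : finGroupType) (a : gT) : commute (iota_of a) a.
Proof. by apply/commute_sym/commuteX. Qed.

Lemma iota_sq (gT : finGroupType) (a : gT) : ~~ odd #[a] -> iota_of a * iota_of a = 1.
Proof.
move=> ev; rewrite /iota_of -expgD addnn -[RHS](expg_order a); congr (_ ^+ _).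
by rewrite -[RHS]odd_double_half (negPf ev).
Qed.

Lemma iota_neq1 (gT : finGroupType) (a : gT) : ~~ odd #[a] -> iota_of a != 1.
Proof.
move=> ev; rewrite /iota_of -order_dvdn; apply/negP => /dvdn_leq.
have := odd_double_half #[a]; rewrite (negPf ev) add0n => e.
by have := order_gt0 a; rewrite -e -addnn; lia.
Qed.

Section PrimeParts.
Variables (p n : nat) (gT : finGroupType) (a b : gT) (L : {group gT}).
Hypotheses (pr : prime p) (p2 : odd p) (k : Kmn_group p n a b L) (n0 : 0 < n).
Local Notation G := (mgrp a b).
Local Notation x := (a ^+ (p - 1)).
Local Notation y := (x ^ b).
Local Notation K := (gcore L G).
Local Notation io := (iota_of a).
Local Notation c := (cyc_gen a b).

Let p3 : 2 < p. Proof. by case: p pr p2 => [|[|[|]]]. Qed.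
Let aG : a \in G. Proof. exact: mem_mgrpl. Qed.
Let bG : b \in G. Proof. exact: mem_mgrpr. Qed.
Let bb : b * b = 1. Proof. exact: (Kmn_bb k). Qed.

Lemma Kmn_even : ~~ odd #[a].
Proof. by rewrite (kmn_orda k) oddM oddB ?p2 //=; lia. Qed.

Lemma Kmn_ioio : io * io = 1. Proof. exact: iota_sq Kmn_even. Qed.

Lemma Kmn_xio : x ^ io = x.
Proof. by apply/conjg_fixP/commgP/commute_sym/commuteX/iota_commute. Qed.

Lemma Kmn_xc : x ^ c = y.
Proof. by rewrite conjgM Kmn_xio. Qed.

Lemma Kmn_cG : c \in G. Proof. by rewrite groupM // groupX. Qed.

Lemma Kmn_cK : c \notin K.
Proof.
have aL : a \in L by rewrite -cycle_subG (kmn_HL k).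
apply: contra (kmn_bL k) => cK.
have : c \in L by apply: (subsetP (Kmn_KL _ _ _) _ cK).
by rewrite groupMl // groupX.
Qed.

Lemma cyc_base : n = 1%N -> #[c] = p /\ a \in 'N(<[c]>).
Proof.
move=> en; have cG : #|G| = (p * (p - 1))%N by rewrite (kmn_cardG k) en !muln1.
have p1 := prime_gt1 pr; have pm : 0 < p - 1 by lia.
have lG : logn p #|G| = 1%N.
  rewrite cG (lognM p (prime_gt0 pr) pm) (logn_prime p pr) eqxx (lognE p (p - 1)) pr pm /=.
  by rewrite gtnNdvd // ; lia.
have : #|'Syl_p(G)| == 1%N.
  have d1 := card_Syl_dvd p G; have m1 := card_Syl_mod G pr.
  rewrite cG Gauss_dvdr in d1; last first.
    by rewrite coprime_sym prime_coprime // /dvdn m1.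
  have := dvdn_leq pm d1 => l1.
  by move: m1; rewrite modn_small //; [move=> -> | lia].
move/normal_sylowP => [P sylP nP].
have cP : #|P| = p by rewrite (card_Hall sylP) p_part lG expn1.
have PN : G \subset 'N(P) := normal_norm nP.
have aP : a \in 'N(P) by rewrite (subsetP PN).
have bP : b \in 'N(P) by rewrite (subsetP PN).
have oa : #[a] = (p - 1)%N by rewrite (kmn_orda k) en muln1.
have ord2 g : g * g = 1 -> g != 1 -> g \in P -> False.
  move=> gg g1 gP; have : #[g] %| p by rewrite -cP order_dvdG.
  have -> : #[g] = 2 by apply: nt_prime_order.
  by rewrite dvdn_prime2 // => /eqP e; move: p2; rewrite -e.
have b1 : b != 1 by apply: contraNneq (kmn_bL k) => ->; rewrite group1.
have cP' : c \in P.
  have E : (G / P)%g = <[coset P a]>.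
    apply/eqP; rewrite eq_sym eqEcard cycle_subG mem_quotient //.
    rewrite card_quotient // -divgS ?normal_sub // cG cP mulKn ?prime_gt0 //.
    rewrite -orderE; apply/dvdn_leq => //; rewrite -oa order_dvdn.
    have : (a ^+ #[coset P a]) \in P.
      apply: coset_idr; first by rewrite groupX.
      by rewrite morphX // expg_order.
    move=> h; have d1 : #[a ^+ #[coset P a]] %| p by rewrite -cP order_dvdG.
    have d2 : #[a ^+ #[coset P a]] %| p - 1 by rewrite -oa orderXdvd.
    rewrite -order_eq1 -dvdn1.
    have cop : coprime p (p - 1) by rewrite subn1 coprimenP ?prime_gt0.
    by rewrite -(eqP cop) dvdn_gcd d1 d2.
  have ib : coset P b = coset P io.
    have o2 g : g \in 'N(P) -> g * g = 1 -> g != 1 -> #[coset P g] = 2.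
      move=> gN gg g1; apply: nt_prime_order => //; first by rewrite -morphX //= expgS expg1 gg morph1.
      by apply/eqP => /coset_idr => /(_ gN); apply: ord2.
    have ioN : io \in 'N(P) by rewrite groupX.
    have o1 := o2 _ bP bb b1; have o3 := o2 _ ioN Kmn_ioio (iota_neq1 Kmn_even).
    have EE : <[coset P b]> = <[coset P io]>.
      have mq g : g \in G -> coset P g \in <[coset P a]> by move=> gG; rewrite -E mem_quotient.
      have s1 : <[coset P b]> \subset <[coset P a]> by rewrite cycle_subG mq.
      have s2 : <[coset P io]> \subset <[coset P a]> by rewrite cycle_subG mq ?groupX.
      apply/eqP; rewrite (eq_subG_cyclic (cycle_cyclic (coset P a)) s1 s2).
      by rewrite -!orderE o1 o3.
    have : coset P b \in <[coset P io]> by rewrite -EE cycle_id.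
    rewrite (cycle2g o3) !inE => /orP[|/eqP //].
    by rewrite -order_eq1 o1.
  apply: coset_idr; first by rewrite groupM ?groupX.
  by rewrite morphM ?groupX //= ib -morphM ?groupX //= Kmn_ioio morph1.
have c1 : c != 1.
  by apply: contraNneq Kmn_cK => ->; rewrite group1.
have oc : #[c] = p.
  by apply: nt_prime_order => //; apply/eqP; rewrite -order_dvdn -cP order_dvdG.
split=> //; have -> : <[c]> = P; last by [].
by apply/eqP; rewrite eqEcard cycle_subG cP' cP -orderE oc /=.
Qed.

Section LayerP.
Hypothesis C : central_layer p n a b L p.
Local Notation N := (layer p n a b p).
Local Notation n1 := (x ^+ (n %/ p)).
Local Notation n2 := (y ^+ (n %/ p)).
Local Notation z := (n1^-1 * n2).
Hypothesis nodd : odd n.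

Let n1N : n1 \in N. Proof. by rewrite mem_gen // inE cycle_id. Qed.
Let n2N : n2 \in N. Proof. by rewrite mem_gen // inE cycle_id orbT. Qed.
Let on1 : #[n1] = p. Proof. exact: (layer_on1 k p3 pr (cl_dvd C)). Qed.
Let n2K : n2 \in K. Proof. exact: (subsetP (cl_sub C)). Qed.
Let cNK g h : g \in N -> h \in K -> commute g h.
Proof. by move=> gN hK; apply/commute_sym/(centP (subsetP (cl_cent C) _ hK)). Qed.
Let n12 : commute n1 n2. Proof. exact: cNK. Qed.
Let on2 : #[n2] = p. Proof. exact: (layer_on2 k p3 pr (cl_dvd C)). Qed.

Lemma layer_n1z : n2 = n1 * z. Proof. by rewrite mulKVg. Qed.

Lemma layer_z_neq1 : z != 1.
Proof.
apply/eqP => z1; have e : n1 = n2 by rewrite layer_n1z z1 mulg1.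
have : n1 \in <[n1]> :&: <[n2]> by rewrite inE cycle_id e cycle_id.
rewrite (layer_TI k) => /set1P e4; have := prime_gt1 pr.
by rewrite -on1 e4 order1.
Qed.

Lemma layer_oz : #[z] = p.
Proof.
apply: nt_prime_order => //; last exact: layer_z_neq1.
have c12 : commute n1^-1 n2 by commute_tac.
have n1p : n1 ^+ p = 1 by apply/eqP; rewrite -order_dvdn on1.
have n2p : n2 ^+ p = 1 by apply/eqP; rewrite -order_dvdn on2.
by rewrite expgMn // expgVn n1p n2p invg1 mulg1.
Qed.

Lemma layer_zTI : <[n1]> :&: <[z]> = 1.
Proof.
apply/trivgP/subsetP=> g /setIP[/cycleP[i ->] /cycleP[j e]].
have c12 : commute n1^-1 n2 by commute_tac.
have e2 : n1 ^+ (i + j) = n2 ^+ j.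
  rewrite expgMn // expgVn in e; rewrite addnC expgD e.
  by rewrite mulKVg.
have : n2 ^+ j \in <[n1]> :&: <[n2]> by rewrite inE -{1}e2 !mem_cycle.
rewrite (layer_TI k) => /set1P e3.
have zj : z ^+ j = 1 by apply/eqP; rewrite -order_dvdn layer_oz -on2 order_dvdn e3.
by rewrite e zj inE.
Qed.

Lemma layer_comm_n1z : commute n1 z. Proof. commute_tac. Qed.

Lemma layer_zN : z \in N. Proof. by rewrite groupM ?groupV. Qed.

Lemma layer_n1b' : n1 ^ b = n1 * z. Proof. by rewrite -layer_n1z conjXg. Qed.

Lemma layer_zb : z ^ b = z^-1.
Proof.
rewrite conjMg conjVg layer_n1b' -layer_n1z (layer_n2b k) invMg invgK.
by [].
Qed.

Lemma layer_n1io : n1 ^ io = n1. Proof. by rewrite conjXg Kmn_xio. Qed.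

Lemma layer_zio : z ^ io = z^-1.
Proof.
have [l za] := cl_za C erefl.
have zaj j : z ^ (a ^+ j) = z ^+ (l ^ j).
  elim: j => [|j IH]; first by rewrite conjg1.
  by rewrite expgSr conjgM IH conjXg za -expgM expnS.
pose la := (l ^ (#[a]./2))%N.
have zl : z ^ io = z ^+ la by exact: zaj.
have zz : z ^+ (la * la) = z ^+ 1.
  by rewrite expgM -zl -conjXg -zl -conjgM Kmn_ioio conjg1.
have h1 : (la == 1 %[mod p]) = false.
  apply/negP => h; have : z ^ io = z.
    by rewrite zl -[RHS]expg1; apply/eqP; rewrite eq_expg_mod_order layer_oz.
  move=> zio; have : n2 ^ (a ^+ (#[a]./2)) = n2.
    by rewrite -/io layer_n1z conjMg layer_n1io zio.
  move/(cl_per C) => /dvdnP[q]; rewrite (kmn_orda k) => e.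
  have := odd_double_half ((p - 1) * n); rewrite e.
  have := Kmn_even; rewrite (kmn_orda k) => /negPf -> /=.
  rewrite add0n -muln2 -mulnA mulnC -subn1 -mulnA => /eqP.
  rewrite eqn_pmul2l ?subn_gt0 ?prime_gt1 // => /eqP en.
  by move: nodd; rewrite -en mul2n odd_double.
have : p %| (la + 1) * (la - 1).
  have la0 : 0 < la.
    case: (posnP la) zz => // -> /eqP; rewrite eq_expg_mod_order layer_oz mul0n.
    by rewrite modn_small ?prime_gt0 // modn_small ?prime_gt1.
  move/eqP: zz; rewrite eq_expg_mod_order layer_oz eqn_mod_dvd ?muln_gt0 ?la0 //.
  by rewrite mulnC -subn_sqr exp1n -mulnn.
rewrite Euclid_dvdM // => /orP[d|d]; last first.
  move: h1; case: (posnP la) => la0; last by rewrite eqn_mod_dvd // d.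
  move: zz => /eqP; rewrite la0 eq_expg_mod_order layer_oz mul0n.
  by rewrite modn_small ?prime_gt0 // modn_small ?prime_gt1.
apply: (mulIg z); rewrite mulVg zl -expgSr; apply/eqP.
by rewrite -order_dvdn layer_oz -addn1.
Qed.

Local Notation aq := (coset N a).
Local Notation bq := (coset N b).

Let aN : a \in 'N(N). Proof. exact: (subsetP (cl_norm C)). Qed.
Let bN : b \in 'N(N). Proof. exact: (subsetP (cl_norm C)). Qed.

Lemma coset_iota : coset N io = iota_of aq.
Proof.
rewrite coset_X // /iota_of; apply/eqP; rewrite eq_expg_mod_order.
have oq := kmn_orda (cl_quo C).
have e : #[a] = (#[aq] * p)%N by rewrite (kmn_orda k) oq -mulnA divnK // (cl_dvd C).
have ev : ~~ odd #[aq] by rewrite oq oddM oddB ?prime_gt0 // p2.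
have -> : #[a]./2 = (#[aq]./2 * p)%N.
  by rewrite e -{1}(odd_double_half #[aq]) (negPf ev) -doubleMl doubleK.
by apply/eqP; exact: half_muln_odd.
Qed.

Lemma coset_cyc : coset N c = cyc_gen aq bq.
Proof. by rewrite coset_M ?groupX // coset_iota. Qed.

Lemma layer_pair g : g \in N -> exists s u, g = n1 ^+ s * z ^+ u.
Proof.
rewrite -(cl_NE C) => /mulsgP[_ _ /cycleP[i ->] /cycleP[j ->] ->]; exists (i + j)%N, j.
have c1 := layer_comm_n1z.
by rewrite expgD -mulgA -expgMn // -layer_n1z.
Qed.

Lemma cyc_ca : aq \in 'N(<[cyc_gen aq bq]>) ->
  exists rho s u, c ^ a = c ^+ rho * (n1 ^+ s * z ^+ u).
Proof.
move=> aqN; have cN : c \in 'N(N) by rewrite (subsetP (cl_norm C)) // Kmn_cG.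
have : cyc_gen aq bq ^ aq \in <[cyc_gen aq bq]> by rewrite memJ_norm // cycle_id.
case/cycleP=> rho; rewrite -coset_cyc -coset_J // -coset_X // => e.
have [v vN ev] := coset_mul_repr (groupJ cN aN) (groupX rho cN) e.
by have [s [u ev2]] := layer_pair vN; exists rho, s, u; rewrite ev ev2.
Qed.

Lemma cyc_step e : n = (p ^ e.+1)%N -> #[cyc_gen aq bq] = (p ^ e.+1)%N ->
  aq \in 'N(<[cyc_gen aq bq]>) -> 0 < e \/ c ^+ (p ^ e.+1) != 1 ->
  [/\ #[c] = (p ^ e.+2)%N, a \in 'N(<[c]>) & z \in <[c]>].
Proof.
move=> nE oq aqN h.
have [rho [s [u ca]]] := cyc_ca aqN.
have cEE : c = io * b by [].
have cN : c \in 'N(N) by rewrite (subsetP (cl_norm C)) // Kmn_cG.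
have cpN : c ^+ (p ^ e.+1) \in N.
  by apply: coset_idr; rewrite ?groupX // coset_X // coset_cyc -oq expg_order.
have ioa := iota_commute a.
have c1 := layer_comm_n1z.
have [cp1|cp1] := eqVneq (c ^+ (p ^ e.+1)) 1; last first.
  have [h1 h2 h3] := step_normal pr p2 cEE bb Kmn_ioio ioa on1 layer_oz layer_zTI c1 layer_n1io layer_zio layer_zb layer_n1b' ca (layer_pair cpN) cp1.
  split=> //.
  have : #[c] %| p ^ e.+2 by rewrite order_dvdn expnSr expgM -{2}h3 expg_order.
  case/(dvdn_pfactor _ _ pr)=> f fe oc; rewrite oc; congr (_ ^ _)%N; apply/eqP; rewrite eqn_leq fe.
  rewrite leqNgt; apply/negP=> fe2; case/eqP: cp1; apply/eqP.
  by rewrite -order_dvdn oc dvdn_exp2l.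
have e0 : 0 < e by case: h => //; rewrite cp1 eqxx.
case: e e0 nE oq h cpN cp1 => // e _ nE oq h cpN cp1; exfalso.
have [l za] := cl_za C erefl.
have xp : x = a ^+ p.-1 by rewrite subn1.
have xK : x \in K := Kmn_xcore k p3 n0.
have zx : z ^ x = z by apply/conjg_fixP/commgP/cNK => //; exact: layer_zN.
have n1E : n1 = x ^+ (p ^ e.+1) by rewrite nE expnSr mulnK ?prime_gt0.
apply: (step_contra pr p2 cEE bb Kmn_ioio ioa on1 layer_oz layer_zTI c1 layer_n1io layer_zio layer_zb layer_n1b' ca za xp zx n1E cp1).
have ca2 := step_ca pr p2 cEE bb Kmn_ioio ioa on1 layer_zTI c1 layer_n1io layer_zio layer_zb layer_n1b' ca.
have [U cU] := step_iter cEE layer_zio layer_zb ca2 za p.-1.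
have GK : G \subset 'N(K) := Kmn_Knorm a b L.
have cNK' : c \in 'N(K) by rewrite (subsetP GK) // Kmn_cG.
have zK : z \in K by apply: (subsetP (cl_sub C)); exact: layer_zN.
have xNK : x \in 'N(K) by rewrite (subsetP GK) // groupX.
pose KG := gcore_group L G.
have eq : coset KG c ^+ (rho ^ p.-1) = coset KG c ^+ 1.
  have e1 : coset KG (c ^ x) = coset KG c by rewrite coset_J // (coset_id xK) conjg1.
  rewrite expg1 -[RHS]e1 xp cU.
  have zUK : z ^+ U \in KG by rewrite groupX.
  rewrite (coset_M (groupX _ cNK') (subsetP (normG KG) _ zUK)).
  by rewrite (coset_id zUK) mulg1 (coset_X _ cNK').
have dv : p %| #[coset KG c].
  have : #[coset KG c] %| p ^ e.+2 by rewrite order_dvdn -coset_X // cp1 morph1.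
  case/(dvdn_pfactor _ _ pr)=> [[|f]] _ oc; last by rewrite oc expnS dvdn_mulr.
  case/negP: Kmn_cK; apply: (coset_idr cNK').
  by apply/eqP; rewrite -order_eq1 oc.
move/eqP: eq; rewrite eq_expg_mod_order => /eqP eq.
by rewrite -(modn_dvdm _ dv) eq modn_dvdm.
Qed.
End LayerP.
End PrimeParts.
End Iota.

Section PrimePower.
Local Open Scope group_scope.

Lemma central_layer_prime p e (gT : finGroupType) (a b : gT) (L : {group gT}) :
  prime p -> 2 < p -> 0 < e -> Kmn_group p (p ^ e) a b L -> central_layer p (p ^ e) a b L p.
Proof.
move=> pr p3 e0 k; have n1 : 1 < p ^ e by rewrite -(expn0 p) ltn_exp2l ?prime_gt1.
have [r C] := Kmn_central_layer k p3 n1.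
suff er : r = p by rewrite er in C.
apply/eqP; have := cl_dvd C.
by rewrite -(dvdn_prime2 (cl_prime C) pr); apply: contraTT => h; rewrite Euclid_dvdX ?(cl_prime C) // (negPf h).
Qed.

Definition cyclic_type (p e : nat) (gT : finGroupType) (a b : gT) : Prop :=
  #[cyc_gen a b] = (p ^ e.+1)%N /\ a \in 'N(<[cyc_gen a b]>).

Lemma quotient_kmn_pow p e (gT : finGroupType) (a b : gT) (L : {group gT}) :
  prime p -> 2 < p -> Kmn_group p (p ^ e.+1) a b L ->
  let N := layer p (p ^ e.+1) a b p in
  Kmn_group p (p ^ e) (coset N a) (coset N b) (L / N)%G.
Proof.
move=> pr p3 k N; have C := central_layer_prime pr p3 (ltn0Sn _) k.
have E : (p ^ e.+1 %/ p = p ^ e)%N by rewrite expnSr mulnK ?prime_gt0.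
by have := cl_quo C; rewrite E.
Qed.

Section NoLift.
Variables (p : nat) (gT : finGroupType) (a b : gT) (L : {group gT}).
Hypotheses (pr : prime p) (p5 : 4 < p) (k : Kmn_group p (p ^ 2) a b L).
Local Notation x := (a ^+ (p - 1)).
Local Notation y := (x ^ b).
Local Notation c := (cyc_gen a b).
Local Notation N := (layer p (p ^ 2) a b p).

Lemma no_lift : coset N c ^+ p = 1 -> False.
Proof.
have p3 : 2 < p by apply: ltn_trans p5.
have p2 : odd p by case: (even_prime pr) p5 => // ->.
have n0 : 0 < p ^ 2 by rewrite expn_gt0 prime_gt0.
have nodd : odd (p ^ 2) by rewrite oddX p2.
have C := central_layer_prime pr p3 (ltn0Sn _) k.
have k' := quotient_kmn_pow pr p3 k; rewrite -/N in k'.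
have n0' : 0 < p ^ 1 by rewrite expn_gt0 prime_gt0.
have nodd' : odd (p ^ 1) by rewrite oddX p2.
have C' := central_layer_prime pr p3 (ltn0Sn 0) k'.
have GN := cl_norm C; have aN := subsetP GN _ (mem_mgrpl a b); have bN := subsetP GN _ (mem_mgrpr a b).
have xN : x \in 'N(N) by rewrite groupX.
have yN : y \in 'N(N) by rewrite groupJ.
have cN : c \in 'N(N) by rewrite groupM ?groupX.
set n1 := x ^+ (p ^ 2 %/ p); set n2 := y ^+ (p ^ 2 %/ p).
have pE : p ^ 2 %/ p = p by rewrite expnS expn1 mulnK ?prime_gt0.
have n1E : n1 = x ^+ p by rewrite /n1 pE.
have n2E : n2 = y ^+ p by rewrite /n2 pE.
move=> cp.
have cpN : c ^+ p \in N by apply: coset_idr; rewrite ?groupX ?coset_X.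
have xK := Kmn_xcore k p3 n0; have yK := Kmn_ycore k p3 n0.
have NC g h : g \in N -> h \in gcore L (mgrp a b) -> commute g h.
  by move=> gN hK; apply/commute_sym/(centP (subsetP (cl_cent C) _ hK)).
set xq := coset N a ^+ (p - 1); set yq := xq ^ coset N b.
have xqE : coset N x = xq by rewrite coset_X.
have yqE : coset N y = yq by rewrite coset_J // xqE.
have p1E : p ^ 1 %/ p = 1%N by rewrite expn1 divnn prime_gt0.
have cxyq : commute xq yq.
  have h : xq \in layer p (p ^ 1) (coset N a) (coset N b) p.
    by rewrite mem_gen // inE p1E cycle_id.
  apply/commute_sym/(centP (subsetP (cl_cent C') _ _) _ h).
  exact: Kmn_ycore k' p3 n0'.
have czcq : commute (xq^-1 * yq) (coset N c).
  rewrite (coset_cyc pr p2 k C).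
  have := step_zc (erefl (cyc_gen (coset N a) (coset N b))) (layer_zio pr p2 k' n0' C' nodd') (layer_zb k').
  by rewrite p1E.
have xyN : [~ x, y] \in N.
  by apply: coset_idr; rewrite ?groupR // coset_R // xqE yqE; apply/eqP/commgP.
have on1 : n1 ^+ p = 1.
  by apply/eqP; rewrite -order_dvdn /n1 (layer_on1 k p3 pr) // dvdn_mulr.
have oz := layer_oz pr p2 k C; rewrite -/n1 -/n2 in oz.
have c1z := layer_comm_n1z C; rewrite -/n1 -/n2 in c1z.
set z := n1^-1 * n2 in oz c1z.
have oN g : g \in N -> g ^+ p = 1.
  move/(layer_pair C) => [s [u ->]]; rewrite expgMn; last by apply: commuteX2.
  rewrite -!expgM ![(_ * p)%N]mulnC !expgM on1 -/n1 -/n2 -/z.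
  by rewrite -{1}oz expg_order !expg1n mulg1.
have oNb g j : g \in N -> 0 < j < p -> g ^+ 'C(p, j) = 1.
  move=> gN jp; have /dvdnP[q ->] : p %| 'C(p, j) by apply: prime_dvd_bin.
  by rewrite mulnC expgM oN // expg1n.
pose z1 := x^-1 * y.
have z1N : z1 \in 'N(N) by rewrite groupM ?groupV.
have [nu nuN e1] : exists2 nu, nu \in N & z1 ^ c = z1 * nu.
  apply: coset_mul_repr; rewrite ?groupJ //.
  rewrite coset_J // coset_M ?groupV // coset_V // xqE yqE.
  by apply/conjg_fixP/commgP.
have z1K : z1 \in gcore L (mgrp a b) by rewrite groupM ?groupV.
have z1p : z1 ^+ p = n1^-1 * n2.
  have cc : [~ y, x^-1] \in N.
    have -> : [~ y, x^-1] = [~ x, y] ^ x^-1.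
      by rewrite !commgEl !conjgE; group_simp.
    by rewrite memJ_norm ?groupV // (subsetP GN) // groupX ?mem_mgrpl.
  rewrite /z1 expMg_Rmul; first last.
  - by apply/commute_sym/NC; rewrite ?groupV.
  - by apply/commute_sym/NC.
  rewrite expgVn -n1E -n2E.
  by rewrite (oNb _ 2) ?mulg1.
have [s [u nuE]] := layer_pair C nuN.
rewrite -/n1 -/n2 -/z in nuE; pose xi := z ^+ s.
have zc : z ^ c = z.
  apply/conjg_fixP/commgP.
  exact: step_zc (erefl c) (layer_zio pr p2 k n0 C nodd) (layer_zb k).
have n1c : n1 ^ c = n1 * z.
  exact: step_n1c (erefl c) (layer_n1io _ _ _) (layer_n1b' _ _ _ _).
have nuc : nu ^ c = nu * xi.
  rewrite nuE conjMg (conjXg n1) (conjXg z) n1c zc expgMn // -!mulgA; congr (_ * _).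
  by rewrite -!expgD addnC.
have xic : xi ^ c = xi by rewrite (conjXg z) zc.
have xcE : x ^ c = x * z1 by rewrite (Kmn_xc p a b) mulKVg.
have c1 : commute z1 nu by apply/commute_sym/NC.
have zN : z \in N by exact: layer_zN.
have c2 : commute nu xi by apply/commuteX/NC => //; apply: (subsetP (cl_sub C)).
have it i : x ^ (c ^+ i) = x * z1 ^+ i * nu ^+ 'C(i, 2) * xi ^+ 'C(i, 3).
  elim: i => [|i IH]; first by rewrite conjg1 !bin0n !mulg1.
  rewrite expgSr conjgM IH !conjMg (conjXg z1) (conjXg nu) (conjXg xi) xcE e1 nuc xic.
  have b2 : ('C(i.+1, 2) = i + 'C(i, 2))%N by rewrite binS bin1 addnC.
  have b3 : ('C(i.+1, 3) = 'C(i, 2) + 'C(i, 3))%N by rewrite binS addnC.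
  rewrite (expgMn i c1) (expgMn 'C(i, 2) c2) b2 b3 !expgD expgS.
  by rewrite -!mulgA.
have : x ^ (c ^+ p) = x by apply/conjg_fixP/commgP/commute_sym/NC.
have xiN : xi \in N by rewrite groupX.
have b2 : 0 < 2 < p by rewrite p3.
have b3 : 0 < 3 < p by rewrite (ltn_trans _ p5).
rewrite it (oNb _ 2 nuN b2) (oNb _ 3 xiN b3) !mulg1.
rewrite z1p -/z -[RHS]mulg1 => /mulgI z1E.
by have := prime_gt1 pr; rewrite -oz z1E order1.
Qed.
End NoLift.

Lemma cyclic_type_base p (gT : finGroupType) (a b : gT) (L : {group gT}) :
  prime p -> odd p -> Kmn_group p (p ^ 0) a b L -> cyclic_type p 0 a b.
Proof. by move=> pr p2 k; rewrite /cyclic_type expn1; apply: (cyc_base pr p2 k). Qed.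

Lemma cyclic_type_step p e (gT : finGroupType) (a b : gT) (L : {group gT}) :
  prime p -> odd p -> Kmn_group p (p ^ e.+1) a b L ->
  let N := layer p (p ^ e.+1) a b p in cyclic_type p e (coset N a) (coset N b) ->
  0 < e \/ cyc_gen a b ^+ (p ^ e.+1) != 1 -> cyclic_type p e.+1 a b.
Proof.
move=> pr p2 k N [h1 h2] h3.
have p3 : 2 < p by case: p pr p2 {k N h1 h2 h3} => [|[|[|]]].
have C := central_layer_prime pr p3 (ltn0Sn _) k.
have n0 : 0 < p ^ e.+1 by rewrite expn_gt0 prime_gt0.
have nodd : odd (p ^ e.+1) by rewrite oddX p2 orbT.
by have [g1 g2 _] := cyc_step pr p2 k n0 C nodd erefl h1 h2 h3.
Qed.

Lemma cyclic_type_ge5 p e (gT : finGroupType) (a b : gT) (L : {group gT}) :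
  prime p -> 4 < p -> Kmn_group p (p ^ e.+1) a b L ->
  cyclic_type p e.+1 a b \/ e = 0 /\ cyc_gen a b ^+ p = 1.
Proof.
move=> pr p5; have p3 : 2 < p by apply: ltn_trans p5.
have p2 : odd p by case: (even_prime pr) p5 => // ->.
elim: e gT a b L => [|e IH] gT a b L k.
  have [c1|c1] := eqVneq (cyc_gen a b ^+ p) 1; first by right.
  left; apply: (cyclic_type_step pr p2 k); last by right; rewrite expn1.
  exact: (cyclic_type_base pr p2 (quotient_kmn_pow pr p3 k)).
have k' := quotient_kmn_pow pr p3 k.
left; case: (IH _ _ _ _ k') => [h|[e0 h]].
  by apply: (cyclic_type_step pr p2 k) => //; left.
rewrite e0 in k k' h *; exfalso; apply: (no_lift pr p5 k).
by rewrite (coset_cyc pr p2 k (central_layer_prime pr p3 (ltn0Sn _) k)).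
Qed.
End PrimePower.

Section CentralExtension.
Local Open Scope group_scope.
Variables (gT : finGroupType) (a b x y P R n : gT) (Q : nat).
Hypotheses (bb : b * b = 1) (aa : a * a = x) (xb : x ^ b = y).
Hypotheses (PE : P = x ^+ Q) (RE : R = y ^+ Q) (Q3 : 3 %| Q).
Hypotheses (P3 : P ^+ 3 = n) (R3 : R ^+ 3 = n) (n3 : n ^+ 3 = 1).
Hypotheses (na : commute n a) (nb : commute n b) (Py : commute P y) (Rx : commute R x).
Variables (i j s l j' : nat).
Hypothesis (zE : [~ x, y] = (P^-1 * R) ^+ i * n ^+ j).
Hypothesis (ya : y ^ a = x^-1 * y^-1 * n ^+ s).
Hypothesis (tE : (a * b) ^+ 3 = (P^-1 * R) ^+ l * n ^+ j').

Let yb : y ^ b = x. Proof. by rewrite -xb -conjgM bb conjg1. Qed.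
Let Px : commute P x. Proof. by rewrite PE; commute_tac. Qed.
Let Ry : commute R y. Proof. by rewrite RE; commute_tac. Qed.
Let nx : commute n x. Proof. by rewrite -aa; commute_tac. Qed.
Let ny : commute n y. Proof. by rewrite -xb conjgE; commute_tac. Qed.
Let PR : commute P R. Proof. by rewrite RE; commute_tac. Qed.
Let nP : commute n P. Proof. by rewrite PE; commute_tac. Qed.
Let nR : commute n R. Proof. by rewrite RE; commute_tac. Qed.
Let nt : n ^ (a * b) = n. Proof. by apply/conjg_fixP/commgP; commute_tac. Qed.
Let xt : x ^ (a * b) = y.
Proof. by rewrite conjgM; have -> : x ^ a = x by [rewrite -aa conjgE -mulgA mulKg]. Qed.
Let Pt : P ^ (a * b) = R. Proof. by rewrite PE conjXg xt -RE. Qed.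
Let zx : commute [~ x, y] x. Proof. by rewrite zE; commute_tac. Qed.
Let zy : commute [~ x, y] y. Proof. by rewrite zE; commute_tac. Qed.
Let nb' : n ^ b = n. Proof. by apply/conjg_fixP/commgP. Qed.
Let yt : y ^ (a * b) = y^-1 * x^-1 * n ^+ s.
Proof. by rewrite conjgM ya !conjMg !conjVg xb yb conjXg nb'. Qed.

Let w3 c : ((P^-1 * R) ^+ c) ^+ 3 = 1.
Proof.
have e : (P^-1 * R) ^+ 3 = 1 by rewrite (expgMn 3 (_ : commute P^-1 R)) ?expgVn ?P3 ?R3 ?mulVg //; commute_tac.
by rewrite -expgM mulnC expgM e expg1n.
Qed.

Let z3 : [~ x, y] ^+ 3 = 1.
Proof.
rewrite zE expgMn ?w3; last by commute_tac.
by rewrite mul1g -expgM mulnC expgM n3 expg1n.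
Qed.

Let Rt : R ^ (a * b) = P^-1 * R^-1.
Proof.
have -> : R ^ (a * b) = (y ^ (a * b)) ^+ Q by rewrite RE conjXg.
have c0 : commute (y^-1 * x^-1) (n ^+ s) by commute_tac.
have nsQ : n ^+ s ^+ Q = 1.
  by case/dvdnP: Q3 => q ->; rewrite -expgM mulnC -mulnA mulnC !expgM n3 ?expg1n.
have zyx : [~ y, x] = [~ x, y]^-1 by rewrite invgR.
have xyQ : (x * y) ^+ Q = P * R.
  have d3 : 3 %| 'C(Q, 2).
    have : 3 %| 2 * 'C(Q, 2) by rewrite bin2 mul2n halfK oddM; lia.
    by rewrite Gauss_dvdr.
  rewrite expMg_Rmul; last 2 first.
  - by rewrite /commute zyx; apply: commuteV; apply/commute_sym.
  - by rewrite /commute zyx; apply: commuteV; apply/commute_sym.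
  case/dvdnP: d3 => q ->.
  by rewrite zyx expgVn mulnC expgM z3 expg1n invg1 mulg1 PE RE.
have e : (y^-1 * x^-1) ^+ Q = (x * y) ^- Q by rewrite -invMg expgVn.
by rewrite yt (expgMn Q c0) nsQ mulg1 e xyQ invMg; commute_tac.
Qed.

Let wt c : ((P^-1 * R) ^+ c) ^ (a * b) = (P^-1 * R) ^+ c * n ^- c.
Proof.
rewrite conjXg conjMg conjVg Pt Rt.
have -> : R^-1 * (P^-1 * R^-1) = P^-1 * R * n^-1.
  rewrite -R3 !expgS expg0 mulg1 !invMg; have c1 : commute R^-1 P^-1 by commute_tac.
  by rewrite mulgA c1 -!mulgA mulKVg.
by rewrite expgMn ?expgVn //; commute_tac.
Qed.

Lemma central_extension_lift : n ^+ i = 1 /\ n ^+ l = 1.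
Proof.
have key c d g : g = (P^-1 * R) ^+ c * n ^+ d -> g ^ (a * b) = g -> n ^+ c = 1.
  move=> ->; rewrite conjMg wt conjXg nt -mulgA => /mulgI e.
  by apply: invg_inj; apply: (mulIg (n ^+ d)); rewrite e invg1 mul1g.
split; first apply: key zE _.
  have nsb : (n ^+ s) ^ b = n ^+ s by rewrite (conjXg n) nb'.
  by apply: (@relation_comm _ a b x y bb aa xb (n ^+ s) ya _ _ zx); rewrite nsb; commute_tac.
by apply: key tE _; apply/conjg_fixP/commgP/commute_sym/commuteX.
Qed.
End CentralExtension.

(** * The relations of [G4] for [m = 3] *)

Section ThreePower.
Local Open Scope group_scope.

Definition rel4 (q i l : nat) (gT : finGroupType) (a b : gT) : Prop :=
  let x := a ^+ 2 in let y := x ^ b in let w := (x ^+ q)^-1 * y ^+ q in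
  [/\ y ^ a = x^-1 * y^-1, [~ x, y] = w ^+ i & (a * b) ^+ 3 = w ^+ l].

Lemma rel4_base (gT : finGroupType) (a b : gT) (L : {group gT}) :
  Kmn_group 3 (3 ^ 0) a b L -> rel4 (3 ^ 0 %/ 3) 0 0 a b.
Proof.
move=> k; have n0 : 0 < 3 ^ 0 by [].
have x1 : a ^+ 2 = 1.
  by apply/eqP; rewrite -order_eq1 (Kmn_orderx k isT).
have c : [~ a ^+ 2, (a ^+ 2) ^ b] = 1 by rewrite x1 conj1g comm1g.
have [s [e _]] := abelian_tau k n0 c.
split; [exact: (abelian_ya k n0 c) | by [] |].
by rewrite e x1 conj1g invg1 mul1g expg1n.
Qed.

Lemma rel4_prime (gT : finGroupType) (a b : gT) (L : {group gT}) :
  Kmn_group 3 (3 ^ 1) a b L -> [~ a ^+ 2, (a ^+ 2) ^ b] = 1 /\ exists l, rel4 (3 ^ 1 %/ 3) 0 l a b.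
Proof.
move=> k; have n0 : 0 < 3 ^ 1 by [].
have C := central_layer_prime (isT : prime 3) isT (isT : 0 < 1) k.
have c : [~ a ^+ 2, (a ^+ 2) ^ b] = 1.
  apply/eqP/commgP/commute_sym.
  apply: (centP (subsetP (cl_cent C) _ _)); last by rewrite mem_gen // inE cycle_id.
  exact: Kmn_ycore k isT n0.
have [s [e _]] := abelian_tau k n0 c.
split=> //; exists s; split; [exact: (abelian_ya k n0 c) | by [] |].
by rewrite e !expg1.
Qed.

Lemma cyc_gen_three (gT : finGroupType) (a b : gT) (L : {group gT}) :
  Kmn_group 3 (3 ^ 1) a b L -> (a * b) ^+ 3 != 1 -> cyc_gen a b ^+ 3 != 1.
Proof.
move=> k; have [cxy [l [ya _ tE]]] := rel4_prime k.
have bb := Kmn_bb k.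
suff -> : cyc_gen a b ^+ 3 = (a * b) ^+ 3 by [].
have -> : cyc_gen a b = a ^+ 2 * (a * b).
  by rewrite /cyc_gen /iota_of (kmn_orda k) mulgA -expgSr.
move: ya cxy tE; set x := a ^+ 2; set y := x ^ b; set t := a * b => ya /eqP/commgP cxy tE.
have yb : y ^ b = x by rewrite -conjgM bb conjg1.
have xt : x ^ t = y by rewrite conjgM; have -> : x ^ a = x by [rewrite conjgE -mulgA mulKg].
have yt : y ^ t = y^-1 * x^-1 by rewrite conjgM ya conjMg !conjVg yb.
have ct : commute (t ^+ 3) x by rewrite tE; commute_tac.
have E : (x * t) ^+ 3 = t ^+ 3 * (x ^ (t ^+ 3) * x ^ (t ^+ 2) * x ^ t).
  rewrite !conjgE !expgS expg0 mulg1; by group_simp.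
have t2 : x ^ (t ^+ 2) = y^-1 * x^-1 by rewrite -yt -xt -conjgM.
have t3 : x ^ (t ^+ 3) = x by apply/conjg_fixP/commgP/commute_sym.
rewrite E t2 t3 xt -[RHS]mulg1; congr (_ * _).
have c : commute x y^-1 by commute_tac.
by rewrite (mulgA x) c mulgK mulVg.
Qed.

Lemma rel4_prime_comm e (gT : finGroupType) (a b : gT) (L : {group gT}) :
  e = 0 -> Kmn_group 3 (3 ^ e.+1) a b L -> [~ a ^+ 2, (a ^+ 2) ^ b] = 1.
Proof. by move=> -> /rel4_prime[]. Qed.

Lemma cyclic_type_prime e (gT : finGroupType) (a b : gT) (L : {group gT}) :
  e = 0 -> Kmn_group 3 (3 ^ e.+1) a b L -> (a * b) ^+ 3 != 1 -> cyclic_type 3 e.+1 a b.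
Proof.
move=> -> k t3; apply: (cyclic_type_step (isT : prime 3) isT k).
  have k0 := quotient_kmn_pow (isT : prime 3) isT k.
  exact: cyclic_type_base (isT : prime 3) isT k0.
by right; rewrite expn1; apply: cyc_gen_three k t3.
Qed.

Section Step.
Variables (e : nat) (gT : finGroupType) (a b : gT) (L : {group gT}).
Local Notation n := (3 ^ e.+2)%N.
Hypothesis (k : Kmn_group 3 n a b L).
Local Notation G := (mgrp a b).
Local Notation x := (a ^+ 2).
Local Notation y := (x ^ b).
Local Notation K := (gcore L G).
Local Notation N := (layer 3 n a b 3).
Local Notation n1 := (x ^+ (n %/ 3)).
Local Notation n2 := (y ^+ (n %/ 3)).
Local Notation z := (n1^-1 * n2).
Local Notation aq := (coset N a).
Local Notation bq := (coset N b).

Let n0 : 0 < n. Proof. by rewrite expn_gt0. Qed.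
Let C : central_layer 3 n a b L 3.
Proof. exact: (central_layer_prime (isT : prime 3) isT (ltn0Sn _) k). Qed.
Let k' : Kmn_group 3 (3 ^ e.+1) aq bq (L / N)%G.
Proof. exact: (quotient_kmn_pow (isT : prime 3) isT k). Qed.
Let GN : G \subset 'N(N). Proof. exact: (cl_norm C). Qed.
Let aN : a \in 'N(N). Proof. exact: (subsetP GN _ (mem_mgrpl a b)). Qed.
Let bN : b \in 'N(N). Proof. exact: (subsetP GN _ (mem_mgrpr a b)). Qed.
Let xN : x \in 'N(N). Proof. by rewrite groupX. Qed.
Let yN : y \in 'N(N). Proof. by rewrite groupJ. Qed.
Let xE : coset N x = aq ^+ 2. Proof. by rewrite coset_X. Qed.
Let yE : coset N y = (aq ^+ 2) ^ bq. Proof. by rewrite coset_J // xE. Qed.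
Let xK : x \in K. Proof. exact: (Kmn_xcore k isT n0). Qed.
Let yK : y \in K. Proof. exact: (Kmn_ycore k isT n0). Qed.
Let cN g h : g \in N -> h \in K -> commute g h.
Proof. by move=> gN hK; apply/commute_sym/(centP (subsetP (cl_cent C) _ hK)). Qed.
Let NK g : g \in N -> g \in K. Proof. exact: (subsetP (cl_sub C)). Qed.
Let n1N : n1 \in N. Proof. by rewrite mem_gen // inE cycle_id. Qed.
Let n2N : n2 \in N. Proof. by rewrite mem_gen // inE cycle_id orbT. Qed.
Let on1 : n1 ^+ 3 = 1.
Proof. by apply/eqP; rewrite -order_dvdn (layer_on1 k isT (cl_prime C) (cl_dvd C)). Qed.
Let on2 : n2 ^+ 3 = 1.
Proof. by apply/eqP; rewrite -order_dvdn (layer_on2 k isT (cl_prime C) (cl_dvd C)). Qed.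
Let tN : a * b \in 'N(N). Proof. by rewrite groupM. Qed.
Let tE : coset N (a * b) = aq * bq. Proof. by rewrite coset_M. Qed.
Let qE : (n %/ 3 = 3 ^ e.+1)%N. Proof. by rewrite expnSr mulnK. Qed.

Lemma rel4_lift : (y ^ a * (x^-1 * y^-1)^-1 \in N) -> [~ x, y] \in N -> (a * b) ^+ 3 \in N ->
  exists i l, rel4 (n %/ 3) i l a b.
Proof.
rewrite invMg !invgK => h1 h2 h3.
have h1' : y * x * y ^ a \in N.
  have -> : y * x * y ^ a = (y ^ a * (y * x)) ^ (y * x)^-1 by move: (y * x) (y ^ a) => u v; rewrite conjgE invgK !mulgA mulgK.
  by rewrite memJ_norm // groupV groupM.
have [i [iE _]] := lift_comm k n0 C h1' h2.
have [l [lE _]] := lift_tau k n0 C h3.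
by exists i, l; split=> //; apply: (lift_ya k n0 C).
Qed.

Local Notation Q := (3 ^ e)%N.
Local Notation w := ((x ^+ Q)^-1 * y ^+ Q).

Lemma rel4_no_lift i l : 0 < e -> rel4 (3 ^ e.+1 %/ 3) i l aq bq -> 3 %| i /\ 3 %| l.
Proof.
move=> e0 [yaq zq tq].
have q'E : (3 ^ e.+1 %/ 3 = Q)%N by rewrite expnSr mulnK.
rewrite q'E in zq tq.
have C' : central_layer 3 (3 ^ e.+1) aq bq (L / N)%G 3.
  exact: (central_layer_prime (isT : prime 3) isT (ltn0Sn _) k').
have n0' : 0 < 3 ^ e.+1 by rewrite expn_gt0.
have pN : coset N (x ^+ Q) \in layer 3 (3 ^ e.+1) aq bq 3.
  by rewrite coset_X // xE mem_gen // inE q'E cycle_id.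
have rN : coset N (y ^+ Q) \in layer 3 (3 ^ e.+1) aq bq 3.
  by rewrite coset_X // yE mem_gen // inE q'E cycle_id orbT.
have cq g h : coset N g \in layer 3 (3 ^ e.+1) aq bq 3 -> g \in 'N(N) -> h \in 'N(N) ->
    coset N h \in gcore (L / N)%G (mgrp aq bq) -> [~ g, h] \in N.
  move=> gl gN hN hK; apply: coset_idr; rewrite ?groupR // coset_R //.
  by apply/eqP/commgP/commute_sym; apply: (centP (subsetP (cl_cent C') _ _)).
have xKq : coset N x \in gcore (L / N)%G (mgrp aq bq).
  by rewrite xE; exact: Kmn_xcore k' isT n0'.
have yKq : coset N y \in gcore (L / N)%G (mgrp aq bq).
  by rewrite yE; exact: Kmn_ycore k' isT n0'.
have xQN : x ^+ Q \in 'N(N) by rewrite groupX.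
have yQN : y ^+ Q \in 'N(N) by rewrite groupX.
have wN : w \in 'N(N) by rewrite groupM ?groupV.
have wqE : coset N w = ((aq ^+ 2) ^+ Q)^-1 * ((aq ^+ 2) ^ bq) ^+ Q.
  by rewrite coset_M ?groupV // coset_V // !coset_X // yE.
have wl : coset N w \in layer 3 (3 ^ e.+1) aq bq 3.
  by rewrite coset_M ?groupV // coset_V // groupM ?groupV.
have [v1 v1N z1] : exists2 v, v \in N & [~ x, y] = w ^+ i * v.
  by apply: coset_mul_repr; rewrite ?groupR ?groupX // coset_R // (coset_X i wN) xE yE wqE.
have [v2 v2N t1] : exists2 v, v \in N & (a * b) ^+ 3 = w ^+ l * v.
  by apply: coset_mul_repr; rewrite ?groupX // (coset_X l wN) (coset_X 3 tN) tE wqE.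
have [v3 v3N y1] : exists2 v, v \in N & y ^ a = x^-1 * y^-1 * v.
  apply: coset_mul_repr; rewrite ?groupJ ?groupM ?groupV //.
  by rewrite (coset_J yN aN) (coset_M (groupVr xN) (groupVr yN)) (coset_V xN) (coset_V yN) xE yE.
have N3 g : g \in N -> g ^+ 3 = 1.
  rewrite -(cl_NE C) => /mulsgP[_ _ /cycleP[s ->] /cycleP[u ->] ->].
  rewrite expgMn; last by apply: commuteX2; apply: cN => //; rewrite groupX.
  by rewrite -!expgM !(mulnC _ 3) !expgM on1 on2 !expg1n mulg1.
have wK : w \in K by exact: groupM (groupVr (groupX Q xK)) (groupX Q yK).
have xQK : x ^+ Q \in K by exact: groupX.
have yQK : y ^+ Q \in K by exact: groupX.
have cPR : [~ y ^+ Q, (x ^+ Q)^-1] \in N.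
  apply: (cq _ _ rN yQN (groupVr xQN)).
  by rewrite (coset_V xQN) (coset_X Q xN); apply: groupVr; apply: groupX.
have w3 : w ^+ 3 = z.
  rewrite expMg_Rmul; last 2 first.
  - exact: commute_sym (cN cPR yQK).
  - exact: commute_sym (cN cPR (groupVr xQK)).
  by rewrite (N3 _ cPR) mulg1 expgVn -!expgM qE expnSr.
have zN : z \in N by rewrite groupM ?groupV.
have zeta3 : [~ x, y] ^+ 3 = z ^+ i.
  rewrite z1 expgMn; last by apply/commute_sym/cN => //; rewrite groupX.
  by rewrite (N3 v1) // mulg1 -expgM mulnC expgM w3.
have x3y : (x ^+ 3) ^ y = x ^+ 3 * z ^+ i.
  have zN' : [~ [~ x, y], x] \in N.
    apply: cq; rewrite ?groupR // coset_R // xE yE zq -wqE groupX //.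
  rewrite conjXg.
  have -> : x ^ y = x * [~ x, y] by rewrite commgEl mulKVg.
  rewrite expMg_Rmul ?zeta3; last 2 first.
  - exact: commute_sym (cN zN' (groupR xK yK)).
  - exact: commute_sym (cN zN' xK).
  by rewrite (N3 _ zN') mulg1.
have za : z ^ a = z^-1.
  have aux (u v : gT) : u ^+ 3 = 1 -> commute u v -> u^-1 * (u^-1 * v^-1) = (u^-1 * v)^-1.
    move=> u3 c; have e2 : u^-1 * u^-1 = u.
      by apply: (mulgI (u * u)); rewrite -invMg mulgV -u3 !expgS expg0 mulg1 mulgA.
    by rewrite mulgA e2 invMg invgK; commute_tac.
  have n1a : n1 ^ a = n1 by rewrite conjXg (Kmn_xa 3 a).
  rewrite conjMg conjVg (cl_n2a3 C) // n1a; apply: aux on1 _.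
  exact: cN n1N (NK n2N).
have zb : z ^ b = z^-1 by apply: layer_zb k.
have GZ : G \subset 'N(<[z]>).
  rewrite mgrp_sub; apply/andP; split; apply/normP;
    by rewrite -cycleJ ?za ?zb; apply: cycleV.
pose Z := <[z]>%G; pose f := coset Z.
have GZ' g : g \in G -> g \in 'N(Z) by apply: subsetP.
have aG := mem_mgrpl a b; have bG := mem_mgrpr a b.
have aZ := GZ' _ aG; have bZ := GZ' _ bG.
have xG : x \in G by rewrite groupX.
have yG : y \in G by rewrite groupJ.
have xZ := GZ' _ xG; have yZ := GZ' _ yG.
have n1Z := GZ' _ (groupX (n %/ 3) xG).
have n2Z := GZ' _ (groupX (n %/ 3) yG).
have PZ := GZ' _ (groupX Q xG).
have RZ := GZ' _ (groupX Q yG).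
have fz u : f (z ^+ u) = 1 by apply: coset_id; rewrite mem_cycle.
have zZ : z \in 'N(Z) by rewrite (subsetP (normG _)) ?cycle_id.
have fN g : g \in N -> exists u, f g = f n1 ^+ u.
  case/(layer_pair C) => s [u ->]; exists s.
  by rewrite /f (coset_M (groupX s n1Z) (groupX u zZ)) -/f fz mulg1; exact: coset_X.
have fn2 : f n2 = f n1.
  have e2 : n2 = n1 * z by rewrite mulKVg.
  by rewrite e2 /f (coset_M n1Z zZ) -[z]expg1 -/f fz mulg1.
have [j1 E1] := fN _ v1N; have [j2 E2] := fN _ v2N; have [j3 E3] := fN _ v3N.
have v1Z : v1 \in 'N(Z) by apply/GZ'/(subsetP (kmn_LG k))/(subsetP (Kmn_KL a b L))/NK.
have v2Z : v2 \in 'N(Z) by apply/GZ'/(subsetP (kmn_LG k))/(subsetP (Kmn_KL a b L))/NK.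
have v3Z : v3 \in 'N(Z) by apply/GZ'/(subsetP (kmn_LG k))/(subsetP (Kmn_KL a b L))/NK.
have wZ : w \in 'N(Z) by exact: groupM (groupVr PZ) RZ.
have fw : f w = (f (x ^+ Q))^-1 * f (y ^+ Q).
  by rewrite /f (coset_M (groupVr PZ) RZ) (coset_V PZ).
have fy : f y = f x ^ f b by exact: coset_J.
have fx : f x = f a ^+ 2 by exact: coset_X.
have fbb : f b * f b = 1 by rewrite -(coset_M bZ bZ) (Kmn_bb k) morph1.
have fyb : f y ^ f b = f x by rewrite fy -conjgM fbb conjg1.
have cx3y : commute (f x ^+ 3) (f y).
  apply/commgP/conjg_fixP.
  have x3Z : x ^+ 3 \in 'N(Z) by exact: groupX.
  rewrite -(coset_X 3 xZ) -(coset_J x3Z yZ) x3y (coset_M x3Z (groupX i zZ)).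
  by rewrite -/f fz mulg1.
have cy3x : commute (f y ^+ 3) (f x).
  have := congr1 (fun g => g ^ f b) cx3y.
  by rewrite (conjMg (f x ^+ 3) (f y)) (conjMg (f y) (f x ^+ 3)) (conjXg (f x)) fyb -fy.
have QE : (Q = 3 * 3 ^ e.-1)%N by rewrite -expnS prednK.
have fP : f (x ^+ Q) = f x ^+ Q by exact: coset_X.
have fR : f (y ^+ Q) = f y ^+ Q by exact: coset_X.
have P3 : f (x ^+ Q) ^+ 3 = f n1 by rewrite -(coset_X 3 PZ) -expgM qE -expnSr.
have R3 : f (y ^+ Q) ^+ 3 = f n1 by rewrite -fn2 -(coset_X 3 RZ) -expgM qE -expnSr.
have n3 : f n1 ^+ 3 = 1 by rewrite -(coset_X 3 n1Z) on1 morph1.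
have na : commute (f n1) (f a).
  by apply/commgP/conjg_fixP; rewrite -(coset_J n1Z aZ) conjXg (Kmn_xa 3 a).
have nb : commute (f n1) (f b).
  apply/commgP/conjg_fixP.
  have n1b : n1 ^ b = n2 by rewrite conjXg.
  by rewrite -(coset_J n1Z bZ) n1b -/f fn2.
have Py : commute (f (x ^+ Q)) (f y).
  by rewrite fP QE (expgM (f x)); apply/commute_sym/commuteX/commute_sym.
have Rx : commute (f (y ^+ Q)) (f x).
  by rewrite fR QE (expgM (f y)); apply/commute_sym/commuteX/commute_sym.
have Z1 : [~ f x, f y] = ((f (x ^+ Q))^-1 * f (y ^+ Q)) ^+ i * f n1 ^+ j1.
  by rewrite -(coset_R xZ yZ) z1 (coset_M (groupX i wZ) v1Z) (coset_X i wZ) -/f fw E1.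
have Z2 : (f a * f b) ^+ 3 = ((f (x ^+ Q))^-1 * f (y ^+ Q)) ^+ l * f n1 ^+ j2.
  rewrite -(coset_M aZ bZ) -(coset_X 3 (groupM aZ bZ)) t1 (coset_M (groupX l wZ) v2Z).
  by rewrite (coset_X l wZ) -/f fw E2.
have Z3 : f y ^ f a = (f x)^-1 * (f y)^-1 * f n1 ^+ j3.
  rewrite -(coset_J yZ aZ) y1 (coset_M (groupM (groupVr xZ) (groupVr yZ)) v3Z) -/f E3.
  by rewrite /f (coset_M (groupVr xZ) (groupVr yZ)) (coset_V xZ) (coset_V yZ).
have Q3 : 3 %| Q by rewrite QE dvdn_mulr.
have [h1 h2] := central_extension_lift fbb (esym fx) (esym fy) fP fR Q3 P3 R3 n3 na nb Py Rx Z1 Z3 Z2.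
have n1TI u : f n1 ^+ u = 1 -> 3 %| u.
  rewrite -(coset_X u n1Z) => h; rewrite -(layer_on1 k isT (cl_prime C) (cl_dvd C)) order_dvdn.
  rewrite -cycle_eq1 -subG1 -(layer_zTI (isT : prime 3) isT k C) subsetI !cycle_subG mem_cycle /=.
  by apply: coset_idr h; apply: groupX.
by split; apply: n1TI.
Qed.
End Step.

Lemma three_power e (gT : finGroupType) (a b : gT) (L : {group gT}) :
  Kmn_group 3 (3 ^ e) a b L ->
  (2 <= e /\ cyclic_type 3 e a b) \/
  exists i l, (e <= 1 -> [~ a ^+ 2, (a ^+ 2) ^ b] = 1) /\ rel4 (3 ^ e %/ 3) i l a b.
Proof.
elim: e gT a b L => [|e IH] gT a b L k.
  have r := rel4_base k; right; exists 0, 0; split=> // _; by case: r => _ ->.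
case: e IH k => [|e] IH k.
  by have [c [l r]] := rel4_prime k; right; exists 0, l.
have k' := quotient_kmn_pow (isT : prime 3) isT k.
have C := central_layer_prime (isT : prime 3) isT (ltn0Sn _) k.
have C' := central_layer_prime (isT : prime 3) isT (ltn0Sn _) k'.
have step := @cyclic_type_step 3 e.+1 _ a b L isT isT k.
case: (IH _ _ _ _ k') => [[e1 c]|[i [l [_ r]]]].
  by left; split=> //; apply: step => //; left.
set N := layer _ _ _ _ _ in k' C' step r *.
have := r; rewrite /rel4; set xq := coset N a ^+ 2; set yq := xq ^ coset N b.
set w := (xq ^+ _)^-1 * _; case=> yaq zq tq.
have ow : #[w] = 3 by exact: (layer_oz (isT : prime 3) isT k' C').
have w3 u : 3 %| u -> w ^+ u = 1.
  by move=> h; apply/eqP; rewrite -order_dvdn ow.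
have GN := cl_norm C; have aN := subsetP GN _ (mem_mgrpl a b); have bN := subsetP GN _ (mem_mgrpr a b).
have xN : a ^+ 2 \in 'N(N) by rewrite groupX.
have yN : (a ^+ 2) ^ b \in 'N(N) by rewrite groupJ.
have tN : a * b \in 'N(N) by rewrite groupM.
have xE : coset N (a ^+ 2) = xq by exact: coset_X.
have yE : coset N ((a ^+ 2) ^ b) = yq by rewrite (coset_J xN bN) xE.
have lift : w ^+ i = 1 -> w ^+ l = 1 ->
    exists i l, (e.+2 <= 1 -> [~ a ^+ 2, (a ^+ 2) ^ b] = 1) /\ rel4 (3 ^ e.+2 %/ 3) i l a b.
  move=> wi wl; have xyV := groupM (groupVr xN) (groupVr yN).
  have [] := rel4_lift k.
  - apply: coset_idr; first exact: groupM (groupJ yN aN) (groupVr xyV).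
    rewrite (coset_M (groupJ yN aN) (groupVr xyV)) (coset_V xyV) (coset_J yN aN).
    by rewrite (coset_M (groupVr xN) (groupVr yN)) (coset_V xN) (coset_V yN) xE yE yaq mulgV.
  - apply: coset_idr; first by rewrite groupR.
    by rewrite (coset_R xN yN) xE yE zq.
  - apply: coset_idr; first by rewrite groupX.
    by rewrite (coset_X 3 tN) (coset_M aN bN) tq.
  by move=> i' [l' r']; exists i', l'.
have [e0|e0] := posnP e; last first.
  have [i3 l3] := rel4_no_lift k e0 r.
  by right; apply: lift; apply: w3.
have [l3|l3] := boolP (3 %| l).
  right; apply: lift; last exact: w3.
  by rewrite -zq; apply: (rel4_prime_comm e0 k').
left; split=> //; apply: step; last by left.
by apply: (cyclic_type_prime e0 k'); rewrite tq -order_dvdn ow.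
Qed.
End ThreePower.

(** * Units modulo prime powers *)

Section UnitGenerators.

Lemma expn_modX r k N : r = 1 %[mod N] -> r ^ k = 1 %[mod N].
Proof. by move=> h; rewrite -modnXm h modnXm exp1n. Qed.

Lemma eqn_modMl_coprime N c u v : coprime c N -> c * u = c * v %[mod N] -> u = v %[mod N].
Proof.
move=> co; wlog le : u v / u <= v => [hw|].
  by case/orP: (leq_total u v) => l h; [|symmetry]; apply: hw.
move=> e; apply/esym/eqP; rewrite eqn_mod_dvd //.
have : N %| c * v - c * u by rewrite -eqn_mod_dvd ?leq_mul2l ?le ?orbT // e.
by rewrite -mulnBr Gauss_dvdr // coprime_sym.
Qed.

Lemma coprime_expn1 r k N : 0 < k -> r ^ k = 1 %[mod N] -> coprime r N.
Proof.
move=> k0 h; have : coprime (r ^ k) N by rewrite -coprime_modl h coprime_modl coprime1n.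
by rewrite coprime_pexpl.
Qed.

Lemma unit_generator_dvd r N k : 0 < N -> unit_generator r N -> r ^ k = 1 %[mod N] -> totient N %| k.
Proof.
move=> N0 [co ug] h; rewrite /dvdn; apply/negPn/negP => nz.
have t0 : 0 < totient N by rewrite totient_gt0.
have := ug (k %% totient N); rewrite lt0n nz => /(_ isT).
have -> : r ^ (k %% totient N) = 1 %[mod N].
  have e : r ^ (k %/ totient N * totient N) = 1 %[mod N].
    by rewrite mulnC expnM; apply/expn_modX/Euler_exp_totient.
  move: h; rewrite {1}(divn_eq k (totient N)) expnD -modnMml e modnMml mul1n.
  by [].
by move=> /(_ erefl); rewrite leqNgt ltn_mod t0.
Qed.

Lemma unit_generator_log r N s : 1 < N -> unit_generator r N -> coprime s N ->
  exists j, s = r ^ j %[mod N].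
Proof.
move=> N1 [co ug] cs; have N0 : 0 < N by apply: ltnW.
pose f (i : 'I_(totient N)) : 'I_N := Ordinal (ltn_pmod (r ^ i) N0).
have finj : injective f.
  move=> i j /(congr1 val) /= e; apply: val_inj => /=.
  wlog lt : i j e / i < j => [hw|].
    by case: (ltngtP i j) => // l; [apply: hw|symmetry; apply: hw].
  have jE : nat_of_ord j = i + (j - i) by rewrite subnKC // ltnW.
  have h : r ^ (j - i) = 1 %[mod N].
    apply: (@eqn_modMl_coprime _ (r ^ i)); first exact: coprimeXl.
    by rewrite -expnD -jE muln1.
  have := ug (j - i); rewrite subn_gt0 => /(_ lt h) le.
  by have := ltn_ord j; lia.
pose U := [set x : 'I_N | coprime N x].
have cU : #|U| = totient N.
  by rewrite cardsE -sum1_card big_mkcond totient_count_coprime big_mkord.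
have sub : [set f i | i in 'I_(totient N)] \subset U.
  apply/subsetP=> _ /imsetP[i _ ->]; rewrite inE /= coprime_modr coprime_sym.
  exact: coprimeXl.
have E : [set f i | i in 'I_(totient N)] = U.
  by apply/eqP; rewrite eqEcard sub (card_imset _ finj) card_ord cU leqnn.
have : Ordinal (ltn_pmod s N0) \in U by rewrite inE /= coprime_modr coprime_sym.
by rewrite -E => /imsetP[i _ /(congr1 val) /= h]; exists i.
Qed.

Lemma log_coprime r N s j : 1 < N -> unit_generator r N -> unit_generator s N ->
  s = r ^ j %[mod N] -> coprime j (totient N).
Proof.
move=> N1 [co ug] [cs us] e; set t := totient N.
have t0 : 0 < t by rewrite totient_gt0 ltnW.
set g := gcdn j t; have g0 : 0 < g by rewrite gcdn_gt0 t0 orbT.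
have gt : g %| t := dvdn_gcdr _ _; have gj : g %| j := dvdn_gcdl _ _.
have h : s ^ (t %/ g) = 1 %[mod N].
  rewrite -modnXm e modnXm -expnM -(divnK gj) -mulnA (mulnC g) divnK //.
  by rewrite mulnC expnM; apply/expn_modX/Euler_exp_totient.
have d0 : 0 < t %/ g by rewrite divn_gt0 // dvdn_leq.
have le := us _ d0 h; rewrite /coprime -/g.
rewrite eqn_leq g0 andbT leqNgt; apply/negP => g1.
by have := ltn_Pdiv g1 t0; rewrite ltnNge le.
Qed.

Lemma unit_generator_eq_exp r N i j : 1 < N -> unit_generator r N ->
  r ^ i = r ^ j %[mod N] -> i = j %[mod totient N].
Proof.
move=> N1 ug; wlog le : i j / i <= j => [hw|].
  by case/orP: (leq_total i j) => l h; [|symmetry]; apply: hw.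
move=> e; apply/esym/eqP; rewrite eqn_mod_dvd //; apply: (unit_generator_dvd (ltnW N1) ug).
apply: (@eqn_modMl_coprime _ (r ^ i)); first by apply: coprimeXl; case: ug.
by rewrite -expnD subnKC // muln1 e.
Qed.

Lemma primitive_root p e : prime p -> odd p -> exists r, unit_generator r (p ^ e.+1).
Proof.
move=> pr p2; set N := p ^ e.+1.
have N1 : 1 < N by rewrite -(expn0 p) ltn_exp2l ?prime_gt1.
have cZ : #|Zp N| = N by rewrite card_Zp // ltnW.
have cyc : cyclic (Zp N) by apply/cyclicP; exists (Zp1 : 'Z_N); rewrite /Zp N1 Zp_cycle.
have pZ : (p.-group (Zp N))%g by rewrite /pgroup cZ pnatX pnat_id.
have nt : Zp N != 1%g by rewrite -cardG_gt1 cZ.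
have [x xE] := cyclicP cyc.
have cA : cyclic (Aut (Zp N)).
  have [m [_ [_ cF _ _] S]] := cyclic_pgroup_Aut_structure pZ cyc nt.
  by move: S; case: eqP => [_ -> //|_ [t [_ _ _]]]; rewrite p2; case=> [[]].
have [al AE] := cyclicP cA.
have alA : al \in Aut (Zp N) by rewrite AE cycle_id.
have ox : #[x]%g = N by rewrite orderE -xE cZ.
have xZ : x \in Zp N by rewrite xE cycle_id.
have [r rE] : exists r, al x = (x ^+ r)%g.
  have h : al x \in Zp N := Aut_closed alA xZ.
  by move: h; rewrite xE => /cycleP.
have alX g : g \in Zp N -> al g = (g ^+ r)%g.
  rewrite {1}xE => /cycleP[i ->].
  have -> : al (x ^+ i)%g = (al x ^+ i)%g by exact: (morphX (autm_morphism alA) i xZ).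
  by rewrite rE -!expgM mulnC.
have alk k g : g \in Zp N -> (al ^+ k)%g g = (g ^+ (r ^ k))%g.
  move=> gZ; elim: k => [|k IH]; first by rewrite expg0 perm1 expn0 expg1.
  by rewrite expgSr permM IH alX ?groupX // -expgM expnSr.
have oal : #[al]%g = totient N by rewrite orderE -AE card_Aut_cyclic // cZ.
have key k : r ^ k = 1 %[mod N] <-> totient N %| k.
  have -> : (totient N %| k) = (al ^+ k == 1)%g by rewrite -oal order_dvdn.
  split=> [h|/eqP h].
    apply/eqP/(eq_Aut (groupX k alA) (group1 _)) => g gZ.
    rewrite alk // perm1; have ex : (g ^+ N = 1)%g by apply/eqP; rewrite -order_dvdn -{2}cZ order_dvdG.
    by rewrite -(expg_mod _ ex) h expg_mod // expg1.
  have e1 := alk k x xZ; rewrite h perm1 in e1.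
  by apply/eqP; rewrite -ox -eq_expg_mod_order expg1 -e1.
exists r; split.
  by apply: (@coprime_expn1 _ (totient N)); [rewrite totient_gt0 ltnW | apply/key].
by move=> k k0 /key; apply: dvdn_leq.
Qed.

Lemma expn4_3 e : exists2 v, ~~ (3 %| v) & 4 ^ (3 ^ e) = 1 + 3 ^ e.+1 * v.
Proof.
elim: e => [|e [v v3 IH]]; first by exists 1.
exists (v + 3 ^ e.+1 * v ^ 2 + 3 ^ e * 3 ^ e.+1 * v ^ 3).
  have h : 3 %| 3 ^ e.+1 by rewrite expnS dvdn_mulr.
  rewrite dvdn_addl; last by rewrite -mulnA dvdn_mull // dvdn_mulr.
  by rewrite dvdn_addl // dvdn_mulr.
have -> : 4 ^ 3 ^ e.+1 = (4 ^ 3 ^ e) ^ 3 by rewrite -expnM -expnSr.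
by rewrite IH !(expnS 3); ring.
Qed.

Lemma expn4_order e k : 4 ^ k = 1 %[mod 3 ^ e.+1] -> 3 ^ e %| k.
Proof.
elim: e => [|e IH] h; first by rewrite dvd1n.
have /dvdnP[q qE] : 3 ^ e %| k.
  by apply: IH; apply/eqP; rewrite -(modn_dvdm (m := 3 ^ e.+2)) ?dvdn_exp2l // h modn_dvdm ?dvdn_exp2l.
have [v v3 vE] := expn4_3 e.
have bin j : exists u, (1 + 3 ^ e.+1 * v) ^ j = 1 + j * (3 ^ e.+1 * v) + 3 ^ e.+2 * u.
  elim: j => [|j [u IHj]]; first by exists 0; rewrite muln0.
  exists (u * (1 + 3 ^ e.+1 * v) + j * 3 ^ e * v ^ 2).
  by rewrite expnSr IHj !(expnS 3); ring.
move: h; rewrite qE mulnC expnM vE; have [u ->] := bin q.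
move/eqP; rewrite eqn_mod_dvd; last by lia.
rewrite -addnA addKn dvdn_addl; last exact: dvdn_mulr.
rewrite mulnCA (expnSr 3 e.+1) dvdn_pmul2l ?expn_gt0 //.
by rewrite Euclid_dvdM // (negPf v3) orbF => /dvdnP[q' ->]; rewrite mulnC -mulnA -expnS dvdn_mull.
Qed.

Lemma two_unit_generator e : unit_generator 2 (3 ^ e.+1).
Proof.
split; first by rewrite coprimeXr.
move=> k k0 h; rewrite totient_pfactor //=; apply: dvdn_leq => //.
have k2 : 2 %| k.
  have : 2 ^ k = 1 %[mod 3].
    by apply/eqP; rewrite -(modn_dvdm (m := 3 ^ e.+1)) ?dvdn_exp // h modn_dvdm ?dvdn_exp.
  rewrite dvdn2; case: (boolP (odd k)) => // ok.
  by rewrite -(odd_double_half k) ok add1n expnS -mul2n expnM -modnMmr -modnXm /= exp1n.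
have kE : k = 2 * (k %/ 2) by rewrite mulnC divnK.
have := h; rewrite {1}kE expnM => /expn4_order d.
by rewrite kE dvdn_pmul2l.
Qed.
End UnitGenerators.

(** * Gluing the primary parts for [m = 3] *)

Section Primary.
Local Open Scope group_scope.
Variables (m n : nat) (gT : finGroupType) (a b : gT) (L : {group gT}).
Hypotheses (k : Kmn_group m n a b L) (m3 : 2 < m) (n0 : 0 < n).
Local Notation G := (mgrp a b).
Local Notation x := (a ^+ (m - 1)).

Definition core_part (pi : nat_pred) (gT : finGroupType) (a b : gT) (L : {group gT}) : {group gT} :=
  'O_pi(gcore L (mgrp a b))%G.

Lemma core_part_norm pi : G \subset 'N(core_part pi a b L).
Proof.
apply: normal_norm; apply: char_normal_trans (pcore_char _ _) _.
exact: (Kmn_Knormal k).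
Qed.

Lemma core_part_card pi d f : n = (d * f)%N -> pi.-nat d -> pi^'.-nat f ->
  #|core_part pi a b L| = (d * d)%N.
Proof.
move=> nE pd pf; have [d0 f0] : 0 < d /\ 0 < f by move: n0; rewrite nE muln_gt0 => /andP[].
rewrite (card_Hall (nilpotent_pcore_Hall _ (Kmn_nilpotent k m3 n0))) (Kmn_cardK k m3 n0) nE.
rewrite !partnM ?muln_gt0 ?d0 ?f0 //.
by rewrite !(part_pnat_id pd) !(part_p'nat pf) !muln1.
Qed.

Lemma core_part_mem pi d f : n = (d * f)%N -> pi.-nat d -> x ^+ f \in core_part pi a b L.
Proof.
move=> nE pd; have [d0 f0] : 0 < d /\ 0 < f by move: n0; rewrite nE muln_gt0 => /andP[].
rewrite (mem_Hall_pcore (nilpotent_pcore_Hall _ (Kmn_nilpotent k m3 n0))).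
  rewrite /p_elt orderXdiv (Kmn_orderx k m3) nE ?dvdn_mull // mulnK //.
by rewrite groupX ?(Kmn_xcore k m3 n0).
Qed.

Lemma core_part_quotient pi d f : n = (d * f)%N -> pi.-nat d -> pi^'.-nat f ->
  let A := core_part pi a b L in Kmn_group m f (coset A a) (coset A b) (L / A)%G.
Proof.
move=> nE pd pf A; have [d0 f0] : 0 < d /\ 0 < f by move: n0; rewrite nE muln_gt0 => /andP[].
have fE : f = n %/ d by rewrite nE mulKn.
rewrite [X in Kmn_group _ X]fE; apply: (quotient_Kmn k m3 n0) => //.
- exact: pcore_sub.
- exact: core_part_norm.
- by rewrite nE dvdn_mulr.
- exact: core_part_card pd pf.
- by rewrite -fE; apply: core_part_mem pd.
Qed.

Lemma core_part_glue pi g h : g \in G -> h \in G ->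
  coset (core_part pi a b L) g = coset (core_part pi a b L) h ->
  coset (core_part pi^' a b L) g = coset (core_part pi^' a b L) h -> g = h.
Proof.
move=> gG hG e1 e2.
have mem pi' : coset (core_part pi' a b L) g = coset (core_part pi' a b L) h ->
    h^-1 * g \in core_part pi' a b L.
  have gN := subsetP (core_part_norm pi') _ gG; have hN := subsetP (core_part_norm pi') _ hG.
  move=> e; apply: coset_idr; first by rewrite groupM ?groupV.
  by rewrite (coset_M (groupVr hN) gN) (coset_V hN) e mulVg.
have : h^-1 * g \in core_part pi a b L :&: core_part pi^' a b L by rewrite inE !mem.
rewrite coprime_TIg ?coprime_pcoreC // => /set1P h1.
by rewrite -(mulKVg h g) h1 mulg1.
Qed.
End Primary.

Section CyclicMultiplier.
Local Open Scope group_scope.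

Lemma cyclic_multiplier p e (gT : finGroupType) (a b : gT) (L : {group gT}) :
  prime p -> odd p -> Kmn_group p (p ^ e) a b L -> cyclic_type p e a b ->
  exists2 r, unit_generator r (p ^ e.+1) & cyc_gen a b ^ a = cyc_gen a b ^+ r.
Proof.
move=> pr p2 k [oc /normP nc]; set c := cyc_gen a b in oc nc *.
have p3 : 2 < p by case: p pr p2 {k oc} => [|[|[|]]].
have n0 : 0 < p ^ e by rewrite expn_gt0 prime_gt0.
have [r rE] : exists r, c ^ a = c ^+ r.
  by apply/cycleP; rewrite -nc memJ_conjg cycle_id.
have rX i : c ^ (a ^+ i) = c ^+ (r ^ i).
  elim: i => [|i IH]; first by rewrite conjg1 expg1.
  by rewrite expgSr conjgM IH conjXg rE -expgM mulnC -expnSr.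
have key i : r ^ i = 1 %[mod p ^ e.+1] -> (p - 1) * p ^ e %| i.
  move=> h; rewrite -(kmn_orda k) order_dvdn.
  have ci : commute (a ^+ i) c.
    apply/commute_sym/commgP/conjg_fixP; rewrite rX -[RHS]expg1; apply/eqP.
    by rewrite eq_expg_mod_order oc h.
  have cb : a ^+ i = (a ^+ i) ^ b.
    symmetry; apply/conjg_fixP/commgP.
    have -> : b = (iota_of a)^-1 * c by rewrite mulKg.
    apply: commuteM => //; apply: commuteV; apply: commute_sym; apply: commuteX.
    exact: iota_commute.
  have : a ^+ i \in <[a]> :&: <[a]> :^ b.
    by rewrite inE mem_cycle {1}cb memJ_conjg mem_cycle.
  by rewrite (kmn_TI k) => /set1P ->.
exists r => //; split.
  rewrite coprime_sym -oc -generator_coprime /generator -rE cycleJ; exact/eqP/esym.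
move=> i i0 /key d; rewrite totient_pfactor //= -subn1.
exact: dvdn_leq.
Qed.
End CyclicMultiplier.

Section Eisenstein.
Local Open Scope group_scope.
Variables (gT : finGroupType) (x y t a : gT).
Hypotheses (cxy : commute x y) (xt : x ^ t = y) (yt : y ^ t = x^-1 * y^-1) (t3 : t ^+ 3 = 1).
Hypotheses (xa : x ^ a = x) (ta : t ^ a = t^-1 * x).

Lemma eisenstein_cyc s : let c := x ^+ s * t in
  c ^+ 3 = 1 /\ c ^ a = c ^+ 2 * x * y ^- s.
Proof.
have c1 : commute x^-1 y^-1 by commute_tac.
have Xt : (x ^+ s) ^ t = y ^+ s by rewrite conjXg xt.
have Yt : (y ^+ s) ^ t = (x ^+ s)^-1 * (y ^+ s)^-1 by rewrite conjXg yt (expgMn s c1) !expgVn.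
have cXx : commute (x ^+ s) x by commute_tac.
have cYx : commute (y ^+ s) x by commute_tac.
have Xa : (x ^+ s) ^ a = x ^+ s by rewrite conjXg xa.
have cXY : commute (x ^+ s) (y ^+ s) by commute_tac.
move: (x ^+ s) (y ^+ s) Xt Yt cXx cYx Xa cXY => X Y Xt Yt cXx cYx Xa cXY c.
have XtE : X * t = t * Y by rewrite -Xt conjgE !mulgA mulgV mul1g.
have YtE : Y * t = t * (X^-1 * Y^-1) by rewrite -Yt conjgE !mulgA mulgV mul1g.
have t2 : t * t = t^-1 by apply: (mulIg t); rewrite mulVg -t3 !expgS expg0 mulg1 mulgA.
have c2 : c ^+ 2 = t * t * X^-1.
  rewrite expgS expg1 /c XtE -mulgA (mulgA Y) YtE.
  by rewrite !mulgA mulgKV.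
have XVt : X^-1 * t = t * Y^-1 by rewrite -Xt conjgE !invMg invgK !mulgA mulgV mul1g.
split.
  rewrite expgSr c2 /c XtE -mulgA (mulgA X^-1 t Y) XVt mulgKV t2.
  exact: mulVg.
rewrite conjMg Xa ta c2 -t2.
rewrite !mulgA XtE -(mulgA t Y) YtE -!mulgA; congr (_ * (_ * (_ * _))).
by commute_tac.
Qed.
End Eisenstein.

Section Coprime3.
Local Open Scope group_scope.
Variables (q : nat) (gT : finGroupType) (a b : gT) (L : {group gT}).
Hypotheses (k : Kmn_group 3 q a b L) (q0 : 0 < q) (q3 : ~~ (3 %| q)).
Local Notation x := (a ^+ 2).
Local Notation y := (x ^ b).
Local Notation t := (a * b).

Lemma coprime3_relations : [/\ [~ x, y] = 1, y ^ a = x^-1 * y^-1 & t ^+ 3 = 1].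
Proof.
have c := coprime3_abelian k q0 q3; have ya := abelian_ya k q0 c.
split=> //; have [s [-> e]] := abelian_tau k q0 c.
have : q %| 3 * s by rewrite -(Kmn_orderx k isT) order_dvdn; apply/eqP.
rewrite Gauss_dvdr; last by rewrite coprime_sym prime_coprime.
move=> d; have xs : x ^+ s = 1 by apply/eqP; rewrite -order_dvdn (Kmn_orderx k isT).
move/eqP/commgP: c => c.
rewrite expgMn; last by commute_tac.
by rewrite expgVn xs -conjXg xs conj1g invg1 mulg1.
Qed.

Lemma coprime3_cyc s : let c := x ^+ s * t in
  c ^+ 3 = 1 /\ c ^ a = c ^+ 2 * x * y ^- s.
Proof.
have [/eqP/commgP cxy ya t3] := coprime3_relations.
have bb := Kmn_bb k.
have yb : y ^ b = x by rewrite -conjgM bb conjg1.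
have xa : x ^ a = x := Kmn_xa 3 a.
apply: eisenstein_cyc => //.
- by rewrite conjgM xa.
- by rewrite conjgM ya conjMg !conjVg yb; commute_tac.
- have bV : b^-1 = b := Kmn_bV k.
  have -> : x = a * a by [].
  by rewrite conjgE invMg bV !mulgA mulVg mul1g -(mulgA b) mulVg mulg1.
Qed.
End Coprime3.

Ltac grp_mem := lazymatch goal with
 | |- is_true ((?u * ?v)%g \in _) => apply: groupM; grp_mem
 | |- is_true ((?u ^+ ?i)%g \in _) => apply: groupX; grp_mem
 | |- is_true ((?u ^-1)%g \in _) => apply: groupVr; grp_mem
 | |- is_true ((?u ^ ?v)%g \in _) => apply: groupJ; grp_mem
 | |- is_true ([~ ?u, ?v]%g \in _) => apply: groupR; grp_mem
 | |- _ => first [assumption | exact: group1]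
 end.

Ltac morph_push f := repeat match goal with
 | |- context [mfun f (?u * ?v)%g] => rewrite (@morphM _ _ _ f u v); [ | grp_mem | grp_mem]
 | |- context [mfun f (?u ^+ ?i)%g] => rewrite (@morphX _ _ _ f i u); [ | grp_mem]
 | |- context [mfun f (?u ^-1)%g] => rewrite (@morphV _ _ _ f u); [ | grp_mem]
 | |- context [mfun f (?u ^ ?v)%g] => rewrite (@morphJ _ _ _ f u v); [ | grp_mem | grp_mem]
 | |- context [mfun f ([~ ?u, ?v])%g] => rewrite (@morphR _ _ _ f u v); [ | grp_mem | grp_mem]
 | |- context [mfun f 1%g] => rewrite (morph1 f)
 end.

Section InjectiveRelations.
Local Open Scope group_scope.
Variables (gT rT : finGroupType) (D : {group gT}) (f : {morphism D >-> rT}).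
Hypothesis injf : 'injm f.
Variables (a b : gT).
Hypotheses (aD : a \in D) (bD : b \in D).

Let inj g h : g \in D -> h \in D -> f g = f h -> g = h.
Proof. by move=> gD hD; apply: (injmP injf). Qed.

Lemma G3rel_inj k e u : G3rel k e u (f a) (f b) -> G3rel k e u a b.
Proof.
case/and5P=> /eqP h1 /eqP h2 /eqP h3 /eqP h4 /andP[/eqP h5 /eqP h6].
by apply/and5P; split; [| | | |apply/andP; split]; apply/eqP; apply: inj; try grp_mem; morph_push f.
Qed.

Lemma rel4_inj q i l : rel4 q i l (f a) (f b) -> rel4 q i l a b.
Proof.
case=> h1 h2 h3.
by split; apply: inj; try grp_mem; morph_push f.
Qed.
End InjectiveRelations.

Section ProductRelations.
Local Open Scope group_scope.
Variables (gT hT : finGroupType).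
Implicit Types u v : (gT * hT)%type.

Lemma fstgM u v : (u * v).1 = u.1 * v.1. Proof. by []. Qed.
Lemma fstgV u : (u^-1).1 = u.1^-1. Proof. by []. Qed.
Lemma fstgJ u v : (u ^ v).1 = u.1 ^ v.1. Proof. by []. Qed.
Lemma fstgR u v : [~ u, v].1 = [~ u.1, v.1]. Proof. by []. Qed.
Lemma fstgX u i : (u ^+ i).1 = u.1 ^+ i.
Proof. by elim: i => // i IH; rewrite !expgS fstgM IH. Qed.
Lemma sndgM u v : (u * v).2 = u.2 * v.2. Proof. by []. Qed.
Lemma sndgV u : (u^-1).2 = u.2^-1. Proof. by []. Qed.
Lemma sndgJ u v : (u ^ v).2 = u.2 ^ v.2. Proof. by []. Qed.
Lemma sndgR u v : [~ u, v].2 = [~ u.2, v.2]. Proof. by []. Qed.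
Lemma sndgX u i : (u ^+ i).2 = u.2 ^+ i.
Proof. by elim: i => // i IH; rewrite !expgS sndgM IH. Qed.
Definition fstgE := (fstgX, fstgJ, fstgR, fstgM, fstgV).
Definition sndgE := (sndgX, sndgJ, sndgR, sndgM, sndgV).

Lemma pair_ext u v : u.1 = v.1 -> u.2 = v.2 -> u = v.
Proof. by case: u v => [? ?] [? ?] /= -> ->. Qed.

Lemma G3rel_pair k e w u v : G3rel k e w u.1 v.1 -> G3rel k e w u.2 v.2 -> G3rel k e w u v.
Proof.
case/and5P=> /eqP h1 /eqP h2 /eqP h3 /eqP h4 /andP[/eqP h5 /eqP h6].
case/and5P=> /eqP k1 /eqP k2 /eqP k3 /eqP k4 /andP[/eqP k5 /eqP k6].
by apply/and5P; split; [| | | |apply/andP; split]; apply/eqP; apply: pair_ext; rewrite ?fstgE ?sndgE.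
Qed.

Lemma rel4_pair q i l u v : rel4 q i l u.1 v.1 -> rel4 q i l u.2 v.2 -> rel4 q i l u v.
Proof.
case=> h1 h2 h3 [k1 k2 k3].
by split; apply: pair_ext; rewrite ?fstgE ?sndgE.
Qed.
End ProductRelations.

Section ProductQuotient.
Local Open Scope group_scope.
Variables (gT : finGroupType) (D A B : {group gT}).
Hypotheses (DA : D \subset 'N(A)) (DB : D \subset 'N(B)).

Definition coset_pair g : (coset_of A * coset_of B)%type := (coset A g, coset B g).

Lemma coset_pairM : {in D &, {morph coset_pair : g h / g * h}}.
Proof.
move=> g h gD hD; rewrite /coset_pair; congr (_, _).
  by rewrite (morphM _ (subsetP DA _ gD) (subsetP DA _ hD)).
by rewrite (morphM _ (subsetP DB _ gD) (subsetP DB _ hD)).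
Qed.
Canonical coset_pair_morphism := Morphism coset_pairM.
End ProductQuotient.

Section Factors.
Local Open Scope group_scope.

Lemma expn_eq_mod_totient r N i j : 0 < N -> coprime r N -> i = j %[mod totient N] ->
  r ^ i = r ^ j %[mod N].
Proof.
move=> N0 co h.
have key u : r ^ u = r ^ (u %% totient N) %[mod N].
  have e1 : (r ^ totient N) ^ (u %/ totient N) = 1 %[mod N].
    exact/expn_modX/Euler_exp_totient.
  by rewrite {1}(divn_eq u (totient N)) expnD (mulnC _ (totient N)) expnM -modnMml e1 modnMml mul1n.
by rewrite key h -key.
Qed.

Lemma G3rel_cyclic e k u r j (gT : finGroupType) (a b : gT) (L : {group gT}) :
  Kmn_group 3 (3 ^ e) a b L -> #[cyc_gen a b] = (3 ^ e.+1)%N ->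
  coprime r (3 ^ e.+1) -> cyc_gen a b ^ a = cyc_gen a b ^+ r -> odd j -> r ^ j = 2 %[mod 3 ^ e.+1] ->
  G3rel k e u (a ^+ j) b.
Proof.
move=> K c3 cor rE jodd rj; set c := cyc_gen a b in c3 rE.
have oA : #[a] = (2 * 3 ^ e)%N := kmn_orda K.
have xj : (a ^+ j) ^+ (2 * 3 ^ e) = 1 by apply/eqP; rewrite -expgM -order_dvdn oA dvdn_mull.
have cE : (a ^+ j) ^+ (3 ^ e) * b = c.
  rewrite /c /cyc_gen /iota_of oA mul2n doubleK; congr (_ * _).
  apply/eqP; rewrite -expgM eq_expg_mod_order oA -(odd_double_half j) jodd.
  by rewrite mulnDl mul1n addnC -muln2 -mulnA modnMDl.
have ca : c ^ (a ^+ j) = c ^+ 2.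
  have h i : c ^ (a ^+ i) = c ^+ (r ^ i).
    elim: i => [|i IH]; first by rewrite conjg1 expg1.
    by rewrite expgSr conjgM IH conjXg rE -expgM mulnC -expnSr.
  by apply/eqP; rewrite h eq_expg_mod_order c3 rj.
apply/and5P; split; [| | | |apply/andP; split]; rewrite ?xj ?cE.
- by rewrite expgM xj expg1n.
- by rewrite expgS expg1 (Kmn_bb K).
- by rewrite conj1g comm1g.
- by rewrite -order_dvdn c3.
- by rewrite !conj1g !invg1 mulg1.
- by rewrite ca conj1g !expg1n invg1 !mulg1.
Qed.

Lemma G3rel_coprime e k u (gT : finGroupType) (a b : gT) (L : {group gT}) :
  Kmn_group 3 k a b L -> 0 < k -> ~~ (3 %| k) -> u * 3 ^ e = 1 %[mod k] -> G3rel k e u a b.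
Proof.
move=> K k0 k3 uE.
have [/eqP/commgP cxy ya t3] := coprime3_relations K k0 k3.
have [c3 ca] := coprime3_cyc K k0 k3 (3 ^ e - 1)./2.
set s := (3 ^ e - 1)./2 in c3 ca *; set x := a ^+ 2 in cxy ya c3 ca *.
have sE : (3 ^ e = s.*2.+1)%N.
  have := odd_double_half (3 ^ e - 1); rewrite oddB ?expn_gt0 //= oddX orbT /= add0n => ->.
  by rewrite subn1 prednK ?expn_gt0.
set y := x ^ b in cxy ya c3 ca *.
have x1E : a ^+ (2 * 3 ^ e) = x ^+ (3 ^ e) by rewrite expgM.
have y1E : x ^+ (3 ^ e) ^ b = y ^+ (3 ^ e) by rewrite conjXg.
have ox : #[x] = k := Kmn_orderx K isT.
have oy : #[y] = k by rewrite orderJ.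
have cE : a ^+ (3 ^ e) * b = x ^+ s * (a * b).
  by rewrite sE expgSr mulgA /x -expgM mul2n.
have pw g : #[g] = k -> g ^+ (3 ^ e) ^+ u = g.
  by move=> og; rewrite -expgM mulnC -[RHS]expg1; apply/eqP; rewrite eq_expg_mod_order og uE.
apply/and5P; split; [| | | |apply/andP; split]; rewrite ?x1E ?y1E ?cE.
- by rewrite -order_dvdn (kmn_orda K) mulnAC dvdn_mulr.
- by rewrite expgS expg1 (Kmn_bb K).
- by apply/commgP/commuteX2.
- by rewrite expnS expgM c3 expg1n.
- rewrite conjXg ya expgMn; last by commute_tac.
  by rewrite !expgVn.
- by rewrite ca mulnC (expgM (y ^+ (3 ^ e))) !pw.
Qed.

Lemma rel4_coprime q i l (gT : finGroupType) (a b : gT) (L : {group gT}) :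
  Kmn_group 3 q a b L -> 0 < q -> ~~ (3 %| q) -> forall v, i * v = 0 %[mod q] -> l * v = 0 %[mod q] ->
  rel4 v i l a b.
Proof.
move=> K k0 k3 v iv lv.
have [cxy ya t3] := coprime3_relations K k0 k3.
set x := a ^+ 2 in cxy ya *; set y := x ^ b in cxy ya *.
have ox : #[x] = q := Kmn_orderx K isT.
have oy : #[y] = q by rewrite orderJ.
have w1 i' : i' * v = 0 %[mod q] -> ((x ^+ v)^-1 * y ^+ v) ^+ i' = 1.
  move=> h; move/eqP/commgP: cxy => cxy; rewrite expgMn; last by commute_tac.
  rewrite -expgVn -!expgM mulnC !(expgM _ i') -expgM -[y ^+ i' ^+ v]expgM.
  have pw g : #[g] = q -> g ^+ (i' * v) = 1.
    by move=> og; apply/eqP; rewrite -order_dvdn og /dvdn h mod0n.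
  by rewrite !pw ?orderV // mulg1.
by split; rewrite -/x -/y ?w1.
Qed.

Lemma rel4_scale q v k i l (gT : finGroupType) (a b : gT) :
  commute (a ^+ 2) (((a ^+ 2) ^ b) ^+ q) -> (((a ^+ 2) ^+ q)^-1 * ((a ^+ 2) ^ b) ^+ q) ^+ 3 = 1 ->
  ~~ (3 %| k) -> v = (q * k)%N -> rel4 q i l a b -> rel4 v (i * k) (l * k) a b.
Proof.
move=> cxy w3 k3 vE [h1 h2 h3]; set x := a ^+ 2 in cxy w3 h1 h2 h3 *; set y := x ^ b in cxy w3 h1 h2 h3 *.
have wE : (x ^+ v)^-1 * y ^+ v = ((x ^+ q)^-1 * y ^+ q) ^+ k.
  have c : commute (x ^+ q)^-1 (y ^+ q) by apply/commute_sym/commuteV/commuteX/commute_sym.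
  by rewrite (expgMn k c) expgVn -!expgM -vE.
have wi j : ((x ^+ v)^-1 * y ^+ v) ^+ (j * k) = ((x ^+ q)^-1 * y ^+ q) ^+ j.
  rewrite wE -expgM -(expg_mod (k * (j * k)) w3).
  have -> : k * (j * k) = j %[mod 3].
    have kk : k * k = 1 %[mod 3].
      by rewrite -modnMm; move: k3 (ltn_pmod k (ltn0Sn 2)); rewrite /dvdn; case: (k %% 3) => [|[|[|]]].
    by rewrite mulnCA -modnMmr kk modnMmr muln1.
  by rewrite expg_mod.
by split; rewrite -/x -/y ?wi.
Qed.
End Factors.

Section ClassifyThree.
Local Open Scope group_scope.
Variables (e k : nat) (gT : finGroupType) (a b : gT) (L : {group gT}).
Hypotheses (k3 : ~~ (3 %| k)) (K : Kmn_group 3 (3 ^ e * k) a b L) (k0 : 0 < k).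
Local Notation G := (mgrp a b).
Local Notation A := (core_part 3^' a b L).
Local Notation B := (core_part 3 a b L).

Let n0 : 0 < 3 ^ e * k. Proof. by rewrite muln_gt0 expn_gt0 k0. Qed.
Let p3 : (3 : nat_pred).-nat (3 ^ e)%N. Proof. by rewrite pnatX pnat_id. Qed.
Let pk : (3^').-nat k. Proof. by rewrite p'natE. Qed.
Let KA : Kmn_group 3 (3 ^ e) (coset A a) (coset A b) (L / A)%G.
Proof. by apply: (core_part_quotient K isT n0 (mulnC _ _) pk); rewrite pnatNK. Qed.
Let KB : Kmn_group 3 k (coset B a) (coset B b) (L / B)%G.
Proof. exact: (core_part_quotient K isT n0 erefl p3 pk). Qed.
Let GA : G \subset 'N(A). Proof. exact: core_part_norm K _. Qed.
Let GB : G \subset 'N(B). Proof. exact: core_part_norm K _. Qed.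
Let aG := mem_mgrpl a b.
Let bG := mem_mgrpr a b.
Local Notation f := (coset_pair_morphism GA GB).

Let injf : 'injm f.
Proof.
by apply/injmP=> g h gG hG [e1 e2]; apply: (core_part_glue K (pi := 3)).
Qed.

Lemma classify_rel4 i l : (e = 0 -> i = 0 /\ l = 0) ->
  rel4 (3 ^ e %/ 3) i l (coset A a) (coset A b) ->
  rel4 (3 ^ e * k %/ 3) (i * k) (l * k) a b.
Proof.
move=> il0 r; apply: (rel4_inj injf) => //; apply: rel4_pair => /=; last first.
  by apply: (rel4_coprime KB k0 k3); rewrite mulnAC modnMl mod0n.
move: KA p3 r; case: e il0 => [|e'] il0 KA' _ r.
  have [i0 l0] := il0 erefl; rewrite i0 l0 in r *.
  by case: r => h1 h2 h3; split.
have C := central_layer_prime (isT : prime 3) isT (ltn0Sn _) KA'.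
have qE : (3 ^ e'.+1 %/ 3 = 3 ^ e')%N by rewrite expnSr mulnK.
apply: rel4_scale r => //; last by rewrite qE expnSr -mulnA [(3 * k)%N]mulnC mulnA mulnK.
- apply: (centP (subsetP (cl_cent C) _ _)).
    exact: Kmn_xcore KA' isT (expn_gt0 _ _).
  by rewrite mem_gen // inE cycle_id orbT.
- by apply/eqP; rewrite -order_dvdn; have := layer_oz (isT : prime 3) isT KA' C => ->.
Qed.

Lemma classify_cyclic : cyclic_type 3 e (coset A a) (coset A b) ->
  exists2 j, coprime j (2 * 3 ^ e * k) & forall u, u * 3 ^ e = 1 %[mod k] -> G3rel k e u (a ^+ j) b.
Proof.
move=> cyc; have [r ur rE] := cyclic_multiplier (isT : prime 3) isT KA cyc.
have N1 : 1 < 3 ^ e.+1 by rewrite -(expn0 3) ltn_exp2l.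
have [j0 j0E] := unit_generator_log N1 ur (two_unit_generator e).1.
have := log_coprime N1 ur (two_unit_generator e) j0E.
rewrite totient_pfactor //= coprimeMr => /andP[j02 j03].
have co2k : coprime (3 ^ e) (2 * k).
  by rewrite coprimeXl // coprimeMr /= prime_coprime.
pose j := chinese (3 ^ e) (2 * k) j0 1.
have j3 : j = j0 %[mod 3 ^ e] by exact: chinese_modl.
have jk : j = 1 %[mod 2 * k] by exact: chinese_modr.
have cj3 : coprime j (3 ^ e) by rewrite -coprime_modl j3 coprime_modl.
have cjk : coprime j (2 * k) by rewrite -coprime_modl jk coprime_modl coprime1n.
have jodd : odd j by move: cjk; rewrite coprimeMr => /andP[]; rewrite coprimen2.
have j0odd : odd j0 by rewrite -coprimen2.
exists j; first by rewrite mulnAC mulnC coprimeMr cj3 cjk.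
move=> u uE; apply: (G3rel_inj injf); rewrite ?groupX //.
have -> : f (a ^+ j) = (coset A a ^+ j, coset B a ^+ j).
  by rewrite /= /coset_pair !coset_X // (subsetP GA, subsetP GB).
apply: G3rel_pair => /=.
  apply: (G3rel_cyclic k u KA cyc.1 ur.1 rE jodd); rewrite j0E.
  apply: expn_eq_mod_totient ur.1 _; first exact: ltnW.
  rewrite totient_pfactor //=; apply/eqP.
  rewrite chinese_remainder ?coprimeXr //; apply/andP; split; last exact/eqP.
  by rewrite !modn2 jodd j0odd.
have -> : coset B a ^+ j = coset B a.
  by rewrite -[RHS]expg1; apply/eqP; rewrite eq_expg_mod_order (kmn_orda KB) jk.
exact: G3rel_coprime KB k0 k3 uE.
Qed.

Lemma classify_three :
  (2 <= e /\ exists2 j, coprime j (2 * 3 ^ e * k) &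
     forall u, u * 3 ^ e = 1 %[mod k] -> G3rel k e u (a ^+ j) b) \/
  exists i l, [/\ e <= 1 -> i = 0, e = 0 -> l = 0 & rel4 (3 ^ e * k %/ 3) i l a b].
Proof.
have [[e2 cyc]|[i [l [i0 r]]]] := three_power KA.
  by left; split=> //; apply: classify_cyclic.
right; have l0 : e = 0 -> exists2 l', l' = 0 & rel4 (3 ^ e %/ 3) i l' (coset A a) (coset A b).
  move=> e0; exists 0 => //; case: r; rewrite e0 /= => h1 h2 h3; split=> //.
  by rewrite h3 !expg0 invg1 mulg1 !expg1n.
have [i' [l' [i1 l1 r']]] : exists i' l', [/\ e <= 1 -> i' = 0, e = 0 -> l' = 0 &
    rel4 (3 ^ e %/ 3) i' l' (coset A a) (coset A b)].
  have [e1|e1] := leqP e 1; last by exists i, l; split=> // e0; rewrite e0 in e1.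
  exists 0; have [e0|e0] := posnP e.
    have [l' l'0 [h1 h2 h3]] := l0 e0; exists l'; split=> //; split=> //.
    by rewrite (i0 e1).
  exists l; split=> //; first by move=> e0'; rewrite e0' in e0.
  by case: r => h1 h2 h3; split=> //; rewrite (i0 e1).
exists (i' * k)%N, (l' * k)%N; split.
- by move=> h; rewrite i1.
- by move=> h; rewrite l1.
by apply: classify_rel4 r' => e0; rewrite i1 ?l1 ?e0.
Qed.
End ClassifyThree.

(** * Order bounds from the presentations *)

Section Presentations.
Local Open Scope group_scope.

Lemma graph_morphism (gT hT : finGroupType) (S : {group (gT * hT)%type}) (D : {set gT}) :
  [set u.1 | u in S] = D -> #|S| <= #|D| ->
  exists f : {morphism D >-> hT}, forall u, u \in S -> f u.1 = u.2.
Proof.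
move=> E le.
have fstM : {in S &, {morph (fun u : gT * hT => u.1) : u v / u * v}} by [].
pose f1 := Morphism fstM.
have imE : f1 @* S = D by rewrite morphimEdom.
have inj1 : 'injm f1 by rewrite -card_im_injm eqn_leq leq_morphim imE.
have gM : {in f1 @* S &, {morph (fun v => (invm inj1 v).2) : u v / u * v}}.
  by move=> u v uS vS /=; rewrite (morphM (invm_morphism inj1) uS vS).
rewrite -imE; exists (Morphism gM) => u uS.
by rewrite /= -[u.1]/(f1 u) invmE.
Qed.

Lemma presents2_of_card (gT : finGroupType) (x y : gT)
    (R : forall hT : finGroupType, hT -> hT -> bool) :
  R gT x y ->
  (forall (hT kT : finGroupType) (u v : (hT * kT)%type), R _ u.1 v.1 -> R _ u.2 v.2 -> R _ u v) ->
  (forall (hT : finGroupType) (u v : hT), R _ u v -> #|mgrp u v| <= #|mgrp x y|) ->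
  presents2 x y R.
Proof.
move=> r rp bd; split=> // hT u v ruv.
pose S := mgrp (x, u) (y, v).
have fE : [set w.1 | w in S] = <<[set x; y]>>.
  have := morphim_gen (fst_morphism gT hT) (subsetT [set (x, u); (y, v)]).
  by rewrite !morphimE !(setIidPr (subsetT _)) imsetU !imset_set1.
have [f fP] := graph_morphism fE (bd _ _ _ (rp _ _ (x, u) (y, v) r ruv)).
by exists f; rewrite (fP (x, u)) ?mem_mgrpl // (fP (y, v)) ?mem_mgrpr.
Qed.

Lemma presents4_of_card (gT : finGroupType) (x y z w : gT)
    (R : forall hT : finGroupType, hT -> hT -> hT -> hT -> bool) :
  R gT x y z w ->
  (forall (hT kT : finGroupType) (u1 u2 u3 u4 : (hT * kT)%type),
    R _ u1.1 u2.1 u3.1 u4.1 -> R _ u1.2 u2.2 u3.2 u4.2 -> R _ u1 u2 u3 u4) ->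
  (forall (hT : finGroupType) (u1 u2 u3 u4 : hT), R _ u1 u2 u3 u4 ->
    #|<<[set u1; u2; u3; u4]>>| <= #|<<[set x; y; z; w]>>|) ->
  presents4 x y z w R.
Proof.
move=> r rp bd; split=> // hT x' y' z' w' ruv.
pose S := <<[set (x, x'); (y, y'); (z, z'); (w, w')]>>%G.
have fE : [set w.1 | w in S] = <<[set x; y; z; w]>>.
  have := morphim_gen (fst_morphism gT hT) (subsetT [set (x, x'); (y, y'); (z, z'); (w, w')]).
  by rewrite !morphimE !(setIidPr (subsetT _)) !imsetU !imset_set1.
have [f fP] := graph_morphism fE (bd _ _ _ _ _ (rp _ _ (x, x') (y, y') (z, z') (w, w') r ruv)).
exists f; rewrite (fP (x, x')) ?(fP (y, y')) ?(fP (z, z')) ?(fP (w, w')) //;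
  by apply: mem_gen; rewrite !inE eqxx ?orbT.
Qed.

Lemma card_cycle_le (gT : finGroupType) (g : gT) d : 0 < d -> g ^+ d = 1 -> #[g] <= d.
Proof. by move=> d0 h; apply: dvdn_leq => //; rewrite order_dvdn h. Qed.

Lemma card_join_cycle (gT : finGroupType) (H : {group gT}) (g : gT) d :
  0 < d -> g \in 'N(H) -> g ^+ d \in H -> #|H <*> <[g]>| <= #|H| * d.
Proof.
move=> d0 gN gd; have HN : H \subset 'N(H) by exact: normG.
have cN : <[g]> \subset 'N(H) by rewrite cycle_subG.
have sN : H <*> <[g]> \subset 'N(H) by rewrite join_subG HN.
rewrite -(Lagrange (joing_subl H <[g]>)) leq_mul2l -card_quotient // quotientYidl //.
rewrite quotient_cycle //; apply/orP; right; apply: card_cycle_le => //.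
by rewrite -morphX //= coset_id.
Qed.

Lemma mem_expgz (gT : finGroupType) (H : {group gT}) (g : gT) z : g \in H -> expgz g z \in H.
Proof. by case: z => i gH; rewrite /= ?groupV groupX. Qed.

Lemma conj_cycle_norm (gT : finGroupType) (H : {group gT}) (x g : gT) :
  x ^ g \in H -> <[x]> :^ g \subset H.
Proof. by rewrite -cycleJ cycle_subG. Qed.
End Presentations.

Section Counting.
Local Open Scope group_scope.

Lemma cycle_expg_coprime (gT : finGroupType) (a : gT) v : coprime v #[a] -> <[a ^+ v]> = <[a]>.
Proof. by rewrite coprime_sym -generator_coprime => /eqP <-. Qed.

Lemma card_mulg_full (gT : finGroupType) (A B : {group gT}) u v :
  #|A| <= u -> #|B| <= v -> u * v <= #|A * B| ->
  [/\ #|A| = u, #|B| = v & A :&: B = 1].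
Proof.
move=> leA leB le; have mc := mul_cardG A B.
have A0 := cardG_gt0 A; have B0 := cardG_gt0 B; have I0 := cardG_gt0 (A :&: B)%G.
have le2 : #|A| * #|B| <= u * v by apply: leq_mul.
have le3 : #|A * B| <= #|A * B| * #|A :&: B| by rewrite leq_pmulr.
have e1 : (#|A| * #|B| = u * v)%N by apply/eqP; rewrite eqn_leq le2 mc (leq_trans le le3).
have e2 : (u * v)%N = #|A * B| by apply/eqP; rewrite eqn_leq le -e1 mc le3.
have I1 : #|A :&: B| = 1%N.
  apply/eqP; rewrite -(eqn_pmul2l (m := #|A * B|)) ?muln1 -?mc ?e1 ?e2 //.
  by rewrite -e2 -e1 muln_gt0 A0.
have eA : #|A| = u.
  apply/eqP; rewrite eqn_leq leA -(leq_pmul2r B0) e1 leq_mul2l leB orbT.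
  by [].
split=> //.
  by apply/eqP; rewrite -(eqn_pmul2l A0) e1 eA.
by apply: card_le1_trivg; rewrite I1.
Qed.
End Counting.

Section Bounds.
Local Open Scope group_scope.
Variable hT : finGroupType.

Lemma G1rel_card p e r (a c : hT) : prime p -> G1rel p e r a c ->
  #|mgrp a c| <= p ^ e.+1 * (p ^ e * (p - 1)).
Proof.
move=> pr; have p1 := prime_gt1 pr; case/and3P=> /eqP ha /eqP hc /eqP ca.
have p0 i : 0 < p ^ i by rewrite expn_gt0 ltnW.
have N : a \in 'N(<[c]>) by rewrite inE conj_cycle_norm // ca mem_cycle.
apply: (@leq_trans #|<[c]> <*> <[a]>|).
  apply: subset_leq_card; rewrite mgrp_sub.
  by rewrite (subsetP (joing_subr _ _)) ?(subsetP (joing_subl _ _)) ?cycle_id.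
have d0 : 0 < p ^ e * (p - 1) by rewrite muln_gt0 p0 subn_gt0.
apply: leq_trans (card_join_cycle d0 N _) _; first by rewrite ha group1.
by rewrite leq_mul2r; apply/orP; right; apply: card_cycle_le.
Qed.

Lemma G2rel_card p t (w z c g : hT) : prime p -> G2rel p t w z c g ->
  #|<<[set w; z; c; g]>>| <= p * p * p * (p - 1).
Proof.
move=> pr; have p1 := prime_gt1 pr; have p0 := ltnW p1.
case/and5P=> /eqP hw /eqP hz /eqP hc /eqP hg /and5P[wz /eqP cg /eqP wc /eqP zc /andP[/eqP wg /eqP zg]].
pose H1 := (<[z]> <*> <[w]>)%G; pose H2 := (H1 <*> <[c]>)%G; pose H3 := (H2 <*> <[g]>)%G.
have zH1 : z \in H1 by rewrite (subsetP (joing_subl _ _)) ?cycle_id.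
have wH1 : w \in H1 by rewrite (subsetP (joing_subr _ _)) ?cycle_id.
have sH2 : H1 \subset H2 by exact: joing_subl.
have cH2 : c \in H2 by rewrite (subsetP (joing_subr _ _)) ?cycle_id.
have sH3 : H2 \subset H3 by exact: joing_subl.
have gH3 : g \in H3 by rewrite (subsetP (joing_subr _ _)) ?cycle_id.
have N1 : w \in 'N(<[z]>).
  by rewrite inE conj_cycle_norm //; move/commgP: wz => /commute_sym/commgP/conjg_fixP ->; rewrite cycle_id.
have N2 : c \in 'N(H1).
  by rewrite inE conjYg join_subG !conj_cycle_norm ?zc ?wc // groupM.
have N3 : g \in 'N(H2).
  rewrite inE conjYg join_subG conjYg join_subG !conj_cycle_norm //.
  - by rewrite cg groupX.
  - by rewrite wg (subsetP sH2).
  - by rewrite zg groupX // (subsetP sH2).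
apply: (@leq_trans #|H3|).
  apply: subset_leq_card; rewrite gen_subG; apply/subsetP=> u; rewrite !inE -!orbA.
  by case/or4P=> /eqP -> //; rewrite (subsetP sH3) // (subsetP sH2).
have q0 : 0 < p - 1 by rewrite subn_gt0.
apply: leq_trans (card_join_cycle q0 N3 _) _; first by rewrite hg group1.
rewrite leq_mul2r; apply/orP; right.
apply: leq_trans (card_join_cycle p0 N2 _) _; first by rewrite hc group1.
rewrite leq_mul2r; apply/orP; right.
apply: leq_trans (card_join_cycle p0 N1 _) _; first by rewrite hw group1.
by rewrite leq_mul2r; apply/orP; right; apply: card_cycle_le.
Qed.

Lemma G3rel_card k e u (a b : hT) : 0 < k -> G3rel k e u a b ->
  #|mgrp a b| <= k * k * 3 ^ e.+1 * (2 * 3 ^ e).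
Proof.
move=> k0; case/and5P=> /eqP ha /eqP hb cxy /eqP c3 /andP[/eqP ya /eqP ca].
set c := a ^+ (3 ^ e) * b in c3 ca; set x := a ^+ (2 * 3 ^ e) in cxy ya ca; set y := x ^ b in cxy ya ca.
move/commgP: cxy => cxy.
have p0 i : 0 < 3 ^ i by rewrite expn_gt0.
have xk : x ^+ k = 1 by rewrite -expgM.
have yk : y ^+ k = 1 by rewrite -conjXg xk conj1g.
have xa : x ^ a = x by apply/conjg_fixP/commgP/commute_sym/commuteX.
have bb : b * b = 1 by [].
have yb : y ^ b = x by rewrite -conjgM bb conjg1.
pose H1 := (<[x]> <*> <[y]>)%G; pose H2 := (H1 <*> <[c]>)%G; pose H3 := (H2 <*> <[a]>)%G.
have xH1 : x \in H1 by rewrite (subsetP (joing_subl _ _)) ?cycle_id.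
have yH1 : y \in H1 by rewrite (subsetP (joing_subr _ _)) ?cycle_id.
have sH2 : H1 \subset H2 by exact: joing_subl.
have cH2 : c \in H2 by rewrite (subsetP (joing_subr _ _)) ?cycle_id.
have sH3 : H2 \subset H3 by exact: joing_subl.
have aH3 : a \in H3 by rewrite (subsetP (joing_subr _ _)) ?cycle_id.
have N1 : y \in 'N(<[x]>).
  by rewrite inE conj_cycle_norm //; move/commgP/conjg_fixP: cxy => ->; rewrite cycle_id.
have Na : a \in 'N(H1).
  by rewrite inE conjYg join_subG !conj_cycle_norm ?xa ?ya // groupM ?groupV.
have Nb : b \in 'N(H1).
  by rewrite inE conjYg join_subG !conj_cycle_norm // ?yb.
have N2 : c \in 'N(H1) by rewrite groupM // groupX.
have N3 : a \in 'N(H2).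
  rewrite inE conjYg join_subG (normsP _ _ Na) // sH2 conj_cycle_norm // ca.
  have xH2 := subsetP sH2 _ xH1; have yH2 := subsetP sH2 _ yH1.
  exact: (groupM (groupM (groupX _ cH2) (groupX _ xH2)) (groupVr (groupX _ yH2))).
apply: (@leq_trans #|H3|).
  apply: subset_leq_card; rewrite mgrp_sub aH3 /=.
  have -> : b = (a ^+ (3 ^ e))^-1 * c by rewrite mulKg.
  by rewrite groupM ?groupV ?groupX // (subsetP sH3).
have q0 : 0 < 2 * 3 ^ e by rewrite muln_gt0 p0.
apply: leq_trans (card_join_cycle q0 N3 _) _; first exact: (subsetP sH2).
rewrite leq_mul2r; apply/orP; right.
apply: leq_trans (card_join_cycle (p0 e.+1) N2 _) _; first by rewrite c3 group1.
rewrite leq_mul2r; apply/orP; right.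
apply: leq_trans (card_join_cycle k0 N1 _) _; first by rewrite yk group1.
by rewrite leq_mul2r; apply/orP; right; apply: card_cycle_le.
Qed.
End Bounds.

Section EisensteinCommute.
Local Open Scope group_scope.
Variables (gT : finGroupType) (a b : gT) (q : nat).
Local Notation x := (a ^+ 2).
Local Notation y := (x ^ b).
Hypotheses (bb : b * b = 1) (ya : y ^ a = x^-1 * y^-1).
Hypotheses (zE : [~ x, y] = x ^+ q * y ^- q) (q3 : 3 %| q) (x3q : x ^+ (3 * q) = 1).

(* With t = ab and s = (xy)^-1, conjugation by t permutes x, y, s cyclically; multiplying the
   three conjugates of [zE] gives x^2 y^2 = (yx)^2, whence y^-1 x commutes with xyx. *)
Lemma rel4_power_central : commute (x ^+ q) y.
Proof.
have yb : y ^ b = x by rewrite -conjgM bb conjg1.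
have xa : x ^ a = x by rewrite conjgE -mulgA mulKg.
have xt : x ^ (a * b) = y by rewrite conjgM xa.
have yt : y ^ (a * b) = y^-1 * x^-1 by rewrite conjgM ya conjMg !conjVg yb.
move: ya zE x3q xa xt yt yb; set xb := y; have xbE : x ^ b = xb by [].
move: xb xbE (a * b) => y0 xbE t.
move: (x) xbE => x0 xbE ya0 zE0 x3q0 xa xt yt yb.
have st : (y0^-1 * x0^-1) ^ t = x0.
  by rewrite conjMg !conjVg yt xt invMg !invgK mulgK.
have R1 : [~ y0, y0^-1 * x0^-1] = y0 ^+ q * (y0^-1 * x0^-1) ^- q.
  by have := congr1 (conjg^~ t) zE0; rewrite conjRg conjMg conjVg !conjXg xt yt.
have R2 : [~ y0^-1 * x0^-1, x0] = (y0^-1 * x0^-1) ^+ q * x0 ^- q.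
  by have := congr1 (conjg^~ t) R1; rewrite conjRg [in RHS]conjMg conjVg !conjXg yt st.
have P1 : [~ x0, y0] * [~ y0, y0^-1 * x0^-1] * [~ y0^-1 * x0^-1, x0] = 1.
  rewrite zE0 R1 R2; move: (x0 ^+ q) (y0 ^+ q) (_ ^+ q) => u v w.
  by group_simp.
have P2 : x0 * x0 * (y0 * y0) = y0 * x0 * (y0 * x0).
  move: P1; rewrite !commgEl !conjgE; group_simp => P1.
  apply: (mulgI (x0^-1 * y0^-1)); apply: (mulIg (x0^-1 * y0^-1)).
  by group_simp; rewrite P1.
have D1 : commute (y0^-1 * x0) (x0 * y0 * x0).
  rewrite /commute; apply: (mulgI y0); apply: (mulIg (x0^-1 * y0)).
  by move: P2; group_simp => ->; group_simp.
have D2 : commute (y0 * (x0 * x0)) (y0^-1 * x0).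
  have := congr1 (conjg^~ a) D1; rewrite !conjMg conjVg ya0 xa; group_simp => e.
  by rewrite /commute; group_simp.
have sE : (y0^-1 * x0^-1)^-1 = x0 * y0 by rewrite invMg !invgK.
have D3 : commute (x0 * (y0 * y0)) (y0^-1 * x0^-1 * (y0 * y0)).
  have := congr1 (conjg^~ t) D2; rewrite !conjMg conjVg yt xt sE => e.
  by rewrite /commute; move: e; group_simp.
have D4 : commute (x0 * (y0 * y0)) (x0^-1 * y0).
  have := congr1 (conjg^~ t) D1; rewrite !conjMg conjVg yt xt sE => e.
  by rewrite /commute; move: e; group_simp.
have D5 : commute (x0 * (y0 * y0)) (y0^-1 * x0^-1 * x0^-1).
  have -> : y0^-1 * x0^-1 * x0^-1 = (y0^-1 * x0^-1 * (y0 * y0)) * (x0 * (y0 * y0))^-1.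
    by group_simp.
  by apply: commuteM => //; apply: commuteV.
have D6 : commute (x0 * (y0 * y0)) (x0 ^+ 3).
  have -> : x0 ^+ 3 = (y0^-1 * x0^-1 * x0^-1)^-1 * (x0^-1 * y0)^-1.
    by rewrite !expgS expg0; group_simp.
  by apply: commuteM; apply: commuteV.
have D7 : commute (x0 ^+ 3) (y0 ^+ 2).
  have -> : y0 ^+ 2 = x0^-1 * (x0 * (y0 * y0)) by rewrite mulKg.
  by apply: commuteM; [commute_tac | apply: commute_sym].
have D8 : commute (y0 ^+ 3) (x0 ^+ 2).
  have := congr1 (conjg^~ b) D7.
  by rewrite (conjMg (x0 ^+ 3) (y0 ^+ 2)) (conjMg (y0 ^+ 2) (x0 ^+ 3)) !conjXg xbE yb.
have [q' qE] := dvdnP q3.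
have E2 : commute (x0 ^+ q) (y0 ^+ 2).
  by rewrite qE mulnC expgM; apply/commute_sym/commuteX/commute_sym.
have E3 : commute (x0 ^+ q) (y0 ^+ 3).
  have e1 : x0 ^+ q * (x0 ^+ 2) ^+ q = 1 by rewrite -expgM -expgD -{1}[q]mul1n -mulnDl.
  have -> : x0 ^+ q = ((x0 ^+ 2) ^+ q)^-1 by apply: (mulIg ((x0 ^+ 2) ^+ q)); rewrite e1 mulVg.
  by apply/commute_sym/commuteV/commuteX.
have e3 : (y0 ^+ 2)^-1 * y0 ^+ 3 = y0 by rewrite (expgSr y0 2) mulKg.
by rewrite -[X in commute _ X]e3; apply: commuteM => //; apply: commuteV.
Qed.
End EisensteinCommute.

Section G4Bound.
Local Open Scope group_scope.
Variables (n i : nat) (l : int) (hT : finGroupType) (a b : hT).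
Hypotheses (n0 : 0 < n) (i01 : i = 0 \/ i = 1%N /\ 9 %| n) (r : G4rel n i l a b).
Local Notation x := (a ^+ 2).
Local Notation y := (x ^ b).
Local Notation q := (n %/ 3).

Let bb : b * b = 1. Proof. by case/and5P: r => _ /eqP. Qed.
Let xn : x ^+ n = 1. Proof. by case/and5P: r => /eqP <- _ _ _ _; rewrite expgM. Qed.
Let yn : y ^+ n = 1. Proof. by rewrite -conjXg xn conj1g. Qed.
Let ya : y ^ a = x^-1 * y^-1. Proof. by case/and5P: r => _ _ _ /eqP. Qed.
Let yb : y ^ b = x. Proof. by rewrite -conjgM bb conjg1. Qed.
Let xa : x ^ a = x. Proof. by rewrite conjgE -mulgA mulKg. Qed.

Lemma G4rel_pair_central : i = 1%N -> commute (x ^+ q) y /\ commute (y ^+ q) x.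
Proof.
case: i01 => [-> //|[iE d9] _]; case/and5P: r => _ _ /eqP zE _ _.
have n3 : n = (3 * q)%N by rewrite mulnC divnK //; apply: dvdn_trans d9.
have q3 : 3 %| q by rewrite dvdn_divRL //; apply: dvdn_trans d9.
have h : commute (x ^+ q) y.
  apply: (rel4_power_central bb ya _ q3); last by rewrite -n3.
  by rewrite zE iE mul1n.
split=> //; have := congr1 (conjg^~ b) h.
by rewrite (conjMg (x ^+ q) y) (conjMg y (x ^+ q)) (conjXg x) yb.
Qed.

Lemma G4rel_coreE : <[x]> <*> <[y]> = <[x]> * <[y]>.
Proof.
case: i01 => [i0|[i1 d9]].
  apply: cent_joinEr; rewrite cycle_subG /= cent_cycle; apply/cent1P/commute_sym.
  by case/and5P: r => _ _ /eqP zE _ _; apply/commgP; rewrite zE i0 mul0n !expg0 invg1 mulg1.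
have [cX cY] := G4rel_pair_central i1.
pose H1 := (<[x]> <*> <[y ^+ q]>)%G.
have xH1 : x \in H1 by rewrite (subsetP (joing_subl _ _)) ?cycle_id.
have YH1 : y ^+ q \in H1 by rewrite (subsetP (joing_subr _ _)) ?cycle_id.
have H1E : H1 = <[x]> * <[y ^+ q]> :> {set hT}.
  by apply: cent_joinEr; rewrite cycle_subG /= cent_cycle; apply/cent1P/commute_sym.
have Ny : <[y]> \subset 'N(H1).
  rewrite cycle_subG inE conjYg join_subG !conj_cycle_norm //.
    by have /conjg_fixP -> : [~ y ^+ q, y] == 1 by apply/commgP/commute_sym/commuteX.
  have -> : x ^ y = x * [~ x, y] by rewrite mulKVg.
  case/and5P: r => _ _ /eqP -> _ _; rewrite i1 mul1n.
  exact: (groupM xH1 (groupM (groupX _ xH1) (groupVr YH1))).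
have -> : <[x]> <*> <[y]> = H1 <*> <[y]>.
  apply/eqP; rewrite eqEsubset !join_subG joing_subr !andbT; apply/and3P; split.
  - by rewrite cycle_subG (subsetP (joing_subl _ _)).
  - by rewrite joing_subl /=; apply: subset_trans (joing_subr _ _); rewrite cycle_subG mem_cycle.
  - exact: joing_subr.
rewrite norm_joinEr // H1E -mulgA; congr (_ * _).
by apply: mulSGid; rewrite cycle_subG mem_cycle.
Qed.

Lemma G4rel_core_card : #|<[x]> <*> <[y]>| <= n * n.
Proof.
rewrite G4rel_coreE; apply: (@leq_trans (#[x] * #[y])).
  by rewrite mul_cardG leq_pmulr // cardG_gt0.
by rewrite leq_mul // card_cycle_le.
Qed.

Lemma G4rel_norm : mgrp a b \subset 'N(<[x]> <*> <[y]>).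
Proof.
have xK : x \in <[x]> <*> <[y]> by rewrite (subsetP (joing_subl _ _)) ?cycle_id.
have yK : y \in <[x]> <*> <[y]> by rewrite (subsetP (joing_subr _ _)) ?cycle_id.
rewrite mgrp_sub; apply/andP; split; rewrite inE conjYg join_subG.
  by rewrite !conj_cycle_norm ?xa ?ya // groupM ?groupV.
by rewrite !conj_cycle_norm // ?yb.
Qed.

Lemma G4rel_tau : (a * b) ^+ 3 \in <[x]> <*> <[y]>.
Proof.
case/and5P: r => _ _ _ _ /eqP ->.
by rewrite groupM // mem_expgz ?(subsetP (joing_subl _ _) _ (cycle_id _)) ?(subsetP (joing_subr _ _) _ (cycle_id _)).
Qed.

Lemma G4rel_rotation_card :
  #|<[x]> <*> <[y]> <*> <[a * b]>| <= #|<[x]> <*> <[y]>| * 3.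
Proof.
apply: card_join_cycle => //; last exact: G4rel_tau.
by rewrite (subsetP G4rel_norm) // groupM ?mem_mgrpl ?mem_mgrpr.
Qed.

Lemma G4rel_top_card : #|mgrp a b| <= #|<[x]> <*> <[y]> <*> <[a * b]>| * 2.
Proof.
pose K := (<[x]> <*> <[y]>)%G; pose t := a * b; pose H := (K <*> <[t]>)%G.
have xK : x \in K by rewrite (subsetP (joing_subl _ _)) ?cycle_id.
have sK : K \subset H by exact: joing_subl.
have tH : t \in H by rewrite (subsetP (joing_subr _ _)) ?cycle_id.
have Na : a \in 'N(K) by rewrite (subsetP G4rel_norm) ?mem_mgrpl.
have NaH : a \in 'N(H).
  rewrite inE conjYg join_subG (normsP _ _ Na) // sK conj_cycle_norm //.
  have -> : t ^ a = t^-1 * x.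
    have bV : b^-1 = b by apply/eqP; rewrite eq_invg_mul bb.
    have -> : x = a * a by [].
    by rewrite conjgE invMg bV !mulgA mulVg mul1g -(mulgA b) mulVg mulg1.
  by rewrite groupM ?groupV // (subsetP sK).
apply: (@leq_trans #|H <*> <[a]>|); last exact: card_join_cycle (subsetP sK _ xK).
apply: subset_leq_card; rewrite mgrp_sub.
have aH : a \in H <*> <[a]> by rewrite (subsetP (joing_subr _ _)) ?cycle_id.
rewrite aH /=; suff : a^-1 * t \in H <*> <[a]> by rewrite [a^-1 * t]mulKg.
by rewrite groupM ?groupV // (subsetP (joing_subl _ _)).
Qed.

Lemma G4rel_card : #|mgrp a b| <= 6 * (n * n).
Proof.
apply: leq_trans G4rel_top_card _; have -> : (6 * (n * n) = n * n * 3 * 2)%N by rewrite -mulnA mulnC.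
by rewrite leq_mul2r (leq_trans G4rel_rotation_card) // leq_mul2r G4rel_core_card.
Qed.

Hypothesis cG : #|mgrp a b| = (6 * (n * n))%N.
Local Notation K := (<[x]> <*> <[y]>)%G.
Local Notation t := (a * b).

Let cK : #|K| = (n * n)%N /\ #|K <*> <[t]>| = (n * n * 3)%N.
Proof.
have h1 := G4rel_core_card; have h2 := G4rel_rotation_card; have h3 := G4rel_top_card.
rewrite cG in h3; have h4 : n * n * 3 <= #|K <*> <[t]>|.
  by rewrite -(leq_pmul2r (ltn0Sn 1)) -[in X in X <= _](mulnA _ 3) mulnC.
have h5 : n * n <= #|K| by rewrite -(leq_pmul2r (ltn0Sn 2)) (leq_trans h4).
have e : #|K| = (n * n)%N by apply/eqP; rewrite eqn_leq h1.
by split=> //; apply/eqP; rewrite eqn_leq h4 andbT (leq_trans h2) // e.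
Qed.

Lemma G4_orders : [/\ #[x] = n, #[y] = n & <[x]> :&: <[y]> = 1].
Proof.
apply: card_mulg_full; try exact: card_cycle_le.
by rewrite -G4rel_coreE -[#|_|]/#|K| cK.1.
Qed.

Let nn0 : 0 < n * n. Proof. by rewrite muln_gt0 n0. Qed.
Let xK : x \in K. Proof. by rewrite (subsetP (joing_subl _ _)) ?cycle_id. Qed.
Let KN g : g \in mgrp a b -> g \in 'N(K). Proof. exact: (subsetP G4rel_norm). Qed.
Let aG := mem_mgrpl a b.
Let bG := mem_mgrpr a b.

Let tK : t \notin K.
Proof.
apply/negP => tK; have [h1 h2] := cK.
have : #|K <*> <[t]>| <= #|K|.
  by apply: subset_leq_card; rewrite join_subG subxx cycle_subG.
by rewrite h1 h2 -{2}[(n * n)%N]muln1 leq_pmul2l.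
Qed.

Let t2K : t ^+ 2 \notin K.
Proof.
apply: contra tK => t2; have -> : t = (t ^+ 2)^-1 * t ^+ 3 by rewrite (expgSr t 2) mulKg.
by rewrite groupM ?groupV // G4rel_tau.
Qed.

Let aK : a \notin K.
Proof.
have bV : b^-1 = b by apply/eqP; rewrite eq_invg_mul bb.
apply: contra t2K => aK; have -> : t ^+ 2 = a * a ^ b * (b * b).
  by rewrite conjgE bV expgS expg1 bb mulg1 !mulgA.
by rewrite bb mulg1 groupM // memJ_norm // KN.
Qed.

Lemma G4_order_a : #[a] = (2 * n)%N.
Proof.
have [ox _ _] := G4_orders; have := orderXgcd a 2; rewrite ox.
have [ev|od] := boolP (2 %| #[a]).
  by rewrite (gcdn_idPr ev) => ->; rewrite mulnC divnK.
have co : coprime 2 #[a] by rewrite prime_coprime.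
have : a \in <[x]> by rewrite cycle_expg_coprime ?cycle_id.
by move=> ax; case/negP: aK; apply: (subsetP (joing_subl _ _)).
Qed.

Lemma G4_Kmn : exists L, Kmn_group 3 n a b L.
Proof.
have [ox oy TI] := G4_orders; have [cKK _] := cK.
pose L := (K <*> <[a]>)%G; have aL : a \in L by rewrite (subsetP (joing_subr _ _)) ?cycle_id.
have KL : K \subset L by exact: joing_subl.
have leL : #|L| <= n * n * 2 by rewrite -cKK; apply: card_join_cycle; rewrite ?KN.
have cL : #|L| = (n * n * 2)%N.
  apply/eqP; rewrite eqn_leq leL -(Lagrange KL) cKK leq_mul2l indexg_gt1.
  by rewrite (contra _ aK) ?orbT // => /subsetP ->.
have bL : b \notin L.
  apply/negP => bL; have : #|mgrp a b| <= #|L| by apply: subset_leq_card; rewrite mgrp_sub aL.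
  by rewrite cG cL mulnC leq_pmul2l.
exists L; split.
- by apply: nt_prime_order => //; apply: contraNneq bL => ->; rewrite group1.
- exact: G4_order_a.
- by rewrite cycle_subG.
- by rewrite join_subG join_subG !cycle_subG groupJ ?groupX.
- by rewrite cL mulnC mulnA.
- by rewrite cG !mulnA.
- exact: bL.
have ao (o : bool) : a ^+ o = if o then a else 1 by case: o.
have par i' : a ^+ i' \in K -> a ^+ i' = x ^+ (i'./2).
  rewrite -{1 2}(odd_double_half i') expgD -mul2n (expgM a) ao; case: (odd i'); rewrite ?mul1g //.
  by rewrite (groupMr a (groupX _ xK)) (negPf aK).
have par' i' : a ^+ i' \notin K -> a ^+ i' = a * x ^+ (i'./2).
  rewrite -{1 2}(odd_double_half i') expgD -mul2n (expgM a) ao; case: (odd i') => //.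
  by rewrite mul1g groupX.
apply/trivgP/subsetP=> u /setIP[/cycleP[i' uE]]; rewrite /= -cycleJ => /cycleP[s].
rewrite -conjXg uE => E; have JK : (a ^+ s \in K) = (a ^+ i' \in K) by rewrite E memJ_norm ?KN.
have [iK|iK] := boolP (a ^+ i' \in K).
  have : a ^+ i' \in <[x]> :&: <[y]>.
    have h1 : a ^+ i' \in <[x]> by rewrite (par _ iK); exact: mem_cycle.
    have h2 : a ^+ i' \in <[y]> by rewrite E (par s) ?JK // (conjXg x); exact: mem_cycle.
    by rewrite inE h1 h2.
  by rewrite TI.
move: E; rewrite (par' _ iK) (par' s) ?JK // conjMg => E.
have : a^-1 * a ^ b \in K.
  have -> : a^-1 * a ^ b = x ^+ i'./2 * ((x ^+ s./2) ^ b)^-1.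
    by apply: (mulgI a); rewrite mulKVg mulgA E mulgK.
  have xb : (x ^+ s./2) ^ b \in K by rewrite (memJ_norm _ (KN bG)); exact: groupX.
  exact: groupM (groupX _ xK) (groupVr xb).
case/negP; have -> : a^-1 * a ^ b = x^-1 * t ^+ 2.
  have bV : b^-1 = b by apply/eqP; rewrite eq_invg_mul bb.
  have -> : x = a * a by [].
  by rewrite conjgE bV expgS expg1 invMg !mulgA mulgKV.
by rewrite (groupMl _ (groupVr xK)); apply/negP.
Qed.
End G4Bound.

Section Transfer.
Local Open Scope group_scope.

Lemma mgrp_cycle_eq (gT : finGroupType) (a a' b : gT) : <[a]> = <[a']> -> mgrp a b = mgrp a' b.
Proof.
move=> E; apply/eqP; rewrite -val_eqE eqEsubset !mgrp_sub !mem_mgrpr !andbT -!cycle_subG E -{2}E.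
by rewrite !cycle_subG !mem_mgrpl.
Qed.

Lemma Kmn_cycle_eq m n (gT : finGroupType) (a a' b : gT) (L : {group gT}) :
  <[a]> = <[a']> -> Kmn_group m n a b L -> Kmn_group m n a' b L.
Proof.
move=> E [h1 h2 h3 h4 h5 h6 h7 h8]; have E2 := mgrp_cycle_eq b E.
by split; rewrite -?E2 -?E // orderE -E.
Qed.

Lemma map_isoP (gT hT : finGroupType) (a b : gT) (a' b' : hT) : map_iso a b a' b' <->
  exists f : {morphism mgrp a b >-> hT}, [/\ 'injm f, f a = a' & f b = b'].
Proof.
split=> [[f /isomP[inj _] [fa fb]]|[f [inj fa fb]]]; exists f => //.
apply/isomP; split=> //.
rewrite morphim_gen ?subset_gen // /mgrp /= morphimU !morphim_set1 ?mem_mgrpl ?mem_mgrpr //.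
by rewrite fa fb.
Qed.

Lemma map_iso_refl (gT : finGroupType) (a b : gT) : map_iso a b a b.
Proof. by apply/map_isoP; exists (idm_morphism _); split; rewrite ?injm_idm. Qed.

Lemma map_iso_sym (gT hT : finGroupType) (a b : gT) (a' b' : hT) :
  map_iso a b a' b' -> map_iso a' b' a b.
Proof.
case=> f /isomP[inj E] [fa fb]; apply/map_isoP.
have EG : (f @* mgrp a b)%G = mgrp a' b' by apply: val_inj.
rewrite -EG; exists (invm_morphism inj); split.
- exact: injm_invm.
- by rewrite -fa /= invmE ?mem_mgrpl.
- by rewrite -fb /= invmE ?mem_mgrpr.
Qed.

Lemma map_iso_order (gT hT : finGroupType) (a b : gT) (a' b' : hT) :
  map_iso a b a' b' -> #[a] = #[a'] /\ #[a * b] = #[a' * b'].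
Proof.
case/map_isoP=> f [inj <- <-]; have aG := mem_mgrpl a b; have bG := mem_mgrpr a b.
by rewrite -morphM // !order_injm // groupM.
Qed.

Lemma map_iso_Kmn m n (gT hT : finGroupType) (a b : gT) (a' b' : hT) (L : {group gT}) :
  map_iso a b a' b' -> Kmn_group m n a b L -> exists L', Kmn_group m n a' b' L'.
Proof.
case=> f /isomP[inj E] [fa fb] k; exists (f @* L)%G.
have EG : (f @* mgrp a b)%G = mgrp a' b' by apply: val_inj.
have aG := mem_mgrpl a b; have bG := mem_mgrpr a b.
have cG : <[a]> \subset mgrp a b by rewrite cycle_subG.
case: k => h1 h2 h3 h4 h5 h6 h7 h8; rewrite -fa -fb in EG *; split.
- by rewrite order_injm.
- by rewrite order_injm.
- by rewrite -morphim_cycle // morphimS.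
- by rewrite -EG morphimS.
- by rewrite card_injm.
- by rewrite -EG card_injm.
- by apply: contra h7 => /morphimP[u uG uL /(injmP inj _ _ bG uG) ->].
by rewrite -morphim_cycle // -morphimJ // -injmI ?(subset_trans _ cG) // ?h8 ?morphim1 // -cycleJ cycle_subG groupJ.
Qed.

Lemma map_iso_cyc_gen (gT hT : finGroupType) (a b : gT) (a' b' : hT)
    (f : {morphism mgrp a b >-> hT}) : 'injm f -> f a = a' -> f b = b' ->
  f (cyc_gen a b) = cyc_gen a' b'.
Proof.
move=> inj <- <-; have aG := mem_mgrpl a b; have bG := mem_mgrpr a b.
by rewrite /cyc_gen /iota_of morphM ?groupX // morphX // order_injm.
Qed.

Lemma presents2_iso (gT hT : finGroupType) (x y : gT) (x' y' : hT)
    (R : forall hT : finGroupType, hT -> hT -> bool) :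
  presents2 x y R -> presents2 x' y' R ->
  exists f : {morphism mgrp x y >-> hT}, [/\ 'injm f, f x = x' & f y = y'].
Proof.
have im (gT' hT' : finGroupType) (u v : gT') (f : {morphism <<[set u; v]>> >-> hT'}) :
    f @* <<[set u; v]>> = <<[set f u; f v]>>.
  have uG := mem_mgrpl u v; have vG := mem_mgrpr u v.
  by rewrite morphim_gen ?subset_gen // morphimU !morphim_set1.
move=> [r1 p1] [r2 p2]; have [f [fx fy]] := p1 _ _ _ r2; have [g [gx gy]] := p2 _ _ _ r1.
exists f; split=> //; rewrite -card_im_injm eqn_leq leq_morphim /=.
rewrite im fx fy; have := leq_morphim g <<[set x'; y']>>.
by rewrite im gx gy.
Qed.

Lemma presents4_iso (gT hT : finGroupType) (x y z w : gT) (x' y' z' w' : hT)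
    (R : forall hT : finGroupType, hT -> hT -> hT -> hT -> bool) :
  presents4 x y z w R -> presents4 x' y' z' w' R ->
  exists f : {morphism <<[set x; y; z; w]>> >-> hT},
    'injm f /\ [/\ f x = x', f y = y', f z = z' & f w = w'].
Proof.
have im (gT' hT' : finGroupType) (u1 u2 u3 u4 : gT') (f : {morphism <<[set u1; u2; u3; u4]>> >-> hT'}) :
    f @* <<[set u1; u2; u3; u4]>> = <<[set f u1; f u2; f u3; f u4]>>.
  rewrite morphim_gen ?subset_gen // !morphimU !morphim_set1 //;
    by apply: mem_gen; rewrite !inE eqxx ?orbT.
move=> [r1 p1] [r2 p2]; have [f [fx fy fz fw]] := p1 _ _ _ _ _ r2.
have [g [gx gy gz gw]] := p2 _ _ _ _ _ r1.
exists f; split=> //; rewrite -card_im_injm eqn_leq leq_morphim /=.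
rewrite im fx fy fz fw; have := leq_morphim g <<[set x'; y'; z'; w']>>.
by rewrite im gx gy gz gw.
Qed.

Lemma map_iso_intro (gT hT : finGroupType) (D : {group gT}) (a b : gT) (a' b' : hT)
    (f : {morphism D >-> hT}) :
  D = mgrp a b -> 'injm f -> f a = a' -> f b = b' -> map_iso a b a' b'.
Proof. by move=> E; move: f; rewrite E => f inj fa fb; apply/map_isoP; exists f. Qed.
End Transfer.

Section MinusOne.

Lemma unit_sqrt1 p e s : prime p -> odd p -> s ^ 2 = 1 %[mod p ^ e.+1] -> s <> 1 %[mod p ^ e.+1] ->
  p ^ e.+1 %| s.+1.
Proof.
move=> pr p2 h n1; have p1 := prime_gt1 pr.
have N1 : 1 < p ^ e.+1 by rewrite -(expn0 p) ltn_exp2l.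
have s0 : 0 < s.
  by case: s h n1 => // h; rewrite exp0n // mod0n modn_small in h.
have : p ^ e.+1 %| (s - 1) * s.+1.
  have -> : (s - 1) * s.+1 = s ^ 2 - 1 by have := subn_sqr s 1; rewrite exp1n addn1 => <-.
  by rewrite -eqn_mod_dvd ?expn_gt0 ?s0 // h.
have [d|d] := boolP (p %| s - 1); last by rewrite Gauss_dvdr // coprimeXl // prime_coprime.
rewrite Gauss_dvdl; last first.
  rewrite coprimeXl // prime_coprime //; apply/negP => d2.
  have : p %| s.+1 - (s - 1) by apply: dvdn_sub.
  have -> : s.+1 - (s - 1) = 2 by clear -s0; lia.
  by rewrite dvdn_prime2 // => /eqP pE; rewrite pE in p2.
by rewrite -eqn_mod_dvd // => /eqP.
Qed.

Lemma unit_generator_half r p e : prime p -> odd p -> unit_generator r (p ^ e.+1) ->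
  p ^ e.+1 %| (r ^ (p ^ e * (p - 1))./2).+1.
Proof.
move=> pr p2 ug; set h := _./2; have p1 := prime_gt1 pr.
have N1 : 1 < p ^ e.+1 by rewrite -(expn0 p) ltn_exp2l.
have tE : totient (p ^ e.+1) = (p ^ e * (p - 1))%N by rewrite totient_pfactor //= mulnC subn1.
have hE : p ^ e * (p - 1) = h * 2.
  by rewrite muln2 /h halfK oddM oddX oddB ?(ltnW p1) // p2 !orbT andbF subn0.
have t0 : 0 < p ^ e * (p - 1) by rewrite -tE totient_gt0 ltnW.
apply: (unit_sqrt1 pr p2).
  by rewrite -expnM -hE -tE Euler_exp_totient //; case: ug.
case: ug => _ ug /ug; rewrite tE hE; have : 0 < h by lia.
by move=> h0 /(_ h0); lia.
Qed.
End MinusOne.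

Section G1Group.
Local Open Scope group_scope.
Variables (p e r : nat) (gT : finGroupType) (x c : gT).
Hypotheses (pr : prime p) (p2 : odd p) (ug : unit_generator r (p ^ e.+1)).
Hypotheses (rel : G1rel p e r x c) (cG : #|mgrp x c| = (p ^ e.+1 * (p ^ e * (p - 1)))%N).
Local Notation n := (p ^ e * (p - 1))%N.
Local Notation b := (x ^+ n./2 * c).

Let p1 : 1 < p. Proof. exact: prime_gt1. Qed.
Let p0 i : 0 < p ^ i. Proof. by rewrite expn_gt0 ltnW. Qed.
Let nn0 : 0 < n. Proof. by rewrite muln_gt0 p0 subn_gt0. Qed.
Let cx : c ^ x = c ^+ r. Proof. by case/and3P: rel => _ _ /eqP. Qed.
Let xN : x \in 'N(<[c]>). Proof. by rewrite inE conj_cycle_norm // cx mem_cycle. Qed.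
Let GE : mgrp x c = <[c]> * <[x]> :> {set gT}.
Proof.
by rewrite -norm_joinEr ?cycle_subG // joingC joing_idl joing_idr.
Qed.

Let n2 : (n./2).*2 = n.
Proof. by rewrite halfK oddM oddB ?(ltnW p1) // p2 andbF subn0. Qed.

Lemma G1_orders : [/\ #[c] = (p ^ e.+1)%N, #[x] = n & <[c]> :&: <[x]> = 1].
Proof.
apply: card_mulg_full.
- by apply: card_cycle_le; rewrite ?p0 //; case/and3P: rel => _ /eqP.
- by apply: card_cycle_le => //; case/and3P: rel => /eqP.
- by rewrite -GE cG.
Qed.

Lemma G1_cxX i : c ^ (x ^+ i) = c ^+ (r ^ i).
Proof.
elim: i => [|i IH]; first by rewrite conjg1 expg1.
by rewrite expgSr conjgM IH conjXg cx -expgM mulnC -expnSr.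
Qed.

Lemma G1_fix i : c ^ (x ^+ i) = c -> x ^+ i = 1.
Proof.
have [oc ox _] := G1_orders.
rewrite G1_cxX -{2}[c]expg1 => /eqP; rewrite eq_expg_mod_order oc => /eqP h.
have := unit_generator_dvd (p0 e.+1) ug h; rewrite totient_pfactor //= -subn1 mulnC -ox order_dvdn.
by move/eqP.
Qed.

Lemma G1_half : c ^ (x ^+ n./2) = c^-1.
Proof.
have [oc _ _] := G1_orders.
rewrite G1_cxX; apply/eqP; rewrite eq_sym eq_invg_mul -expgS -order_dvdn oc.
exact: unit_generator_half.
Qed.

Lemma G1_mgrp : mgrp x b = mgrp x c.
Proof.
apply/eqP; rewrite -val_eqE eqEsubset !mgrp_sub !mem_mgrpl /=; apply/andP; split.
  by rewrite groupM ?groupX ?mem_mgrpl ?mem_mgrpr.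
have e1 : c = x ^- n./2 * b by rewrite mulKg.
by rewrite [X in X \in _]e1 groupM ?groupV ?groupX ?mem_mgrpl ?mem_mgrpr.
Qed.

Lemma G1_cyc_gen : cyc_gen x b = c.
Proof.
have [_ ox _] := G1_orders.
rewrite /cyc_gen /iota_of ox mulgA -expgD addnn n2.
by rewrite -ox expg_order mul1g.
Qed.

Lemma G1_Kmn : exists L, Kmn_group p (p ^ e) x b L.
Proof.
have [oc ox TI] := G1_orders.
have ocp : #[c ^+ p] = (p ^ e)%N.
  by rewrite orderXdiv oc ?expnS ?dvdn_mulr // mulKn // ltnW.
have xNp : x \in 'N(<[c ^+ p]>).
  by rewrite inE conj_cycle_norm // conjXg cx -!expgM mulnC expgM mem_cycle.
pose L := (<[c ^+ p]> <*> <[x]>)%G.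
have LE : L = <[c ^+ p]> * <[x]> :> {set gT} by apply: norm_joinEr; rewrite cycle_subG.
have cpc : <[c ^+ p]> \subset <[c]> by rewrite cycle_subG mem_cycle.
have xL : x \in L by rewrite (subsetP (joing_subr _ _)) ?cycle_id.
have cL : #|L| = (p ^ e * n)%N.
  rewrite LE TI_cardMg -?orderE ?ocp ?ox //; apply/trivgP; rewrite -TI; exact: setSI.
have cnL : c \notin L.
  apply/negP => /= cL'; have /mulsgP[u v uc vx E] : c \in <[c ^+ p]> * <[x]> by rewrite -LE.
  have : v \in <[c]> :&: <[x]>.
    by rewrite inE vx andbT -(groupMl v (subsetP cpc _ uc)) -E cycle_id.
  rewrite TI => /set1P v1; have := uc; rewrite -[u]mulg1 -v1 -E -cycle_subG => /subset_leq_card.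
  by rewrite -!orderE oc ocp leq_exp2l // ltnn.
have bnL : b \notin L by rewrite groupMl // groupX.
exists L; split.
- apply: nt_prime_order => //.
    rewrite expgS expg1 mulgA -(mulgA _ c) (conjgC c) mulgA G1_half.
    by rewrite mulgKV -expgD addnn n2 -ox expg_order.
  by apply: contraNneq bnL => ->; rewrite group1.
- by rewrite ox mulnC.
- by rewrite cycle_subG.
- by rewrite G1_mgrp join_subG !cycle_subG groupX ?mem_mgrpl ?mem_mgrpr.
- by rewrite cL mulnC (mulnC (p ^ e)%N (p - 1)).
- by rewrite G1_mgrp cG expnS -mulnA; congr (p * _)%N; rewrite mulnC (mulnC (p ^ e)%N (p - 1)).
- exact: bnL.
apply/trivgP/subsetP=> g /setIP[/cycleP[i ->]]; rewrite /= -cycleJ => /cycleP[s].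
rewrite -conjXg (conjgM _ (x ^+ n./2)).
have -> : (x ^+ s) ^ (x ^+ n./2) = x ^+ s by apply/conjg_fixP/commgP/commuteX2.
move=> E; have sN : c ^ (x ^+ s) \in <[c]> by rewrite G1_cxX mem_cycle.
have : x ^- s * x ^+ i \in <[c]> :&: <[x]>.
  rewrite inE andbC groupM ?groupV ?mem_cycle //= E -commgEl commgEr.
  by rewrite groupM ?cycle_id // conjVg groupV.
rewrite TI => /set1P e1; have e2 : x ^+ i = x ^+ s by rewrite -[LHS](mulKVg (x ^+ s)) e1 mulg1.
apply/set1P/G1_fix/conjg_fixP/commgP/commute_sym/commgP/conjg_fixP.
by rewrite {2}E -e2.
Qed.
End G1Group.

Section G2Group.
Local Open Scope group_scope.
Variables (p t j : nat) (gT : finGroupType) (w z c g : gT).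
Hypotheses (pr : prime p) (p2 : odd p) (ug : unit_generator t p) (cj : coprime j (p - 1)).
Hypotheses (rel : G2rel p t w z c g) (cG : #|<<[set w; z; c; g]>>| = (p * p * (p * (p - 1)))%N).
Local Notation h := (p - 1)./2.
Local Notation a := (w * g ^+ j).
Local Notation b := (c * g ^+ h).

Let p1 : 1 < p. Proof. exact: prime_gt1. Qed.
Let p0 : 0 < p. Proof. exact: ltnW. Qed.
Let q0 : 0 < p - 1. Proof. by rewrite subn_gt0. Qed.
Let h2 : h.*2 = p - 1. Proof. by rewrite halfK oddB ?(ltnW p1) // p2 subn0. Qed.
Let wp : w ^+ p = 1. Proof. by case/and5P: rel => /eqP. Qed.
Let zp : z ^+ p = 1. Proof. by case/and5P: rel => _ /eqP. Qed.
Let cp : c ^+ p = 1. Proof. by case/and5P: rel => _ _ /eqP. Qed.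
Let gp : g ^+ (p - 1) = 1. Proof. by case/and5P: rel => _ _ _ /eqP. Qed.
Let wz : commute w z. Proof. by case/and5P: rel => _ _ _ _ /andP[/commgP]. Qed.
Let cg : c ^ g = c ^+ t. Proof. by case/and5P: rel => _ _ _ _ /and3P[_ /eqP]. Qed.
Let wc : w ^ c = w * z. Proof. by case/and5P: rel => _ _ _ _ /and4P[_ _ /eqP]. Qed.
Let zc : commute z c.
Proof. by case/and5P: rel => _ _ _ _ /and5P[_ _ _ /eqP/conjg_fixP/commgP]. Qed.
Let wg : commute w g.
Proof. by case/and5P: rel => _ _ _ _ /and5P[_ _ _ _ /andP[/eqP/conjg_fixP/commgP]]. Qed.
Let zg : z ^ g = z ^+ t.
Proof. by case/and5P: rel => _ _ _ _ /and5P[_ _ _ _ /andP[_ /eqP]]. Qed.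

Let cw : c ^ w = c * z^-1.
Proof.
have e : w * c = c * w * z by rewrite -mulgA -wc conjgE mulKVg.
have e2 : c * w = w * (c * z^-1) by rewrite mulgA e mulgK.
by rewrite conjgE e2 mulKg.
Qed.

Let V := (<[z]> <*> <[c]>)%G.
Let W := (<[w]> <*> <[g]>)%G.
Let VE : V = <[z]> * <[c]> :> {set gT}.
Proof. by apply: cent_joinEr; rewrite cycle_subG /= cent_cycle; apply/cent1P; exact: (commute_sym zc). Qed.
Let WE : W = <[w]> * <[g]> :> {set gT}.
Proof. by apply: cent_joinEr; rewrite cycle_subG /= cent_cycle; apply/cent1P; exact: (commute_sym wg). Qed.
Let zV : z \in V. Proof. by rewrite (subsetP (joing_subl _ _)) ?cycle_id. Qed.
Let cV : c \in V. Proof. by rewrite (subsetP (joing_subr _ _)) ?cycle_id. Qed.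
Let wW : w \in W. Proof. by rewrite (subsetP (joing_subl _ _)) ?cycle_id. Qed.
Let gW : g \in W. Proof. by rewrite (subsetP (joing_subr _ _)) ?cycle_id. Qed.
Let WN : W \subset 'N(V).
Proof.
rewrite join_subG !cycle_subG !inE !conjYg !join_subG !conj_cycle_norm //.
- by rewrite cg groupX.
- by rewrite zg groupX.
- by rewrite cw groupM ?groupV.
- by have /conjg_fixP -> : [~ z, w] == 1 by apply/commgP.
Qed.

Let full : [/\ #|V| = (p * p)%N, #|W| = (p * (p - 1))%N & V :&: W = 1].
Proof.
have cy (u : gT) d : 0 < d -> u ^+ d = 1 -> #|<[u]>| <= d by apply: card_cycle_le.
apply: card_mulg_full.
- rewrite VE; apply: (@leq_trans (#|<[z]>| * #|<[c]>|)); last by rewrite leq_mul ?cy.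
  by rewrite mul_cardG leq_pmulr // cardG_gt0.
- rewrite WE; apply: (@leq_trans (#|<[w]>| * #|<[g]>|)); last by rewrite leq_mul ?cy.
  by rewrite mul_cardG leq_pmulr // cardG_gt0.
rewrite -norm_joinEr // -cG; apply: subset_leq_card.
rewrite gen_subG; apply/subsetP=> u; rewrite !inE -!orbA.
by case/or4P=> /eqP ->; [apply: (subsetP (joing_subr _ _))|apply: (subsetP (joing_subl _ _))
  |apply: (subsetP (joing_subl _ _))|apply: (subsetP (joing_subr _ _))].
Qed.

Lemma G2_TI : (<[z]> <*> <[c]>) :&: (<[w]> <*> <[g]>) = 1. Proof. by case: full. Qed.

Lemma G2_norm : <[w]> <*> <[g]> \subset 'N(<[z]> <*> <[c]>). Proof. exact: WN. Qed.

Lemma G2_orders : [/\ #[z] = p, #[c] = p & <[z]> :&: <[c]> = 1].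
Proof. by case: full => cVV _ _; apply: card_mulg_full; rewrite -?VE ?cVV ?card_cycle_le. Qed.

Lemma G2_orders' : [/\ #[w] = p, #[g] = (p - 1)%N & <[w]> :&: <[g]> = 1].
Proof. by case: full => _ cW _; apply: card_mulg_full; rewrite -?WE ?cW ?card_cycle_le. Qed.

Let cop : coprime p (p - 1). Proof. by rewrite subn1 coprimenP. Qed.

Lemma G2_order_a : #[a] = (p * (p - 1))%N.
Proof.
have [ow og _] := G2_orders'.
have ogj : #[g ^+ j] = (p - 1)%N.
  by rewrite orderE cycle_expg_coprime -?orderE ?og.
by rewrite (orderM (commuteX j wg)) ow ogj.
Qed.

Let aW : <[a]> = W.
Proof.
apply/eqP; rewrite eqEcard cycle_subG groupM ?groupX //= -/W.
by case: full => _ -> _; rewrite -orderE G2_order_a.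
Qed.

Lemma G2_cgX i : c ^ (g ^+ i) = c ^+ (t ^ i).
Proof.
elim: i => [|i IH]; first by rewrite conjg1 expg1.
by rewrite expgSr conjgM IH conjXg cg -expgM mulnC -expnSr.
Qed.

Let zgX i : z ^ (g ^+ i) = z ^+ (t ^ i).
Proof.
elim: i => [|i IH]; first by rewrite conjg1 expg1.
by rewrite expgSr conjgM IH conjXg zg -expgM mulnC -expnSr.
Qed.

Lemma G2_half : c ^ (g ^+ h) = c^-1.
Proof.
have [_ oc _] := G2_orders.
rewrite G2_cgX; apply/eqP; rewrite eq_sym eq_invg_mul -expgS -order_dvdn oc.
by have := @unit_generator_half t p 0 pr p2; rewrite expn1 expn0 mul1n; apply.
Qed.

Lemma G2_mgrp : <<[set w; z; c; g]>> = mgrp a b.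
Proof.
have wA : w \in mgrp a b.
  by rewrite (subsetP (_ : W \subset _)) // -aW cycle_subG mem_mgrpl.
have gA : g \in mgrp a b.
  by rewrite (subsetP (_ : W \subset _)) // -aW cycle_subG mem_mgrpl.
have cA : c \in mgrp a b.
  have : b * g ^- h \in mgrp a b by rewrite groupM ?groupV ?groupX ?mem_mgrpr.
  by rewrite mulgK.
have zA : z \in mgrp a b.
  have : w^-1 * w ^ c \in mgrp a b by rewrite groupM ?groupV ?groupJ.
  by rewrite wc mulKg.
have m1 u : u \in [set w; z; c; g] -> u \in <<[set w; z; c; g]>> by apply: mem_gen.
apply/eqP; rewrite eqEsubset; apply/andP; split.
  rewrite gen_subG; apply/subsetP=> u; rewrite !inE -!orbA.
  by case/or4P=> /eqP ->.
rewrite gen_subG; apply/subsetP=> u; rewrite !inE => /orP[] /eqP ->.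
  by rewrite groupM ?groupX // m1 // !inE eqxx ?orbT.
by rewrite groupM ?groupX // m1 // !inE eqxx ?orbT.
Qed.

Let giV : g ^+ h * g ^+ h = 1. Proof. by rewrite -expgD addnn h2. Qed.

Lemma G2_bb : b * b = 1.
Proof.
rewrite {2}(conjgC c) G2_half mulgA -(mulgA c) giV mulg1.
by rewrite mulgV.
Qed.

Lemma G2_cyc_gen : cyc_gen a b = c^-1.
Proof.
rewrite /cyc_gen /iota_of G2_order_a.
have -> : (p * (p - 1))./2 = (p * h)%N.
  have -> : (p * (p - 1) = (p * h).*2)%N by rewrite -mul2n mulnCA mul2n h2.
  by rewrite doubleK.
have -> : a ^+ (p * h) = g ^+ h.
  rewrite expgMn; last exact: commuteX.
  rewrite expgM wp expg1n mul1g -expgM; apply/eqP; have [_ og _] := G2_orders'.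
  rewrite eq_expg_mod_order og mulnA mulnC half_muln_odd //; first by rewrite -h2 odd_double.
  rewrite oddM p2 andbT -coprimen2; apply: coprime_dvdr cj.
  by rewrite -h2 dvdn2 odd_double.
by rewrite -G2_half conjgE; congr (_ * _); apply/eqP; rewrite eq_sym eq_invg_mul giV.
Qed.

Lemma G2_conj : cyc_gen a b ^ (a ^+ p) = cyc_gen a b ^+ (t ^ j).
Proof.
have [_ oc _] := G2_orders.
rewrite G2_cyc_gen expgMn; last exact: commuteX.
rewrite wp mul1g -expgM conjVg G2_cgX expgVn; congr (_ ^-1); apply/eqP.
by rewrite eq_expg_mod_order oc expnM fermat_little.
Qed.

Lemma G2_Kmn : exists L, Kmn_group p p a b L.
Proof.
have [oz oc TIzc] := G2_orders; have [cVV cW TI] := full.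
have WNz : W \subset 'N(<[z]>).
  rewrite join_subG !cycle_subG !inE !conj_cycle_norm ?zg ?mem_cycle //.
  by have /conjg_fixP -> : [~ z, w] == 1 by [apply/commgP]; exact: cycle_id.
pose L := (<[z]> <*> W)%G.
have LE : L = <[z]> * W :> {set gT} by apply: norm_joinEr.
have zsV : <[z]> \subset V by rewrite cycle_subG.
have cL : #|L| = (p * (p * (p - 1)))%N.
  rewrite LE TI_cardMg ?cW -?orderE ?oz //; apply/trivgP; rewrite -TI; exact: setSI.
have sWL : W \subset L by exact: joing_subr.
have cnL : c \notin L.
  apply/negP => cL'; have /mulsgP[u v uz vW E] : c \in <[z]> * W by rewrite -LE.
  have : v \in V :&: W.
    by rewrite inE vW andbT -(groupMl v (subsetP zsV _ uz)) -E.
  rewrite TI => /set1P v1; have : c \in <[z]> :&: <[c]> by rewrite inE cycle_id E v1 mulg1 uz.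
  by rewrite TIzc => /set1P c1; move: p1; rewrite -oc c1 order1.
have gL : g ^+ h \in L by rewrite (subsetP sWL) ?groupX.
have bnL : b \notin L by rewrite groupMr.
exists L; split.
- apply: nt_prime_order; [by []|exact: G2_bb|].
  by apply: contraNneq bnL => ->; rewrite group1.
- by rewrite G2_order_a mulnC.
- by rewrite aW.
- rewrite -[mgrp _ _ : {set _}]G2_mgrp join_subG cycle_subG join_subG !cycle_subG !mem_gen // !inE eqxx ?orbT //.
- by rewrite cL mulnC (mulnC p (p - 1)).
- by rewrite -G2_mgrp cG -mulnA (mulnC (p - 1)) (mulnC _ p).
- exact: bnL.
rewrite aW; apply/trivgP/subsetP=> u /setIP[uW]; rewrite /= conjsgM.
rewrite -{1}(conjGid (groupX h gW : g ^+ h \in W)) in uW.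
case/imsetP: uW => u' u'W uE; rewrite uE memJ_conjg => /imsetP[v vW vE].
suff v1 : v = 1 by rewrite vE v1 !conj1g set11.
have : v^-1 * v ^ c \in V :&: W.
  rewrite inE (groupM (groupVr vW)) -?vE // andbT vE -commgEl commgEr groupM //.
  by rewrite conjVg groupV memJ_norm // (subsetP WN).
rewrite TI => /set1P cv.
have {}cv : c ^ v = c.
  by apply/conjg_fixP; rewrite -invgR commgEl cv invg1.
have /mulsgP[_ _ /cycleP[i ->] /cycleP[s ->] vE'] : v \in <[w]> * <[g]> by rewrite -WE.
have cwi : c ^ (w ^+ i) = c * z ^- i.
  elim: (i) => [|i' IH]; first by rewrite conjg1 expg0 invg1 mulg1.
  have zw : z ^ w = z by apply/conjg_fixP/commgP/commute_sym.
  by rewrite expgSr conjgM IH conjMg conjVg conjXg zw cw expgS invMg -mulgA; congr (_ * _); commute_tac.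
move: cv; rewrite vE' conjgM cwi conjMg conjVg conjXg zgX G2_cgX => E.
have E2 : c^-1 * c ^+ (t ^ s) = z ^+ (t ^ s) ^+ i.
  by rewrite -[X in X^-1 * _]E invMg invgK -mulgA mulVg mulg1.
have : c^-1 * c ^+ (t ^ s) \in <[z]> :&: <[c]>.
  by rewrite inE {1}E2 !groupX ?cycle_id //= groupM ?groupV ?groupX ?cycle_id.
rewrite TIzc => /set1P e1; move: E2; rewrite e1 -expgM => /esym/eqP.
rewrite -order_dvdn oz Gauss_dvdr; last first.
  by rewrite coprimeXr // coprime_sym; case: ug.
move/dvdnP=> [i' ->]; rewrite mulnC expgM wp expg1n mul1g.
have : c ^+ (t ^ s) = c ^+ 1 by rewrite expg1 -[LHS](mulKVg c) e1 mulg1.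
move/eqP; rewrite eq_expg_mod_order oc => /eqP ts.
have := unit_generator_dvd p0 ug ts; rewrite totient_prime // -subn1 => /dvdnP[s' ->].
by rewrite mulnC expgM gp expg1n.
Qed.
End G2Group.

(** * Models of the presented groups *)

Section PermutationModels.
Local Open Scope group_scope.

Lemma card_perm_group_ge (T : finType) (D : {group {perm T}}) (a : {perm T}) (o s : T) d :
  a \in D -> a o = o -> (forall u, exists2 g : {perm T}, g \in D & g o = u) ->
  (forall i, (a ^+ i) s = s -> d %| i) -> #|T| * d <= #|D|.
Proof.
move=> aD ao tr ord; rewrite -(card_orbit_stab 'P D o).
have -> : orbit 'P D o = [set: T].
  apply/eqP; rewrite eqEsubset subsetT; apply/subsetP=> u _.
  by have [g gD <-] := tr u; apply/orbitP; exists g.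
rewrite cardsT leq_mul2l; apply/orP; right.
have aS : a \in 'C_D[o | 'P].
  by apply/setIP; split=> //; apply/astab1P.
apply: (@leq_trans #[a]).
  by apply: dvdn_leq => //; apply: ord; rewrite expg_order perm1.
by apply: dvdn_leq => //; apply: order_dvdG.
Qed.

Lemma conjg_eq (gT : finGroupType) (u v w : gT) : u * v = v * w -> u ^ v = w.
Proof. by move=> e; rewrite conjgE e mulKg. Qed.

End PermutationModels.

Section ModularCasts.
Import GRing.Theory.
Local Open Scope ring_scope.

Lemma modular_ring N : (1 < N)%N -> exists R : finComUnitRingType,
  [/\ #|R| = N, forall u v : nat, (u%:R : R) = v%:R <-> (u = v %[mod N])%N
    & forall t : R, exists u, t = u%:R].
Proof.
move=> N1; exists 'Z_N; split.
- by rewrite card_ord Zp_cast.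
- move=> u v; split=> [/(congr1 (@nat_of_ord _))|h]; first by rewrite !val_Zp_nat.
  by apply: val_inj; rewrite /= !val_Zp_nat.
- by move=> t; exists t; rewrite natr_Zp.
Qed.

Lemma natr_unit (R : finComUnitRingType) N r :
  (0 < N)%N -> (forall u v : nat, (u%:R : R) = v%:R <-> (u = v %[mod N])%N) -> coprime r N ->
  (r%:R : R) \is a GRing.unit.
Proof.
move=> N0 natE co; apply/unitrPr; exists (r ^ (totient N).-1)%:R.
rewrite -natrM -expnS prednK ?totient_gt0 //.
by apply: (proj2 (natE (r ^ totient N)%N 1%N)); apply: Euler_exp_totient.
Qed.
End ModularCasts.

Section G1Model.
Import GRing.Theory.
Local Open Scope ring_scope.
Variables (p e r : nat).
Hypotheses (pr : prime p) (ug : unit_generator r (p ^ e.+1)).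
Local Notation N := (p ^ e.+1)%N.
Local Notation n := (p ^ e * (p - 1))%N.
Variable R : finComUnitRingType.
Hypotheses (cR : #|R| = N) (natE : forall u v : nat, (u%:R : R) = v%:R <-> (u = v %[mod N])%N).
Hypothesis (natR : forall t : R, exists u, t = u%:R).

Let p1 : (1 < p)%N. Proof. exact: prime_gt1. Qed.
Let N1 : (1 < N)%N. Proof. by rewrite -(expn0 p) ltn_exp2l. Qed.
Let tE : totient N = n. Proof. by rewrite totient_pfactor //= mulnC subn1. Qed.
Let rU : (r%:R : R) \is a GRing.unit.
Proof. by apply: natr_unit natE _; [exact: ltnW | case: ug]. Qed.

Let mul_inj : injective (fun t : R => r%:R * t). Proof. exact: mulrI. Qed.
Let add_inj : injective (fun t : R => t + 1). Proof. exact: addIr. Qed.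
Let x : {perm R} := perm mul_inj.
Let c : {perm R} := perm add_inj.
Let xX i t : (x ^+ i)%g t = (r ^ i)%:R * t.
Proof.
elim: i => [|i IH]; first by rewrite expg0 perm1 mul1r.
by rewrite expgSr permM IH permE expnS natrM mulrA.
Qed.
Let cX i t : (c ^+ i)%g t = t + i%:R.
Proof.
elim: i => [|i IH]; first by rewrite expg0 perm1 addr0.
by rewrite expgSr permM IH permE -addrA -natr1.
Qed.

Lemma G1_model_ring : exists (gT : finGroupType) (x c : gT),
  G1rel p e r x c /\ #|mgrp x c| = (N * n)%N.
Proof.
have rel : G1rel p e r x c.
  apply/and3P; split; apply/eqP.
  - apply/permP=> t; rewrite xX perm1 -tE.
    have -> : (r ^ totient N)%:R = 1 :> R.
      by apply: (proj2 (natE (r ^ totient N) 1)); apply: Euler_exp_totient; case: ug.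
    by rewrite mul1r.
  - by apply/permP=> t; rewrite cX perm1 (proj2 (natE N 0)) ?addr0 // modnn mod0n.
  - apply: conjg_eq; apply/permP=> t; rewrite !permM cX !permE.
    by rewrite mulrDr mulr1.
exists {perm R}, x, c; split=> //; apply/eqP; rewrite eqn_leq (G1rel_card pr rel) /=.
have h : (#|R| * n <= #|mgrp x c|)%N.
  apply: (@card_perm_group_ge _ _ x 0 1); first exact: mem_mgrpl.
  - by rewrite permE mulr0.
  - move=> t; have [u ->] := natR t; exists (c ^+ u)%g; first by rewrite groupX ?mem_mgrpr.
    by rewrite cX add0r.
  - move=> i; rewrite xX mulr1 -tE => h; apply: unit_generator_dvd ug _; first exact: ltnW.
    by apply: (proj1 (natE (r ^ i) 1)); rewrite h.
by rewrite cR in h.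
Qed.
End G1Model.

Lemma G1_model p e r : prime p -> unit_generator r (p ^ e.+1) ->
  exists (gT : finGroupType) (x c : gT),
    G1rel p e r x c /\ #|mgrp x c| = (p ^ e.+1 * (p ^ e * (p - 1)))%N.
Proof.
move=> pr ug; have N1 : 1 < p ^ e.+1 by rewrite -(expn0 p) ltn_exp2l ?prime_gt1.
by have [R [cR natE natR]] := modular_ring N1; exact: (G1_model_ring pr ug cR natE natR).
Qed.


Section G2Model.
Import GRing.Theory.
Local Open Scope ring_scope.
Variables (p t : nat).
Hypotheses (pr : prime p) (ug : unit_generator t p).
Variable F : finComUnitRingType.
Hypotheses (cF : #|F| = p) (natE : forall u v : nat, (u%:R : F) = v%:R <-> (u = v %[mod p])%N).
Hypothesis (natR : forall t : F, exists u, t = u%:R).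
Local Notation T := (F * F)%type.

Let p1 : (1 < p)%N. Proof. exact: prime_gt1. Qed.
Let tU : (t%:R : F) \is a GRing.unit.
Proof. by apply: natr_unit natE _; [exact: ltnW | case: ug]. Qed.
Let w_inj : injective (fun u : T => (u.1, u.2 - u.1)).
Proof. by move=> [u v] [u' v'] [-> e]; congr (_, _); apply: addIr e. Qed.
Let z_inj : injective (fun u : T => (u.1, u.2 + 1)).
Proof. by move=> [u v] [u' v'] [-> e]; congr (_, _); apply: addIr e. Qed.
Let c_inj : injective (fun u : T => (u.1 + 1, u.2)).
Proof. by move=> [u v] [u' v'] [e ->]; congr (_, _); apply: addIr e. Qed.
Let g_inj : injective (fun u : T => (t%:R * u.1, t%:R * u.2)).
Proof. by move=> [u v] [u' v'] [e e']; congr (_, _); [apply: mulrI e|apply: mulrI e']. Qed.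
Let w : {perm T} := perm w_inj.
Let z : {perm T} := perm z_inj.
Let c : {perm T} := perm c_inj.
Let g : {perm T} := perm g_inj.
Let wX i u : (w ^+ i)%g u = (u.1, u.2 - i%:R * u.1).
Proof.
elim: i => [|i IH]; first by rewrite expg0 perm1 mul0r subr0; case: u.
by rewrite expgSr permM IH permE /= -natr1 mulrDl mul1r opprD addrA.
Qed.
Let zX i u : (z ^+ i)%g u = (u.1, u.2 + i%:R).
Proof.
elim: i => [|i IH]; first by rewrite expg0 perm1 addr0; case: u.
by rewrite expgSr permM IH permE /= -natr1 addrA.
Qed.
Let cX i u : (c ^+ i)%g u = (u.1 + i%:R, u.2).
Proof.
elim: i => [|i IH]; first by rewrite expg0 perm1 addr0; case: u.
by rewrite expgSr permM IH permE /= -natr1 addrA.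
Qed.
Let gX i u : (g ^+ i)%g u = ((t ^ i)%:R * u.1, (t ^ i)%:R * u.2).
Proof.
elim: i => [|i IH]; first by rewrite expg0 perm1 !mul1r; case: u.
by rewrite expgSr permM IH permE /= expnS natrM !mulrA.
Qed.

Lemma G2_model_ring : exists (gT : finGroupType) (w z c g : gT),
  G2rel p t w z c g /\ #|<<[set w; z; c; g]>>%g| = (p * p * (p * (p - 1)))%N.
Proof.
have p0 : p%:R = 0 :> F by apply: (proj2 (natE p 0)); rewrite modnn mod0n.
have tp : totient p = (p - 1)%N by rewrite totient_prime // subn1.
have rel : G2rel p t w z c g.
  apply/and5P; split; last (apply/and5P; split; last apply/andP; try split); apply/eqP.
  - by apply/permP=> u; rewrite wX perm1 p0 mul0r subr0; case: u.
  - by apply/permP=> u; rewrite zX perm1 p0 addr0; case: u.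
  - by apply/permP=> u; rewrite cX perm1 p0 addr0; case: u.
  - apply/permP=> u; rewrite gX perm1 -tp.
    have -> : (t ^ totient p)%:R = 1 :> F.
      by apply: (proj2 (natE (t ^ totient p) 1)); apply: Euler_exp_totient; case: ug.
    by rewrite !mul1r; case: u.
  - by apply/eqP/commgP/permP=> u; rewrite !permM !permE /= addrAC.
  - by apply: conjg_eq; apply/permP=> u; rewrite !permM cX !permE /= mulrDr mulr1.
  - apply: conjg_eq; apply/permP=> u; rewrite !permM !permE /= opprD addrA addrNK //.
  - by apply: conjg_eq; apply/permP=> u; rewrite !permM !permE.
  - by apply: conjg_eq; apply/permP=> u; rewrite !permM !permE /= mulrBr.
  - by apply: conjg_eq; apply/permP=> u; rewrite !permM zX !permE /= mulrDr mulr1.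
exists {perm T}, w, z, c, g; split=> //.
have := G2rel_card pr rel; rewrite -mulnA => le; apply/eqP; rewrite eqn_leq le /=.
have mem u : u \in [set w; z; c; g] -> u \in <<[set w; z; c; g]>>%G by apply: mem_gen.
have [wG zG cG gG] : [/\ w \in <<[set w; z; c; g]>>%G, z \in <<[set w; z; c; g]>>%G,
    c \in <<[set w; z; c; g]>>%G & g \in <<[set w; z; c; g]>>%G].
  by split; apply: mem; rewrite !inE eqxx ?orbT.
have wgX i u : ((w * g) ^+ i)%g u = ((t ^ i)%:R * u.1, (t ^ i)%:R * (u.2 - i%:R * u.1)).
  have cwg : commute w g.
    by apply/permP=> u'; rewrite !permM !permE /= mulrBr.
  by rewrite expgMn // permM gX wX.
have h : (#|{: T}| * (p * (p - 1)) <= #|<<[set w; z; c; g]>>%G|)%N.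
  apply: (@card_perm_group_ge _ _ (w * g)%g (0, 0) (1, 0)).
  - by rewrite groupM.
  - by rewrite permM !permE /= subr0 !mulr0.
  - move=> [u' v']; have [u ->] := natR u'; have [v ->] := natR v'.
    exists (c ^+ u * z ^+ v)%g; first by rewrite groupM ?groupX.
    by rewrite permM cX zX /= !add0r.
  - move=> i; rewrite wgX /= mulr1 add0r => [[h1 h2]].
    have d1 : (p - 1 %| i)%N.
      rewrite -tp; apply: unit_generator_dvd ug _; first exact: ltnW.
      exact: (proj1 (natE (t ^ i) 1)).
    have d2 : (p %| i)%N.
      move: h2; rewrite h1 mul1r mulr1 => /eqP; rewrite oppr_eq0 => /eqP h.
      by have := proj1 (natE i 0) h; rewrite mod0n => /eqP.
    by rewrite Gauss_dvd ?d1 ?d2 // subn1 coprimenP // prime_gt0.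
by rewrite card_prod cF in h.
Qed.
End G2Model.

Lemma G2_model p t : prime p -> unit_generator t p ->
  exists (gT : finGroupType) (w z c g : gT),
    G2rel p t w z c g /\ #|<<[set w; z; c; g]>>%g| = (p * p * (p * (p - 1)))%N.
Proof.
move=> pr ug; have [F [cF natE natR]] := modular_ring (prime_gt1 pr).
exact: (G2_model_ring pr ug cF natE natR).
Qed.

Section G4Model.
Import GRing.Theory.
Local Open Scope ring_scope.
Variables (n k m : nat) (R : finComUnitRingType).
Hypothesis cR : #|R| = n.
Hypothesis natE : forall u v : nat, (u%:R : R) = v%:R <-> (u = v %[mod n])%N.
Hypothesis natR : forall t : R, exists u, t = u%:R.
Local Notation w := (k%:R : R).
Local Notation v := (m%:R : R).
Hypotheses (ww : w * w = 0) (wv : w * v = 0) (w3 : w + w + w = 0) (v3 : v + v + v = 0).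

Let f (t : R) := - t - w * t * (t - 1).
Let fi (t : R) := - t - w * t * (t + 1).
Let h (t : R) := - t - 1 - w * t * (t + 1) - v.

Ltac mod_ring P Q S U := match goal with |- ?l = ?r =>
  transitivity (r + w * w * P + (w + w + w) * Q + w * v * S + (v + v + v) * U);
  [rewrite /f /fi /h; ring | rewrite ww w3 wv v3; ring] end.

Let fK t : fi (f t) = t.
Proof. mod_ring (- 2%:R*t*t*t + 3%:R*t*t - w*t*t*t*t + 2%:R*w*t*t*t - w*t*t - t) (0 : R) (0 : R) (0 : R). Qed.
Let hK t : h (h t) = t.
Proof. mod_ring (- 2%:R*t*t*t - 3%:R*t*t - t - w*t*t*t*t - 2%:R*w*t*t*t - 2%:R*v*t*t - w*t*t - 2%:R*v*t) (0 : R) (- 2%:R*t - 1%:R - v) (0 : R). Qed.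
Let ff t : f (f t) = t + w * t.
Proof. mod_ring (- 2%:R*t*t*t + t*t - w*t*t*t*t + 2%:R*w*t*t*t - w*t*t + t) (- t) (0 : R) (0 : R). Qed.
Let hh t : h (h t + 1) = t - 1 - w * t.
Proof. mod_ring (- 2%:R*t*t*t - t*t - w*t*t*t*t - 2%:R*w*t*t*t - 2%:R*v*t*t - w*t*t - 2%:R*v*t + t) t (- 2%:R*t - v + 1%:R) (0 : R). Qed.
Let yaN t : f (t + 1) + 1 + w * (f (t + 1) + 1) = f t.
Proof. mod_ring (- t*t - t) (- t) (0 : R) (0 : R). Qed.
Let yaF t : (t + w * t) - 1 - w * (t + w * t) + 1 = t.
Proof. mod_ring (- t) (0 : R) (0 : R) (0 : R). Qed.
Let yaT t : (t - 1 - w * t + 1) + w * (t - 1 - w * t + 1) = t.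
Proof. mod_ring (- t) (0 : R) (0 : R) (0 : R). Qed.
Let tN t : h (f t) + 1 + v = t.
Proof. mod_ring (- 2%:R*t*t*t + 3%:R*t*t - w*t*t*t*t + 2%:R*w*t*t*t - w*t*t - t) (0 : R) (0 : R) (0 : R). Qed.
Let tF t : f (h t + 1) = t + v.
Proof. mod_ring (- 2%:R*t*t*t - 3%:R*t*t - w*t*t*t*t - 2%:R*w*t*t*t - 2%:R*v*t*t - w*t*t - 2%:R*v*t - t) (0 : R) (- 2%:R*t - v - 1%:R) (0 : R). Qed.
Let tT t : h (f (t + 1)) - v = t + v.
Proof. mod_ring (- 2%:R*t*t*t - 3%:R*t*t - t - w*t*t*t*t - 2%:R*w*t*t*t - w*t*t) (0 : R) (0 : R) (- 1%:R : R). Qed.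
Let cT t : t + 1 - 1 - w * (t + 1) - w = t - 1 - w * t + 1 + w.
Proof. mod_ring (0 : R) (- 1%:R : R) (0 : R) (0 : R). Qed.
Let xp i t : (t + i * w * t) + w * (t + i * w * t) = t + (i + 1) * w * t.
Proof. mod_ring (t * i) (0 : R) (0 : R) (0 : R). Qed.
Let yp i j t : (t - i - i * w * t + j * w) - 1 - w * (t - i - i * w * t + j * w) =
  t - (i + 1) - (i + 1) * w * t + (j + i) * w.
Proof. mod_ring (i * t - j) (0 : R) (0 : R) (0 : R). Qed.

Local Notation T := (option bool * R)%type.
Let fa (u : T) : T := match u with
  | (None, t) => (None, f t)
  | (Some false, t) => (Some true, t)
  | (Some true, t) => (Some false, t + 1)
  end.
Let fb (u : T) : T := match u with
  | (None, t) => (Some false, t)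
  | (Some false, t) => (None, t)
  | (Some true, t) => (Some true, h t)
  end.
Let fa_inj : injective fa.
Proof.
move=> [[[]|] t] [[[]|] t'] //= [] e; congr (_, _) => //; first exact: addIr e.
by rewrite -[t]fK e fK.
Qed.
Let fb_inj : injective fb.
Proof. by apply: (can_inj (g := fb)) => -[[[]|] t] //=; rewrite hK. Qed.

Let a : {perm T} := perm fa_inj.
Let b : {perm T} := perm fb_inj.
Let x := (a ^+ 2)%g.
Let y := (x ^ b)%g.

Let bb : (b * b = 1)%g.
Proof. by apply/permP=> -[[[]|] t]; rewrite permM !permE /= ?hK. Qed.
Let xE (u : T) : x u = match u with (None, t) => (None, t + w * t) | (Some o, t) => (Some o, t + 1) end.
Proof. by case: u => -[[]|] t; rewrite /x expgS expg1 permM !permE /= ?ff. Qed.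
Let yE (u : T) : y u = match u with
  | (None, t) => (None, t + 1)
  | (Some false, t) => (Some false, t + w * t)
  | (Some true, t) => (Some true, t - 1 - w * t) end.
Proof.
have bV : b^-1%g = b by apply/eqP; rewrite eq_invg_mul bb.
have bE u' : b u' = fb u' by rewrite permE.
have -> : y u = b (x (b u)) by rewrite /y conjgE bV (permM b) (permM x).
by rewrite (bE u); case: u => -[[]|] t; rewrite /= xE bE /= ?hh.
Qed.
Let xX i (u : T) : (x ^+ i)%g u =
  match u with (None, t) => (None, t + i%:R * w * t) | (Some o, t) => (Some o, t + i%:R) end.
Proof.
elim: i u => [|i IH] u.
  by rewrite expg0 perm1; case: u => -[[]|] t; rewrite ?mul0r ?addr0 // mul0r mul0r addr0.
rewrite expgSr permM IH; case: u => -[o|] t; rewrite xE -natr1; last by rewrite xp.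
by rewrite addrA.
Qed.
Let yX i (u : T) : (y ^+ i)%g u = match u with
  | (None, t) => (None, t + i%:R)
  | (Some false, t) => (Some false, t + i%:R * w * t)
  | (Some true, t) => (Some true, t - i%:R - i%:R * w * t + 'C(i, 2)%:R * w) end.
Proof.
elim: i u => [|i IH] u.
  by rewrite expg0 perm1; case: u => -[[]|] t; rewrite ?bin0n ?mul0r ?mul0r ?subr0 ?addr0.
rewrite expgSr permM IH; case: u => -[[]|] t; rewrite yE -natr1 ?xp //; last by rewrite addrA.
by rewrite yp binS bin1 natrD.
Qed.

Let C2 i : i%:R * w = 0 :> R -> 'C(i, 2)%:R * w = 0 :> R.
Proof.
have e2 : (2 * 'C(i, 2) = i.-1 * i)%N.
  by rewrite bin2 mul2n halfK oddM mulnC; case: (i) => //= j; case: (odd j); rewrite ?andbF ?subn0.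
move=> iw; have e3 : 2%:R * ('C(i, 2)%:R * w) = 0 by rewrite mulrA -natrM e2 natrM -mulrA iw mulr0.
have -> : 'C(i, 2)%:R * w = 'C(i, 2)%:R * (w + w + w) - 2%:R * ('C(i, 2)%:R * w) by ring.
by rewrite w3 e3 mulr0 subr0.
Qed.

Lemma G4_model_ring : exists (gT : finGroupType) (a b : gT),
  let x := (a ^+ 2)%g in let y := (x ^ b)%g in
  [/\ (a ^+ (2 * n) = 1)%g, (b ^+ 2 = 1)%g, (x * y * y ^+ k = y * x * x ^+ k)%g,
      (y * a * y * x = a)%g & ((a * b) ^+ 3 * y ^+ m = x ^+ m)%g]
  /\ (3 * n * (2 * n) <= #|mgrp a b|)%N.
Proof.
exists {perm T}, a, b.
suff : [/\ (a ^+ (2 * n) = 1)%g, (b ^+ 2 = 1)%g, (x * y * y ^+ k = y * x * x ^+ k)%g,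
      (y * a * y * x = a)%g & ((a * b) ^+ 3 * y ^+ m = x ^+ m)%g]
  /\ (3 * n * (2 * n) <= #|mgrp a b|)%N by [].
have n00 : n%:R = 0 :> R by apply: (proj2 (natE n 0)); rewrite modnn mod0n.
have Ck := C2 ww; have Cm : 'C(m, 2)%:R * w = 0 by apply: C2; rewrite mulrC.
have vw : v * w = 0 by rewrite mulrC.
split; first split.
- rewrite expgM -/x; apply/permP=> -[[o|] t]; rewrite xX perm1 n00 ?addr0 //.
  by rewrite !mul0r addr0.
- exact: bb.
- move: xE yE xX yX; move: (x) (y) => x' y' xE' yE' xX' yX'; apply/permP=> -[[[]|] t]; rewrite !permM.
  + by rewrite !(xE', yE') xX' yX' ww Ck mul0r subr0 addr0 cT.
  + rewrite !(xE', yE') xX' yX' ww mul0r addr0; congr (_, _); ring.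
  + rewrite !(xE', yE') xX' yX' ww mul0r addr0; congr (_, _); ring.
- move: xE yE xX yX; move: (x) (y) => x' y' xE' yE' xX' yX'; apply/permP=> -[[[]|] t]; rewrite !permM yE' ![a _]permE /= yE' xE' /=.
  + by rewrite yaT.
  + by rewrite yaF.
  + by rewrite yaN.
- move: xE yE xX yX; move: (x) (y) => x' y' xE' yE' xX' yX'; apply/permP=> -[[[]|] t]; rewrite !expgS expg0 mulg1 !permM !permE /= xX' yX' vw !mul0r.
  + by rewrite Cm subr0 addr0 tT.
  + by rewrite addr0 tF.
  + by rewrite addr0 tN.
have cT' : #|{: T}| = (3 * n)%N by rewrite card_prod card_option card_bool cR.
rewrite -cT'; apply: (@card_perm_group_ge _ _ a (None, 0) (Some false, 0)).
- exact: mem_mgrpl.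
- by rewrite permE /= /f oppr0 mulr0 mul0r subr0.
- have xG : x \in mgrp a b by rewrite groupX ?mem_mgrpl.
  have yG : y \in mgrp a b by rewrite groupJ ?mem_mgrpr.
  have bG : b \in mgrp a b by exact: mem_mgrpr.
  have aG : a \in mgrp a b by exact: mem_mgrpl.
  have aux t : exists2 g : {perm T}, g \in mgrp a b & g (None, 0) = (None, t).
    by have [i ->] := natR t; exists (y ^+ i)%g; [exact: groupX|rewrite yX add0r].
  move=> [o t]; have [g gG gE] := aux t; case: o => [[]|]; last by exists g.
    by exists (g * (b * a))%g; [exact: groupM gG (groupM bG aG)|rewrite !permM gE !permE].
  by exists (g * b)%g; [exact: groupM|rewrite permM gE permE].
move=> i; rewrite -{1}(odd_double_half i) addnC expgD -mul2n expgM permM -/x xX add0r.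
case: odd (odd_double_half i) => /=; first by move=> _; rewrite permE.
move=> iE; rewrite expg0 perm1 => -[] e'; have e := proj1 (natE i./2 0) e'.
by rewrite -iE add0n -mul2n dvdn_pmul2l // /dvdn e mod0n.
Qed.
End G4Model.

Section G4Exists.
Local Open Scope group_scope.

Definition lnat (l : int) : nat := (if l == 0%R then 0 else if l == 1%R then 1 else 2)%N.

Lemma expgzN (gT : finGroupType) (x : gT) z : expgz x (- z)%R = (expgz x z)^-1.
Proof. by case: z => [[|i]|i]; rewrite /= ?expg0 ?invg1 ?invgK. Qed.

Definition sign_int (l : int) : bool := l \in [:: 0; 1; -1]%R.

Lemma expgz_lnat (gT : finGroupType) (x : gT) q l : sign_int l ->
  (l != 0%R -> x ^+ (3 * q) = 1) -> expgz x (l * q%:Z)%R = x ^+ (lnat l * q).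
Proof.
rewrite /sign_int !inE => /or3P[] /eqP -> h.
- by rewrite GRing.mul0r mul0n.
- by rewrite GRing.mul1r mul1n.
rewrite GRing.mulN1r expgzN /=; apply: (mulgI (x ^+ q)).
by rewrite mulgV -expgD -{1}[q]mul1n -mulnDl h.
Qed.

Lemma adm_il_facts e k i l : adm_il e i l -> let n := (3 ^ e * k)%N in
  [/\ i = 0 \/ i = 1%N /\ 9 %| n, sign_int l & l != 0%R -> (3 * (n %/ 3) = n)%N].
Proof.
move=> ad n; have n3 : 0 < e -> (3 * (n %/ 3) = n)%N.
  by move=> e0; rewrite mulnC divnK // /n -(prednK e0) expnS -mulnA dvdn_mulr.
have n9 : 1 < e -> 9 %| n.
  by case: (e) @n {n3} => [|[|e']] // n' _; rewrite /n' !expnS !mulnA -mulnA dvdn_mulr.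
case/or3P: ad => [/andP[/eqP -> /eqP ->]|/and3P[e1 /eqP -> /eqP ->]|/and3P[e2 /eqP -> ls]].
- by split=> //; left.
- by split=> [|//|_]; [left|apply: n3].
- by split=> [|//|_]; [right; split; [|exact: n9]|apply: n3; apply: ltnW].
Qed.

Lemma G4rel_intro n i l (gT : finGroupType) (a b : gT) : sign_int l ->
  (l != 0%R -> (3 * (n %/ 3) = n)%N) -> let x := a ^+ 2 in let y := x ^ b in
  let k := (i * (n %/ 3))%N in let m := (lnat l * (n %/ 3))%N in
  [/\ a ^+ (2 * n) = 1, b ^+ 2 = 1, x * y * y ^+ k = y * x * x ^+ k,
      y * a * y * x = a & (a * b) ^+ 3 * y ^+ m = x ^+ m] ->
  G4rel n i l a b.
Proof.
move=> ls n3 x y k m [h1 h2 h3 h4 h5].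
have xn : x ^+ n = 1 by rewrite -expgM.
have yn : y ^+ n = 1 by rewrite -conjXg xn conj1g.
apply/and5P; split; apply/eqP => //; rewrite -/x -/y -/k.
- apply: (mulIg (y ^+ k)); rewrite mulgKV; apply: (mulgI (y * x)); rewrite -h3 mulgA; congr (_ * _).
  by move: (x) (y) => u v'; rewrite commgEl conjgE !mulgA mulgK mulgV mul1g.
- by move: (x) (y) h4 => u v' e; apply: conjg_eq; rewrite -{2}e !mulgA !mulgK.
rewrite expgzN !expgz_lnat // -/m; try by move=> l0; rewrite n3.
by rewrite -h5 mulgK.
Qed.

Lemma G4_model e k i l : 1 < 3 ^ e * k -> adm_il e i l ->
  exists (gT : finGroupType) (a b : gT),
    G4rel (3 ^ e * k) i l a b /\ #|mgrp a b| = (6 * ((3 ^ e * k) * (3 ^ e * k)))%N.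
Proof.
move=> n1 /(@adm_il_facts e k); set n := (3 ^ e * k)%N in n1 * => -[i01 ls n3].
have [R [cR natE natR]] := modular_ring n1; have n0 := ltnW n1.
have zero u : n %| u -> (u%:R = 0 :> R)%R by rewrite /dvdn => /eqP h; apply: (proj2 (natE u 0%N)); rewrite h mod0n.
have qq : i = 1%N -> n %| n %/ 3 * (n %/ 3) /\ (3 * (n %/ 3) = n)%N.
  move=> i1; case: i01 => [|[_ d9]]; first by rewrite i1.
  have n3' : n = (3 * (n %/ 3))%N by rewrite mulnC divnK //; apply: dvdn_trans d9.
  split=> //; rewrite {1}n3' mulnC dvdn_pmul2l ?dvdn_divRL //; first exact: dvdn_trans d9.
  by move: n0; rewrite {1}n3' muln_gt0.
have i0 u : n %| i * u \/ i = 1%N.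
  by case: i01 => [->|[-> _]]; [left|right].
have l0 u : n %| lnat l * u \/ (3 * (n %/ 3) = n)%N.
  by case: (eqVneq l 0%R) => [->|/n3]; [left; rewrite mul0n dvdn0|right].
have := @G4_model_ring n (i * (n %/ 3)) (lnat l * (n %/ 3)) R cR natE natR.
case; rewrite -?GRing.natrM -?GRing.natrD; try apply: zero.
- case: (i0 (n %/ 3 * (i * (n %/ 3)))%N) => [|i1]; first by rewrite mulnA.
  by rewrite i1 !mul1n; case: (qq i1).
- case: (i0 (n %/ 3 * (lnat l * (n %/ 3)))%N) => [|i1]; first by rewrite mulnA.
  by rewrite i1 mul1n mulnCA dvdn_mull //; case: (qq i1).
- case: (i0 (n %/ 3 * 3)%N) => [|i1]; first by rewrite mulnA !mulnS muln0 addn0 addnA.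
  by rewrite i1 mul1n; case: (qq i1) => _ e1; rewrite -{1}e1 !mulSn mul0n addn0 addnA.
- case: (l0 (n %/ 3 * 3)%N) => [|e1]; first by rewrite mulnA !mulnS muln0 addn0 addnA.
  by rewrite -{1}e1 -!mulnDr dvdn_mull // !mulSn mul0n addn0 addnA.
move=> gT [a [b [rel ge]]]; exists gT, a, b.
have r := G4rel_intro ls n3 rel; split=> //; apply/eqP; rewrite eqn_leq (G4rel_card n0 i01 r) /=.
by apply: leq_trans ge; rewrite [X in X <= _](_ : _ = 3 * n * (2 * n))%N // mulnACA.
Qed.
End G4Exists.

Section SubdirectProduct.
Local Open Scope group_scope.
Variables (n1 n2 : nat) (gT hT : finGroupType) (a1 b1 : gT) (a2 b2 : hT).
Variables (L1 : {group gT}) (L2 : {group hT}).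
Hypotheses (K1 : Kmn_group 3 n1 a1 b1 L1) (K2 : Kmn_group 3 n2 a2 b2 L2).
Hypothesis co : coprime n1 n2.
Local Notation a := ((a1, a2) : (gT * hT)%type).
Local Notation b := ((b1, b2) : (gT * hT)%type).
Hypothesis le : #|mgrp a b| <= 6 * ((n1 * n2) * (n1 * n2)).

Let p1M : {in mgrp a b &, {morph (fun u : gT * hT => u.1) : u v / u * v}}. Proof. by []. Qed.
Let p2M : {in mgrp a b &, {morph (fun u : gT * hT => u.2) : u v / u * v}}. Proof. by []. Qed.
Let p1 := Morphism p1M.
Let p2 := Morphism p2M.
Let im1 : p1 @* mgrp a b = mgrp a1 b1.
Proof.
by rewrite morphim_gen ?subset_gen // morphimU !morphim_set1 ?mem_mgrpl ?mem_mgrpr.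
Qed.
Let im2 : p2 @* mgrp a b = mgrp a2 b2.
Proof.
by rewrite morphim_gen ?subset_gen // morphimU !morphim_set1 ?mem_mgrpl ?mem_mgrpr.
Qed.

Lemma pair_card : #|mgrp a b| = (6 * ((n1 * n2) * (n1 * n2)))%N.
Proof.
apply/eqP; rewrite eqn_leq le /=; apply: dvdn_leq => //.
have d1 : 6 * (n1 * n1) %| #|mgrp a b|.
  have := dvdn_morphim p1 (mgrp a b); rewrite im1 (kmn_cardG K1).
  by rewrite (_ : (3 * ((3 - 1) * n1 * n1) = 6 * (n1 * n1))%N) // !mulnA.
have d2 : 6 * (n2 * n2) %| #|mgrp a b|.
  have := dvdn_morphim p2 (mgrp a b); rewrite im2 (kmn_cardG K2).
  by rewrite (_ : (3 * ((3 - 1) * n2 * n2) = 6 * (n2 * n2))%N) // !mulnA.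
have /dvdnP[q E] : 6 %| #|mgrp a b| by apply: dvdn_trans d1; rewrite dvdn_mulr.
rewrite E mulnC dvdn_pmul2r // in d1; rewrite E mulnC dvdn_pmul2r // in d2.
rewrite E mulnC dvdn_pmul2r // mulnACA Gauss_dvd ?d1 //.
by rewrite coprimeMl !coprimeMr co.
Qed.

Lemma pair_order : #[a] = (2 * (n1 * n2))%N.
Proof.
have aX i : a ^+ i = (a1 ^+ i, a2 ^+ i) by apply: pair_ext; rewrite ?fstgX ?sndgX.
apply/eqP; rewrite eqn_dvd; apply/andP; split.
  rewrite order_dvdn aX; apply/eqP; congr (_, _); apply/eqP.
    by rewrite -order_dvdn (kmn_orda K1) mulnA dvdn_mulr.
  by rewrite -order_dvdn (kmn_orda K2) mulnCA dvdn_mull.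
have /eqP := expg_order a; rewrite aX => /eqP[/eqP h1 /eqP h2].
move: h1 h2; rewrite -!order_dvdn (kmn_orda K1) (kmn_orda K2) => d1 d2.
have /dvdnP[q E] : 2 %| #[a] by apply: dvdn_trans d1; rewrite dvdn_mulr.
rewrite E mulnC dvdn_pmul2r // in d1; rewrite E mulnC dvdn_pmul2r // in d2.
by rewrite E mulnC dvdn_pmul2r // Gauss_dvd // d1.
Qed.

Lemma pair_Kmn : exists L, Kmn_group 3 (n1 * n2) a b L.
Proof.
have aG := mem_mgrpl a b; have bG := mem_mgrpr a b.
have L1im : L1 \subset p1 @* mgrp a b by rewrite im1 (kmn_LG K1).
pose L := (p1 @*^-1 L1)%G.
have bL : b \notin L.
  by apply/negP => /morphpreP[_ /=]; apply/negP; exact: (kmn_bL K1).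
have cL : (3 * #|L| = #|mgrp a b|)%N.
  have kD : 'ker p1 \subset mgrp a b by exact: subsetIl.
  have c1 : #|L| = (#|'ker p1| * #|L1|)%N := card_morphpre L1im.
  have c2 : #|mgrp a b| = (#|'ker p1| * #|mgrp a1 b1|)%N.
    by have := card_morphpre (subxx (p1 @* mgrp a b)); rewrite (morphimGK kD (subxx _)) -im1.
  by rewrite c2 c1 (kmn_cardG K1) (kmn_cardL K1) mulnCA.
exists L; split.
- apply: nt_prime_order => //; last by apply: contraNneq bL => ->; rewrite group1.
  by apply: pair_ext; [exact: (Kmn_bb K1) | exact: (Kmn_bb K2)].
- exact: pair_order.
- rewrite cycle_subG; apply/morphpreP; split=> //=.
  by rewrite -cycle_subG (kmn_HL K1).
- exact: subsetIl.
- apply/eqP; rewrite -(eqn_pmul2l (ltn0Sn 2)) cL pair_card; apply/eqP; rewrite !mulnA.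
  by [].
- by rewrite pair_card !mulnA.
- exact: bL.
apply/trivgP/subsetP=> u /setIP[/cycleP[i ->]]; rewrite /= -cycleJ => /cycleP[s].
rewrite -conjXg => E.
have E1 := congr1 (fun v => v.1) E; have E2 := congr1 (fun v => v.2) E.
rewrite /= !(fstgX, fstgJ) in E1; rewrite /= !(sndgX, sndgJ) in E2.
apply/set1P/pair_ext; rewrite ?fstgX ?sndgX /=.
  have : a1 ^+ i \in <[a1]> :&: <[a1]> :^ b1 by rewrite inE mem_cycle E1 memJ_conjg mem_cycle.
  by rewrite (kmn_TI K1) => /set1P.
have : a2 ^+ i \in <[a2]> :&: <[a2]> :^ b2 by rewrite inE mem_cycle E2 memJ_conjg mem_cycle.
by rewrite (kmn_TI K2) => /set1P.
Qed.
End SubdirectProduct.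

Section RelationPairs.
Local Open Scope group_scope.
Variables (gT hT : finGroupType).

Lemma fstgZ (u : gT * hT) z : (expgz u z).1 = expgz u.1 z.
Proof. by case: z => i; rewrite /= ?fstgV fstgX. Qed.
Lemma sndgZ (u : gT * hT) z : (expgz u z).2 = expgz u.2 z.
Proof. by case: z => i; rewrite /= ?sndgV sndgX. Qed.

Lemma G1rel_pair p e r (u v : gT * hT) :
  G1rel p e r u.1 v.1 -> G1rel p e r u.2 v.2 -> G1rel p e r u v.
Proof.
case/and3P=> /eqP h1 /eqP h2 /eqP h3 /and3P[/eqP k1 /eqP k2 /eqP k3].
by apply/and3P; split; apply/eqP; apply: pair_ext; rewrite ?fstgE ?sndgE.
Qed.

Lemma G2rel_pair p t (u1 u2 u3 u4 : gT * hT) :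
  G2rel p t u1.1 u2.1 u3.1 u4.1 -> G2rel p t u1.2 u2.2 u3.2 u4.2 -> G2rel p t u1 u2 u3 u4.
Proof.
case/and5P=> /eqP h1 /eqP h2 /eqP h3 /eqP h4 /and5P[/eqP h5 /eqP h6 /eqP h7 /eqP h8 /andP[/eqP h9 /eqP h10]].
case/and5P=> /eqP k1 /eqP k2 /eqP k3 /eqP k4 /and5P[/eqP k5 /eqP k6 /eqP k7 /eqP k8 /andP[/eqP k9 /eqP k10]].
apply/and5P; split; last (apply/and5P; split; last (apply/andP; split));
  by apply/eqP; apply: pair_ext; rewrite ?fstgE ?sndgE.
Qed.

Lemma G4rel_pair n i l (u v : gT * hT) :
  G4rel n i l u.1 v.1 -> G4rel n i l u.2 v.2 -> G4rel n i l u v.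
Proof.
case/and5P=> /eqP h1 /eqP h2 /eqP h3 /eqP h4 /eqP h5.
case/and5P=> /eqP k1 /eqP k2 /eqP k3 /eqP k4 /eqP k5.
by apply/and5P; split; apply/eqP; apply: pair_ext; rewrite ?fstgE ?sndgE ?fstgZ ?sndgZ ?fstgE ?sndgE.
Qed.
End RelationPairs.

Section ExactPresentations.
Local Open Scope group_scope.

Lemma presents2_ge (gT hT : finGroupType) (x y : gT) (u v : hT)
    (R : forall hT : finGroupType, hT -> hT -> bool) :
  presents2 x y R -> R hT u v -> #|mgrp u v| <= #|mgrp x y|.
Proof.
move=> [_ p] /p[f [fx fy]]; apply: leq_trans (leq_morphim f _).
rewrite morphim_gen ?subset_gen // morphimU !morphim_set1 ?(mem_mgrpl x y) ?(mem_mgrpr x y) //.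
by rewrite fx fy.
Qed.

Lemma presents4_ge (gT hT : finGroupType) (x y z w : gT) (u1 u2 u3 u4 : hT)
    (R : forall hT : finGroupType, hT -> hT -> hT -> hT -> bool) :
  presents4 x y z w R -> R hT u1 u2 u3 u4 ->
  #|<<[set u1; u2; u3; u4]>>| <= #|<<[set x; y; z; w]>>|.
Proof.
move=> [_ p] /p[f [fx fy fz fw]]; apply: leq_trans (leq_morphim f _).
rewrite morphim_gen ?subset_gen // !morphimU !morphim_set1 ?fx ?fy ?fz ?fw //;
  by apply: mem_gen; rewrite !inE eqxx ?orbT.
Qed.

Lemma G1_presentsP p e r (gT : finGroupType) (x c : gT) : prime p -> unit_generator r (p ^ e.+1) ->
  presents2 x c (G1rel p e r) <->
  G1rel p e r x c /\ #|mgrp x c| = (p ^ e.+1 * (p ^ e * (p - 1)))%N.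
Proof.
move=> pr ug; split=> [P|[rel cG]].
  split; first by case: P.
  apply/eqP; rewrite eqn_leq (G1rel_card pr P.1) /=.
  by have [hT [u [v [ruv <-]]]] := G1_model pr ug; apply: presents2_ge P ruv.
apply: presents2_of_card => //; first by move=> *; apply: G1rel_pair.
by move=> hT u v ruv; rewrite cG; apply: G1rel_card pr ruv.
Qed.

Lemma G2_presentsP p t (gT : finGroupType) (w z c g : gT) : prime p -> unit_generator t p ->
  presents4 w z c g (G2rel p t) <->
  G2rel p t w z c g /\ #|<<[set w; z; c; g]>>| = (p * p * (p * (p - 1)))%N.
Proof.
move=> pr ug; have E : (p * p * (p * (p - 1)) = p * p * p * (p - 1))%N by rewrite !mulnA.
split=> [P|[rel cG]].
  split; first by case: P.
  apply/eqP; rewrite eqn_leq E (G2rel_card pr P.1) /= -E.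
  by have [hT [u1 [u2 [u3 [u4 [ru <-]]]]]] := G2_model pr ug; apply: presents4_ge P ru.
apply: presents4_of_card => //; first by move=> *; apply: G2rel_pair.
by move=> hT u1 u2 u3 u4 ru; rewrite cG E; apply: G2rel_card ru.
Qed.

Lemma G4_presentsP e k i l (gT : finGroupType) (x y : gT) : 1 < 3 ^ e * k -> adm_il e i l ->
  presents2 x y (G4rel (3 ^ e * k) i l) <->
  G4rel (3 ^ e * k) i l x y /\ #|mgrp x y| = (6 * ((3 ^ e * k) * (3 ^ e * k)))%N.
Proof.
move=> n1 ad; have [i01 _ _] := adm_il_facts k ad; have n0 := ltnW n1.
split=> [P|[rel cG]].
  split; first by case: P.
  apply/eqP; rewrite eqn_leq (G4rel_card n0 i01 P.1) /=.
  by have [hT [u [v [ruv <-]]]] := G4_model n1 ad; apply: presents2_ge P ruv.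
apply: presents2_of_card => //; first by move=> *; apply: G4rel_pair.
by move=> hT u v ruv; rewrite cG; apply: G4rel_card ruv.
Qed.

Lemma G3_bound e k : (k * k * 3 ^ e.+1 * (2 * 3 ^ e) = 6 * ((3 ^ e * k) * (3 ^ e * k)))%N.
Proof. by rewrite expnS; ring. Qed.

Lemma G3_model e k u : 0 < k -> ~~ (3 %| k) -> 0 < e -> u * 3 ^ e = 1 %[mod k] ->
  exists (gT : finGroupType) (x y : gT) (L : {group gT}),
    [/\ G3rel k e u x y, #|mgrp x y| = (6 * ((3 ^ e * k) * (3 ^ e * k)))%N
      & Kmn_group 3 (3 ^ e * k) x y L].
Proof.
move=> k0 k3 e0 uE; have pr : prime 3 by [].
have ug := two_unit_generator e.
have [gT [x [c [rel cG]]]] := G1_model pr ug.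
set y := x ^+ (3 ^ e * (3 - 1))./2 * c.
have [L K1] := G1_Kmn pr isT ug rel cG.
have r1 k' u' : G3rel k' e u' x y.
  rewrite -[x]expg1; apply: (G3rel_cyclic k' u' K1) => //.
  - by rewrite (G1_cyc_gen pr isT rel cG); case: (G1_orders pr rel cG).
  - exact: ug.1.
  - by rewrite (G1_cyc_gen pr isT rel cG); case/and3P: rel => _ _ /eqP.
have [k1|k1] := leqP k 1.
  have -> : k = 1%N by apply/eqP; rewrite eqn_leq k1.
  exists gT, x, y, L; rewrite muln1; split=> //; rewrite (kmn_cardG K1).
  by rewrite !mulnA.
have k1' : 1 < 3 ^ 0 * k by rewrite mul1n.
have ad : adm_il 0 0 0%R by [].
have [hT [x' [y' [rel' cG']]]] := G4_model k1' ad.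
rewrite mul1n in rel' cG'; have [L2 K2] := G4_Kmn k0 (or_introl erefl) rel' cG'.
have r2 : G3rel k e u x' y' by exact: G3rel_coprime K2 k0 k3 uE.
have r12 : G3rel k e u (x, x') (y, y') by exact: G3rel_pair.
have co : coprime (3 ^ e) k by rewrite coprimeXl // prime_coprime.
have le := G3rel_card k0 r12; rewrite G3_bound in le.
have cP := pair_card K1 K2 co le; have [L3 K3] := pair_Kmn K1 K2 co le.
by exists _, (x, x'), (y, y'), L3.
Qed.

Lemma G3_presentsP e k u (gT : finGroupType) (x y : gT) :
  0 < k -> ~~ (3 %| k) -> 0 < e -> u * 3 ^ e = 1 %[mod k] ->
  presents2 x y (G3rel k e u) <->
  G3rel k e u x y /\ #|mgrp x y| = (6 * ((3 ^ e * k) * (3 ^ e * k)))%N.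
Proof.
move=> k0 k3 e0 uE; split=> [P|[rel cG]].
  split; first by case: P.
  apply/eqP; rewrite eqn_leq -G3_bound (G3rel_card k0 P.1) /= G3_bound.
  by have [hT [u' [v' [L [ruv <- _]]]]] := G3_model k0 k3 e0 uE; apply: presents2_ge P ruv.
apply: presents2_of_card => //; first by move=> *; apply: G3rel_pair.
by move=> hT u' v' ruv; rewrite cG -G3_bound; apply: G3rel_card ruv.
Qed.

Lemma G3_Kmn e k u (gT : finGroupType) (x y : gT) :
  0 < k -> ~~ (3 %| k) -> 0 < e -> u * 3 ^ e = 1 %[mod k] ->
  presents2 x y (G3rel k e u) -> exists L, Kmn_group 3 (3 ^ e * k) x y L.
Proof.
move=> k0 k3 e0 uE P; have [hT [x' [y' [L [rel cG K]]]]] := G3_model k0 k3 e0 uE.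
have P' : presents2 x' y' (G3rel k e u) by apply/(G3_presentsP _ _ k0 k3 e0 uE).
have [f [inj fx fy]] := presents2_iso P' P.
by apply: map_iso_Kmn K; apply/map_isoP; exists f.
Qed.
End ExactPresentations.

(** * The four families of maps *)

Section IsoInvariants.
Local Open Scope group_scope.

Lemma iota_of_cycle_eq (gT : finGroupType) (a a' : gT) : ~~ odd #[a] -> <[a]> = <[a']> ->
  iota_of a = iota_of a'.
Proof.
move=> ev E; have oE : #[a'] = #[a] by rewrite !orderE E.
have /cycleP[j jE] : a' \in <[a]> by rewrite E cycle_id.
have co : coprime #[a] j by rewrite -generator_coprime /generator -jE E.
rewrite /iota_of oE jE -expgM; apply/eqP; rewrite eq_sym eq_expg_mod_order mulnC half_muln_odd //.
by rewrite -coprime2n; apply: coprime_dvdl co; rewrite dvdn2.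
Qed.

Lemma cyc_gen_cycle_eq (gT : finGroupType) (a a' b : gT) : ~~ odd #[a] -> <[a]> = <[a']> ->
  cyc_gen a b = cyc_gen a' b.
Proof. by move=> ev E; rewrite /cyc_gen (iota_of_cycle_eq ev E). Qed.

Lemma cyc_gen_invariant (gT hT : finGroupType) (a b : gT) (a' b' : hT) s m m' :
  map_iso a b a' b' -> cyc_gen a b ^ (a ^+ s) = cyc_gen a b ^+ m ->
  cyc_gen a' b' ^ (a' ^+ s) = cyc_gen a' b' ^+ m' -> m = m' %[mod #[cyc_gen a' b']].
Proof.
case/map_isoP=> f [inj fa fb] h h'; have fc := map_iso_cyc_gen inj fa fb.
have aG := mem_mgrpl a b; have bG := mem_mgrpr a b.
have cG : cyc_gen a b \in mgrp a b by rewrite groupM ?groupX.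
have : f (cyc_gen a b ^ (a ^+ s)) = f (cyc_gen a b ^+ m) by rewrite h.
rewrite morphJ ?groupX // !morphX // fc fa h' => /eqP.
by rewrite eq_expg_mod_order eq_sym => /eqP.
Qed.

Lemma gcdn_half_shift j h : coprime j (2 * h) -> gcdn (2 * h) (j + h) = (if odd h then 2 else 1)%N.
Proof.
move=> co; have jo : odd j by rewrite -coprimen2; apply: coprime_dvdr co; rewrite dvdn_mulr.
set d := gcdn _ _; have d1 : d %| 2 * h := dvdn_gcdl _ _; have d2 : d %| j + h := dvdn_gcdr _ _.
have d3 : d %| 2 * j.
  have : d %| 2 * (j + h) by apply: dvdn_mull.
  by rewrite mulnDr dvdn_addl.
have cjh : coprime j h by apply: coprime_dvdr co; rewrite dvdn_mull.
have : d %| gcdn (2 * j) (2 * h) by rewrite dvdn_gcd d3.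
rewrite -muln_gcdr (eqP cjh) muln1 => d4.
have d5 : (2 %| d) = odd h.
  by rewrite dvdn_gcd dvdn_mulr //= dvdn2 oddD jo /= negbK.
have : d <= 2 by apply: dvdn_leq.
move: d4 d5; move: d {d1 d2 d3} => [|[|[|]]] //; case: (odd h) => //.
Qed.

Lemma odd_half_pred p : odd p -> odd (p - 1)./2 = ~~ (p %% 4 == 1%N).
Proof.
move=> p2; rewrite {1}(divn_eq p 4); have : odd (p %% 4) by rewrite odd_mod.
have : p %% 4 < 4 by rewrite ltn_mod.
have e (q : nat) : (q * 4 = (2 * q).*2)%N by rewrite -mul2n mulnA mulnC.
case: (p %% 4) => [|[|[|[|]]]] //= _ _; rewrite e.
  by rewrite addnK doubleK oddM.
have -> : ((2 * (p %/ 4)).*2 + 3 - 1 = (2 * (p %/ 4) + 1).*2)%N by rewrite -!mul2n; lia.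
by rewrite doubleK oddD oddM.
Qed.

Lemma half_pred_muln p e : odd p -> (p ^ e * (p - 1)./2 = (p ^ e * (p - 1))./2)%N.
Proof.
move=> p2; have h : ((p - 1)./2.*2 = p - 1)%N.
  by rewrite halfK; case: p p2 => // q /=; rewrite subn1 /= => /negPf ->; rewrite subn0.
by rewrite -{2}h -muln2 mulnA muln2 doubleK.
Qed.
End IsoInvariants.

Section AffineOrder.
Local Open Scope group_scope.
Variables (gT : finGroupType) (y c : gT) (s : nat).
Hypothesis cy : c ^ y = c ^+ s.

Lemma affine_expg m : (y * c) ^+ m = y ^+ m * c ^+ (\sum_(i < m) s ^ i).
Proof.
have cyX i : c ^ (y ^+ i) = c ^+ (s ^ i).
  elim: i => [|i IH]; first by rewrite conjg1 expg1.
  by rewrite expgSr conjgM IH conjXg cy -expgM mulnC -expnSr.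
elim: m => [|m IH]; first by rewrite big_ord0 !expg0 mulg1.
rewrite expgS IH big_ord_recr /= addnC expgD mulgA -(mulgA y) (conjgC c) cyX.
by rewrite !mulgA -expgS.
Qed.

Lemma affine_order : (forall i, y ^+ i \in <[c]> -> y ^+ i = 1) -> 0 < s -> coprime (s - 1) #[c] ->
  #[y * c] = #[y].
Proof.
move=> TI s0 co; apply/eqP; rewrite eqn_dvd !order_dvdn; apply/andP; split.
  rewrite affine_expg expg_order mul1g -order_dvdn.
  set S := \sum_(i < _) _; suff : #[c] %| (s - 1) * S.
    by rewrite Gauss_dvdr // coprime_sym.
  have -> : ((s - 1) * S = s ^ #[y] - 1)%N.
    rewrite -[(s ^ _ - 1)%N]/(s ^ #[y] - 1)%N /S; have := @predn_exp s #[y].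
    by rewrite -!subn1 => ->.
  rewrite -eqn_mod_dvd ?expn_gt0 ?s0 // -eq_expg_mod_order expg1.
  have cyX i : c ^ (y ^+ i) = c ^+ (s ^ i).
    elim: i => [|i IH]; first by rewrite conjg1 expg1.
    by rewrite expgSr conjgM IH conjXg cy -expgM mulnC -expnSr.
  by rewrite -cyX expg_order conjg1.
have := affine_expg #[y * c]; rewrite expg_order => e.
apply/eqP/TI; have -> : y ^+ #[y * c] = (c ^+ (\sum_(i < #[y * c]) s ^ i))^-1.
  by apply: (mulIg (c ^+ (\sum_(i < #[y * c]) s ^ i))); rewrite -e mulVg.
by rewrite groupV mem_cycle.
Qed.
End AffineOrder.

Section FamilyM1.
Local Open Scope group_scope.
Variables (p e r : nat).
Hypotheses (pr : prime p) (p5 : 4 < p) (ug : unit_generator r (p ^ e.+1)).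
Local Notation n := (p ^ e * (p - 1))%N.

Let p2 : odd p. Proof. by case: (even_prime pr) p5 => // ->. Qed.
Let p1 : 1 < p. Proof. exact: prime_gt1. Qed.
Let N1 : 1 < p ^ e.+1. Proof. by rewrite -(expn0 p) ltn_exp2l. Qed.
Let tE : totient (p ^ e.+1) = n. Proof. by rewrite totient_pfactor //= mulnC subn1. Qed.
Let n0 : 0 < n. Proof. by rewrite -tE totient_gt0 ltnW. Qed.
Let h2 : (n = 2 * n./2)%N.
Proof. by rewrite mul2n halfK oddM oddB ?(ltnW p1) // p2 andbF subn0. Qed.

Lemma M1_facts j (gT : finGroupType) (a b : gT) : coprime j n -> isM1 p e r j a b ->
  (exists L, Kmn_group p (p ^ e) a b L) /\
  [/\ #[cyc_gen a b] = (p ^ e.+1)%N, cyc_gen a b ^ a = cyc_gen a b ^+ (r ^ j) &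
      #[a * b] = if p %% 4 == 1%N then n else n./2].
Proof.
move=> cj [x [c [E /(G1_presentsP x c pr ug)[rel cG] aE bE]]].
have [oc ox TI] := G1_orders pr rel cG; have [L K] := G1_Kmn pr p2 ug rel cG.
have cyE : <[x]> = <[a]> by rewrite aE cycle_expg_coprime ?ox.
rewrite -bE in K.
have ev : ~~ odd #[x] by rewrite ox h2 mul2n odd_double.
have cgE : cyc_gen a b = c.
  by rewrite -(cyc_gen_cycle_eq b ev cyE) bE (G1_cyc_gen pr p2 rel cG).
have xX := G1_cxX rel.
split; first by exists L; apply: Kmn_cycle_eq K.
rewrite cgE; split=> //; first by rewrite aE xX.
have rp i : r ^ i = 1 %[mod p] -> p - 1 %| i.
  move=> h; have := @expn_mod_prime_pow p (r ^ i) e (ltnW p1) h; rewrite -expnM.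
  move=> /(unit_generator_dvd (ltnW N1) ug); rewrite tE mulnC dvdn_pmul2r //.
  by rewrite expn_gt0 ltnW.
have r0 : 0 < r.
  by case: (posnP r) ug => // -> [] /=; rewrite /coprime gcd0n => /eqP h; move: N1; rewrite h.
rewrite aE bE mulgA -expgD (affine_order (xX _)) ?expn_gt0 ?r0 //.
- rewrite orderXgcd ox {1 2}h2 gcdn_half_shift -?h2 //.
  have oh : odd n./2 = ~~ (p %% 4 == 1%N).
    by rewrite -(odd_half_pred p2) -(half_pred_muln e p2) oddM oddX p2 orbT.
  by rewrite oh; case: (p %% 4 == 1%N); rewrite /= ?divn1 ?divn2.
- move=> i iN; have : x ^+ (j + n./2) ^+ i \in <[c]> :&: <[x]> by rewrite inE iN -expgM mem_cycle.
  by rewrite TI => /set1P.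
rewrite oc coprimeXr // coprime_sym prime_coprime //; apply/negP => d.
have /rp : r ^ (j + n./2) = 1 %[mod p] by apply/eqP; rewrite eqn_mod_dvd ?expn_gt0 ?r0.
move=> d1; have : p - 1 %| 2 * (j + n./2) by apply: dvdn_mull.
rewrite mulnDr -h2 dvdn_addl; last exact: dvdn_mull.
rewrite Gauss_dvdl.
  by move=> /dvdn_leq => /(_ isT); lia.
by rewrite coprime_sym; apply: coprime_dvdr cj; rewrite dvdn_mull.
Qed.

Lemma M1_converse (gT : finGroupType) (a b : gT) (L : {group gT}) :
  Kmn_group p (p ^ e) a b L -> cyclic_type p e a b ->
  exists2 j, coprime j n & isM1 p e r j a b.
Proof.
move=> K cyc; have [s us sE] := cyclic_multiplier pr p2 K cyc.
have [j' j'E] := unit_generator_log N1 us ug.1.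
have cj' := log_coprime N1 us ug j'E; rewrite tE in cj'.
have oa : #[a] = n by rewrite (kmn_orda K) mulnC.
have ev : ~~ odd #[a] by rewrite oa h2 mul2n odd_double.
set x := a ^+ j'; have cyE : <[x]> = <[a]> by apply: cycle_expg_coprime; rewrite oa.
have ox : #[x] = n by rewrite -oa !orderE cyE.
have /cycleP[j jE] : a \in <[x]> by rewrite cyE cycle_id.
exists j.
  by rewrite coprime_sym -ox -generator_coprime /generator -jE cyE.
set c := cyc_gen a b in sE; have oc : #[c] = (p ^ e.+1)%N := cyc.1.
have cX i : c ^ (a ^+ i) = c ^+ (s ^ i).
  elim: i => [|i IH]; first by rewrite conjg1 expg1.
  by rewrite expgSr conjgM IH conjXg sE -expgM mulnC -expnSr.
have bE : b = x ^+ n./2 * c.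
  have -> : x ^+ n./2 = iota_of a by rewrite -{1}ox -[LHS]/(iota_of x) (iota_of_cycle_eq _ cyE) ?ox -?oa.
  by rewrite /c /cyc_gen mulgA iota_sq // mul1g.
have E : mgrp x c = mgrp a b.
  rewrite (mgrp_cycle_eq c cyE); apply/eqP; rewrite -val_eqE eqEsubset !mgrp_sub !mem_mgrpl /=.
  rewrite {1}/c {1}/cyc_gen /iota_of groupM ?groupX ?mem_mgrpl ?mem_mgrpr //=.
  have : (iota_of a) ^-1 * c \in mgrp a c by rewrite groupM ?groupV ?groupX ?mem_mgrpl ?mem_mgrpr.
  by rewrite /c /cyc_gen mulKg.
exists x, c; split=> //; apply/G1_presentsP => //; split.
  apply/and3P; split; apply/eqP.
  - by rewrite -ox expg_order.
  - by rewrite -oc expg_order.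
  - by apply/eqP; rewrite cX eq_expg_mod_order oc j'E.
by rewrite E (kmn_cardG K) expnS; ring.
Qed.

Lemma M1_iso j (gT hT : finGroupType) (a b : gT) (a' b' : hT) :
  isM1 p e r j a b -> isM1 p e r j a' b' -> map_iso a b a' b'.
Proof.
move=> [x [c [E P aE bE]]] [x' [c' [E' P' aE' bE']]].
have [f [inj fx fc]] := presents2_iso P P'.
have xG := mem_mgrpl x c; have cG := mem_mgrpr x c.
apply: map_iso_intro E inj _ _; first by rewrite aE aE' -fx morphX.
by rewrite bE bE' -fx -fc morphM ?groupX // morphX.
Qed.

Lemma M1_inj j j' (gT hT : finGroupType) (a b : gT) (a' b' : hT) :
  coprime j n -> coprime j' n -> isM1 p e r j a b -> isM1 p e r j' a' b' ->
  map_iso a b a' b' -> j = j' %[mod n].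
Proof.
move=> cj cj' /(M1_facts cj)[_ [_ C _]] /(M1_facts cj')[_ [oc' C' _]] I.
have := cyc_gen_invariant (s := 1) I; rewrite !expg1 => /(_ _ _ C C'); rewrite oc' => h.
by rewrite -tE; apply: unit_generator_eq_exp N1 ug h.
Qed.

Lemma M1_mod j j' (gT : finGroupType) (a b : gT) : j = j' %[mod n] ->
  isM1 p e r j a b -> isM1 p e r j' a b.
Proof.
move=> h [x [c [E P aE bE]]]; exists x, c; split=> //; rewrite aE.
have xn : x ^+ n = 1 by case/and3P: P.1 => /eqP.
by rewrite -(expg_mod j xn) h expg_mod.
Qed.

Lemma M1_chiral j (gT : finGroupType) (a b : gT) : coprime j n -> isM1 p e r j a b -> chiral a b.
Proof.
move=> cj M I.
have M' : isM1 p e r (n.-1 * j) a^-1 b.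
  case: M => x [c [E P aE bE]]; exists x, c; split=> //.
    by rewrite E; apply: mgrp_cycle_eq; rewrite cycleV.
  have xn : x ^+ n = 1 by case/and3P: P.1 => /eqP.
  apply/eqP; rewrite eq_invg_mul aE -expgD addnC -mulSnr prednK //.
  by rewrite expgM xn expg1n.
have cj' : coprime (n.-1 * j) n by rewrite coprimeMl coprimePn // cj.
have := M1_inj cj cj' M M' I => h.
have : n %| 2 * j.
  have : j + j = n.-1 * j + j %[mod n] by rewrite -modnDml h modnDml.
  by rewrite -mulSnr prednK // modnMr addnn -mul2n => /eqP.
rewrite Gauss_dvdl; last by rewrite coprime_sym.
move=> /dvdn_leq => /(_ isT); rewrite leqNgt => /negP; apply.
have : 1 * 4 <= p ^ e * (p - 1) by apply: leq_mul; [rewrite expn_gt0 ltnW|lia].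
by apply: leq_trans.
Qed.

Lemma M1_exists j : coprime j n -> exists (gT : finGroupType) (a b : gT), isM1 p e r j a b.
Proof.
move=> cj; have [gT [x [c [rel cG]]]] := G1_model pr ug.
exists gT, (x ^+ j), (x ^+ n./2 * c), x, c; split=> //; last exact/G1_presentsP.
have [oc ox _] := G1_orders pr rel cG.
rewrite -(G1_mgrp p e x c); symmetry; apply: mgrp_cycle_eq.
by apply: cycle_expg_coprime; rewrite ox.
Qed.
End FamilyM1.

Section FamilyM2.
Local Open Scope group_scope.
Variables (p t : nat).
Hypotheses (pr : prime p) (p5 : 4 < p) (ug : unit_generator t p).
Local Notation n := (p - 1)%N.

Let p2 : odd p. Proof. by case: (even_prime pr) p5 => // ->. Qed.
Let p1 : 1 < p. Proof. exact: prime_gt1. Qed.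
Let tE : totient p = n. Proof. by rewrite totient_prime // subn1. Qed.
Let n0 : 0 < n. Proof. by rewrite subn_gt0. Qed.
Let h2 : (n = 2 * n./2)%N.
Proof. by rewrite mul2n halfK oddB ?(ltnW p1) // p2 subn0. Qed.
Let cop : coprime p n. Proof. by rewrite subn1 coprimenP // ltnW. Qed.

Lemma M2_order j (gT : finGroupType) (w z c g : gT) : coprime j n -> G2rel p t w z c g ->
  #|<<[set w; z; c; g]>>| = (p * p * (p * (p - 1)))%N ->
  #[w * g ^+ j * (c * g ^+ n./2)] = if p %% 4 == 1%N then (p * (p - 1))%N else (p * (p - 1))./2.
Proof.
move=> cj rel cG.
have [oz oc TIzc] := G2_orders pr rel cG; have [ow og TIwg] := G2_orders' pr rel cG.
have wp : w ^+ p = 1 by rewrite -ow expg_order.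
have zp : z ^+ p = 1 by rewrite -oz expg_order.
have half := G2_half pr p2 ug rel cG; have cX := G2_cgX rel.
case/and5P: (rel) => _ _ _ _ /and5P[/commgP wz _ /eqP wc /eqP zc /andP[/eqP wg /eqP zg]].
have {}wg : commute w g by apply/commgP/conjg_fixP.
have {}zc : commute z c by apply/commgP/conjg_fixP.
set h := n./2 in half *; set y := g ^+ (j + h); set s := y * c^-1.
have wsz : w * (g ^+ j * (c * g ^+ h)) = w * s.
  by rewrite /s /y expgD (conjgC c) half -!mulgA.
have t0 : 0 < t.
  by case: (posnP t) ug => // -> []; rewrite /coprime gcd0n => /eqP t00; move: p1; rewrite t00.
have cyV : c^-1 ^ y = c^-1 ^+ (t ^ (j + h)) by rewrite conjVg cX expgVn.
have rp i : t ^ i = 1 %[mod p] -> n %| i.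
  by move/(unit_generator_dvd (ltnW p1) ug); rewrite tE.
have c1 : c != 1 by rewrite -order_eq1 oc neq_ltn p1 orbT.
have TIcg i : g ^+ i \in <[c]> -> g ^+ i = 1.
  move=> /cycleP[u E]; have cc : commute (g ^+ i) c by rewrite E; apply/commute_sym/commuteX.
  have : c ^ (g ^+ i) = c ^+ 1 by rewrite expg1; apply/conjg_fixP/commgP/commute_sym.
  rewrite cX => /eqP; rewrite eq_expg_mod_order oc => /eqP /rp /dvdnP[v ->].
  by rewrite mulnC expgM -og expg_order expg1n.
have os : #[s] = #[y].
  apply: (affine_order cyV).
  - by move=> i; rewrite cycleV -expgM; apply: TIcg.
  - by rewrite expn_gt0 t0.
  rewrite orderV oc coprime_sym prime_coprime //; apply/negP => d.
  have /rp : t ^ (j + h) = 1 %[mod p] by apply/eqP; rewrite eqn_mod_dvd ?expn_gt0 ?t0.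
  move=> d1; have : n %| 2 * (j + h) by apply: dvdn_mull.
  rewrite mulnDr -h2 dvdn_addl // Gauss_dvdl; last by rewrite coprime_sym.
  by move=> /dvdn_leq => /(_ isT); clear -p5; lia.
have oy : #[y] = if p %% 4 == 1%N then n else h.
  rewrite orderXgcd og {1 2}h2 gcdn_half_shift -?h2 //.
  by rewrite /h (odd_half_pred p2); case: (p %% 4 == 1%N); rewrite /= ?divn1 ?divn2.
set o := #[y] in oy os.
have o_n : o %| n by rewrite -og /o orderXdvd.
have o0 : 0 < o by apply: order_gt0.
have -> : (if p %% 4 == 1%N then (p * (p - 1))%N else (p * (p - 1))./2) = (p * o)%N.
  rewrite oy; case: ifP => _ //; have := half_pred_muln 1 p2; rewrite expn1 => <-.
  by [].
have copo : coprime p o by apply: coprime_dvdr o_n cop.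
rewrite -mulgA wsz; apply/eqP; rewrite eqn_dvd; apply/andP; split.
  (* modulo <z> the factors w and s commute *)
  pose Z := <[z]>%G.
  have WN (v : gT) : z ^ v \in <[z]> -> v \in 'N(Z).
    by move=> h'; rewrite inE conj_cycle_norm.
  have wN : w \in 'N(Z).
    by apply: WN; have /conjg_fixP -> : [~ z, w] == 1 by [apply/commgP]; exact: cycle_id.
  have cN : c \in 'N(Z).
    by apply: WN; have /conjg_fixP -> : [~ z, c] == 1 by [apply/commgP]; exact: cycle_id.
  have gN : g \in 'N(Z) by apply: WN; rewrite zg mem_cycle.
  have sN : s \in 'N(Z) by rewrite groupM ?groupX ?groupV.
  have cws : commute (coset Z w) (coset Z s).
    have cwc : commute (coset Z w) (coset Z c).
      apply/commgP/conjg_fixP; rewrite -coset_J // wc (coset_M wN (subsetP (normG Z) z (cycle_id z))).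
      by rewrite (coset_id (cycle_id z)) mulg1.
    have cwg : commute (coset Z w) (coset Z g).
      by apply/commgP/conjg_fixP; rewrite -coset_J //; congr (coset Z _); apply/conjg_fixP/commgP.
    have yN : y \in 'N(Z) by apply: groupX.
    rewrite /s (coset_M yN (groupVr cN)) (coset_V cN) (coset_X _ gN).
    by apply: commuteM; [apply: commuteX|apply: commuteV].
  have : (w * s) ^+ o * w ^- o \in Z.
    apply: coset_idr; first by rewrite groupM ?groupV ?groupX // groupM.
    have wsN : w * s \in 'N(Z) by rewrite groupM.
    rewrite (coset_M (groupX o wsN) (groupVr (groupX o wN))) (coset_V (groupX o wN)).
    rewrite (coset_X o wsN) (coset_X o wN) (coset_M wN sN) (expgMn _ cws) -(coset_X _ sN) -os.
    rewrite expg_order morph1 mulg1 mulgV.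
    by [].
  case/cycleP=> u E; have -> : (p * o = o * p)%N by rewrite mulnC.
  rewrite order_dvdn expgM -[(w * s) ^+ o](mulgKV (w ^+ o)) E expgMn; last by commute_tac.
  by rewrite -!expgM ![(_ * p)%N]mulnC !expgM zp wp !expg1n mulg1.
(* modulo V = <z, c> one has w s = w y, and <w> <g> meets V trivially *)
have := expg_order (w * s); set m := #[w * s] => E.
pose V := (<[z]> <*> <[c]>)%G; pose W := (<[w]> <*> <[g]>)%G.
have WV : W \subset 'N(V) := G2_norm rel.
have wW : w \in W by rewrite (subsetP (joing_subl _ _)) ?cycle_id.
have gW : g \in W by rewrite (subsetP (joing_subr _ _)) ?cycle_id.
have cV : c \in V by rewrite (subsetP (joing_subr _ _)) ?cycle_id.
have yW : y \in W by rewrite groupX.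
have wyV : w * y \in 'N(V) by rewrite (subsetP WV) // groupM.
have wy1 : (w * y) ^+ m = 1.
  have : (w * y) ^+ m \in V :&: W.
    apply/setIP; split; last by rewrite groupX ?groupM.
    apply: coset_idr; first exact: groupX.
    have cV' : c^-1 \in 'N(V) by rewrite (subsetP (normG V)) // groupV.
    have e1 : coset V (w * y) = coset V (w * s).
      rewrite /s mulgA (coset_M wyV cV') (coset_id (groupVr cV)) mulg1.
      by [].
    have wsV : w * s \in 'N(V) by rewrite /s mulgA groupM.
    by rewrite (coset_X _ wyV) e1 -(coset_X _ wsV) E morph1.
  by rewrite [V :&: W](G2_TI pr rel cG) => /set1P.
have cwy : commute w y by apply: commuteX.
by rewrite -ow -[o]/#[y] -orderM ?ow // order_dvdn wy1.
Qed.

Lemma M2_facts j (gT : finGroupType) (a b : gT) : coprime j n -> isM2 p t j a b ->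
  (exists L, Kmn_group p p a b L) /\
  [/\ #[cyc_gen a b] = p, cyc_gen a b ^ (a ^+ p) = cyc_gen a b ^+ (t ^ j) &
      #[a * b] = if p %% 4 == 1%N then (p * (p - 1))%N else (p * (p - 1))./2].
Proof.
move=> cj [w [z [c [g [E /(G2_presentsP w z c g pr ug)[rel cG] -> ->]]]]].
split; first exact: (G2_Kmn pr p2 ug cj rel cG).
split.
- by rewrite (G2_cyc_gen pr p2 ug cj rel cG) orderV; case: (G2_orders pr rel cG).
- exact: (G2_conj pr p2 ug cj rel cG).
- exact: (M2_order cj rel cG).
Qed.

Lemma M2_iso j (gT hT : finGroupType) (a b : gT) (a' b' : hT) :
  isM2 p t j a b -> isM2 p t j a' b' -> map_iso a b a' b'.
Proof.
move=> [w [z [c [g [E P aE bE]]]]] [w' [z' [c' [g' [E' P' aE' bE']]]]].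
have [f [inj [fw fz fc fg]]] := presents4_iso P P'.
have m1 u : u \in [set w; z; c; g] -> u \in <<[set w; z; c; g]>> by apply: mem_gen.
have [wG cG gG] : [/\ w \in <<[set w; z; c; g]>>, c \in <<[set w; z; c; g]>>
    & g \in <<[set w; z; c; g]>>] by split; apply: m1; rewrite !inE eqxx ?orbT.
have EG : <<[set w; z; c; g]>>%G = mgrp a b by apply: val_inj.
apply: (map_iso_intro (f := f) EG inj).
  by rewrite aE aE' -fw -fg morphM ?groupX // morphX.
by rewrite bE bE' -fc -fg morphM ?groupX // morphX.
Qed.

Lemma M2_inj j j' (gT hT : finGroupType) (a b : gT) (a' b' : hT) :
  coprime j n -> coprime j' n -> isM2 p t j a b -> isM2 p t j' a' b' ->
  map_iso a b a' b' -> j = j' %[mod n].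
Proof.
move=> cj cj' /(M2_facts cj)[_ [_ C _]] /(M2_facts cj')[_ [oc' C' _]] I.
have := cyc_gen_invariant I C C'; rewrite oc' => h.
by rewrite -tE; apply: unit_generator_eq_exp p1 ug h.
Qed.

Lemma M2_mod j j' (gT : finGroupType) (a b : gT) : j = j' %[mod n] ->
  isM2 p t j a b -> isM2 p t j' a b.
Proof.
move=> h [w [z [c [g [E P aE bE]]]]]; exists w, z, c, g; split=> //; rewrite aE.
have gn : g ^+ n = 1 by case/and5P: P.1 => _ _ _ /eqP.
by rewrite -(expg_mod j gn) h expg_mod.
Qed.

Lemma M2_chiral j (gT : finGroupType) (a b : gT) : coprime j n -> isM2 p t j a b -> chiral a b.
Proof.
move=> cj M I; have [[L K] [oc C _]] := M2_facts cj M.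
have oa := kmn_orda K.
have ev : ~~ odd #[a] by rewrite oa h2 -mulnA mul2n odd_double.
have cgE : cyc_gen a^-1 b = cyc_gen a b by rewrite (cyc_gen_cycle_eq b ev (esym (cycleV a))).
set c := cyc_gen a b in cgE oc C.
have CX i : c ^ ((a ^+ p) ^+ i) = c ^+ (t ^ (j * i)).
  elim: i => [|i IH]; first by rewrite muln0 conjg1 expg1.
  by rewrite expgSr conjgM IH conjXg C -expgM mulnC -expnD mulnS addnC.
have C' : cyc_gen a^-1 b ^ (a^-1 ^+ p) = cyc_gen a^-1 b ^+ (t ^ (j * (n - 1))).
  rewrite cgE -CX; congr (c ^ _); rewrite expgVn; apply/eqP.
  rewrite eq_invg_mul -expgS subn1 prednK // -expgM mulnC.
  by rewrite -oa expg_order.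
have := cyc_gen_invariant I C C'; rewrite cgE oc => h.
have := unit_generator_eq_exp p1 ug h; rewrite tE => h3.
have : n %| 2 * j.
  have : j + j = j * (n - 1) + j %[mod n] by rewrite -modnDml h3 modnDml.
  rewrite -[X in _ = _ + X %[mod _]]muln1 -mulnDr subnK // modnMl addnn -mul2n.
  by move/eqP.
rewrite Gauss_dvdl; last by rewrite coprime_sym.
by move=> /dvdn_leq => /(_ isT); clear -p5; lia.
Qed.

Lemma M2_exists j : coprime j n -> exists (gT : finGroupType) (a b : gT), isM2 p t j a b.
Proof.
move=> cj; have [gT [w [z [c [g [rel cG]]]]]] := G2_model pr ug.
exists gT, (w * g ^+ j), (c * g ^+ n./2), w, z, c, g; split=> //; last exact/G2_presentsP.
exact: (G2_mgrp pr cj rel cG).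
Qed.

Lemma M2_converse (gT : finGroupType) (a b : gT) (L : {group gT}) :
  Kmn_group p p a b L -> cyc_gen a b ^+ p = 1 -> exists2 j, coprime j n & isM2 p t j a b.
Proof.
move=> K; have p3 : 2 < p by apply: ltn_trans p5.
have K1 : Kmn_group p (p ^ 1) a b L by rewrite expn1.
have C := central_layer_prime pr p3 (isT : 0 < 1) K1.
have k0 := quotient_kmn_pow pr p3 K1.
have nodd : odd (p ^ 1) by rewrite expn1.
have n10 : 0 < p ^ 1 by rewrite expn1 ltnW.
have cb := (cyclic_type_base pr p2 k0).2.
have [rho [s [u ca]]] := cyc_ca pr p2 K1 C cb.
have [l za] := cl_za C erefl.
have cEE : cyc_gen a b = iota_of a * b by [].
have bb := Kmn_bb K; have ioa := iota_commute a.
have ioio : iota_of a * iota_of a = 1 := Kmn_ioio pr p2 K (ltnW p1).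
move=> cp.
have on1 := layer_on1 K1 p3 pr (dvdn_exp (isT : 0 < 1) (dvdnn p)).
have ca2 := step_ca pr p2 cEE bb ioio ioa on1 (layer_zTI pr p2 K1 C) (layer_comm_n1z C)
  (layer_n1io _ _ _) (layer_zio pr p2 K1 n10 C nodd) (layer_zb K1) (layer_n1b' _ _ _ _) ca.
have zc := step_zc cEE (layer_zio pr p2 K1 n10 C nodd) (layer_zb K1).
have oz := layer_oz pr p2 K1 C.
have c1z := layer_comm_n1z C.
have qE : (p ^ 1 %/ p = 1)%N by rewrite expn1 divnn ltnW.
rewrite qE !expg1 in za ca2 zc oz c1z.
have xc := Kmn_xc p a b; set c := cyc_gen a b in cp cEE ca ca2 zc xc.
set x := a ^+ n in za ca2 zc oz c1z xc; set z := x^-1 * x ^ b in za ca2 zc oz c1z.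
have {}xc : x ^ c = x * z by rewrite xc /z mulKVg.
have oa : #[a] = (n * p)%N := kmn_orda K.
have zp : z ^+ p = 1 by rewrite -oz expg_order.
have xp : x ^+ p = 1 by rewrite /x -expgM -oa expg_order.
have zl : z ^+ l = z ^+ rho.
  have zx : z ^ x = z by apply/conjg_fixP/commgP/commute_sym.
  have xca : x ^ (c ^ a) = x * z ^+ l.
    have xa : x ^ a = x by apply/conjg_fixP/commgP/commute_sym/commuteX.
    by rewrite -{1}xa -conjJg xc conjMg xa za.
  have xcX i : x ^ (c ^+ i) = x * z ^+ i.
    elim: i => [|i IH]; first by rewrite conjg1 mulg1.
    rewrite expgSr conjgM IH conjMg xc conjXg.
    have -> : z ^ c = z by apply/conjg_fixP/commgP.
    by rewrite -mulgA -expgS.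
  have xzu : x ^ (z ^+ u) = x by apply/conjg_fixP/commgP/commuteX.
  apply: (mulgI x); rewrite -xca ca2 conjgM xcX conjMg xzu conjXg.
  by have -> : z ^ (z ^+ u) = z by apply/conjg_fixP/commgP/commuteX.
have c1 : c != 1.
  apply: contraTneq (p1) => c1; rewrite -oz; suff -> : z = 1 by rewrite order1.
  by apply: (mulgI x); rewrite -xc c1 conjg1 mulg1.
have oc : #[c] = p by apply: nt_prime_order.
have caX i : c ^ (a ^+ i.+1) = c ^+ (rho ^ i.+1) * z ^+ (i.+1 * rho ^ i * u).
  elim: i => [|i IH]; first by rewrite expg1 expn1 expn0 !mul1n.
  have cz v v' : commute (c ^+ v) (z ^+ v') by apply/commuteX2/commute_sym.
  rewrite expgSr conjgM IH conjMg conjXg ca2 expgMn // conjXg za zl -!expgM -mulgA -expgD.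
  congr (_ * _).
  congr (z ^+ _); rewrite !expnS; ring.
have cg' : c ^ (a ^+ p) = c ^+ rho.
  rewrite -(prednK (ltnW p1)) caX prednK ?(ltnW p1) // -mulnA expgM zp expg1n mulg1.
  by apply/eqP; rewrite eq_expg_mod_order oc fermat_little.
have zg' : z ^ (a ^+ p) = z ^+ rho.
  have zaX i : z ^ (a ^+ i) = z ^+ (rho ^ i).
    elim: i => [|i IH]; first by rewrite conjg1.
    by rewrite expgSr conjgM IH conjXg za zl -expgM -expnS.
  by rewrite zaX; apply/eqP; rewrite eq_expg_mod_order oz fermat_little.
set g1 := a ^+ p in cg' zg'.
have og1 : #[g1] = n by rewrite /g1 orderXdiv oa ?dvdn_mull // mulnK // ltnW.
have cgX i : c ^ (g1 ^+ i) = c ^+ (rho ^ i).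
  elim: i => [|i IH]; first by rewrite conjg1.
  by rewrite expgSr conjgM IH conjXg cg' -expgM -expnS.
have zgX i : z ^ (g1 ^+ i) = z ^+ (rho ^ i).
  elim: i => [|i IH]; first by rewrite conjg1.
  by rewrite expgSr conjgM IH conjXg zg' -expgM -expnS.
have bE : b = c^-1 * iota_of a.
  have bV : b^-1 = b by apply/eqP; rewrite eq_invg_mul bb.
  have iV : (iota_of a)^-1 = iota_of a by apply/eqP; rewrite eq_invg_mul ioio.
  by rewrite cEE invMg bV iV -mulgA ioio mulg1.
have ugr : unit_generator rho p.
  split.
    rewrite coprime_sym prime_coprime //; apply/negP=> /dvdnP[v E].
    move: c1; rewrite -(conjg_eq1 c g1) cg' E mulnC expgM cp expg1n.
    by rewrite eqxx.
  move=> k kp E; rewrite tE.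
  have cgk : commute (g1 ^+ k) c.
    apply/commute_sym/commgP/conjg_fixP; rewrite cgX -[RHS]expg1.
    by apply/eqP; rewrite eq_expg_mod_order oc; apply/eqP.
  have cgb : commute (g1 ^+ k) b.
    rewrite bE; apply: commuteM; first exact: commuteV.
    by apply/commute_sym/commuteX; rewrite /g1; apply: commuteX.
  have : g1 ^+ k \in <[a]> :&: <[a]> :^ b.
    have h : g1 ^+ k \in <[a]> by rewrite groupX ?mem_cycle.
    rewrite inE h; have <- : (g1 ^+ k) ^ b = g1 ^+ k by apply/conjg_fixP/commgP.
    by rewrite memJ_conjg.
  rewrite (kmn_TI K) => /set1P/eqP; rewrite -order_dvdn og1 => /dvdn_leq; exact.
have [j' tj] := unit_generator_log p1 ugr ug.1.
have cj' : coprime j' n by rewrite -tE; apply: log_coprime p1 ugr ug tj.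
have [j jE] : exists j, j' * j = 1 %[mod n].
  have j0 : 0 < j' by case: (posnP j') cj' => // ->; rewrite /coprime gcd0n; lia.
  have [v w vw _] := egcdnP n j0; exists v.
  by rewrite mulnC vw (eqP cj') -modnDml modnMl add0n.
have cj : coprime j n.
  have : coprime (j' * j) n by rewrite -coprime_modl jE coprime_modl coprime1n.
  by rewrite coprimeMl => /andP[].
exists j => //; exists x^-1, z, c^-1, (g1 ^+ j').
have gj : (g1 ^+ j') ^+ j = g1.
  by rewrite -expgM -[RHS]expg1; apply/eqP; rewrite eq_expg_mod_order og1 jE.
have gh : (g1 ^+ j') ^+ n./2 = iota_of a.
  have -> : iota_of a = g1 ^+ n./2.
    by rewrite /iota_of /g1 oa -expgM; congr (a ^+ _); rewrite {1}h2 -mulnA mul2n doubleK mulnC.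
  rewrite -expgM; apply/eqP; rewrite eq_expg_mod_order og1; apply/eqP.
  have o : odd j'.
    rewrite -coprimen2; apply: coprime_dvdr cj'; by rewrite h2 dvdn_mulr.
  rewrite -[j']odd_double_half o mulnDl mul1n -muln2 -mulnA -h2 addnC.
  by rewrite modnMDl.
have aE : a = x^-1 * (g1 ^+ j') ^+ j.
  rewrite gj; apply: (mulgI x).
  by rewrite mulKVg /x -expgSr subn1 prednK // ltnW.
have bE' : b = c^-1 * (g1 ^+ j') ^+ n./2 by rewrite gh.
have GE : <<[set x^-1; z; c^-1; g1 ^+ j']>> = mgrp a b.
  have aA := mem_mgrpl a b; have bA := mem_mgrpr a b.
  have xA : x \in mgrp a b by apply: groupX.
  have iA : iota_of a \in mgrp a b by apply: groupX.
  apply/eqP; rewrite eqEsubset; apply/andP; split.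
    rewrite gen_subG; apply/subsetP=> v; rewrite !inE -!orbA => /or4P[] /eqP ->.
    - by rewrite groupV.
    - by rewrite groupM ?groupV ?groupJ.
    - by rewrite groupV groupM.
    - by rewrite !groupX.
  have m1 v : v \in [set x^-1; z; c^-1; g1 ^+ j'] -> v \in <<[set x^-1; z; c^-1; g1 ^+ j']>>.
    exact: mem_gen.
  rewrite gen_subG; apply/subsetP=> v; rewrite !inE => /orP[] /eqP ->.
    have : x^-1 * (g1 ^+ j') ^+ j \in <<[set x^-1; z; c^-1; g1 ^+ j']>>.
      by apply: groupM; [|apply: groupX]; apply: m1; rewrite !inE eqxx ?orbT.
    by rewrite -aE.
  have : c^-1 * (g1 ^+ j') ^+ n./2 \in <<[set x^-1; z; c^-1; g1 ^+ j']>>.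
    by apply: groupM; [|apply: groupX]; apply: m1; rewrite !inE eqxx ?orbT.
  by rewrite -bE'.
split=> //; apply/(G2_presentsP _ _ _ _ pr ug); split; last first.
  by rewrite GE (kmn_cardG K); ring.
have zcV : z ^ c^-1 = z by apply/conjg_fixP/commgP/commuteV.
have xga i : commute x (g1 ^+ i) by apply: commuteX; apply: commuteX2.
apply/and5P; split; rewrite ?expgVn ?xp ?zp ?cp ?invg1 //.
  by rewrite -expgM mulnC expgM -og1 expg_order expg1n.
apply/and5P; split.
- by apply/commgP; apply/commute_sym/commuteV/commute_sym.
- rewrite conjVg cgX; apply/eqP; congr (_ ^-1).
  by apply/eqP; rewrite eq_expg_mod_order oc -tj.
- have xcV : x ^ c^-1 = x * z^-1.
    apply: (conjg_inj c); rewrite conjgKV conjMg conjVg xc.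
    by have -> : z ^ c = z by [apply/conjg_fixP/commgP]; rewrite mulgK.
  apply/eqP; rewrite conjVg xcV invMg invgK.
  exact: commuteV (commute_sym c1z).
- by rewrite zcV.
- rewrite conjVg; have -> : x ^ (g1 ^+ j') = x by apply/conjg_fixP/commgP.
  by rewrite eqxx zgX eq_expg_mod_order oz -tj eqxx.
Qed.
End FamilyM2.

Section FamilyM3.
Local Open Scope group_scope.

Lemma G3rel_morph (gT rT : finGroupType) (D : {group gT}) (f : {morphism D >-> rT}) (a b : gT) k e u :
  a \in D -> b \in D -> G3rel k e u a b -> G3rel k e u (f a) (f b).
Proof.
move=> aD bD /and5P[/eqP h1 /eqP h2 /eqP h3 /eqP h4 /andP[/eqP h5 /eqP h6]].
have push (g h : gT) : g = h -> f g = f h by move->.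
move: (push _ _ h1) (push _ _ h2) (push _ _ h3) (push _ _ h4) (push _ _ h5) (push _ _ h6).
by morph_push f => {}h1 {}h2 {}h3 {}h4 {}h5 {}h6; apply/and5P; split;
  [| | | |apply/andP; split]; apply/eqP.
Qed.

Lemma sum_geometric_three s e : s = 1 %[mod 3] ->
  exists2 v, ~~ (3 %| v) & (\sum_(i < 3 ^ e) s ^ i = 3 ^ e * v)%N.
Proof.
move=> s1; elim: e => [|e [v v3 IH]]; first by exists 1%N => //; rewrite big_ord1.
set t := (s ^ (3 ^ e))%N; have t1 : t = 1 %[mod 3] by rewrite /t -modnXm s1 modnXm exp1n.
have E : (\sum_(i < 3 ^ e.+1) s ^ i = (3 ^ e * v) * (1 + t + t * t))%N.
  have -> : (3 ^ e.+1 = 3 ^ e + (3 ^ e + 3 ^ e))%N by rewrite expnS; lia.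
  rewrite big_split_ord /= big_split_ord /= IH.
  under [X in (_ + (X + _))%N]eq_bigr do rewrite expnD.
  under [X in (_ + (_ + X))%N]eq_bigr do rewrite expnD expnD mulnA.
  by rewrite -!big_distrr /= IH -/t; ring.
have [m tm] : exists m, t = (3 * m + 1)%N.
  by exists (t %/ 3); rewrite {1}(divn_eq t 3) t1 mulnC.
exists (v * (3 * (m * m + m) + 1))%N; last by rewrite E tm expnS; ring.
rewrite Euclid_dvdM // negb_or v3 /= dvdn_addr ?dvdn_mulr //.
Qed.

Variables (k e u : nat).
Hypotheses (k3 : ~~ (3 %| k)) (e0 : 0 < e) (uE : u * 3 ^ e = 1 %[mod k]).
Local Notation q := (3 ^ e)%N.
Local Notation n := (3 ^ e * k)%N.

Let k0 : 0 < k. Proof. by case: k k3. Qed.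
Let q0 : 0 < q. Proof. by rewrite expn_gt0. Qed.
Let n0 : 0 < n. Proof. by rewrite muln_gt0 q0. Qed.
Let qodd : odd q. Proof. by rewrite oddX orbT. Qed.
Let p3 : (3 : nat_pred).-nat q. Proof. by rewrite pnatX pnat_id. Qed.
Let pk : (3^').-nat k. Proof. by rewrite p'natE. Qed.
Let ug := two_unit_generator e.
Let tE : totient (3 ^ e.+1) = (2 * q)%N. Proof. by rewrite totient_pfactor. Qed.
Let N1 : 1 < 3 ^ e.+1. Proof. by rewrite -(expn0 3) ltn_exp2l. Qed.

Lemma G3rel_glue (gT : finGroupType) (a b : gT) (L : {group gT}) :
  Kmn_group 3 n a b L -> let A := core_part 3^' a b L in
  G3rel k e u (coset A a) (coset A b) -> G3rel k e u a b.
Proof.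
move=> K A relA; pose B := core_part 3 a b L.
have KB : Kmn_group 3 k (coset B a) (coset B b) (L / B)%G.
  exact: (core_part_quotient K isT n0 erefl p3 pk).
have GA : mgrp a b \subset 'N(A) by apply: core_part_norm K _.
have GB : mgrp a b \subset 'N(B) by apply: core_part_norm K _.
have injf : 'injm (coset_pair_morphism GA GB).
  by apply/injmP=> g h gG hG [e1 e2]; apply: (core_part_glue K (pi := 3)).
apply: (G3rel_inj injf); rewrite ?mem_mgrpl ?mem_mgrpr //.
apply: G3rel_pair => //=.
exact: G3rel_coprime KB k0 k3 uE.
Qed.

Section Generators.
Variables (gT : finGroupType) (X b : gT) (L : {group gT}).
Hypotheses (rel : G3rel k e u X b) (K : Kmn_group 3 n X b L).
Local Notation A := (core_part 3^' X b L).
Local Notation Xq := (coset A X).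
Local Notation bq := (coset A b).

Let KA : Kmn_group 3 q Xq bq (L / A)%G.
Proof. by apply: (core_part_quotient K isT n0 (mulnC _ _) pk); rewrite pnatNK. Qed.

Let oX : #[Xq] = (2 * q)%N. Proof. exact: kmn_orda KA. Qed.
Let NA : mgrp X b \subset 'N(A). Proof. exact: core_part_norm K _. Qed.

Lemma G3_quotient_cyc : cyc_gen Xq bq = Xq ^+ q * bq.
Proof. by rewrite /cyc_gen /iota_of oX mul2n doubleK. Qed.
Local Notation c := (cyc_gen Xq bq).

Lemma G3_quotient_conj : c ^ Xq = c ^+ 2.
Proof.
have := G3rel_morph (coset_morphism A) (subsetP NA _ (mem_mgrpl X b)) (subsetP NA _ (mem_mgrpr X b)) rel.
case/and5P=> _ _ _ _ /andP[_ /eqP]; rewrite -G3_quotient_cyc -oX expg_order.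
by rewrite conj1g !expg1n invg1 !mulg1.
Qed.

Lemma G3_quotient_order : #[c] = (3 ^ e.+1)%N.
Proof.
have := G3rel_morph (coset_morphism A) (subsetP NA _ (mem_mgrpl X b)) (subsetP NA _ (mem_mgrpr X b)) rel.
case/and5P=> _ _ _ /eqP h _; rewrite -G3_quotient_cyc in h.
apply/eqP; rewrite eqn_leq; apply/andP; split.
  by apply: dvdn_leq; [rewrite expn_gt0|rewrite order_dvdn h].
have XN : Xq \in 'N(<[c]>) by rewrite inE conj_cycle_norm // G3_quotient_conj mem_cycle.
have Xd : Xq ^+ (2 * q) \in <[c]> by rewrite -oX expg_order group1.
have S : mgrp Xq bq \subset <[c]> <*> <[Xq]>.
  have XJ : Xq \in <[c]> <*> <[Xq]> by rewrite (subsetP (joing_subr _ _)) ?cycle_id.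
  rewrite gen_subG; apply/subsetP=> v; rewrite !inE => /orP[] /eqP -> //.
  have := subsetP (joing_subl <[c]> <[Xq]>) _ (cycle_id c).
  by rewrite {1}G3_quotient_cyc (groupMl _ (groupX q XJ)).
have d0 : 0 < 2 * q by rewrite muln_gt0.
have := leq_trans (subset_leq_card S) (card_join_cycle (H := <[c]>%G) d0 XN Xd).
rewrite (kmn_cardG KA) -orderE expnS => le.
by rewrite -(@leq_pmul2r (2 * q)) // -mulnA [(q * _)%N]mulnC.
Qed.

Variable j : nat.
Hypothesis cj : coprime j (2 * n).

Let cjq : coprime j (2 * q). Proof. by move: cj; rewrite mulnA coprimeMr => /andP[]. Qed.
Local Notation C := ((X ^+ j) ^+ q * b).
Let XN : X \in 'N(A). Proof. by rewrite (subsetP NA) ?mem_mgrpl. Qed.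
Let bN : b \in 'N(A). Proof. by rewrite (subsetP NA) ?mem_mgrpr. Qed.
Let jo : odd j. Proof. by move: cjq; rewrite coprimeMr coprimen2 => /andP[]. Qed.
Let CN : C \in 'N(A). Proof. by rewrite groupM ?groupX. Qed.
Let Xjq : Xq ^+ j ^+ q = Xq ^+ q.
Proof.
rewrite -expgM; apply/eqP; rewrite eq_expg_mod_order oX -{1}[j]odd_double_half jo mulnDl mul1n.
by rewrite -muln2 -mulnA addnC modnMDl.
Qed.
Let Cq : coset A C = c.
Proof. by rewrite (coset_M (groupX _ (groupX _ XN)) bN) !(coset_X _ _) ?groupX // Xjq G3_quotient_cyc. Qed.

Let cXX i : c ^ (Xq ^+ i) = c ^+ (2 ^ i).
Proof.
elim: i => [|i IH]; first by rewrite conjg1 expg1.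
by rewrite expgSr conjgM IH conjXg G3_quotient_conj -expgM -expnS.
Qed.

Lemma G3_invariant m : (C ^ (X ^+ j) * C ^- m) ^+ (k * k) = 1 <-> m = 2 ^ j %[mod 3 ^ e.+1].
Proof.
have XjN : X ^+ j \in 'N(A) by rewrite groupX.
have E : coset A (C ^ (X ^+ j) * C ^- m) = c ^+ (2 ^ j) * c ^- m.
  rewrite coset_M ?groupV ?groupX ?groupJ // coset_V ?groupX // coset_X // coset_J // Cq.
  by rewrite coset_X // cXX.
have gN : C ^ (X ^+ j) * C ^- m \in 'N(A) by rewrite groupM ?groupV ?groupX ?groupJ.
have cA : #|A| = (k * k)%N by apply: (core_part_card K isT n0 (mulnC _ _) pk); rewrite pnatNK.
have iffA : (C ^ (X ^+ j) * C ^- m) ^+ (k * k) = 1 <-> coset A (C ^ (X ^+ j) * C ^- m) = 1.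
  split=> [h|h]; last by apply/eqP; rewrite -order_dvdn -cA order_dvdG // coset_idr.
  apply/eqP; rewrite -order_eq1 -dvdn1.
  have co : coprime (3 ^ e.+1) (k * k) by rewrite coprimeXl // coprimeMr prime_coprime // k3.
  have : #[coset A (C ^ (X ^+ j) * C ^- m)] %| gcdn (3 ^ e.+1) (k * k).
    rewrite dvdn_gcd; apply/andP; split; last by rewrite order_dvdn -(coset_X _ gN) h morph1.
    by rewrite E -G3_quotient_order orderE order_dvdG // groupM ?groupV ?mem_cycle.
  by rewrite (eqP co).
rewrite iffA E; split=> [/eqP|h].
  by rewrite -eq_mulgV1 eq_expg_mod_order G3_quotient_order eq_sym => /eqP.
by apply/eqP; rewrite -eq_mulgV1 eq_expg_mod_order G3_quotient_order h.
Qed.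

Lemma G3_order_ab : #[X ^+ j * b] = (3 ^ e.+1)%N.
Proof.
have XjN : X ^+ j \in 'N(A) by rewrite groupX.
have bE : bq = Xq ^+ q * c.
  have XX : Xq ^+ q * Xq ^+ q = 1 by rewrite -expgD addnn -mul2n -oX expg_order.
  by rewrite G3_quotient_cyc mulgA XX mul1g.
have E : coset A (X ^+ j * b) = Xq ^+ (j + q) * c.
  by rewrite coset_M // coset_X // {1}bE mulgA -expgD.
have [v v3 S] : exists2 v, ~~ (3 %| v) & (\sum_(i < 3 ^ e) (2 ^ (j + q)) ^ i = 3 ^ e * v)%N.
  apply: sum_geometric_three.
  rewrite -[(j + q)%N]odd_double_half oddD jo qodd add0n -mul2n expnM -modnXm.
  by rewrite -[(2 ^ 2 %% 3)%N]/1%N exp1n.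
have P : (Xq ^+ (j + q) * c) ^+ q = c ^+ (q * v).
  rewrite (affine_expg (cXX _)) S -expgM.
  have -> : Xq ^+ ((j + q) * q) = 1; last by rewrite mul1g.
  apply/eqP; rewrite -order_dvdn oX dvdn_pmul2r // dvdn2 oddD jo qodd.
  by [].
have [L' KB] : exists L', Kmn_group 3 k (coset (core_part 3 X b L) (X ^+ j)) (coset (core_part 3 X b L) b) L'.
  exists (L / core_part 3 X b L)%G.
  have K1 := core_part_quotient K isT n0 erefl p3 pk.
  have o1 := kmn_orda K1; have XNB : X \in 'N(core_part 3 X b L).
    by rewrite (subsetP (core_part_norm K _)) ?mem_mgrpl.
  rewrite coset_X //; apply: Kmn_cycle_eq K1; rewrite cycle_expg_coprime // o1.
  by apply: coprime_dvdr cj; rewrite dvdn_pmul2l // dvdn_mull.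
have tB : (X ^+ j * b) ^+ 3 \in core_part 3 X b L.
  have [_ _ h] := coprime3_relations KB k0 k3.
  have NB : mgrp X b \subset 'N(core_part 3 X b L) by apply: core_part_norm K _.
  have [XNB bNB] : X \in 'N(core_part 3 X b L) /\ b \in 'N(core_part 3 X b L).
    by rewrite !(subsetP NB) ?mem_mgrpl ?mem_mgrpr.
  apply: coset_idr; first by rewrite groupX ?groupM ?groupX.
  by rewrite coset_X ?groupM ?groupX // coset_M ?groupX.
apply/eqP; rewrite eqn_dvd; apply/andP; split.
  rewrite order_dvdn; apply/eqP; apply: (core_part_glue K (pi := 3)).
  - by rewrite groupX ?groupM ?groupX ?mem_mgrpl ?mem_mgrpr.
  - exact: group1.
  - by rewrite morph1; apply: coset_id; rewrite expnS expgM groupX.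
  rewrite morph1 (coset_X _ (groupM XjN bN)) E expnSr expgM P -expgM.
  by apply/eqP; rewrite -order_dvdn G3_quotient_order expnSr mulnAC dvdn_mulr.
apply: (@dvdn_trans #[coset A (X ^+ j * b)]); last by rewrite (morph_order _ _) ?groupM.
rewrite E expnSr; set g := _ * c in P *.
have d1 : #[g] %| 3 ^ e.+1.
  by rewrite order_dvdn expnSr expgM P -expgM -order_dvdn G3_quotient_order expnSr mulnAC dvdn_mulr.
case/(dvdn_pfactor _ _ (isT : prime 3)): (d1) => f fe gE.
have [fe'|] := ltnP f e.+1; last by move=> le; rewrite gE -expnSr dvdn_exp2l.
have : #[g] %| q by rewrite gE dvdn_exp2l.
rewrite order_dvdn P -order_dvdn G3_quotient_order expnSr dvdn_pmul2l //.
by rewrite (negPf v3).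
Qed.
End Generators.

Local Notation nn := (2 * 3 ^ e * k)%N.
Let nnE : nn = (2 * n)%N. Proof. by rewrite mulnA. Qed.

Lemma unit_inverse j N : 1 < N -> coprime j N -> exists2 i, coprime i N & i * j = 1 %[mod N].
Proof.
move=> N1' cj; have j0 : 0 < j.
  by case: (posnP j) cj => // ->; rewrite /coprime gcd0n => /eqP N1''; rewrite N1'' in N1'.
have [v w vw _] := egcdnP N j0.
have E : v * j = 1 %[mod N] by rewrite vw (eqP cj) -modnDml modnMl add0n.
exists v => //.
have : coprime (v * j) N by rewrite -coprime_modl E coprime_modl coprime1n.
by rewrite coprimeMl => /andP[].
Qed.

Lemma M3_facts j (gT : finGroupType) (a b : gT) : coprime j nn -> isM3 k e u j a b ->
  [/\ exists L, Kmn_group 3 n a b L, #[a * b] = (3 ^ e.+1)%N &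
    forall m, ((a ^+ q * b) ^ a * (a ^+ q * b) ^- m) ^+ (k * k) = 1 <-> m = 2 ^ j %[mod 3 ^ e.+1]].
Proof.
rewrite nnE => cj [X [y [E P -> ->]]]; have [L K] := G3_Kmn k0 k3 e0 uE P.
split; last by move=> m; apply: (G3_invariant P.1 K cj).
  by exists L; apply: (Kmn_cycle_eq _ K); rewrite cycle_expg_coprime // (kmn_orda K).
exact: G3_order_ab P.1 K _ cj.
Qed.

Lemma M3_iso j (gT hT : finGroupType) (a b : gT) (a' b' : hT) :
  isM3 k e u j a b -> isM3 k e u j a' b' -> map_iso a b a' b'.
Proof.
move=> [X [y [E P aE bE]]] [X' [y' [E' P' aE' bE']]].
have [f [inj fx fy]] := presents2_iso P P'.
by apply: map_iso_intro E inj _ _; rewrite ?aE ?aE' ?bE ?bE' -?fx ?morphX ?mem_mgrpl.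
Qed.

Lemma M3_inj j j' (gT hT : finGroupType) (a b : gT) (a' b' : hT) :
  coprime j nn -> coprime j' nn -> isM3 k e u j a b -> isM3 k e u j' a' b' ->
  map_iso a b a' b' -> j = j' %[mod 2 * q].
Proof.
move=> cj cj' /(M3_facts cj)[_ _ I] /(M3_facts cj')[_ _ I'] /map_isoP[f [inj fa fb]].
have aG := mem_mgrpl a b; have bG := mem_mgrpr a b.
have /I : 2 ^ j = 2 ^ j %[mod 3 ^ e.+1] by [].
move=> /(congr1 f); morph_push f; rewrite fa fb => /I' h.
by rewrite -tE; apply: unit_generator_eq_exp N1 ug h.
Qed.

Lemma M3_transfer j j' (gT : finGroupType) (a b : gT) : coprime j nn -> coprime j' nn ->
  j = j' %[mod 2 * q] -> isM3 k e u j a b -> isM3 k e u j' a b.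
Proof.
move=> cj cj' jj' [X [y [E P aE bE]]]; have [L K] := G3_Kmn k0 k3 e0 uE P.
have oX : #[X] = nn by rewrite (kmn_orda K) nnE.
have nn1 : 1 < nn by rewrite nnE; move: n0; clear; lia.
have [i ci iE] := unit_inverse nn1 cj'.
have sq : j * i = 1 %[mod 2 * q].
  rewrite -modnMml jj' modnMml mulnC.
  have d : 2 * q %| nn by rewrite dvdn_mulr.
  by rewrite -(modn_dvdm _ d) iE modn_dvdm.
have cs : coprime (j * i) #[X] by rewrite oX coprimeMl cj.
have cy : <[X]> = <[X ^+ (j * i)]> by rewrite cycle_expg_coprime.
have mE := mgrp_cycle_eq y cy.
have Ks : Kmn_group 3 n (X ^+ (j * i)) y L by apply: Kmn_cycle_eq K.
exists (X ^+ (j * i)), y; split=> //; first by rewrite -mE.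
  apply/(G3_presentsP _ _ k0 k3 e0 uE); split; last first.
    by rewrite -mE; case/(G3_presentsP _ _ k0 k3 e0 uE): P.
  apply: (G3rel_glue Ks); rewrite /core_part -mE -/(core_part 3^' X y L).
  have KA := core_part_quotient K isT n0 (mulnC _ _) pk; rewrite pnatNK in KA.
  have NA := core_part_norm K 3^'; have XN := subsetP NA _ (mem_mgrpl X y).
  have yN := subsetP NA _ (mem_mgrpr X y).
  rewrite (coset_X _ XN).
  have -> : coset (core_part 3^' X y L) X ^+ (j * i) = coset (core_part 3^' X y L) X.
    rewrite -[RHS]expg1; apply/eqP; rewrite eq_expg_mod_order (kmn_orda (KA p3)).
    by apply/eqP.
  exact: (G3rel_morph (coset_morphism _) XN yN P.1).
rewrite aE -expgM; apply/eqP; rewrite eq_expg_mod_order oX -(mulnA j i).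
by rewrite -(modnMmr j (i * j')) iE modnMmr muln1.
Qed.

Lemma M3_chiral j (gT : finGroupType) (a b : gT) : coprime j nn -> isM3 k e u j a b -> chiral a b.
Proof.
move=> cj M I; have [X [y [E P aE bE]]] := M; have [L K] := G3_Kmn k0 k3 e0 uE P.
have oX : #[X] = nn by rewrite (kmn_orda K) nnE.
have nn0 : 0 < nn by rewrite nnE muln_gt0.
have cV : coprime (nn - 1) nn by rewrite subn1 coprime_sym coprimenP.
have M' : isM3 k e u (j * (nn - 1)) a^-1 b.
  exists X, y; split=> //.
    by rewrite E; apply: mgrp_cycle_eq; rewrite cycleV.
  rewrite aE expgM; apply/eqP; rewrite eq_invg_mul -expgS subn1 prednK // -oX.
  by rewrite -expgM mulnC expgM expg_order expg1n.
have cj' : coprime (j * (nn - 1)) nn by rewrite coprimeMl cj.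
have h := M3_inj cj cj' M M' I.
have : 2 * q %| 2 * j.
  have : j + j = j * (nn - 1) + j %[mod 2 * q] by rewrite -modnDml h modnDml.
  rewrite -[X in _ = _ + X %[mod _]]muln1 -mulnDr subnK // addnn -mul2n.
  by rewrite /dvdn => ->; apply: dvdn_mull; apply: dvdn_mulr.
rewrite dvdn_pmul2l // => d; move: cj; rewrite nnE coprimeMr => /andP[_].
rewrite coprimeMr => /andP[/(coprime_dvdl d) + _].
rewrite /coprime gcdnn => /eqP q1; have : 3 ^ 1 <= q by rewrite leq_exp2l.
by rewrite q1.
Qed.

Lemma M3_exists j : coprime j nn -> exists (gT : finGroupType) (a b : gT), isM3 k e u j a b.
Proof.
move=> cj; have [gT [X [y [L [rel cG K]]]]] := G3_model k0 k3 e0 uE.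
exists gT, (X ^+ j), y; exists X, y; split=> //; last exact/(G3_presentsP _ _ k0 k3 e0 uE).
by apply: mgrp_cycle_eq; rewrite cycle_expg_coprime // (kmn_orda K) -nnE.
Qed.

Lemma M3_converse j (gT : finGroupType) (a b : gT) (L : {group gT}) :
  Kmn_group 3 n a b L -> coprime j nn -> G3rel k e u (a ^+ j) b ->
  exists2 i, coprime i nn & isM3 k e u i a b.
Proof.
move=> K cj rel; have oa : #[a] = nn by rewrite (kmn_orda K) nnE.
have nn1 : 1 < nn by rewrite nnE; move: n0; clear; lia.
have [i ci iE] := unit_inverse nn1 cj; exists i => //.
have mE : mgrp a b = mgrp (a ^+ j) b by apply: mgrp_cycle_eq; rewrite cycle_expg_coprime // oa.
exists (a ^+ j), b; split=> //.
  apply/(G3_presentsP _ _ k0 k3 e0 uE); split=> //; rewrite -mE (kmn_cardG K) -[(3 - 1)%N]/2%N; ring.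
by rewrite -expgM mulnC -[LHS]expg1; apply/eqP; rewrite eq_expg_mod_order oa iE.
Qed.
End FamilyM3.

Section FamilyM4.
Local Open Scope group_scope.

Lemma rel4_morph (gT rT : finGroupType) (D : {group gT}) (f : {morphism D >-> rT}) (a b : gT) q i l :
  a \in D -> b \in D -> rel4 q i l a b -> rel4 q i l (f a) (f b).
Proof.
move=> aD bD [h1 h2 h3].
have push (g h : gT) : g = h -> f g = f h by move->.
move: (push _ _ h1) (push _ _ h2) (push _ _ h3).
by morph_push f => {}h1 {}h2 {}h3.
Qed.

Lemma flip_relations (gT : finGroupType) (a b c d : gT) : let x := a ^+ 2 in let y := x ^ b in
  b * b = 1 -> y ^ a = x^-1 * y^-1 -> [~ x, y] = c -> commute x c -> commute y c ->
  (a * b) ^+ 3 = d ->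
  [/\ (y^-1) ^ a^-1 = x * y, [~ x^-1, y^-1] = c & (a^-1 * b) ^+ 3 = (d ^ b)^-1].
Proof.
move=> x y bb ya cE xc yc dE.
have xa : x ^ a = x by apply/conjg_fixP/commgP/commute_sym/commuteX.
have bV : b^-1 = b by apply/eqP; rewrite eq_invg_mul bb.
have yx : y * x * c = x * y by rewrite -cE -commgC.
split.
- apply: (conjg_inj a); rewrite conjgKV conjMg xa ya.
  by rewrite mulKVg.
- apply: (mulgI (y^-1 * x^-1)); rewrite -commgC -!invMg -yx.
  have cc : commute (y * x)^-1 c by apply/commute_sym/commuteV/commuteM; exact: commute_sym.
  by rewrite (invMg (y * x) c) -(mulgA c^-1) cc mulKg.
- rewrite -dE conjXg conjMg -expgVn; congr (_ ^+ 3).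
  by rewrite -conjMg -conjVg invMg conjgE bV !mulgA bb mul1g.
Qed.

Lemma rel4_mod q i l i' l' (gT : finGroupType) (a b : gT) :
  ((a ^+ 2) ^- q * (a ^+ 2 ^ b) ^+ q) ^+ 3 = 1 -> i = i' %[mod 3] -> l = l' %[mod 3] ->
  rel4 q i l a b -> rel4 q i' l' a b.
Proof.
move=> w3 ii ll [h1 h2 h3]; split=> //.
  by rewrite h2 -(expg_mod i w3) ii expg_mod.
by rewrite h3 -(expg_mod l w3) ll expg_mod.
Qed.

Variables (e k : nat).
Hypotheses (k3 : ~~ (3 %| k)) (n1 : 1 < 3 ^ e * k).
Local Notation n := (3 ^ e * k)%N.
Local Notation q := (3 ^ e * k %/ 3)%N.

Let n0 : 0 < n. Proof. exact: ltnW. Qed.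
Let k0 : 0 < k. Proof. by case: k k3. Qed.

Section Layer.
Variables (gT : finGroupType) (a b : gT) (L : {group gT}).
Hypotheses (K : Kmn_group 3 n a b L) (e0 : 0 < e).
Local Notation x := (a ^+ 2).
Local Notation y := (x ^ b).
Local Notation w := (x ^- q * y ^+ q).

Let q3 : (3 * q = n)%N.
Proof. by move: e0; case: e => // f _; rewrite mulnC divnK // expnS -mulnA dvdn_mulr. Qed.

Let p3 : (3 : nat_pred).-nat (3 ^ e)%N. Proof. by rewrite pnatX pnat_id. Qed.
Let pk : (3^').-nat k. Proof. by rewrite p'natE. Qed.
Let ox : #[x] = n. Proof. exact: (Kmn_orderx K isT). Qed.

Lemma layer_commute : commute (x ^+ q) y.
Proof.
have xG : x \in mgrp a b by rewrite groupX ?mem_mgrpl.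
have yG : y \in mgrp a b by rewrite groupJ ?mem_mgrpr.
have aN i := subsetP (core_part_norm K i) _ (mem_mgrpl a b).
have bN i := subsetP (core_part_norm K i) _ (mem_mgrpr a b).
apply: (core_part_glue K (pi := 3)); [exact: groupM (groupX _ xG) yG|exact: groupM yG (groupX _ xG)| |].
  have KB := core_part_quotient K isT n0 erefl p3 pk.
  have [/eqP/commgP c _ _] := coprime3_relations KB k0 k3.
  have aN' := aN 3; have bN' := bN 3; have xN := groupX 2 aN'; have yN := groupJ xN bN'.
  rewrite (coset_M (groupX _ xN) yN) (coset_M yN (groupX _ xN)) (coset_X _ xN) (coset_J xN bN') (coset_X _ aN').
  exact/commute_sym/commuteX/commute_sym.
have KA := core_part_quotient K isT n0 (mulnC _ _) pk; rewrite pnatNK in KA.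
have {}KA := KA p3; move: KA q3; case: (e) e0 => // f _ KA q3'.
have C := central_layer_prime (isT : prime 3) isT (ltn0Sn f) KA.
have aN' := aN 3^'; have bN' := bN 3^'; have xN := groupX 2 aN'; have yN := groupJ xN bN'.
rewrite (coset_M (groupX _ xN) yN) (coset_M yN (groupX _ xN)) (coset_X _ xN) (coset_J xN bN') (coset_X _ aN').
have -> : (3 ^ f.+1 * k %/ 3 = 3 ^ f * k)%N by rewrite expnS -mulnA mulKn.
rewrite expgM; set X := coset _ a; set b' := coset _ b.
have c : commute (X ^+ 2 ^ b') (X ^+ 2 ^+ (3 ^ f)).
  have qE : (3 ^ f.+1 %/ 3 = 3 ^ f)%N by rewrite expnS mulKn.
  apply: (centP (subsetP (cl_cent C) _ _)).
    have := Kmn_xcore KA isT (expn_gt0 _ _).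
    by rewrite memJ_norm // (subsetP (normal_norm (Kmn_Knormal KA))) ?mem_mgrpr.
  by rewrite mem_gen // inE -qE cycle_id.
exact/commute_sym/commuteX.
Qed.

Let xy : commute (x ^+ q) (y ^+ q). Proof. exact/commuteX/layer_commute. Qed.
Let x3 : x ^+ q ^+ 3 = 1. Proof. by rewrite -expgM mulnC q3 -ox expg_order. Qed.
Let y3 : y ^+ q ^+ 3 = 1. Proof. by rewrite -!conjXg x3 conj1g. Qed.

Lemma layer_cube : w ^+ 3 = 1.
Proof.
rewrite expgMn; last by apply/commute_sym/commuteV/commute_sym.
by rewrite expgVn x3 y3 invg1 mulg1.
Qed.

Lemma layer_order : #[w] = 3.
Proof.
apply: nt_prime_order => //; first exact: layer_cube.
rewrite -eq_mulVg1; apply/eqP=> E.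
have : x ^+ q \in <[a]> :&: <[a]> :^ b.
  by rewrite inE {2}E -expgM mem_cycle /= -!conjXg memJ_conjg -expgM mem_cycle.
rewrite (kmn_TI K) => /set1P/eqP; rewrite -order_dvdn ox => /dvdn_leq h.
have qn : q < n by apply: ltn_Pdiv.
suff /h : 0 < q by rewrite leqNgt qn.
by case: (posnP q) => // q0; move: n0; rewrite -q3 q0.
Qed.

Lemma layer_central : commute x w /\ commute y w.
Proof.
have bb := Kmn_bb K; have yb : y ^ b = x by rewrite -conjgM bb conjg1.
have cyx : commute (y ^+ q) x.
  have : (x ^+ q * y) ^ b = (y * x ^+ q) ^ b by rewrite layer_commute.
  by rewrite (conjMg (x ^+ q)) (conjMg y) (conjXg x) yb.
split; apply: commuteM.
- exact/commuteV/commuteX.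
- exact: commute_sym.
- by apply/commuteV/commute_sym/layer_commute.
exact: commuteX.
Qed.

Lemma rel4_unique i l i' l' : rel4 q i l a b -> rel4 q i' l' a b ->
  i = i' %[mod 3] /\ l = l' %[mod 3].
Proof.
move=> [_ h1 h2] [_ h1' h2']; split; apply/eqP; rewrite -layer_order -eq_expg_mod_order.
  by rewrite -h1 -h1'.
by rewrite -h2 -h2'.
Qed.

Lemma rel4_flip i l : rel4 q i l a b -> rel4 q (2 * i) (2 * l) a^-1 b.
Proof.
case=> h1 h2 h3; have [xw yw] := layer_central.
have bb := Kmn_bb K; have yb : y ^ b = x by rewrite -conjgM bb conjg1.
have [f1 f2 f3] := flip_relations bb h1 h2 (commuteX i xw) (commuteX i yw) h3.
have wE : (x^-1) ^- q * (x ^-1 ^ b) ^+ q = w^-1.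
  by rewrite conjVg !(expgVn _ q) invgK invMg invgK; apply: commuteV; apply: xy.
have w2 j : w^-1 ^+ (2 * j) = w ^+ j.
  by rewrite expgM; congr (_ ^+ j); apply: (mulgI w^-1); rewrite -expgS expgVn layer_cube invg1 mulVg.
split; rewrite expgVn ?wE ?w2.
- by rewrite conjVg f1 !invgK.
- by rewrite conjVg f2.
rewrite f3 conjXg -expgVn; congr (_ ^+ l).
by rewrite (conjMg (x ^- q)) conjVg (conjXg x) (conjXg y) yb invMg invgK.
Qed.

Lemma layer_power i : x ^+ (i * q) * y ^- (i * q) = w ^+ (2 * i).
Proof.
have wV : w^-1 = x ^+ q * y ^- q.
  by rewrite invMg invgK; apply/commute_sym/commuteV/xy.
have w2 : w ^+ 2 = w^-1 by apply: (mulgI w); rewrite -expgS layer_cube mulgV.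
rewrite (expgM w) w2 wV (expgMn i (commuteV xy)).
by rewrite expgVn -!(expgM _ q) mulnC.
Qed.
End Layer.

Lemma G4rel_of_rel4 i l (gT : finGroupType) (a b : gT) (L : {group gT}) :
  Kmn_group 3 n a b L -> adm_il e i l ->
  G4rel n i l a b <-> rel4 q (2 * i) (2 * lnat l) a b.
Proof.
move=> K adm; have [i01 ls n3] := adm_il_facts k adm.
have xn : (a ^+ 2) ^+ n = 1 by rewrite -(Kmn_orderx K isT) expg_order.
have yn : (a ^+ 2 ^ b) ^+ n = 1 by rewrite -conjXg xn conj1g.
have e1 : expgz (a ^+ 2) (l * q%:Z)%R = (a ^+ 2) ^+ (lnat l * q).
  by apply: expgz_lnat => // l0; rewrite n3.
have e2 : expgz (a ^+ 2 ^ b) (l * q%:Z)%R = (a ^+ 2 ^ b) ^+ (lnat l * q).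
  by apply: expgz_lnat => // l0; rewrite n3.
have P d : (e = 0 -> d = 0) -> (a ^+ 2) ^+ (d * q) * (a ^+ 2 ^ b) ^- (d * q) =
    ((a ^+ 2) ^- q * (a ^+ 2 ^ b) ^+ q) ^+ (2 * d).
  case: (posnP e) => [e0 /(_ e0) ->|e0 _]; first by rewrite muln0 mul0n !expg0 invg1 mulg1.
  exact: layer_power K e0 d.
have i0 : e = 0 -> i = 0.
  by move=> e0; move: adm; rewrite /adm_il e0 /= orbF => /andP[/eqP].
have l0 : e = 0 -> lnat l = 0.
  by move=> e0; move: adm; rewrite /adm_il e0 /= orbF => /andP[_ /eqP ->].
have a2n : a ^+ (2 * n) = 1 by rewrite expgM.
have b2 : b ^+ 2 = 1 := Kmn_bb K.
split.
  case/and5P=> _ _ /eqP h1 /eqP h2 /eqP; rewrite expgzN e1 e2 P // => h3.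
  by split=> //; rewrite -P.
case=> h2 h1 h3; apply/and5P; split; apply/eqP => //; first by rewrite P.
by rewrite expgzN e1 e2 P.
Qed.

Lemma G4_presents_of_rel4 i l (gT : finGroupType) (a b : gT) (L : {group gT}) :
  Kmn_group 3 n a b L -> adm_il e i l -> rel4 q (2 * i) (2 * lnat l) a b ->
  presents2 a b (G4rel n i l).
Proof.
move=> K adm r; apply/(G4_presentsP _ _ n1 adm); split; first exact/(G4rel_of_rel4 K adm).
by rewrite (kmn_cardG K) -[(3 - 1)%N]/2%N; ring.
Qed.

(* exponents mod 3 of the commutator and of (ab)^3 in the pair (X^j, b) *)
Definition m4_code (t : nat * int * int) : nat * nat :=
  let s := (if t.2 == 1%R then 2 else 1)%N in (s * t.1.1 %% 3, s * lnat t.1.2 %% 3)%N.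

Definition m4_list : seq (nat * int * int) :=
  [:: (0%N, 0, 1); (0%N, 1, 1); (0%N, 1, -1); (1%N, 0, 1); (1%N, 0, -1);
      (1%N, 1, 1); (1%N, 1, -1); (1%N, -1, 1); (1%N, -1, -1)]%R.

Lemma m4_code_inj : {in m4_list &, injective m4_code}.
Proof.
have : all (fun t => all (fun t' => (m4_code t == m4_code t') ==> (t == t')) m4_list) m4_list by [].
by move=> /allP h t t' tL tL' E; have /allP/(_ _ tL')/implyP := h _ tL; rewrite E eqxx => /(_ isT)/eqP.
Qed.

Lemma adm_m4_list i l j : adm_il e i l -> adm_j4 i l j -> (i, l, j) \in m4_list.
Proof.
rewrite /adm_il /adm_j4 => /or3P[/andP[/eqP-> /eqP->]|/and3P[_ /eqP-> /eqP->]|/and3P[_ /eqP->]].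
- by move=> /eqP ->.
- by move=> /orP[] /eqP ->.
by rewrite !inE => /or3P[] /eqP -> /orP[] /eqP ->.
Qed.

Lemma adm_sign i l j : adm_j4 i l j -> j = 1%R \/ (j = (-1)%R).
Proof.
rewrite /adm_j4; case: ifP => _; first by move/eqP; left.
by move=> /orP[]/eqP; [left|right].
Qed.

Lemma M4_facts i l j (gT : finGroupType) (a b : gT) : adm_il e i l -> adm_j4 i l j ->
  isM4 k e i l j a b ->
  [/\ exists L, Kmn_group 3 n a b L, l = 0%R -> (a * b) ^+ 3 = 1 &
    0 < e -> rel4 q (m4_code (i, l, j)).1 (m4_code (i, l, j)).2 a b].
Proof.
move=> adm adj [X [y [E P aE bE]]]; have [rel cG] := (G4_presentsP _ _ n1 adm).1 P.
have [i01 ls n3] := adm_il_facts k adm.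
have [L K] := G4_Kmn n0 i01 rel cG.
have r := (G4rel_of_rel4 K adm).1 rel.
have K' : Kmn_group 3 n a b L.
  rewrite bE; apply: (Kmn_cycle_eq _ K); rewrite aE.
  by case: (adm_sign adj) => ->; rewrite /= ?expg1 // cycleV.
split; first by exists L.
  move=> l0; have [r1 r2 r3] := r; rewrite l0 muln0 expg0 in r3.
  rewrite aE bE; case: (adm_sign adj) => -> /=; rewrite ?expg1 //.
  have <- : (((X * y) ^+ 3) ^ y)^-1 = 1 by rewrite r3 conj1g invg1.
  rewrite conjXg conjMg -expgVn; congr (_ ^+ 3).
  have yV : y^-1 = y by apply/eqP; rewrite eq_invg_mul (Kmn_bb K).
  by rewrite -conjMg -conjVg invMg conjgE yV !mulgA (Kmn_bb K) mul1g.
move=> e0; move: K'; rewrite aE bE /m4_code /=; case: (adm_sign adj) => -> /=; rewrite expg1 => K'.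
  by apply: (rel4_mod (layer_cube K' e0) _ _ r); rewrite modn_mod.
by apply: (rel4_mod (layer_cube K' e0) _ _ (rel4_flip K e0 r)); rewrite modn_mod; clear; lia.
Qed.

Lemma M4_iso i l j (gT hT : finGroupType) (a b : gT) (a' b' : hT) :
  isM4 k e i l j a b -> isM4 k e i l j a' b' -> map_iso a b a' b'.
Proof.
move=> [X [y [E P aE bE]]] [X' [y' [E' P' aE' bE']]].
have [f [inj fx fy]] := presents2_iso P P'.
apply: (map_iso_intro (f := f) E inj); last by rewrite bE bE'.
have XG := mem_mgrpl X y.
by rewrite aE aE'; case: (j) => i' /=; rewrite -fx; morph_push f.
Qed.

Lemma M4_inj i l j i' l' j' (gT hT : finGroupType) (a b : gT) (a' b' : hT) :
  adm_il e i l -> adm_j4 i l j -> adm_il e i' l' -> adm_j4 i' l' j' ->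
  isM4 k e i l j a b -> isM4 k e i' l' j' a' b' -> map_iso a b a' b' ->
  (i, l, j) = (i', l', j').
Proof.
move=> adm adj adm' adj' M M' I.
have [e0|e0] := posnP e.
  have h i1 l1 j1 : adm_il e i1 l1 -> adm_j4 i1 l1 j1 -> (i1, l1, j1) = (0%N, 0%R, 1%R).
    rewrite /adm_il e0 /= orbF => /andP[/eqP-> /eqP->].
    by rewrite /adm_j4 /= => /eqP ->.
  by rewrite (h _ _ _ adm adj) (h _ _ _ adm' adj').
have [[L K] _ /(_ e0) r] := M4_facts adm adj M.
have [[L' K'] _ /(_ e0) r'] := M4_facts adm' adj' M'.
have [f [inj fa fb]] := (map_isoP _ _ _ _).1 I.
have := rel4_morph f (mem_mgrpl a b) (mem_mgrpr a b) r; rewrite fa fb => r1.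
have [h1 h2] := rel4_unique K' e0 r1 r'.
apply: m4_code_inj; rewrite ?adm_m4_list //.
by move: h1 h2; rewrite /m4_code /= !modn_mod => -> ->.
Qed.

Lemma M4_order_ab i l j (gT : finGroupType) (a b : gT) : adm_il e i l -> adm_j4 i l j ->
  isM4 k e i l j a b -> #[a * b] = (if l == 0%R then 3 else 9)%N.
Proof.
move=> adm adj M; have [[L K] l0 r] := M4_facts adm adj M.
case: ifP => [/eqP/l0 h|lN].
  apply: nt_prime_order => //; apply/eqP=> E.
  have := kmn_orda K; have -> : a = b^-1 by apply/eqP; rewrite eq_mulgV1 invgK E.
  by rewrite orderV (kmn_ordb K); move: n1; clear; lia.
have e0 : 0 < e.
  case: (posnP e) adm => // -> ; rewrite /adm_il /= orbF => /andP[_ /eqP l00].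
  by rewrite l00 eqxx in lN.
have [_ _ h] := r e0.
have o3 : #[(a * b) ^+ 3] = 3.
  apply: nt_prime_order => //.
    by rewrite h -(expgM _ _ 3) (mulnC _ 3) (expgM _ 3) (layer_cube K e0) expg1n.
  rewrite h -order_dvdn (layer_order K e0).
  by move: (adm_m4_list adm adj) lN; rewrite !inE => /or4P[|||/or4P[|||/orP[|/orP[]]]]; case/eqP=> -> -> ->.
exact: orderXprime o3 _ _.
Qed.

Lemma M4_chiral i l j (gT : finGroupType) (a b : gT) : adm_il e i l -> adm_j4 i l j ->
  ~~ ((i == 0%N) && (l == 0%R)) -> isM4 k e i l j a b -> chiral a b.
Proof.
move=> adm adj il M I; have jj := adm_sign adj.
have adj' : adm_j4 i l (- j)%R.
  by move: adj; rewrite /adm_j4 (negPf il); case: jj => ->.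
have M' : isM4 k e i l (- j)%R a^-1 b.
  have [X [y [E P aE bE]]] := M; exists X, y; split=> //; last by rewrite aE expgzN.
  by rewrite E; apply: mgrp_cycle_eq; rewrite cycleV.
have := M4_inj adm adj adm adj' M M' I.
by case: jj => ->.
Qed.

Lemma M4_reflexible (gT : finGroupType) (a b : gT) :
  isM4 k e 0 0%R 1%R a b -> reflexible a b.
Proof.
move=> M; have adm : adm_il e 0 0%R by [].
have [X [y [E P aE bE]]] := M; have [rel cG] := (G4_presentsP _ _ n1 adm).1 P.
have [i01 _ _] := adm_il_facts k adm; have [L K] := G4_Kmn n0 i01 rel cG.
have [r1 r2 r3] := (G4rel_of_rel4 K adm).1 rel.
have bb : y * y = 1 := Kmn_bb K.
have [f1 f2 f3] := flip_relations bb r1 (r2 : _ = 1) (commute1 _) (commute1 _) (r3 : _ = 1).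
have cyV : <[X]> = <[X^-1]> by rewrite cycleV.
have P' : presents2 X^-1 y (G4rel n 0 0%R).
  apply: (G4_presents_of_rel4 (Kmn_cycle_eq cyV K) adm).
  by split; rewrite expgVn ?expg0 ?f3 ?conj1g ?invg1 // conjVg ?f1 ?invgK.
have [f [inj fx fy]] := presents2_iso P P'.
have XG := mem_mgrpl X y.
by apply: (map_iso_intro (f := f) E inj); rewrite ?bE // aE /= expg1.
Qed.

Lemma M4_exists i l j : adm_il e i l -> adm_j4 i l j ->
  exists (gT : finGroupType) (a b : gT), isM4 k e i l j a b.
Proof.
move=> adm adj; have [gT [X [y [rel cG]]]] := G4_model n1 adm.
exists gT, (expgz X j), y, X, y; split=> //; last exact/(G4_presentsP _ _ n1 adm).
by apply: mgrp_cycle_eq; case: (adm_sign adj) => ->; rewrite /= ?expg1 // cycleV.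
Qed.

Lemma M4_converse i0 l0 (gT : finGroupType) (a b : gT) (L : {group gT}) :
  Kmn_group 3 n a b L -> (e <= 1 -> i0 = 0%N) -> (e = 0%N -> l0 = 0%N) -> rel4 q i0 l0 a b ->
  exists (i : nat) (l j : int), [/\ adm_il e i l, adm_j4 i l j & isM4 k e i l j a b].
Proof.
move=> K i00 l00 r; have [e0|e0] := posnP e.
  exists 0%N, 0%R, 1%R; split=> //; exists a, b; split=> //.
  apply: (G4_presents_of_rel4 K (isT : adm_il e 0 0%R)); rewrite e0 in i00 l00.
  by move: r; rewrite i00 ?l00.
suff [i [l [j [adm adj [c1 c2]]]]] : exists (i : nat) (l j : int),
    [/\ adm_il e i l, adm_j4 i l j & m4_code (i, l, j) = (i0 %% 3, l0 %% 3)%N].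
  exists i, l, j; split=> //; move: c1 c2 => /=; case: (adm_sign adj) => -> /= c1 c2.
    exists a, b; split=> //.
    by apply: (G4_presents_of_rel4 K adm); apply: (rel4_mod (layer_cube K e0) _ _ r).
  have cyV : <[a]> = <[a^-1]> by rewrite cycleV.
  have K' := Kmn_cycle_eq cyV K.
  exists a^-1, b; split=> //; [by rewrite (mgrp_cycle_eq b cyV)| |by rewrite /= expg1 invgK].
  apply: (G4_presents_of_rel4 K' adm); apply: (rel4_mod (layer_cube K' e0) _ _ (rel4_flip K e0 r)).
    by move: c1; clear; lia.
  by move: c2; clear; lia.
have e2 : i0 %% 3 != 0%N -> 1 < e.
  by case: ltnP => // e1; rewrite (i00 e1) mod0n.
case: (i0 %% 3)%N (ltn_pmod i0 (isT : 0 < 3)) e2 => [|[|[|//]]] _ e2;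
case: (l0 %% 3)%N (ltn_pmod l0 (isT : 0 < 3)) => [|[|[|//]]] _.
- by exists 0%N, 0%R, 1%R.
- by exists 0%N, 1%R, (-1)%R; rewrite /adm_il e0.
- by exists 0%N, 1%R, 1%R; rewrite /adm_il e0.
- by exists 1%N, 0%R, (-1)%R; rewrite /adm_il e2 ?orbT.
- by exists 1%N, 1%R, (-1)%R; rewrite /adm_il e2 ?orbT.
- by exists 1%N, (-1)%R, (-1)%R; rewrite /adm_il e2 ?orbT.
- by exists 1%N, 0%R, 1%R; rewrite /adm_il e2 ?orbT.
- by exists 1%N, (-1)%R, 1%R; rewrite /adm_il e2 ?orbT.
by exists 1%N, 1%R, 1%R; rewrite /adm_il e2 ?orbT.
Qed.
End FamilyM4.

(** * Counting isomorphism classes *)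

Section ClassCounting.
Local Notation omap := Defs.omap.

Definition iso_classes (I : finType) (F : I -> omap -> Prop) : Prop :=
  [/\ forall i, exists M, F i M,
      forall i M M', F i M -> F i M' -> omap_iso M M'
    & forall i j M M', F i M -> F j M' -> omap_iso M M' -> i = j].

Lemma num_classes_of (I : finType) (F : I -> omap -> Prop) (P : omap -> Prop) N :
  iso_classes F -> #|I| = N -> (forall M, P M <-> exists i, F i M) -> num_classes P N.
Proof.
move=> [ex iso inj] <- PF; have [L FL] := fin_all_exists ex.
exists (fun k => L (enum_val k)); split.
- by move=> k; apply/PF; exists (enum_val k).
- by move=> k k' h; apply: enum_val_inj; apply: inj (FL _) (FL _) h.
move=> M /PF[i FM]; exists (enum_rank i); rewrite enum_rankK.
exact: iso FM (FL i).
Qed.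

Lemma num_classes0 (P : omap -> Prop) : (forall M, ~ P M) -> num_classes P 0.
Proof.
move=> P0; have ic : iso_classes (fun (_ : void) (_ : omap) => False) by split; case.
by apply: (num_classes_of ic); rewrite ?card_void // => M; split=> [/P0|[]].
Qed.

Lemma omap_iso_sym M M' : omap_iso M M' -> omap_iso M' M.
Proof. exact: map_iso_sym. Qed.

Definition sum_family (I J : finType) (F : I -> omap -> Prop) (G : J -> omap -> Prop)
  (s : I + J) : omap -> Prop := match s with inl i => F i | inr j => G j end.

Lemma sum_classes (I J : finType) (F : I -> omap -> Prop) (G : J -> omap -> Prop) :
  iso_classes F -> iso_classes G ->
  (forall i j M M', F i M -> G j M' -> ~ omap_iso M M') -> iso_classes (sum_family F G).
Proof.
move=> [exF isoF injF] [exG isoG injG] dis; split.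
- by case=> i; [apply: exF|apply: exG].
- by case=> i M M'; [apply: isoF|apply: isoG].
case=> i [] j M M' FM FM' I1 => //=; first by congr inl; apply: injF FM FM' I1.
- by case: (dis _ _ _ _ FM FM').
- by case: (dis _ _ _ _ FM' FM); apply: omap_iso_sym.
by congr inr; apply: injG FM FM' I1.
Qed.

Lemma card_units N : #|{: {j : 'I_N | coprime j N}}| = totient N.
Proof.
rewrite card_sig totient_count_coprime -sum1_card big_mkord [RHS]big_mkcond /=.
by rewrite big_mkcond; apply: eq_bigr => i _; rewrite inE coprime_sym; case: (coprime _ _).
Qed.

Definition unit_family N N' (G : nat -> omap -> Prop) (i : {j : 'I_N | coprime j N}) (M : omap) :=
  exists j, [/\ coprime j N', j = val (val i) %[mod N] & G j M].

Section Units.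
Variables (N N' : nat) (G : nat -> omap -> Prop).
Hypotheses (N0 : 0 < N) (dN : N %| N').
Hypothesis lift : forall i, coprime i N -> exists2 j, coprime j N' & j = i %[mod N].
Hypothesis ex : forall j, coprime j N' -> exists M, G j M.
Hypothesis iso : forall j M M', coprime j N' -> G j M -> G j M' -> omap_iso M M'.
Hypothesis tr : forall j j' M, coprime j N' -> coprime j' N' -> j = j' %[mod N] -> G j M -> G j' M.
Hypothesis inj : forall j j' M M', coprime j N' -> coprime j' N' -> G j M -> G j' M' ->
  omap_iso M M' -> j = j' %[mod N].

Lemma unit_classes : iso_classes (@unit_family N N' G).
Proof.
split.
- move=> i; have [j cj ji] := lift (valP i); have [M GM] := ex cj.
  by exists M, j.
- move=> i M M' [j [cj ji GM]] [j' [cj' ji' GM']].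
  by apply: (iso cj' _ GM'); apply: (tr cj cj' _ GM); rewrite ji ji'.
move=> i i' M M' [j [cj ji GM]] [j' [cj' ji' GM']] I.
have := inj cj cj' GM GM' I; rewrite ji ji' (modn_small (ltn_ord (val i))) (modn_small (ltn_ord (val i'))).
by move=> h; apply: val_inj; apply: val_inj.
Qed.

Lemma unit_familyE M : (exists2 j, coprime j N' & G j M) <-> exists i, @unit_family N N' G i M.
Proof.
split=> [[j cj GM]|[i [j [cj _ GM]]]]; last by exists j.
have lt : j %% N < N by rewrite ltn_mod.
have co : coprime (Ordinal lt) N by rewrite coprime_modl; apply: coprime_dvdr cj.
by exists (exist _ (Ordinal lt) co), j; rewrite /= modn_mod.
Qed.
End Units.
End ClassCounting.

Section EmbeddingClasses.
Local Notation omap := Defs.omap.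
Local Notation M1 := (fun p e r j M => isM1 p e r j (om_a M) (om_b M)).
Local Notation M2 := (fun p t j M => isM2 p t j (om_a M) (om_b M)).
Local Notation M3 := (fun k e u j M => isM3 k e u j (om_a M) (om_b M)).
Local Notation M4 := (fun k e (t : nat * int * int) M => isM4 k e t.1.1 t.1.2 t.2 (om_a M) (om_b M)).

Lemma om_exists (P : forall gT : finGroupType, gT -> gT -> Prop) :
  (exists (gT : finGroupType) (a b : gT), P gT a b) -> exists M, P _ (om_a M) (om_b M).
Proof. by case=> gT [a [b Pab]]; exists (OMap a b). Qed.

Lemma M1_classes p e r : prime p -> 4 < p -> unit_generator r (p ^ e.+1) -> 0 < e ->
  let N := (p ^ e * (p - 1))%N in iso_classes (@unit_family N N (M1 p e r)).
Proof.
move=> pr p5 ug e0 N; apply: unit_classes => //.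
- by move=> i ci; exists i.
- by move=> j cj; apply: (om_exists (P := isM1 p e r j)); apply: M1_exists.
- by move=> j M M' _; apply: M1_iso.
- by move=> j j' M cj cj'; apply: M1_mod.
by move=> j j' M M'; apply: M1_inj.
Qed.

Lemma M2_classes p t : prime p -> 4 < p -> unit_generator t p ->
  iso_classes (@unit_family (p - 1) (p - 1) (M2 p t)).
Proof.
move=> pr p5 ug; apply: unit_classes => //.
- by move=> i ci; exists i.
- by move=> j cj; apply: (om_exists (P := isM2 p t j)); apply: M2_exists.
- by move=> j M M' _; apply: M2_iso.
- by move=> j j' M cj cj'; apply: M2_mod.
by move=> j j' M M'; apply: M2_inj.
Qed.

Lemma M3_lift e k i : ~~ (3 %| k) -> coprime i (2 * 3 ^ e) ->
  exists2 j, coprime j (2 * 3 ^ e * k) & j = i %[mod 2 * 3 ^ e].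
Proof.
move=> k3; rewrite coprimeMr => /andP[i2 i3].
have co2k : coprime (3 ^ e) (2 * k) by rewrite coprimeXl // coprimeMr /= prime_coprime.
pose j := chinese (3 ^ e) (2 * k) i 1.
have j3 : j = i %[mod 3 ^ e] by exact: chinese_modl.
have jk : j = 1 %[mod 2 * k] by exact: chinese_modr.
have cj3 : coprime j (3 ^ e) by rewrite -coprime_modl j3 coprime_modl.
have cjk : coprime j (2 * k) by rewrite -coprime_modl jk coprime_modl coprime1n.
have j2 : odd j by move: cjk; rewrite coprimeMr coprimen2 => /andP[].
exists j; first by rewrite mulnAC mulnC coprimeMr cj3 cjk.
apply/eqP; rewrite chinese_remainder ?coprimeXr //; apply/andP; split; last exact/eqP.
by rewrite coprimen2 in i2; rewrite !modn2 j2 i2.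
Qed.

Lemma M3_classes k e u : ~~ (3 %| k) -> 0 < e -> u * 3 ^ e = 1 %[mod k] ->
  iso_classes (@unit_family (2 * 3 ^ e) (2 * 3 ^ e * k) (M3 k e u)).
Proof.
move=> k3 e0 uE; apply: unit_classes.
- by move=> i; apply: M3_lift.
- by move=> j cj; apply: (om_exists (P := isM3 k e u j)); apply: M3_exists.
- by move=> j M M' _; apply: M3_iso.
- by move=> j j' M cj cj' h; apply: M3_transfer.
by move=> j j' M M' cj cj'; apply: M3_inj.
Qed.

Definition adm_triple e (t : nat * int * int) := adm_il e t.1.1 t.1.2 && adm_j4 t.1.1 t.1.2 t.2.

Lemma M4_classes k e (s : seq (nat * int * int)) : ~~ (3 %| k) -> 1 < 3 ^ e * k ->
  all (adm_triple e) s -> iso_classes (fun t : seq_sub s => M4 k e (val t)).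
Proof.
move=> k3 n1 /allP adm; split.
- move=> t; have /andP[a1 a2] := adm _ (valP t).
  apply: (om_exists (P := isM4 k e (val t).1.1 (val t).1.2 (val t).2)); exact: M4_exists.
- by move=> t M M'; apply: M4_iso.
move=> t t' M M' h h' I; apply: val_inj.
have /andP[a1 a2] := adm _ (valP t); have /andP[a1' a2'] := adm _ (valP t').
have := M4_inj k3 n1 a1 a2 a1' a2' h h' I.
by case: (val t) => [[? ?] ?]; case: (val t') => [[? ?] ?].
Qed.

Lemma M4_count k e (s : seq (nat * int * int)) (P : omap -> Prop) N :
  ~~ (3 %| k) -> 1 < 3 ^ e * k -> all (adm_triple e) s -> uniq s -> size s = N ->
  (forall M, P M <-> exists2 t, t \in s & M4 k e t M) -> num_classes P N.
Proof.
move=> k3 n1 adm us sN PF; apply: (num_classes_of (M4_classes k3 n1 adm)).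
  by rewrite card_seq_sub.
move=> M; rewrite PF; split=> [[t ts h]|[t h]]; last by exists (val t) => //; apply: valP.
by exists (SeqSub ts).
Qed.
End EmbeddingClasses.

Section Embeddings.
Local Notation omap := Defs.omap.
Local Notation M1 := (fun p e r j M => isM1 p e r j (om_a M) (om_b M)).
Local Notation M2 := (fun p t j M => isM2 p t j (om_a M) (om_b M)).
Local Notation M3 := (fun k e u j M => isM3 k e u j (om_a M) (om_b M)).
Local Notation M4 := (fun k e (t : nat * int * int) M => isM4 k e t.1.1 t.1.2 t.2 (om_a M) (om_b M)).
Local Notation emb := (fun m n M => is_Kmn_embedding m n (om_a M) (om_b M)).

Lemma three_inverse_mod k e : ~~ (3 %| k) -> exists u, u * 3 ^ e = 1 %[mod k].
Proof.
move=> k3; have [k1|k1] := leqP k 1.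
  exists 0; move: k1 k3; case: k => [|[|//]] _ k3; last by rewrite !modn1.
  by [].
have co : coprime (3 ^ e) k by rewrite coprimeXl // prime_coprime.
by have [u _ uE] := unit_inverse k1 co; exists u.
Qed.

Lemma three_embedding e k (gT : finGroupType) (a b : gT) : ~~ (3 %| k) -> 1 < 3 ^ e * k ->
  is_Kmn_embedding 3 (3 ^ e * k) a b ->
  (1 < e /\ forall u, u * 3 ^ e = 1 %[mod k] ->
     exists2 j, coprime j (2 * 3 ^ e * k) & isM3 k e u j a b) \/
  exists (i : nat) (l j : int), [/\ adm_il e i l, adm_j4 i l j & isM4 k e i l j a b].
Proof.
move=> k3 n1 /embedding_Kmn[] //; first exact: ltnW.
move=> L K; have k0 : 0 < k by case: k k3 {n1 K}.
have [[e2 [j cj rel]]|[i [l [i0 l0 r]]]] := classify_three k3 K k0; last first.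
  by right; apply: (M4_converse k3 n1 K i0 l0 r).
by left; split=> // u uE; apply: (M3_converse k3 (ltnW e2) uE K cj); apply: rel.
Qed.

Lemma M3_embedding e k u j (gT : finGroupType) (a b : gT) : ~~ (3 %| k) -> 0 < e ->
  u * 3 ^ e = 1 %[mod k] -> coprime j (2 * 3 ^ e * k) -> isM3 k e u j a b ->
  [/\ is_Kmn_embedding 3 (3 ^ e * k) a b, chiral a b & map_type (3 ^ e.+1) (2 * (3 ^ e * k)) a b].
Proof.
move=> k3 e0 uE cj M; have [[L K] oab _] := M3_facts k3 e0 uE cj M.
split; [|exact: M3_chiral cj M|by split=> //; exact: kmn_orda K].
by apply: (Kmn_is_embedding K) => //; rewrite muln_gt0 expn_gt0; case: k k3 {uE cj M K}.
Qed.

Lemma M4_embedding e k i l j (gT : finGroupType) (a b : gT) : ~~ (3 %| k) -> 1 < 3 ^ e * k ->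
  adm_il e i l -> adm_j4 i l j -> isM4 k e i l j a b ->
  [/\ is_Kmn_embedding 3 (3 ^ e * k) a b,
      (if (i == 0) && (l == 0%R) then reflexible a b else chiral a b) &
      map_type (if l == 0%R then 3 else 9) (2 * (3 ^ e * k)) a b].
Proof.
move=> k3 n1 adm adj M; have [[L K] _ _] := M4_facts k3 n1 adm adj M.
split.
- by apply: (Kmn_is_embedding K) => //; apply: ltnW.
- case: ifP => [/andP[/eqP i0 /eqP l0]|il].
    move: adj M; rewrite i0 l0 /adm_j4 /= => /eqP -> M.
    exact: M4_reflexible k3 n1 _ _ _ M.
  by apply: (M4_chiral k3 n1 adm adj _ M); rewrite il.
by split; [apply: (M4_order_ab k3 n1 adm adj M)|exact: kmn_orda K].
Qed.

Lemma M3_M4_not_iso e k u j (l : int) (gT hT : finGroupType) (a b : gT) (a' b' : hT) :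
  ~~ (3 %| k) -> 1 < e -> u * 3 ^ e = 1 %[mod k] -> coprime j (2 * 3 ^ e * k) ->
  isM3 k e u j a b -> #[a' * b']%g = (if l == 0%R then 3 else 9) ->
  ~ map_iso a b a' b'.
Proof.
move=> k3 e1 uE cj M o' /map_iso_order[_].
have [_ -> _] := M3_facts k3 (ltnW e1) uE cj M; rewrite o'.
have : 3 ^ 3 <= 3 ^ e.+1 by rewrite leq_exp2l.
by case: ifP => _ h E; rewrite E in h.
Qed.

Definition m4_all e := [seq t <- m4_list | adm_triple e t].
Definition m4_chiral e := [seq t <- m4_all e | t != (0, 0%R, 1%R)].

Lemma m4_all_uniq e : uniq (m4_all e). Proof. exact: filter_uniq. Qed.
Lemma m4_all_adm e : all (adm_triple e) (m4_all e). Proof. exact: filter_all. Qed.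

Lemma mem_m4_all e i l j : ((i, l, j) \in m4_all e) = adm_il e i l && adm_j4 i l j.
Proof.
rewrite mem_filter /adm_triple /=; case E: (adm_il e i l && adm_j4 i l j) => //=.
by case/andP: E => a1 a2; rewrite (adm_m4_list a1 a2).
Qed.

Section Three.
Variables (e k u : nat).
Hypotheses (k3 : ~~ (3 %| k)) (n1 : 1 < 3 ^ e * k) (uE : u * 3 ^ e = 1 %[mod k]).
Local Notation n := (3 ^ e * k).
Local Notation nn := (2 * 3 ^ e * k).

Lemma three_embeddingE M : emb 3 n M <->
  (1 < e /\ exists2 j, coprime j nn & M3 k e u j M) \/ exists2 t, t \in m4_all e & M4 k e t M.
Proof.
split=> [/(three_embedding k3 n1)[[e1 /(_ u uE) h]|[i [l [j [a1 a2 h]]]]]|].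
- by left.
- by right; exists (i, l, j); rewrite ?mem_m4_all ?a1.
case=> [[e1 [j cj h]]|[[[i l] j]]].
  by case: (M3_embedding k3 (ltnW e1) uE cj h).
by rewrite mem_m4_all => /andP[a1 a2] h; case: (M4_embedding k3 n1 a1 a2 h).
Qed.

Lemma three_chiralE M : emb 3 n M /\ chiral (om_a M) (om_b M) <->
  (1 < e /\ exists2 j, coprime j nn & M3 k e u j M) \/ exists2 t, t \in m4_chiral e & M4 k e t M.
Proof.
split=> [[/three_embeddingE[h|[t tA h]] ch]|]; first by left.
  right; exists t => //; rewrite mem_filter tA andbT; apply/eqP => tE.
  by apply: ch; rewrite tE in h; apply: M4_reflexible k3 n1 _ _ _ h.
case=> [[e1 [j cj h]]|[[[i l] j]]].
  by case: (M3_embedding k3 (ltnW e1) uE cj h).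
rewrite mem_filter mem_m4_all => /and3P[tE a1 a2] h.
case: (M4_embedding k3 n1 a1 a2 h) => E + _; case: ifP => // /andP[/eqP i0 /eqP l0].
by move: a2 tE; rewrite /adm_j4 i0 l0 /= => /eqP ->.
Qed.

Lemma three_reflexibleE M : emb 3 n M /\ reflexible (om_a M) (om_b M) <->
  exists2 t, t \in [:: (0, 0%R, 1%R)] & M4 k e t M.
Proof.
split=> [[E r]|[t]].
  have /three_embeddingE[[e1 [j cj h]]|[[[i l] j]]] := E.
    by have [_ [] ] := M3_embedding k3 (ltnW e1) uE cj h.
  rewrite mem_m4_all => /andP[a1 a2] h; exists (i, l, j) => //.
  case: (M4_embedding k3 n1 a1 a2 h) => _ + _; case: ifP => [|_ []] //.
  by move=> /andP[/eqP i0 /eqP l0] _; move: a2; rewrite /adm_j4 i0 l0 /= => /eqP ->.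
rewrite inE => /eqP -> /= h; have a1 : adm_il e 0 0%R by [].
by case: (M4_embedding k3 n1 a1 (isT : adm_j4 0 0%R 1%R) h).
Qed.

Lemma three_count (s : seq (nat * int * int)) (P : omap -> Prop) :
  all (adm_triple e) s -> uniq s ->
  (forall M, P M <-> (1 < e /\ exists2 j, coprime j nn & M3 k e u j M) \/
                     exists2 t, t \in s & M4 k e t M) ->
  num_classes P ((if 1 < e then 2 * 3 ^ e.-1 else 0) + size s).
Proof.
move=> adm us PF; case: ifP => [e1|e1]; last first.
  apply: (M4_count k3 n1 adm us) => // M; rewrite PF e1.
  by split=> [[[]|]|] //; right.
have e0 := ltnW e1.
have C : iso_classes (sum_family (@unit_family (2 * 3 ^ e) nn (M3 k e u))
    (fun t : seq_sub s => M4 k e (val t))).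
  apply: sum_classes (M3_classes k3 e0 uE) (M4_classes k3 n1 adm) _.
  move=> i t M M' [j [cj _ h]] h'.
  have /andP[a1 a2] := allP adm _ (valP t).
  exact: (M3_M4_not_iso k3 e1 uE cj h (M4_order_ab k3 n1 a1 a2 h')).
apply: (num_classes_of C).
  rewrite card_sum card_units card_seq_sub // totient_coprime ?coprimeXr // totient_pfactor //.
  by rewrite mul1n.
have UE := unit_familyE (N := 2 * 3 ^ e) (N' := nn) (M3 k e u).
move=> M; rewrite PF; split=> [[[_ /UE h]|[t ts h]]|[[i h|t h]]].
- have [||i h'] := h; [by rewrite muln_gt0 expn_gt0|exact: dvdn_mulr|].
  by exists (inl i).
- by exists (inr (SeqSub ts)).
- by left; split=> //; case: h => j [cj _ h]; exists j.
by right; exists (val t) => //; apply: valP.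
Qed.

Lemma three_counts : embedding_counts 3 n 1
  ((if 1 < e then 2 * 3 ^ e.-1 else 0) + size (m4_chiral e))
  ((if 1 < e then 2 * 3 ^ e.-1 else 0) + size (m4_all e)).
Proof.
split.
- by apply: (M4_count k3 n1 _ _ _ three_reflexibleE).
- apply: three_count three_chiralE; rewrite ?filter_uniq ?m4_all_uniq //.
  by apply/allP=> t; rewrite mem_filter => /andP[_ /(allP (m4_all_adm e))].
by apply: three_count three_embeddingE; rewrite ?m4_all_uniq ?m4_all_adm.
Qed.
End Three.

Section Large.
Variables (p e : nat).
Hypotheses (pr : prime p) (p5 : 4 < p) (e0 : 0 < e).
Let p0 : 0 < p. Proof. exact: prime_gt0. Qed.

Lemma large_embedding (gT : finGroupType) (a b : gT) : is_Kmn_embedding p (p ^ e) a b ->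
  (forall r, unit_generator r (p ^ e.+1) ->
     exists2 j, coprime j (p ^ e * (p - 1)) & isM1 p e r j a b) \/
  e = 1 /\ forall t, unit_generator t p -> exists2 j, coprime j (p - 1) & isM2 p t j a b.
Proof.
move=> /embedding_Kmn[]; rewrite ?expn_gt0 ?p0 ?prime_gt1 //.
case: e e0 => // f _ L K; have [cyc|[f0 cp]] := cyclic_type_ge5 pr p5 K.
  by left=> r ug; apply: (M1_converse pr p5 ug K cyc).
right; split; first by rewrite f0.
by rewrite f0 expn1 in K => t ug; apply: (M2_converse pr p5 ug K cp).
Qed.

Lemma M1_embedding r j (gT : finGroupType) (a b : gT) : unit_generator r (p ^ e.+1) ->
  coprime j (p ^ e * (p - 1)) -> isM1 p e r j a b ->
  [/\ is_Kmn_embedding p (p ^ e) a b, chiral a b &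
      map_type (if p %% 4 == 1 then p ^ e * (p - 1) else (p ^ e * (p - 1))./2)
               (p ^ e * (p - 1)) a b].
Proof.
move=> ug cj M; have [[L K] [_ _ oab]] := M1_facts pr p5 ug cj M.
split; [|exact: M1_chiral cj M|split=> //].
  by apply: (Kmn_is_embedding K); rewrite ?prime_gt1 ?expn_gt0 ?p0.
by rewrite (kmn_orda K) mulnC.
Qed.

Lemma M2_embedding t j (gT : finGroupType) (a b : gT) : unit_generator t p ->
  coprime j (p - 1) -> isM2 p t j a b ->
  [/\ is_Kmn_embedding p p a b, chiral a b &
      map_type (if p %% 4 == 1 then p * (p - 1) else (p * (p - 1))./2)
               (p * (p - 1)) a b].
Proof.
move=> ug cj M; have [[L K] [_ _ oab]] := M2_facts pr p5 ug cj M.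
split; [|exact: M2_chiral cj M|split=> //].
  by apply: (Kmn_is_embedding K); rewrite ?prime_gt1.
by rewrite (kmn_orda K) mulnC.
Qed.

Lemma M1_M2_not_iso r t j j' (gT hT : finGroupType) (a b : gT) (a' b' : hT) :
  unit_generator r (p ^ e.+1) -> unit_generator t p ->
  coprime j (p ^ e * (p - 1)) -> coprime j' (p - 1) ->
  isM1 p e r j a b -> isM2 p t j' a' b' -> ~ map_iso a b a' b'.
Proof.
move=> ug ug' cj cj' /(M1_facts pr p5 ug cj)[_ [o _ _]] /(M2_facts pr p5 ug' cj')[_ [o' _ _]].
case/map_isoP=> f [inj fa fb].
have cG : cyc_gen a b \in mgrp a b by rewrite groupM ?groupX ?mem_mgrpl ?mem_mgrpr.
have := order_injm inj cG; rewrite (map_iso_cyc_gen inj fa fb) o' o => E.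
have : p ^ 1 < p ^ e.+1 by rewrite (ltn_exp2l _ _ (prime_gt1 pr)).
by rewrite -E expn1 ltnn.
Qed.

Lemma large_counts_M1 r (P : omap -> Prop) : unit_generator r (p ^ e.+1) ->
  (forall M, P M <-> exists2 j, coprime j (p ^ e * (p - 1)) & M1 p e r j M) ->
  num_classes P (p ^ e.-1 * (p - 1) * totient (p - 1)).
Proof.
move=> ug PF; apply: (num_classes_of (M1_classes pr p5 ug e0)).
  rewrite card_units totient_coprime ?coprimeXl ?subn1 ?coprimenP // totient_pfactor // mulnC.
  by rewrite mulnC [(p.-1 * _)%N]mulnC.
move=> M; rewrite PF; apply: unit_familyE => //.
by rewrite muln_gt0 expn_gt0 p0 subn_gt0 prime_gt1.
Qed.

Lemma large_counts_M2 t (P : omap -> Prop) : unit_generator t p ->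
  (forall M, P M <-> exists2 j, coprime j (p - 1) & M2 p t j M) ->
  num_classes P (totient (p - 1)).
Proof.
move=> ug PF; apply: (num_classes_of (M2_classes pr p5 ug)); first exact: card_units.
move=> M; rewrite PF; apply: unit_familyE => //.
by rewrite subn_gt0 prime_gt1.
Qed.
End Large.
End Embeddings.

Section Cases.

Lemma odd_prime_ge5 p : 4 < p -> prime p -> odd p.
Proof. by move=> p5 pr; case: (even_prime pr) p5 => // ->. Qed.

Lemma exactly_one_case : (forall (m n : nat) (gT : finGroupType) (a b : gT),
     (3 <= m)%N -> (2 <= n)%N -> is_Kmn_embedding m n a b ->
     exactly_one4
       (exists p e : nat,
          [/\ prime p, (5 <= p)%N, (1 <= e)%N, m = p & n = (p ^ e)%N] /\
          forall r : nat, unit_generator r (p ^ e.+1) ->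
            exists2 j : nat, coprime j (p ^ e * (p - 1)) & isM1 p e r j a b)
       (exists p : nat,
          [/\ prime p, (5 <= p)%N, m = p & n = p] /\
          forall t : nat, unit_generator t p ->
            exists2 j : nat, coprime j (p - 1) & isM2 p t j a b)
       (exists e k : nat,
          [/\ (2 <= e)%N, ~~ (3 %| k), m = 3 & n = (3 ^ e * k)%N] /\
          forall u : nat, u * 3 ^ e = 1 %[mod k] ->
            exists2 j : nat, coprime j (2 * 3 ^ e * k) & isM3 k e u j a b)
       (exists (e k i : nat) (l j : int),
          [/\ ~~ (3 %| k), m = 3, n = (3 ^ e * k)%N, adm_il e i l & adm_j4 i l j] /\
          isM4 k e i l j a b)).
Proof.
move=> m n gT a b m3 n2 E; have [L K] := embedding_Kmn E (ltnW m3) (ltnW n2).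
have C3 e k : ~~ (3 %| k) -> n = (3 ^ e * k)%N -> 1 < 3 ^ e * k by move=> _ <-.
split; last first.
  split.
    move=> [[p [e [[pr p5 e0 mp ne] h]]] [p' [[pr' _ mp' np'] h']]].
    subst p p'.
    have [r ug] := primitive_root e pr (odd_prime_ge5 p5 pr).
    have [t ug'] := primitive_root 0 pr (odd_prime_ge5 p5 pr); rewrite expn1 in ug'.
    have [j cj M] := h r ug; have [j' cj' M'] := h' t ug'.
    exact: (M1_M2_not_iso pr p5 e0 ug ug' cj cj' M M') (map_iso_refl _ _).
  split; first by move=> [[p [e [[_ p5 _ mp _] _]]] [e' [k' [[_ _ m3' _] _]]]]; rewrite -mp m3' in p5.
  split; first by move=> [[p [e [[_ p5 _ mp _] _]]] [e' [k' [i [l [j [[_ m3' _ _ _] _]]]]]]];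
    rewrite -mp m3' in p5.
  split; first by move=> [[p [[_ p5 mp _] _]] [e' [k' [[_ _ m3' _] _]]]]; rewrite -mp m3' in p5.
  split; first by move=> [[p [[_ p5 mp _] _]] [e' [k' [i [l [j [[_ m3' _ _ _] _]]]]]]];
    rewrite -mp m3' in p5.
  move=> [[e [k [[e2 k3 _ nE] h]]] [e' [k' [i [l [j [[k3' _ nE' a1 a2] M']]]]]]].
  have [u uE] := three_inverse_mod e k3; have [j' cj' M] := h u uE.
  have o := M4_order_ab k3' (C3 _ _ k3' nE') a1 a2 M'.
  exact: (M3_M4_not_iso k3 e2 uE cj' M o) (map_iso_refl _ _).
have [m4|m4] := leqP m 3.
  have mE : m = 3 by apply/eqP; rewrite eqn_leq m4.
  have n0 : 0 < n by apply: ltnW.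
  have [k k3 nE] := pfactor_coprime (isT : prime 3) n0.
  rewrite prime_coprime // in k3; rewrite mulnC in nE; set e := logn 3 n in nE.
  have n1 := C3 e k k3 nE; rewrite mE nE in E.
  have [[e2 h]|[i [l [j [a1 a2 M]]]]] := three_embedding k3 n1 E.
    by right; right; left; exists e, k.
  by right; right; right; exists e, k, i, l, j.
have [pr [e nE]] := Kmn_prime_power K m4 (ltnW n2); have {}pr := pr n2.
have m5 : 4 < m by case: (m) pr m4 => [|[|[|[|[|]]]]].
have e0 : 0 < e by case: e nE n2 => // -> .
rewrite nE in E; have [h|[e1 h]] := large_embedding pr m5 e0 E.
  by left; exists m, e.
by right; left; exists m; split=> //; split=> //; rewrite nE e1 expn1.
Qed.

Lemma M3_num_classes k e u : ~~ (3 %| k) -> 0 < e -> u * 3 ^ e = 1 %[mod k] ->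
  num_classes (fun M => exists2 j : nat, coprime j (2 * 3 ^ e * k) &
    isM3 k e u j (om_a M) (om_b M)) (2 * 3 ^ e.-1).
Proof.
move=> k3 e0 uE; apply: (num_classes_of (M3_classes k3 e0 uE)).
  by rewrite card_units totient_coprime ?coprimeXr // totient_pfactor // mul1n.
move=> M; apply: (unit_familyE (N := 2 * 3 ^ e) (N' := 2 * 3 ^ e * k)
  (fun j M => isM3 k e u j (om_a M) (om_b M))).
  by rewrite muln_gt0 expn_gt0.
exact: dvdn_mulr.
Qed.

Lemma M4_num_classes k e : ~~ (3 %| k) -> 1 < 3 ^ e * k ->
  [/\ num_classes (fun M => isM4 k e 0 0%R 1%R (om_a M) (om_b M)) 1,
            (1 <= e)%N ->
              num_classes (fun M => exists2 j : int, adm_j4 0 1%R j &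
                                      isM4 k e 0 1%R j (om_a M) (om_b M)) 2,
            (2 <= e)%N ->
              num_classes (fun M => exists2 j : int, adm_j4 1 0%R j &
                                      isM4 k e 1 0%R j (om_a M) (om_b M)) 2
          & (2 <= e)%N ->
              num_classes (fun M => exists (l j : int),
                                      [/\ (l == 1%R) || (l == (-1)%R), adm_j4 1 l j &
                                          isM4 k e 1 l j (om_a M) (om_b M)]) 4].
Proof.
move=> k3 n1; split.
- apply: (M4_count (e := e) (s := [:: (0%N, 0%R, 1%R)]) k3 n1) => // M.
  by split=> [h|[t]]; [exists (0%N, 0%R, 1%R)|rewrite inE => /eqP ->].
- move=> e1; apply: (M4_count (e := e) (s := [:: (0%N, 1%R, 1%R); (0%N, 1%R, (-1)%R)]) k3 n1) => //.
    by rewrite /adm_triple /adm_il e1.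
  move=> M; split=> [[j aj h]|[t]].
    by exists (0%N, 1%R, j) => //; move: aj; rewrite /adm_j4 /= => /orP[] /eqP ->.
  by rewrite !inE => /orP[] /eqP ->; [exists 1%R|exists (-1)%R].
- move=> e2; apply: (M4_count (e := e) (s := [:: (1%N, 0%R, 1%R); (1%N, 0%R, (-1)%R)]) k3 n1) => //.
    by rewrite /adm_triple /adm_il e2 /= !orbT.
  move=> M; split=> [[j aj h]|[t]].
    by exists (1%N, 0%R, j) => //; move: aj; rewrite /adm_j4 /= => /orP[] /eqP ->.
  by rewrite !inE => /orP[] /eqP ->; [exists 1%R|exists (-1)%R].
move=> e2; apply: (M4_count (e := e) (s := [:: (1%N, 1%R, 1%R); (1%N, 1%R, (-1)%R);
  (1%N, (-1)%R, 1%R); (1%N, (-1)%R, (-1)%R)]) k3 n1) => //.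
  by rewrite /adm_triple /adm_il e2 /= !orbT.
move=> M; split=> [[l [j [l1 aj h]]]|[t]].
  exists (1%N, l, j) => //; move: l1 aj; rewrite /adm_j4 /=.
  by move=> /orP[] /eqP -> /orP[] /eqP ->.
rewrite !inE => /or4P[] /eqP -> h; [exists 1%R, 1%R|exists 1%R, (-1)%R
  |exists (-1)%R, 1%R|exists (-1)%R, (-1)%R]; split=> //.
Qed.

Lemma counting_case : (forall m n : nat, (3 <= m)%N -> (2 <= n)%N ->
     [/\ m = 3 -> ~~ (3 %| n) -> embedding_counts m n 1 0 1,
         forall k : nat, m = 3 -> n = (3 * k)%N -> ~~ (3 %| k) ->
           embedding_counts m n 1 2 3,
         forall e k : nat, m = 3 -> (2 <= e)%N -> n = (3 ^ e * k)%N -> ~~ (3 %| k) ->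
           embedding_counts m n 1 (2 * 3 ^ e.-1 + 8) (2 * 3 ^ e.-1 + 9),
         prime m -> (5 <= m)%N -> n = m ->
           embedding_counts m n 0 (m * totient (m - 1)) (m * totient (m - 1))
       &
         forall e : nat, prime m -> (5 <= m)%N -> (2 <= e)%N -> n = (m ^ e)%N ->
           embedding_counts m n 0 (m ^ e.-1 * (m - 1) * totient (m - 1))
                                  (m ^ e.-1 * (m - 1) * totient (m - 1))]
     /\ (m <> 3 -> ~ (prime m /\ exists2 e : nat, (1 <= e)%N & n = (m ^ e)%N) ->
           embedding_counts m n 0 0 0)).
Proof.
move=> m n m3 n2; split; last first.
  move=> m3' notp; have E0 M : ~ is_Kmn_embedding m n (om_a M) (om_b M).
    move=> E; have [L K] := embedding_Kmn E (ltnW m3) (ltnW n2).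
    have m4 : 3 < m by rewrite ltn_neqAle m3 andbT; apply/eqP=> h; apply: m3'.
    have [pr [e nE]] := Kmn_prime_power K m4 (ltnW n2).
    apply: notp; split; first exact: pr.
    by exists e => //; case: e nE n2 => // -> .
  by split; apply: num_classes0 => M; [case=> /E0|case=> /E0|move/E0].
have three e k : m = 3 -> n = (3 ^ e * k)%N -> ~~ (3 %| k) -> embedding_counts m n 1
    ((if 1 < e then 2 * 3 ^ e.-1 else 0) + size (m4_chiral e))
    ((if 1 < e then 2 * 3 ^ e.-1 else 0) + size (m4_all e)).
  move=> -> nE k3; have [u uE] := three_inverse_mod e k3.
  by rewrite nE; apply: (three_counts k3 _ uE); rewrite -nE.
have large e : prime m -> 4 < m -> 0 < e -> n = (m ^ e)%N -> forall (P : Defs.omap -> Prop) N,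
    (forall Q : Defs.omap -> Prop, (forall M, Q M <-> is_Kmn_embedding m n (om_a M) (om_b M)) ->
       num_classes Q N) ->
    embedding_counts m n 0 N N.
  move=> pr m5 e0 nE _ N cnt.
  have ch M : is_Kmn_embedding m n (om_a M) (om_b M) -> chiral (om_a M) (om_b M).
    rewrite nE => E; have po := odd_prime_ge5 m5 pr.
    have [r ug] := primitive_root e pr po; have [t ug'] := primitive_root 0 pr po.
    rewrite expn1 in ug'; have [/(_ r ug)[j cj h]|[_ /(_ t ug')[j cj h]]] := large_embedding pr m5 e0 E.
      by case: (M1_embedding pr m5 ug cj h).
    by case: (M2_embedding pr m5 ug' cj h).
  split; first by apply: num_classes0 => M [/ch].
    by apply: cnt => M; split=> [[]|E] //; split=> //; apply: ch.
  by apply: cnt.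
split.
- by move=> m3' n3; apply: (three 0); rewrite ?expn0 ?mul1n.
- by move=> k m3' nE k3; apply: (three 1 k); rewrite ?expn1.
- move=> e k m3' e2 nE k3; have := three e k m3' nE k3; rewrite e2.
  have -> : m4_chiral e = m4_chiral 2 by rewrite /m4_chiral /m4_all /adm_triple /adm_il e2 (ltnW e2).
  have -> : m4_all e = m4_all 2 by rewrite /m4_all /adm_triple /adm_il e2 (ltnW e2).
  by [].
- move=> pr m5 nE; have nE' : n = (m ^ 1)%N by rewrite expn1.
  apply: (large 1 pr m5 isT nE' (fun=> True)) => Q QE; have po := odd_prime_ge5 m5 pr.
  have [r ug] := primitive_root 1 pr po; have [t ug'] := primitive_root 0 pr po.
  rewrite expn1 in ug'.
  pose F := sum_family (@unit_family (m ^ 1 * (m - 1)) (m ^ 1 * (m - 1))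
     (fun j M => isM1 m 1 r j (om_a M) (om_b M)))
    (@unit_family (m - 1) (m - 1) (fun j M => isM2 m t j (om_a M) (om_b M))).
  have C : iso_classes F.
    apply: sum_classes (M1_classes pr m5 ug isT) (M2_classes pr m5 ug') _.
    move=> i i' M M' [j [cj _ h]] [j' [cj' _ h']].
    have := M1_M2_not_iso pr m5 (isT : 0 < 1) ug ug' cj cj' h h'.
    exact.
  apply: (num_classes_of C).
    rewrite card_sum !card_units expn1 totient_coprime ?subn1 ?coprimenP ?prime_gt0 //.
    by rewrite totient_prime // addnC -mulSn (prednK (prime_gt0 pr)).
  have m0 : 0 < m ^ 1 * (m - 1) by rewrite muln_gt0 expn_gt0 prime_gt0 // subn_gt0 prime_gt1.
  have m0' : 0 < m - 1 by rewrite subn_gt0 prime_gt1.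
  move=> M; rewrite QE nE'; split=> [E|[[i [j [cj _ h]]|i [j [cj _ h]]]]].
  + have [/(_ r ug)h|[_ /(_ t ug')h]] := large_embedding pr m5 (isT : 0 < 1) E.
      by have [i hi] := (unit_familyE (fun j M => isM1 m 1 r j (om_a M) (om_b M)) m0 (dvdnn _) M).1 h; exists (inl i).
    by have [i hi] := (unit_familyE (fun j M => isM2 m t j (om_a M) (om_b M)) m0' (dvdnn _) M).1 h; exists (inr i).
  + by case: (M1_embedding pr m5 ug cj h).
  by rewrite expn1; case: (M2_embedding pr m5 ug' cj h).
move=> e pr m5 e2 nE; have e0 := ltnW e2.
apply: (large e pr m5 e0 nE (fun=> True)) => Q QE; have po := odd_prime_ge5 m5 pr.
have [r ug] := primitive_root e pr po.
apply: (large_counts_M1 pr m5 e0 ug) => M; rewrite QE nE; split=> [E|[j cj h]].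
  by have [/(_ r ug)|[e1]] := large_embedding pr m5 e0 E; rewrite ?e1 in e2 *.
by case: (M1_embedding pr m5 ug cj h).
Qed.
End Cases.

Theorem theorem1p2 :
  (* Classification: an orientably-regular embedding of K_{m[n]} (m >= 3,
     n >= 2) falls in exactly one of the four cases.
     (Case 3 is taken with e >= 2: see NOTES.md, READING.) *)
  (forall (m n : nat) (gT : finGroupType) (a b : gT),
     (3 <= m)%N -> (2 <= n)%N -> is_Kmn_embedding m n a b ->
     exactly_one4
       (exists p e : nat,
          [/\ prime p, (5 <= p)%N, (1 <= e)%N, m = p & n = (p ^ e)%N] /\
          forall r : nat, unit_generator r (p ^ e.+1) ->
            exists2 j : nat, coprime j (p ^ e * (p - 1)) & isM1 p e r j a b)
       (exists p : nat,
          [/\ prime p, (5 <= p)%N, m = p & n = p] /\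
          forall t : nat, unit_generator t p ->
            exists2 j : nat, coprime j (p - 1) & isM2 p t j a b)
       (exists e k : nat,
          [/\ (2 <= e)%N, ~~ (3 %| k), m = 3 & n = (3 ^ e * k)%N] /\
          forall u : nat, u * 3 ^ e = 1 %[mod k] ->
            exists2 j : nat, coprime j (2 * 3 ^ e * k) & isM3 k e u j a b)
       (exists (e k i : nat) (l j : int),
          [/\ ~~ (3 %| k), m = 3, n = (3 ^ e * k)%N, adm_il e i l & adm_j4 i l j] /\
          isM4 k e i l j a b))
  /\
  (* The maps M_1(p,e,j). *)
  (forall p e r : nat, prime p -> (5 <= p)%N -> (1 <= e)%N ->
     unit_generator r (p ^ e.+1) ->
     (forall j : nat, coprime j (p ^ e * (p - 1)) ->
        [/\ exists (gT : finGroupType) (a b : gT), isM1 p e r j a b,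
            forall (gT : finGroupType) (a b : gT), isM1 p e r j a b ->
              [/\ is_Kmn_embedding p (p ^ e) a b, chiral a b &
                  map_type (if p %% 4 == 1 then p ^ e * (p - 1) else (p ^ e * (p - 1))./2)
                           (p ^ e * (p - 1)) a b]
          & forall (gT hT : finGroupType) (a b : gT) (a' b' : hT),
              isM1 p e r j a b -> isM1 p e r j a' b' -> map_iso a b a' b'])
     /\ num_classes (fun M => exists2 j : nat, coprime j (p ^ e * (p - 1)) &
                                isM1 p e r j (om_a M) (om_b M))
                    (p ^ e.-1 * (p - 1) * totient (p - 1)))
  /\
  (* The maps M_2(p,j). *)
  (forall p t : nat, prime p -> (5 <= p)%N -> unit_generator t p ->
     (forall j : nat, coprime j (p - 1) ->
        [/\ exists (gT : finGroupType) (a b : gT), isM2 p t j a b,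
            forall (gT : finGroupType) (a b : gT), isM2 p t j a b ->
              [/\ is_Kmn_embedding p p a b, chiral a b &
                  map_type (if p %% 4 == 1 then p * (p - 1) else (p * (p - 1))./2)
                           (p * (p - 1)) a b]
          & forall (gT hT : finGroupType) (a b : gT) (a' b' : hT),
              isM2 p t j a b -> isM2 p t j a' b' -> map_iso a b a' b'])
     /\ num_classes (fun M => exists2 j : nat, coprime j (p - 1) &
                                isM2 p t j (om_a M) (om_b M))
                    (totient (p - 1)))
  /\
  (* The maps M_3(k,e,j). *)
  (forall k e u : nat, ~~ (3 %| k) -> (1 <= e)%N -> u * 3 ^ e = 1 %[mod k] ->
     (forall j : nat, coprime j (2 * 3 ^ e * k) ->
        [/\ exists (gT : finGroupType) (a b : gT), isM3 k e u j a b,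
            forall (gT : finGroupType) (a b : gT), isM3 k e u j a b ->
              [/\ is_Kmn_embedding 3 (3 ^ e * k) a b, chiral a b &
                  map_type (3 ^ e.+1) (2 * (3 ^ e * k)) a b]
          & forall (gT hT : finGroupType) (a b : gT) (a' b' : hT),
              isM3 k e u j a b -> isM3 k e u j a' b' -> map_iso a b a' b'])
     /\ num_classes (fun M => exists2 j : nat, coprime j (2 * 3 ^ e * k) &
                                isM3 k e u j (om_a M) (om_b M))
                    (2 * 3 ^ e.-1))
  /\
  (* The maps M_4(k,e,i,l,j). *)
  (forall k e : nat, ~~ (3 %| k) -> (2 <= 3 ^ e * k)%N ->
     (forall (i : nat) (l j : int), adm_il e i l -> adm_j4 i l j ->
        [/\ exists (gT : finGroupType) (a b : gT), isM4 k e i l j a b,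
            forall (gT : finGroupType) (a b : gT), isM4 k e i l j a b ->
              [/\ is_Kmn_embedding 3 (3 ^ e * k) a b,
                  (if (i == 0) && (l == 0%R) then reflexible a b else chiral a b) &
                  map_type (if l == 0%R then 3 else 9) (2 * (3 ^ e * k)) a b]
          & forall (gT hT : finGroupType) (a b : gT) (a' b' : hT),
              isM4 k e i l j a b -> isM4 k e i l j a' b' -> map_iso a b a' b'])
     /\ [/\ num_classes (fun M => isM4 k e 0 0%R 1%R (om_a M) (om_b M)) 1,
            (1 <= e)%N ->
              num_classes (fun M => exists2 j : int, adm_j4 0 1%R j &
                                      isM4 k e 0 1%R j (om_a M) (om_b M)) 2,
            (2 <= e)%N ->
              num_classes (fun M => exists2 j : int, adm_j4 1 0%R j &
                                      isM4 k e 1 0%R j (om_a M) (om_b M)) 2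
          & (2 <= e)%N ->
              num_classes (fun M => exists (l j : int),
                                      [/\ (l == 1%R) || (l == (-1)%R), adm_j4 1 l j &
                                          isM4 k e 1 l j (om_a M) (om_b M)]) 4])
  /\
  (* Numbers of orientably-regular embeddings of K_{m[n]}
     (reflexible / chiral / total). *)
  (forall m n : nat, (3 <= m)%N -> (2 <= n)%N ->
     [/\ m = 3 -> ~~ (3 %| n) -> embedding_counts m n 1 0 1,
         forall k : nat, m = 3 -> n = (3 * k)%N -> ~~ (3 %| k) ->
           embedding_counts m n 1 2 3,
         forall e k : nat, m = 3 -> (2 <= e)%N -> n = (3 ^ e * k)%N -> ~~ (3 %| k) ->
           embedding_counts m n 1 (2 * 3 ^ e.-1 + 8) (2 * 3 ^ e.-1 + 9),
         prime m -> (5 <= m)%N -> n = m ->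
           embedding_counts m n 0 (m * totient (m - 1)) (m * totient (m - 1))
       &
         forall e : nat, prime m -> (5 <= m)%N -> (2 <= e)%N -> n = (m ^ e)%N ->
           embedding_counts m n 0 (m ^ e.-1 * (m - 1) * totient (m - 1))
                                  (m ^ e.-1 * (m - 1) * totient (m - 1))]
     /\ (m <> 3 -> ~ (prime m /\ exists2 e : nat, (1 <= e)%N & n = (m ^ e)%N) ->
           embedding_counts m n 0 0 0)).
Proof.
split; first exact: exactly_one_case.
split.
  move=> p e r pr p5 e0 ug; split; last exact: (large_counts_M1 pr p5 e0 ug).
  move=> j cj; split; first exact: M1_exists.
    by move=> gT a b; apply: M1_embedding.
  by move=> gT hT a b a' b'; apply: M1_iso.
split.
  move=> p t pr p5 ug; split; last exact: (large_counts_M2 pr p5 ug).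
  move=> j cj; split; first exact: M2_exists.
    by move=> gT a b; apply: M2_embedding.
  by move=> gT hT a b a' b'; apply: M2_iso.
split.
  move=> k e u k3 e0 uE; split; last exact: M3_num_classes.
  move=> j cj; split; first exact: M3_exists.
    by move=> gT a b; apply: M3_embedding.
  by move=> gT hT a b a' b'; apply: M3_iso.
split.
  move=> k e k3 n1; split; last exact: M4_num_classes.
  move=> i l j a1 a2; split; first exact: M4_exists.
    by move=> gT a b; apply: M4_embedding.
  by move=> gT hT a b a' b'; apply: M4_iso.
exact: counting_case.
Qed.
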